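(* Given a single-sink DAG $G$ of fan-in at most $2$ and an integer $s$, it is PSPACE-complete to decide whether the reversible pebbling price of $G$ is at most $s$. In more detail, given a quantified Boolean formula $\phi = Q_1x_1\,Q_2x_2\cdots Q_nx_n\,F$ with $Q_i\in\{\forall,\exists\}$ and $F$ a 3-CNF formula over $x_1,\dots,x_n$, there is a polynomial-time constructible single-sink DAG $G(\phi)$ of fan-in at most $2$ and a polynomial-time computable integer $\gamma(\phi)$ such that the reversible pebbling price of $G(\phi)$ equals $\gamma(\phi)+[\phi\text{ is false}]$, where $[B]$ is $1$ if $B$ holds and $0$ otherwise.
   Context: All graphs are finite DAGs; $\mathrm{pred}(v)$ is the set of immediate predecessors of $v$; fan-in at most $2$ means $|\mathrm{pred}(v)|\le2$. A pebble configuration is a set of vertices. A reversible pebbling is a sequence of configurations $P_0,\dots,P_\tau$, each obtained from the previous by placing a pebble on some $v\notin P$ with $\mathrm{pred}(v)\subseteq P$, or removing a pebble from some $v\in P$ with $\mathrm{pred}(v)\subseteq P$. Its space is $\max_t|P_t|$. The reversible pebbling price of a DAG with unique sink $z$ is the minimum space of a reversible pebbling with $P_0=\emptyset$ and $P_\tau=\{z\}$. *)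

(* Defs.v *)
From mathcomp Require Import all_boot all_order all_algebra.
From mathcomp Require Import boolp.

Set Implicit Arguments.
Unset Strict Implicit.
Unset Printing Implicit Defensive.

Section Pebbling.
Variables (V : finType) (e : rel V).

Definition pred_set (v : V) : {set V} := [set u | e u v].

Definition is_sink (v : V) : bool := [forall w, ~~ e v w].

Definition acyclic : Prop := forall c : seq V, cycle e c -> c = [::].

Definition rev_place (v : V) (P P' : {set V}) : bool :=
  [&& v \notin P, pred_set v \subset P & P' == v |: P].

Definition rev_remove (v : V) (P P' : {set V}) : bool :=
  [&& v \in P, pred_set v \subset P & P' == P :\ v].

Definition rev_step : rel {set V} :=
  fun P P' => [exists v, rev_place v P P' || rev_remove v P P'].

(* The sequence P_0, ..., P_tau is given as its first element and its tail. *)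
Definition rev_pebbling (P0 : {set V}) (Ps : seq {set V}) : bool :=
  path rev_step P0 Ps.

Definition pebbling_space (P0 : {set V}) (Ps : seq {set V}) : nat :=
  \max_(P <- P0 :: Ps) #|P|.

Definition attained_space (z : V) (k : nat) : Prop :=
  exists Ps, [/\ rev_pebbling set0 Ps, last set0 Ps = [set z]
               & pebbling_space set0 Ps = k].

Lemma acyclic_irr v : acyclic -> ~~ e v v.
Proof.
move=> acy; apply/negP => evv; have := acy [:: v].
by rewrite /= evv => /(_ isT).
Qed.

Lemma acyclic_source (A : {set V}) : acyclic -> A != set0 ->
  exists2 v, v \in A & [disjoint pred_set v & A].
Proof.
move=> acy /set0Pn[x0 Ax0].
pose anc v := #|[set u | connect e u v]|.
case: (arg_minnP anc Ax0) => v Av minv; exists v => //.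
apply/pred0P => u /=; apply/negP => /andP[]; rewrite inE => euv Au.
have := minv u Au; apply/negP; rewrite -ltnNge; apply: proper_card.
apply/properP; split.
  apply/subsetP => w; rewrite !inE => wu.
  exact: connect_trans wu (connect1 euv).
exists v; rewrite !inE ?connect0 //.
apply/negP => /connectP[p pvp def_u].
have := acy (v :: p); rewrite /= rcons_path pvp -def_u euv.
by move=> /(_ isT).
Qed.

Lemma rev_step_sym : acyclic -> symmetric rev_step.
Proof.
move=> acy.
have imp P P' : rev_step P P' -> rev_step P' P.
  case/existsP => v stepv; apply/existsP; exists v.
  have irr : v \notin pred_set v by rewrite inE acyclic_irr.
  case/orP: stepv => /and3P[vP sub /eqP->]; apply/orP; [right|left].
    rewrite /rev_remove setU11 setU1K // eqxx andbT /=.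
    exact: subset_trans sub (subsetUr _ _).
  by rewrite /rev_place setD11 setD1K // eqxx andbT /= subsetD1 sub irr.
by move=> P P'; apply/idP/idP; apply: imp.
Qed.

Lemma rev_connect_full P : acyclic -> connect rev_step P setT.
Proof.
move=> acy; have [m] := ubnP #|~: P|; elim: m P => // m IHm P ltPm.
have [-> | ] := eqVneq P setT; first exact: connect0.
rewrite -(inj_eq (@setC_inj _)) setCT => /(acyclic_source acy)[v].
rewrite inE => vP; rewrite disjoints_subset setCK => sub.
apply: (connect_trans (y := v |: P)).
  apply: connect1; apply/existsP; exists v; apply/orP; left.
  by rewrite /rev_place vP sub eqxx.
apply: IHm; rewrite -ltnS; apply: leq_trans ltPm; rewrite ltnS.
by apply: proper_card; rewrite properC properUr // sub1set.
Qed.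

Lemma attained_space_exists z : acyclic ->
  exists k, `[< attained_space z k >].
Proof.
move=> acy.
have : connect rev_step set0 [set z].
  apply: connect_trans (rev_connect_full _ acy) _.
  rewrite (sym_connect_sym (rev_step_sym acy)).
  exact: rev_connect_full.
case/connectP => Ps path_Ps last_Ps; exists (pebbling_space set0 Ps).
by apply/asboolP; exists Ps; split.
Qed.

End Pebbling.

Record ssdag := SSDag {
  dag_size : nat;
  dag_edge : rel 'I_dag_size;
  dag_acyclic : acyclic dag_edge;
  dag_sink : 'I_dag_size;
  dag_sinkP : forall v, is_sink dag_edge v = (v == dag_sink)
}.

Definition fanin_le (d : nat) (G : ssdag) : Prop :=
  forall v, #|pred_set (@dag_edge G) v| <= d.

Definition rev_price (G : ssdag) : nat :=
  ex_minn (attained_space_exists (dag_sink G) (@dag_acyclic G)).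

Inductive quantifier := QAll | QEx.

(* The literal (i, true) is x_i and (i, false) is its negation. *)
Definition literal (n : nat) : Type := ('I_n * bool)%type.
Definition clause (n : nat) : Type := seq (literal n).

(* A clause of a 3-CNF has at most three literals. *)
Record qbf := QBF {
  qbf_size : nat;
  qbf_prefix : qbf_size.-tuple quantifier;
  qbf_matrix : seq (clause qbf_size);
  qbf_3cnf : all (fun C : clause qbf_size => size C <= 3) qbf_matrix
}.

Definition cnf_true (n : nat) (F : seq (clause n)) (rho : nat -> bool) : bool :=
  all (fun C : clause n => has (fun l : literal n => rho l.1 == l.2) C) F.

(* rho lists the values of the variables quantified so far, outermost first. *)
Fixpoint prefix_true (qs : seq quantifier) (F : (nat -> bool) -> bool)
    (rho : seq bool) : bool :=
  match qs with
  | [::] => F (nth false rho)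
  | QAll :: qs' =>
      prefix_true qs' F (rcons rho false) && prefix_true qs' F (rcons rho true)
  | QEx :: qs' =>
      prefix_true qs' F (rcons rho false) || prefix_true qs' F (rcons rho true)
  end.

Definition qbf_true (phi : qbf) : bool :=
  prefix_true (qbf_prefix phi) (cnf_true (qbf_matrix phi)) [::].

Inductive move := MoveL | MoveN | MoveR.

Section Tapes.
Variable A : finType.

Definition symbol : Type := option (bool + A).
Definition blank : symbol := None.
Definition bit (b : bool) : symbol := Some (inl b).

(* A two-way infinite tape, all blank outside the stored cells.  The left part
   is listed starting from the cell next to the head. *)
Record tape := Tape {
  tape_left : seq symbol; tape_head : symbol; tape_right : seq symbol
}.

(* The cells visited so far, together with those that held the input. *)
Definition tape_size (t : tape) : nat :=
  (size (tape_left t) + size (tape_right t)).+1.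

Definition tape_of (s : seq symbol) : tape :=
  Tape [::] (head blank s) (behead s).

Definition tape_act (t : tape) (a : symbol) (m : move) : tape :=
  let: Tape l _ r := t in
  match m with
  | MoveL => Tape (behead l) (head blank l) (a :: r)
  | MoveN => Tape l a r
  | MoveR => Tape (a :: l) (head blank r) (behead r)
  end.

Fixpoint bit_prefix (s : seq symbol) : seq bool :=
  if s is Some (inl b) :: s' then b :: bit_prefix s' else [::].

Definition tape_word (t : tape) : seq bool :=
  bit_prefix (tape_head t :: tape_right t).

End Tapes.

(* A machine has tm_extra.+1 tapes; tape 0 is used for input and output.  It
   halts when tm_trans returns None. *)
Record tm := TM {
  tm_extra : nat;
  tm_alpha : finType;
  tm_state : finType;
  tm_start : tm_state;
  tm_accept : pred tm_state;
  tm_trans : tm_state -> {ffun 'I_tm_extra.+1 -> symbol tm_alpha} ->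
    option (tm_state * ('I_tm_extra.+1 -> symbol tm_alpha * move))
}.

Section Runs.
Variable M : tm.

Record config := Config {
  conf_state : tm_state M;
  conf_tape : 'I_(tm_extra M).+1 -> tape (tm_alpha M)
}.

Definition conf_trans (c : config) :=
  tm_trans (conf_state c) [ffun i => tape_head (conf_tape c i)].

Definition halted (c : config) : bool := ~~ isSome (conf_trans c).

Definition conf_next (c : config) : config :=
  if conf_trans c is Some (q, act) then
    Config q (fun i => tape_act (conf_tape c i) (act i).1 (act i).2)
  else c.

Definition conf_init (w : seq bool) : config :=
  Config (tm_start M)
    (fun i => if i == ord0 then tape_of (map (bit (tm_alpha M)) w)
              else tape_of [::]).

Definition conf_run (w : seq bool) (t : nat) : config :=
  iter t conf_next (conf_init w).

(* The input tape is counted, which makes no difference for polynomial bounds. *)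
Definition conf_space (c : config) : nat := \sum_i tape_size (conf_tape c i).

Definition conf_accept (c : config) : bool := tm_accept (conf_state c).

Definition conf_output (c : config) : seq bool := tape_word (conf_tape c ord0).

End Runs.

Definition language : Type := seq bool -> Prop.

Definition poly_bounded (f : nat -> nat) : Prop :=
  exists c k, forall n, f n <= c * n ^ k + c.

Definition in_PSPACE (L : language) : Prop :=
  exists (M : tm) (s : nat -> nat), poly_bounded s /\ forall w : seq bool,
    (forall t, conf_space (conf_run M w t) <= s (size w)) /\
    exists t, halted (conf_run M w t) /\ (conf_accept (conf_run M w t) <-> L w).

(* Only the behaviour on codes of elements of A is constrained. *)
Definition polytime (A B : Type) (encA : A -> seq bool) (encB : B -> seq bool)
    (f : A -> B) : Prop :=
  exists (M : tm) (T : nat -> nat), poly_bounded T /\ forall a : A,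
    exists t, [/\ t <= T (size (encA a)), halted (conf_run M (encA a) t)
                & conf_output (conf_run M (encA a) t) = encB (f a)].

Definition polytime_reducible (L1 L2 : language) : Prop :=
  exists f : seq bool -> seq bool, polytime id id f /\ forall w, L1 w <-> L2 (f w).

Definition PSPACE_complete (L : language) : Prop :=
  in_PSPACE L /\ forall L', in_PSPACE L' -> polytime_reducible L' L.

Definition enc_unary (n : nat) : seq bool := rcons (nseq n true) false.

(* Binary digits, least significant first, without leading zeros. *)
Definition enc_binary (n : nat) : seq bool :=
  [seq odd (n %/ 2 ^ i) | i <- iota 0 (up_log 2 n.+1)].

Definition enc_int (s : int) : seq bool := (s < 0)%R :: enc_binary `|s|%N.

Definition enc_seq (A : Type) (enc : A -> seq bool) (s : seq A) : seq bool :=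
  rcons (flatten [seq true :: enc x | x <- s]) false.

(* The sink is not encoded: the edges determine it.  The number of vertices in
   unary is followed by the adjacency matrix, row by row. *)
Definition enc_dag (G : ssdag) : seq bool :=
  enc_unary (dag_size G) ++
  [seq dag_edge u v | u <- enum 'I_(dag_size G), v <- enum 'I_(dag_size G)].

Definition enc_quantifier (Q : quantifier) : bool :=
  if Q is QAll then true else false.

Definition enc_literal (n : nat) (l : literal n) : seq bool :=
  l.2 :: enc_unary l.1.

Definition enc_qbf (phi : qbf) : seq bool :=
  enc_unary (qbf_size phi) ++ map enc_quantifier (qbf_prefix phi) ++
  enc_seq (enc_seq (@enc_literal _)) (qbf_matrix phi).

Definition rev_price_problem : language := fun w =>
  exists (G : ssdag) (s : int),
    [/\ w = enc_dag G ++ enc_int s, fanin_le 2 G & ((rev_price G)%:Z <= s)%R].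

(* Main.v *)
Require Import Defs.
From mathcomp Require Import all_boot all_order all_algebra.
From mathcomp Require Import boolp zify ring.
Set Implicit Arguments.
Unset Strict Implicit.
Unset Printing Implicit Defensive.

(* A reversible pebbling of space [k] exists iff the pebbler wins with [k] placements the game in which, after
   each of them, the challenger moves along a path to an unpebbled vertex (Dymond and Tompa); a pebble halves
   what the challenger can reach.  Towers serve as leaves of known value, and chains of gadgets make the
   pebbler choose the existential literals and the challenger the universal ones.  The game tree has polynomial
   depth, which gives membership; hardness goes through the formula given by Savitch's recursion.  All maps
   are written as expressions with bounded recursion, which are compiled once to Turing machines. *)

(** A single round has to separate true from false formulas after polynomially many levels, although
    the pebbler may pebble anywhere, also far below the current gadget. Hence gadgets are chains
    with very many leaves compared with the total number of pebbles, and a pebble outside the chain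
    spoils at most one leaf. Leaves of a false tower are harder by one round as long as no pebble
    prejudges a later choice; a pebble that does is locally a lost round, which pays exactly for
    that unit. A literal is true if its top is pebbled and false if its top can merely be placed at
    once; a test costs 3 or 4 rounds accordingly. Choosing a value takes four pebbles; the chain
    lengths, about 8, 2, 2, 1 and 1 units, are such that every other move leaves the challenger one
    unit more than the remaining rounds can handle. Universal variables too get their value from the
    pebbler: the challenger picks a half of a fork, and a test compares. Vertices outside the
    gadgets are strung on one path below the root, so that the edges are given by arithmetic.
    Expressions bounded polynomially in their argument run in polynomial time on [size w] and in
    polynomial space on [2 ^ size w]. *)

Module Lib.
Export all_boot all_order all_algebra boolp.
End Lib.

(** * The pebble game and its equivalence with reversible pebbling *)

Module Game.

Section Game.
Variables (V : finType) (e : rel V).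

(** [D] is the set of pebbled vertices and [v] the challenged one. After [u] is pebbled the
    challenger only stays at [v] or moves to [u]; descents to other unpebbled vertices would gain
    nothing, by [win_down]. *)
Fixpoint win (k : nat) (D : {set V}) (v : V) : bool :=
  (pred_set e v \subset D) ||
  (if k is k'.+1 then [exists u, win k' (u |: D) v && win k' (u |: D) u]
   else false).

Lemma win0 k (D : {set V}) v : pred_set e v \subset D -> win k D v.
Proof. by case: k => [|k] /= ->. Qed.

Lemma winS u k (D : {set V}) v : win k (u |: D) v -> win k (u |: D) u -> win k.+1 D v.
Proof.
by move=> h1 h2 /=; apply/orP; right; apply/existsP; exists u; rewrite h1 h2.
Qed.

Lemma winP k (D : {set V}) v : reflect (pred_set e v \subset D \/
   exists k' u, [/\ k = k'.+1, win k' (u |: D) v & win k' (u |: D) u]) (win k D v).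
Proof.
apply: (iffP idP).
  case: k => [|k] /= /orP[]; [by left | by [] | by left |].
  by case/existsP => u /andP[h1 h2]; right; exists k, u.
by case=> [/win0 //|[k' [u [-> h1 h2]]]]; exact: winS h1 h2.
Qed.

Lemma win_subset k (D D' : {set V}) v : D \subset D' -> win k D v -> win k D' v.
Proof.
elim: k D D' v => [|k IH] D D' v sub /=.
  by rewrite !orbF => h; exact: subset_trans h sub.
case/orP=> [h|/existsP[u /andP[h1 h2]]]; first by rewrite (subset_trans h sub).
by apply: (@winS u); [apply: IH h1|apply: IH h2]; apply: setUS.
Qed.

Lemma win_leq k k' D v : k <= k' -> win k D v -> win k' D v.
Proof.
elim: k' k D v => [|k' IH] k D v; first by rewrite leqn0 => /eqP->.
case: k => [|k] lek; first by move=> /=; rewrite orbF => ->.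
case/winP => [|[k0 [u [[<-] h1 h2]]]]; first exact: win0.
by apply: (@winS u); [exact: IH h1|exact: IH h2].
Qed.

(* The challenger may always descend along an unpebbled edge. *)
Lemma win_down k (D : {set V}) v y : e y v -> y \notin D -> win k D v -> win k D y.
Proof.
elim: k D v y => [|k IH] D v y eyv yD.
  rewrite /= orbF => /subsetP/(_ y); rewrite inE eyv (negPf yD).
  by move=> /(_ isT).
case/winP => [/subsetP/(_ y)|[_ [u [[<-] h1 h2]]]].
  by rewrite inE eyv (negPf yD) => /(_ isT).
have [uy|nuy] := eqVneq u y; first by subst u; apply: (@winS y).
apply: (@winS u) h2; apply: IH h1 => //.
by rewrite !inE negb_or eq_sym nuy.
Qed.

Hypothesis acy : acyclic e.

Definition spaced (s : nat) (A B : {set V}) : bool :=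
  [&& rev_step e A B, #|A| <= s & #|B| <= s].

Lemma spaced_sym s : symmetric (spaced s).
Proof.
by move=> A B; rewrite /spaced (rev_step_sym acy); congr (_ && _); rewrite andbC.
Qed.

Lemma conn_sym s : connect_sym (spaced s).
Proof. exact: sym_connect_sym (@spaced_sym s). Qed.

Lemma spaced_place s (A : {set V}) v : v \notin A -> pred_set e v \subset A ->
  #|A| < s -> spaced s A (v |: A).
Proof.
move=> vA sub cA; rewrite /spaced (ltnW cA) cardsU1 vA cA !andbT.
by apply/existsP; exists v; rewrite /rev_place vA sub eqxx.
Qed.

Lemma acyclic_connect x y : e x y -> ~~ connect e y x.
Proof.
move=> exy; apply/negP => /connectP[p pth def_x].
have := acy (c := y :: p); rewrite /= rcons_path pth -def_x exy.
by move=> /(_ isT).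
Qed.

Lemma acyclic_anti x y : connect e x y -> connect e y x -> x = y.
Proof.
case/connectP => [[|z p]] /=; first by move=> _ ->.
case/andP => exz pth def_y cyx.
have := acyclic_connect exz; rewrite (connect_trans _ cyx) //.
by apply/connectP; exists p.
Qed.

(* Pebbles of [D] that are not ancestors of the challenged vertex are useless,
   hence need not be present in the actual configuration [A]. *)
Lemma win_conn k (D A : {set V}) v s :
  (forall x, x \in D -> connect e x v -> x != v -> x \in A) ->
  v \notin A -> #|A| + k < s -> win k D v -> connect (spaced s) A (v |: A).
Proof.
elim: k D A v s => [|k IH] D A v s DA vA cA wv.
  apply: connect1; apply: spaced_place => //; last by rewrite -[X in X < _]addn0.
  move: wv; rewrite /= orbF => /subsetP h; apply/subsetP => x px.
  have exv : e x v by rewrite inE in px.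
  apply: DA (h _ px) (connect1 exv) _; apply: contraL exv => /eqP ->.
  exact: acyclic_irr.
case/winP: (wv) => [/subsetP h|[_ [u [[<-] h1 h2]]]].
  apply: connect1; apply: spaced_place => //; last first.
    by apply: leq_ltn_trans cA; rewrite leq_addr.
  apply/subsetP => x px; have exv : e x v by rewrite inE in px.
  apply: DA (h _ px) (connect1 exv) _; apply: contraL exv => /eqP ->.
  exact: acyclic_irr.
have cA' : #|A| + k < s by apply: leq_trans cA; rewrite ltnS leq_add2l.
(* Only a proper ancestor [u] of [v] outside [A] is really placed: pebble [u], then [v], and take
   [u] off again by running its placement backwards on top of [v]. *)
have [/andP[/andP[uA uv] cuv]|bad] := boolP [&& (u \notin A) && (u != v) & connect e u v].
  have hu (B : {set V}) : A \subset B -> u \notin B -> #|B| + k < s ->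
      connect (spaced s) B (u |: B).
    move=> /subsetP AB uB cB; apply: IH h2 => // x.
    rewrite !inE => /orP[/eqP->|xD] cxu xu; first by rewrite eqxx in xu.
    apply: AB; apply: DA xD _ _; first exact: connect_trans cxu cuv.
    apply: contraNneq uv => xv; apply/eqP; apply: acyclic_anti => //.
    by rewrite -xv.
  apply: connect_trans (hu A _ _ _) _ => //.
  apply: (connect_trans (y := v |: (u |: A))).
    apply: IH h1.
    - move=> x; rewrite !inE => /orP[->//|xD] c1 c2.
      by rewrite (DA _ xD) ?orbT.
    - by rewrite !inE negb_or eq_sym uv.
    - by rewrite cardsU1 uA add1n addSnnS.
  rewrite (conn_sym s) setUCA; apply: hu; first exact: subsetUr.
    by rewrite !inE negb_or uv.
  by rewrite cardsU1 vA add1n addSnnS.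
(* Here [u] is in [A], equals [v], or is no ancestor of [v], so [A] already meets the requirement
   for [u |: D]. *)
apply: IH h1 => // x; rewrite !inE => /orP[/eqP->|xD] c1 c2; last exact: DA.
by move: bad; rewrite c1 c2 !andbT negbK.
Qed.

Lemma conn_pebbling s (A B : {set V}) : connect (spaced s) A B -> #|A| <= s ->
  exists Ps, [/\ rev_pebbling e A Ps, last A Ps = B & pebbling_space A Ps <= s].
Proof.
case/connectP => Ps pth lst cA; exists Ps; split => //.
  by apply: sub_path pth => x y /andP[].
rewrite /pebbling_space big_cons geq_max cA /=.
elim: Ps A pth {lst} cA => [|P Ps IHs] A /=; first by rewrite big_nil.
case/andP => /and3P[_ _ cP] pth _; rewrite big_cons geq_max cP /=.
exact: IHs pth cP.
Qed.

(* The vertices of [D] are regarded as always pebbled. *)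
Definition rel_step (D A B : {set V}) : bool :=
  [exists v, (pred_set e v \subset A :|: D) &&
     ((v \notin A) && (B == v |: A) || (v \in A) && (B == A :\ v))].

Lemma rel_step_sym D : symmetric (rel_step D).
Proof.
have imp A B : rel_step D A B -> rel_step D B A.
  case/existsP => v /andP[sub stp]; apply/existsP; exists v.
  have irr : v \notin pred_set e v by rewrite inE acyclic_irr.
  have sub' : pred_set e v \subset A :\ v :|: D.
    apply/subsetP => x px; move/subsetP: sub => /(_ x px); rewrite !inE.
    by case/orP=> ->; rewrite ?orbT // andbT; case: eqVneq px irr => // -> ->.
  case/orP: stp => /andP[vA /eqP->]; apply/andP; split.
  - by apply: subset_trans sub _; rewrite setSU // subsetUr.
  - by rewrite setU11 setU1K // eqxx orbT.
  - exact: sub'.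
  - by rewrite setD11 setD1K // eqxx.
by move=> A B; apply/idP/idP; apply: imp.
Qed.

(** A pebble present during the whole segment is traded for a permanent one, which saves one unit of
    space. *)
Lemma rel_path_remove (D : {set V}) u (A : {set V}) (Qs : seq {set V}) :
  path (rel_step D) A Qs -> {in A :: Qs, forall B : {set V}, u \in B} ->
  path (rel_step (u |: D)) (A :\ u) [seq B :\ u | B <- Qs].
Proof.
elim: Qs A => //= B Qs IH B0 /andP[st pt] uQ; apply/andP; split; last first.
  by apply: IH pt _ => X XQ; apply: uQ; rewrite inE XQ orbT.
have uB0 : u \in B0 by rewrite uQ // mem_head.
have uB : u \in B by rewrite uQ // !inE eqxx orbT.
case/existsP: st => w /andP[sw cw]; apply/existsP; exists w.
have -> : pred_set e w \subset B0 :\ u :|: (u |: D).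
  by apply/subsetP => x /(subsetP sw); rewrite !inE; case: (eqVneq x u).
have nwu : w != u.
  apply: contraTneq cw => ->; rewrite uB0 /=.
  by apply/eqP => dB; move: uB; rewrite dB !inE eqxx.
case/orP: cw => /andP[wB /eqP->]; rewrite !inE nwu ?(negPf wB) /= ?wB /=.
  by rewrite orbF; apply/eqP/setP => x; rewrite !inE; case: (eqVneq x w) => [->|]; rewrite ?nwu.
by apply/eqP/setP => x; rewrite !inE; do 2 case: eqP.
Qed.

(** The move is read off the pebbling. Drop the first configuration as long as the remaining ones
    have no common vertex. Otherwise the first step places a vertex [u] that stays to the end, and
    the pebbler plays [u]. If the challenger stays, the rest of the segment with [u] made permanent
    still justifies [v]; if he follows, the same segment read backwards ends in [A], which justifies
    [u]. Either way one pebble is saved. *)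
Lemma segment_win k (D : {set V}) v (A : {set V}) (Qs : seq {set V}) :
  path (rel_step D) A Qs -> {in A :: Qs, forall B : {set V}, #|B| <= k} ->
  (forall w, exists2 B, B \in A :: Qs & w \notin B) ->
  pred_set e v \subset last A Qs :|: D -> win k D v.
Proof.
elim: k D v A Qs => [|k IHk] D v A Qs pth cQ iQ sub.
  apply: win0; move: sub; have := cQ _ (mem_last A Qs).
  by rewrite leqn0 cards_eq0 => /eqP->; rewrite set0U.
elim: Qs A pth cQ iQ sub => [|A1 Qs IH] A /= pth cQ iQ sub.
  apply: (@win0 k.+1); apply/subsetP => x /(subsetP sub); rewrite inE => /orP[xA|//].
  by have [B] := iQ x; rewrite inE => /eqP->; rewrite xA.
have [all1|/existsNP[u nu]] := pselect (forall w, exists2 B, B \in A1 :: Qs & w \notin B).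
  by apply: IH all1 sub => [|B BQ]; [case/andP: pth | rewrite cQ // inE BQ orbT].
have uQ : {in A1 :: Qs, forall B : {set V}, u \in B}.
  by move=> B BQ; apply/negPn/negP => uB; apply: nu; exists B.
have uA : u \notin A.
  have [B] := iQ u; rewrite inE => /orP[/eqP->//|BQ].
  by rewrite uQ.
case/andP: pth => stp pth.
have uA1 : u \in A1 by rewrite uQ // mem_head.
have [subu defA1] : pred_set e u \subset A :|: D /\ A1 = u |: A.
  case/existsP: stp => w /andP[sw /orP[]/andP[wA /eqP dA1]]; last first.
    by move: uA1; rewrite dA1 !inE (negPf uA) andbF.
  by move: uA1; rewrite dA1 !inE (negPf uA) orbF => /eqP->.
have A1u : A1 :\ u = A by rewrite defA1 setU1K.
have pth' := rel_path_remove pth uQ.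
have cQ' : {in (A1 :\ u) :: [seq B :\ u | B <- Qs], forall B : {set V}, #|B| <= k}.
  move=> B; rewrite -(map_cons (fun B => B :\ u)) => /mapP[X XQ ->].
  have := cQ X; rewrite inE XQ orbT => /(_ isT).
  by rewrite (cardsD1 u) uQ.
have iQ' w : exists2 B, B \in (A1 :\ u) :: [seq B :\ u | B <- Qs] & w \notin B.
  have [B] := iQ w; rewrite inE => /orP[/eqP->|BQ] wB.
    by exists (A1 :\ u); rewrite ?mem_head // A1u.
  exists (B :\ u); last by rewrite !inE negb_and wB orbT.
  by rewrite -(map_cons (fun B => B :\ u)); apply/mapP; exists B.
have lastE : last (A1 :\ u) [seq B :\ u | B <- Qs] = last A1 Qs :\ u.
  by rewrite (last_map (fun B => B :\ u)).
apply: (@winS u).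
  apply: IHk pth' cQ' iQ' _; rewrite lastE; apply: subset_trans sub _.
  by apply/subsetP => x; rewrite !inE; case: (eqVneq x u).
(* The reversed segment, legal because [rel_step] is symmetric; it ends in [A]. *)
set R := rev (belast (A1 :\ u) [seq B :\ u | B <- Qs]).
have memR B : (B \in last A1 Qs :\ u :: R) = (B \in (A1 :\ u) :: [seq B :\ u | B <- Qs]).
  by rewrite -lastE /R -rev_rcons -lastI mem_rev.
apply: (IHk _ _ (last A1 Qs :\ u) R).
- rewrite -lastE rev_path.
  by rewrite (eq_path (e' := rel_step (u |: D))) // => x y; rewrite rel_step_sym.
- by move=> B; rewrite memR; apply: cQ'.
- by move=> w; have [B] := iQ' w; exists B; rewrite ?memR.
- have -> : last (last A1 Qs :\ u) R = A.
    rewrite -A1u /R; case: (Qs) => [|B Q] //=.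
    by rewrite rev_cons last_rcons.
  by apply: subset_trans subu _; rewrite setUS // subsetUr.
Qed.

(** Take the last moment at which [z] is unpebbled. Afterwards [z] occupies one pebble and, being a
    sink, supports no move. Without it and read backwards, the remainder is a segment with one
    pebble fewer from the empty set to a configuration that contains the predecessors of [z]. *)
Lemma pebbling_win z (Ps : seq {set V}) s : is_sink e z ->
  rev_pebbling e set0 Ps -> last set0 Ps = [set z] ->
  pebbling_space set0 Ps <= s.+1 -> win s set0 z.
Proof.
move=> /forallP snk pth lst /bigmax_leqP_seq spc.
suff gen (A : {set V}) : path (rev_step e) A Ps -> last A Ps = [set z] ->
    {in A :: Ps, forall B : {set V}, #|B| <= s.+1} ->
    ~~ all (fun B : {set V} => z \in B) (A :: Ps) -> win s set0 z.
  apply: gen pth lst _ _; first by move=> B BP; apply: spc.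
  by rewrite /= inE.
move=> {pth lst spc}.
elim: Ps A => [|A1 Ps IH] A; first by rewrite /= => _ ->; rewrite set11.
rewrite [path _ _ _]/= [last _ _]/= => /andP[stp pth] lst cP nall.
have cP1 : {in A1 :: Ps, forall B : {set V}, #|B| <= s.+1}.
  by move=> B BQ; apply: cP; rewrite inE BQ orbT.
have [/allP zP|] := boolP (all (fun B : {set V} => z \in B) (A1 :: Ps)); last first.
  exact: IH pth lst cP1.
have zA : z \notin A.
  by apply: contraNN nall => zA; apply/allP => B; rewrite inE => /orP[/eqP->|/zP].
have relE : subrel (rev_step e) (rel_step set0).
  move=> X Y /existsP[w /orP[]/and3P[wX sub dY]]; apply/existsP; exists w;
  by rewrite setU0 sub wX dY ?orbT.
have {}pth := rel_path_remove (sub_path relE pth) zP.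
have zn w : z \notin pred_set e w by rewrite inE snk.
have {pth}pth : path (rel_step set0) (A1 :\ z) [seq B :\ z | B <- Ps].
  apply: sub_path pth => X Y /existsP[w /andP[/subsetP sub dY]].
  apply/existsP; exists w; rewrite dY andbT; apply/subsetP => x xw.
  move: (sub x xw); rewrite !inE; case: (eqVneq x z) xw => [-> xw|//].
  by have := zn w; rewrite xw.
have A1z : pred_set e z \subset A :|: set0 /\ A1 :\ z = A.
  have zA1 : z \in A1 by rewrite zP // mem_head.
  case/existsP: stp => w /orP[]/and3P[wA sub /eqP dA1]; move: zA1; rewrite dA1.
    rewrite !inE (negPf zA) orbF => /eqP zw; subst w.
    by rewrite setU0 setU1K.
  by rewrite !inE (negPf zA) andbF.
case: A1z => sub A1z.
have lastE : last (A1 :\ z) [seq B :\ z | B <- Ps] = set0.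
  by rewrite (last_map (fun B : {set V} => B :\ z)) lst setDv.
set R := rev (belast (A1 :\ z) [seq B :\ z | B <- Ps]).
have memR B : (B \in set0 :: R) = (B \in (A1 :\ z) :: [seq B :\ z | B <- Ps]).
  by rewrite -lastE /R -rev_rcons -lastI mem_rev.
apply: (segment_win (A := set0) (Qs := R)).
- rewrite -[X in path _ X]lastE rev_path.
  by rewrite (eq_path (e' := rel_step set0)) // => x y; rewrite rel_step_sym.
- move=> B; rewrite memR -(map_cons (fun B : {set V} => B :\ z)) => /mapP[X XQ ->].
  by have := cP1 X XQ; rewrite (cardsD1 z) zP.
- by move=> w; exists set0; rewrite ?mem_head ?inE.
- have -> : last set0 R = A.
    rewrite -[X in last X]lastE -A1z /R.
    by case: (Ps) => [|B Q] //=; rewrite rev_cons last_rcons.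
  exact: sub.
Qed.

End Game.

(** The shift by one is the pebble on the sink itself, which the game does not count. *)
Lemma rev_price_le (G : ssdag) s :
  (rev_price G <= s.+1) = win (@dag_edge G) s set0 (dag_sink G).
Proof.
rewrite /rev_price; case: ex_minnP => k /asboolP[Ps [pth lst spc]] mink.
have acy := @dag_acyclic G.
have snk : is_sink (@dag_edge G) (dag_sink G) by rewrite dag_sinkP.
apply/idP/idP => [lek|w].
  by apply: pebbling_win pth lst _ => //; rewrite spc.
have cn : connect (spaced (@dag_edge G) s.+1) set0 (dag_sink G |: set0).
  apply: (win_conn acy _ _ _ w) => [x||]; first by rewrite in_set0.
    by rewrite in_set0.
  by rewrite cards0.
have [|Qs [pth' lst' spc']] := conn_pebbling cn; first by rewrite cards0.
apply: leq_trans spc'; apply: mink.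
by apply/asboolP; exists Qs; split => //; rewrite lst' setU0.
Qed.


End Game.

(** * Counting the leaves that the challenger can still reach *)

Module Reaching.
Import Game Lib.

Lemma disjointsU1r (V : finType) (A D : {set V}) u :
  [disjoint A & u |: D] = (u \notin A) && [disjoint A & D].
Proof.
rewrite !(disjoint_sym A) !disjoints_subset; apply/idP/andP => [/subsetP sub|[uA /subsetP sub]].
  by split; [rewrite -in_setC sub ?setU11 | apply/subsetP => x xD; rewrite sub // inE xD orbT].
by apply/subsetP => x; rewrite !inE => /orP[/eqP->//|/sub]; rewrite inE.
Qed.

Section Count.
Variables (V : finType) (e : rel V) (Loc Lf : {set V}) (P : V -> {set V}).
Hypothesis P_self : forall y, y \in Lf -> y \in P y.
Hypothesis P_out : forall y x, y \in Lf -> x \in P y -> x \notin Loc.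
Hypothesis P_uniq : forall y y' x, y \in Lf -> y' \in Lf -> x \in P y -> x \in P y' -> y = y'.

(** [Loc] is the gadget under consideration, [Lf] the tops of the chains hanging from it, and [P y]
    the whole chain of the leaf [y]. A step starts only inside [Loc], so paths end at leaves. *)
Definition down (D : {set V}) : rel V := fun a b => [&& e b a, b \notin D & a \in Loc].
Definition reach (D : {set V}) : rel V := connect (down D).
Definition avail (D : {set V}) v : {set V} :=
  [set y in Lf | [disjoint P y & D] && reach D v y].

Lemma reach_split (D : {set V}) u v y :
  reach D v y -> reach (u |: D) v y || reach (u |: D) u y.
Proof.
case/connectP => p; elim: p v => [|x p IH] v /=.
  by move=> _ ->; rewrite /reach connect0.
case/andP => /and3P[exv xD vL] pth /(IH _ pth) /orP[r|->]; last by rewrite orbT.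
have [xu|nxu] := eqVneq x u; first by rewrite xu in r; rewrite r orbT.
apply/orP; left; apply: connect_trans r; apply: connect1.
by rewrite /down exv vL !inE negb_or nxu xD.
Qed.

Lemma reach_out (D : {set V}) u y : u \notin Loc -> reach D u y -> y = u.
Proof.
move=> uL /connectP[[|x p]] /=; first by move=> _ ->.
by rewrite /down (negPf uL) !andbF.
Qed.

Lemma win_reach k (D : {set V}) v y : reach D v y -> win e k D v -> win e k D y.
Proof.
case/connectP => p; elim: p v => [|x p IH] v /=; first by move=> _ ->.
case/andP => /and3P[exv xD _] pth def_y wv.
exact: IH pth def_y (win_down exv xD wv).
Qed.

Lemma avail_win_moves k (D : {set V}) v : v \notin Lf -> 0 < #|avail D v| ->
  win e k D v -> exists k' u, [/\ k = k'.+1, win e k' (u |: D) v & win e k' (u |: D) u].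
Proof.
move=> vL /card_gt0P[y]; rewrite inE => /and3P[yL dy /connectP[[|x p]]] /=.
  by move=> _ yv; rewrite yv (negPf vL) in yL.
case/andP => /and3P[exv xD _] _ _ /winP[/subsetP/(_ x)|//].
by rewrite inE exv (negPf xD) => /(_ isT).
Qed.

Lemma avail_base (D : {set V}) v k : v \notin Lf -> 0 < #|avail D v| -> win e k D v ->
  exists x y, [/\ y \in Lf, [disjoint P y & D], e y x & win e k D x].
Proof.
move=> vL /card_gt0P[y]; rewrite inE => /and3P[yL dy /connectP[p pth def_y]] wv.
case/lastP: p pth def_y => [_ /= yv|p z]; first by rewrite yv (negPf vL) in yL.
rewrite rcons_path last_rcons => /andP[pth /and3P[ez _ _]] yz; subst z.
exists (last v p), y; split => //; apply: win_reach wv.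
by apply/connectP; exists p.
Qed.

(** A move inside the gadget distributes the available leaves between staying and following. A move
    outside hits at most one of the disjoint chains and so spoils at most one leaf. *)
Lemma avail_step (D : {set V}) u v :
  (#|avail D v| <= #|avail (u |: D) v|.+1) \/
  (u \notin Lf /\ #|avail D v| <= #|avail (u |: D) v| + #|avail (u |: D) u|).
Proof.
have [uL|uL] := boolP (u \in Loc).
  right; split; first by apply/negP => uf; have := P_out uf (P_self uf); rewrite uL.
  rewrite -cardsUI; apply: leq_trans (leq_addr _ _); apply: subset_leq_card.
  apply/subsetP => y; rewrite !inE => /and3P[yL dy ry]; rewrite yL /=.
  have -> : [disjoint P y & u |: D].
    rewrite disjointsU1r dy andbT.
    by apply/negP => uy; have := P_out yL uy; rewrite uL.
  exact: reach_split.
left; have [/existsP[y0 /andP[y0L uy0]]|none] := boolP [exists y, (y \in Lf) && (u \in P y)].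
  apply: (@leq_trans #|y0 |: avail (u |: D) v|); last by rewrite cardsU1; case: (_ \notin _).
  apply: subset_leq_card; apply/subsetP => y; rewrite !inE => /and3P[yL dy ry].
  have [->//|ny] := eqVneq y y0; rewrite yL /=.
  have uy : u \notin P y by apply: contra_neqN ny => uy; apply: P_uniq uy uy0.
  rewrite disjointsU1r dy uy /=.
  have /orP[//|/(reach_out uL) yu] := reach_split u ry.
  by rewrite -yu (P_self yL) in uy.
apply: leqW; apply: subset_leq_card; apply/subsetP => y; rewrite !inE => /and3P[yL dy ry].
rewrite yL /=.
have uy : u \notin P y by apply: contra none => uy; apply/existsP; exists y; rewrite yL.
rewrite disjointsU1r dy uy /=.
have /orP[//|/(reach_out uL) yu] := reach_split u ry.
by rewrite -yu (P_self yL) in uy.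
Qed.

Variables (R h : nat).
Hypothesis hard : forall (D : {set V}) x y, y \in Lf -> [disjoint P y & D] -> e y x ->
  #|D| + h <= R -> ~~ win e h D x.

Lemma card_move (D : {set V}) u k : #|D| + k.+1 <= R -> #|u |: D| + k <= R.
Proof. by rewrite cardsU1; case: (_ \notin _) => /= H; lia. Qed.

(* Every pebble at most halves the number of reachable leaves. *)
Lemma count_hard q (D : {set V}) v : v \notin Lf -> #|D| + (h + q) <= R ->
  2 ^ q < 2 * #|avail D v| -> ~~ win e (h + q) D v.
Proof.
elim: q D v => [|q IH] D v vL cD n.
  apply/negP => w; have n0 : 0 < #|avail D v| by lia.
  have [x [y [yL dy eyx]]] := avail_base vL n0 w.
  by rewrite addn0 in cD *; apply/negP/(hard yL).
apply/negP => w; have n0 : 0 < #|avail D v| by lia.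
have [k [u []]] := avail_win_moves vL n0 w.
rewrite addnS => -[<-] w1 w2.
have cD' : #|u |: D| + (h + q) <= R by apply: card_move; rewrite -addnS.
have p2 : 0 < 2 ^ q by rewrite expn_gt0.
(* [2 ^ q] doubles while the available leaves are split in two or lose a single one; the factor 2 in
   the strict bound absorbs the single loss. *)
move: n; rewrite expnS; have [le|[uL le]] := avail_step D u v => n.
  by move: w1; apply/negP/IH => //; lia.
have [lt|ge] := ltnP (2 ^ q) (2 * #|avail (u |: D) v|).
  by move: w1; apply/negP/IH.
by move: w2; apply/negP/IH => //; lia.
Qed.

Variable Good : {set V} -> Prop.
Hypothesis good_hard : forall (D : {set V}) x y, Good D -> y \in Lf -> [disjoint P y & D] ->
  e y x -> #|D| + h.+1 <= R -> ~~ win e h.+1 D x.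
Hypothesis good_step : forall (D : {set V}) u, Good D -> ~ Good (u |: D) ->
  u \notin Loc /\ forall y, y \in Lf -> u \notin P y.

(** While the configuration is good the leaves are harder by one round. The move that ends this
    touches neither the gadget nor any leaf: it leaves the count unchanged, and the round spent on
    it is exactly the one by which the leaves become easier, so [count_hard] takes over with the
    same total. *)
Lemma count_good q (D : {set V}) v : Good D -> v \notin Lf -> #|D| + (h.+1 + q) <= R ->
  2 ^ q < 2 * #|avail D v| -> ~~ win e (h.+1 + q) D v.
Proof.
elim: q D v => [|q IH] D v gD vL cD n.
  apply/negP => w; have n0 : 0 < #|avail D v| by lia.
  have [x [y [yL dy eyx]]] := avail_base vL n0 w.
  by rewrite addn0 in cD *; apply/negP/(good_hard gD yL).
apply/negP => w; have n0 : 0 < #|avail D v| by lia.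
have [k [u []]] := avail_win_moves vL n0 w.
rewrite addnS => -[<-] w1 w2.
have cD' : #|u |: D| + (h.+1 + q) <= R by apply: card_move; rewrite -addnS.
have [gD'|bad] := pselect (Good (u |: D)).
  have p2 : 0 < 2 ^ q by rewrite expn_gt0.
move: n; rewrite expnS; have [le|[uL le]] := avail_step D u v => n.
    by move: w1; apply/negP/IH => //; lia.
  have [lt|ge] := ltnP (2 ^ q) (2 * #|avail (u |: D) v|).
    by move: w1; apply/negP/IH.
  by move: w2; apply/negP/IH => //; lia.
have [uL uP] := good_step gD bad.
move: w1; rewrite addSnnS; apply/negP/count_hard => //; first by rewrite -addSnnS.
apply: leq_trans n _; rewrite leq_mul2l /=; apply: subset_leq_card.
apply/subsetP => y; rewrite !inE => /and3P[yL dy ry]; rewrite yL /=.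
rewrite disjointsU1r dy (uP _ yL) /=.
have /orP[//|/(reach_out uL) yu] := reach_split u ry.
by have := P_self yL; rewrite {1}yu (negPf (uP _ yL)).
Qed.

Definition rb (D : {set V}) v (B : {set V}) : Prop :=
  forall y, y \in B -> [disjoint P y & D] -> reach D v y.

Lemma card_avail (D : {set V}) v (B : {set V}) : B \subset Lf -> rb D v B ->
  #|B| <= #|avail D v| + #|D|.
Proof.
move=> /subsetP BL rB; rewrite -(cardsID (avail D v) B).
apply: leq_add; first by rewrite subset_leq_card // subsetIr.
pose f y := odflt y [pick x in P y :&: D].
have fP y : y \in B :\: avail D v -> f y \in P y :&: D.
  rewrite !inE => /andP[na yB]; rewrite /f; case: pickP => [x|none] /=.
    by rewrite inE.
  have dy : [disjoint P y & D] by apply/pred0P => x; have := none x; rewrite !inE.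
  by rewrite BL // dy (rB _ yB dy) in na.
rewrite -(card_in_imset (f := f)).
  apply: subset_leq_card; apply/subsetP => x /imsetP[y yB ->].
  by have := fP _ yB; rewrite inE => /andP[].
move=> y y' yB yB' ff; have := fP _ yB; have := fP _ yB'; rewrite -ff.
rewrite !inE => /andP[f1 _] /andP[f2 _].
have [yb yb'] : y \in B /\ y' \in B by move: yB yB'; rewrite !inE => /andP[_ ?] /andP[_ ?].
by apply: P_uniq f2 f1; apply: BL.
Qed.

(** The form in which the count is used: spoiled leaves number at most [#|D|], hence at most [R],
    which is small compared with the lengths of the gadgets. *)
Lemma count_bound q (D : {set V}) v (B : {set V}) : v \notin Lf -> #|D| + (h + q) <= R ->
  win e (h + q) D v -> B \subset Lf -> rb D v B -> 2 * #|B| <= 2 ^ q + 2 * R.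
Proof.
move=> vL cD w BL rB; have le := card_avail BL rB.
have := count_hard vL cD; case: ltnP => [_ /(_ isT)|ge _]; first by rewrite w.
by apply: (@leq_trans (2 * (#|avail D v| + #|D|))); rewrite ?leq_mul2l //; lia.
Qed.

Lemma count_good_bound q (D : {set V}) v (B : {set V}) : Good D -> v \notin Lf ->
  #|D| + (h.+1 + q) <= R ->
  win e (h.+1 + q) D v -> B \subset Lf -> rb D v B -> 2 * #|B| <= 2 ^ q + 2 * R.
Proof.
move=> gD vL cD w BL rB; have le := card_avail BL rB.
have := count_good gD vL cD; case: ltnP => [_ /(_ isT)|ge _]; first by rewrite w.
by apply: (@leq_trans (2 * (#|avail D v| + #|D|))); rewrite ?leq_mul2l //; lia.
Qed.

End Count.

(* Binary search along a chain: every pebble halves the segment in which the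
   challenged vertex has to be justified. *)
Lemma chain_search (V : finType) (e : rel V) (g : nat -> V) N c s (D : {set V}) a b :
  (forall (D' : {set V}) k, D \subset D' -> k < N -> (k == 0) || (g k \in D') -> win e c D' (g k.+1)) ->
  a < b <= N -> b - a <= 2 ^ s -> (a == 0) || (g a \in D) -> win e (c + s) D (g b).
Proof.
move=> H; suff gen (D0 : {set V}) : D \subset D0 -> a < b <= N -> b - a <= 2 ^ s ->
  (a == 0) || (g a \in D0) -> win e (c + s) D0 (g b) by apply: gen.
elim: s D0 a b => [|s IH] D0 a b DD /andP[ab bN] le ga.
  have eb : b = a.+1 by move: le; rewrite expn0; lia.
  by subst b; rewrite addn0; apply: H.
have [small|big] := leqP (b - a) (2 ^ s).
  by apply: (@win_leq _ _ (c + s)); [lia | apply: IH small ga => //; rewrite ab].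
have p2 : 0 < 2 ^ s by rewrite expn_gt0.
rewrite addnS; apply: (@winS _ _ (g (a + 2 ^ s))).
  apply: (IH _ (a + 2 ^ s)).
  - exact: subset_trans DD (subsetUr _ _).
  - by rewrite bN andbT; lia.
  - by move: le; rewrite expnS; lia.
  - by rewrite setU11 orbT.
apply: (IH _ a).
- exact: subset_trans DD (subsetUr _ _).
- by apply/andP; split; lia.
- by rewrite addKn.
- by rewrite !inE; case/orP: ga => ->; rewrite ?orbT.
Qed.

End Reaching.

(** * The graph of a formula as an array of chains *)

Module Layout.
Import Game Reaching Lib.

Section Graph.
Variables (n c : nat) (q : nat -> bool) (lf : nat -> nat -> nat).

(** Three levels for each variable, one for each clause, and four at the bottom; with these four a
    tower of level [lmax] is worth at least as much as the dead path at the root ([root_win]). *)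
Definition lmax : nat := 3 * n + c + 4.
(** The unit [unt] is polynomial and at least [1024] times the square of the number of levels, so it
    dwarfs every number of pebbles that can occur in the game ([unt_huge], [RR_le]). *)
Definition usz : nat := 2 * up_log 2 lmax.+1 + 10.
Definition unt : nat := 2 ^ usz.
(** Rounds per level. The four beyond [usz] are those in which the pebbler cuts a choice chain,
    pebbles the chosen literal, prepares the opposite one and pebbles the middle item ([ub_ex]). *)
Definition rnd : nat := usz + 4.
Definition wid : nat := 16 * unt.
(** Family 0 consists of plain towers, 1 and 2 of positions in the prefix and the matrix, 3 and 4 of
    the negative and positive literals, 5 of the middle items, and [6 + t] of the towers of test
    [t]. Tests [2 * i + b] belong to variable [i], tests [2 * n + j] to clause [j]. *)
Definition fams : nat := 2 * n + c + 6.
Definition chains : nat := lmax.+2 * fams * wid.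
Definition ord_real : nat := chains * wid.
(** The three additional vertices are sources that fill absent literal slots. *)
Definition ord_dag : nat := ord_real + 3.

(** Slightly less than [8 * unt], [2 * unt] and [unt]. The missing eight leave room for the marked
    positions and the ends of the pebbler's binary searches and are negligible in the challenger's
    counts. *)
Definition nbr : nat := 8 * unt - 8.
Definition nlit : nat := 2 * unt - 8.
Definition nsml : nat := unt - 8.

Definition vi lam : nat := (lmax - lam) %/ 3.
Definition vr lam : nat := (lmax - lam) %% 3.
Definition isvar lam : bool := c + 4 < lam <= lmax.

Definition cn lam f l : nat := (lam * fams + f) * wid + l.
Definition vn lam f l p : nat := cn lam f l * wid + p.

Definition kd lam f : nat :=
  if f == 0 then (if lam == 0 then 1 else 3)
  else if f == 1 then
    (if lam == lmax.+1 then 4 else if lam == 0 then 1 else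
     if lam <= c + 4 then 3 else if vr lam == 1 then 5 else 3)
  else if f == 2 then
    (if isvar lam then (if vr lam == 0 then 0 else if vr lam == 1 then 5 else 3) else 0)
  else if f <= 5 then
    (if isvar lam && (vr lam == 1) then (if f == 5 then 7 else 6) else 0)
  else (if lam == 0 then 2 else 3).

Definition br0 lam f : nat :=
  if f == 0 then 0
  else if f == 1 then
    (if lam == lmax.+1 then 0 else
     if lam <= c + 4 then (if 4 < lam then 6 + 2 * n + (c + 4 - lam) else 0) else
     if vr lam == 0 then 1 else 6 + 2 * vi lam)
  else if f == 2 then 7 + 2 * vi lam else f.
Definition br1 lam f : nat :=
  if f == 0 then 0 else if f == 1 then (if isvar lam && (vr lam == 0) then 2 else 1)
  else if f == 2 then 1 else f.

Definition gp k : nat :=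
  if k == 0 then 0 else if k <= 2 then 3 else if k == 3 then 2 * nbr else
  if k == 4 then 2 * nbr + 1 else if k == 5 then nbr + 3 + nsml else
  if k == 6 then nlit + 1 else nsml.

(** The number of the chain whose top is the second predecessor of position [p]. A choice chain
    lists plain towers, the middle item, the positive literal, the negative literal, and copies of
    the next tower. The offsets in multiples of [unt] give the literals, the middle item and the
    choice chain disjoint ranges of plain towers. The first leaf of the root is the dead chain with
    the largest number. *)
Definition lfc lam f p : nat :=
  let k := kd lam f in
  if k == 3 then cn lam.-1 (if p < nbr then br0 lam f else br1 lam f) p
  else if k == 4 then
    (if p == 0 then chains.-1 else
     cn lam.-1 (if p.-1 < nbr then br0 lam f else br1 lam f) p.-1)
  else if k == 5 then
    (if p < nbr then cn lam.-1 0 (5 * unt + p) else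
     if p == nbr then cn lam 5 0 else if p == nbr + 1 then cn lam 4 0 else
     if p == nbr + 2 then cn lam 3 0 else cn lam.-1 f (p - (nbr + 3)))
  else if k == 6 then
    (if p == 0 then cn lam 5 0 else cn lam.-1 0 ((f - 3) * (2 * unt) + p.-1))
  else cn lam.-1 0 (4 * unt + p).

(* The level at which the tower of test [f - 6] is used. *)
Definition ul f : nat :=
  if f - 6 < 2 * n then lmax - 3 * ((f - 6) %/ 2) - 3 else c + 3 - (f - 6 - 2 * n).

(** The copies that some chain above refers to. Position [p] of a fork refers to copy [p], so its
    two halves use the copies below [nbr] and those from [nbr] on. *)
Definition live lam f l : bool :=
  if f == 0 then ((lam < lmax) && (l < 2 * nbr)) || ((lam == lmax) && (l < nbr))
  else if f == 1 then
    (if lam == lmax.+1 then l == 0 else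
     if isvar lam && (vr lam == 1) then l < nbr else
     if isvar lam && (vr lam == 2) then l < nsml else nbr <= l < 2 * nbr)
  else if f == 2 then isvar lam &&
    (if vr lam == 1 then nbr <= l < 2 * nbr else (vr lam == 2) && (l < nsml))
  else if f <= 5 then [&& isvar lam, vr lam == 1 & l == 0]
  else ((lam < ul f) && (l < 2 * nbr)) || ((lam == ul f) && (l < nbr)).

Definition gl lam f l : nat := if live lam f l then gp (kd lam f) else 0.

(* Codes of literals: 0 is "absent", [2 * i + b + 1] is the literal [(i, b)]. *)
Definition lcode t k : nat :=
  if t < 2 * n then
    (if q (t %/ 2) then (if k == 0 then t.+1 else 0)
     else if k < 2 then 2 * (t %/ 2) + k + 1 else 0)
  else
    let x := lf (t - 2 * n) k in
    if [&& 0 < x <= 2 * n, (k == 0) || (lf (t - 2 * n) 0 != x)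
         & (k <= 1) || (lf (t - 2 * n) 1 != x)] then x else 0.

Definition lve i : nat := lmax - 3 * i - 1.
(** An absent literal gets its own source for each [k]; since [lcode] also drops repeated literals,
    the three slots of a test are different vertices. *)
Definition slotv t k : nat :=
  if lcode t k == 0 then ord_real + k
  else vn (lve ((lcode t k).-1 %/ 2)) (3 + (lcode t k).-1 %% 2) 0 0.

Definition dlam v : nat := v %/ wid %/ wid %/ fams.
Definition dfam v : nat := (v %/ wid %/ wid) %% fams.
Definition dcop v : nat := (v %/ wid) %% wid.
Definition dpos v : nat := v %% wid.
Definition dgl v : nat := gl (dlam v) (dfam v) (dcop v).

(** The value [ord_dag] stands for no predecessor. Positions from [dgl v] on are dead: they form one
    path from the last chain through all chains down to the three sources, which keeps the vertex
    set an interval and the root the only sink. *)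
Definition pr1 v : nat :=
  if ord_real <= v then ord_dag
  else if dpos v < dgl v then
    (if kd (dlam v) (dfam v) <= 2 then
       (if dpos v == 0 then v.+1 else
        if kd (dlam v) (dfam v) == 2 then slotv (dfam v - 6) (dpos v).-1 else ord_dag)
     else if (dpos v).+1 < dgl v then v.+1 else ord_dag)
  else if (dpos v).+1 < wid then v.+1
  else if v < wid then ord_real
  else ((v %/ wid).-1) * wid + dgl ((v %/ wid).-1 * wid).

Definition pr2 v : nat :=
  if ord_real <= v then ord_dag
  else if dpos v < dgl v then
    (if kd (dlam v) (dfam v) <= 2 then
       (if dpos v == 0 then v.+2 else
        if kd (dlam v) (dfam v) == 2 then slotv (dfam v - 6) (dpos v) else ord_dag)
     else lfc (dlam v) (dfam v) (dpos v) * wid)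
  else if v.+1 == wid then ord_real + 1
  else if v.+2 == wid then ord_real + 2 else ord_dag.

Definition edge u v : bool := (u == pr1 v) || (u == pr2 v).
Definition root : nat := vn lmax.+1 1 0 0.

Arguments lmax : simpl never.
Arguments usz : simpl never.
Arguments unt : simpl never.
Arguments rnd : simpl never.
Arguments wid : simpl never.
Arguments fams : simpl never.
Arguments chains : simpl never.
Arguments ord_real : simpl never.
Arguments nbr : simpl never.
Arguments nlit : simpl never.
Arguments nsml : simpl never.
Arguments gl : simpl never.
Arguments live : simpl never.
Arguments vi : simpl never.
Arguments vr : simpl never.

Lemma unt_huge : 32 * (rnd * lmax.+1 + 5) + 100 <= unt.
Proof.
rewrite /unt /rnd /usz; set t := up_log 2 _.
have h : lmax.+1 <= 2 ^ t by apply: up_logP.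
have h2 : t < 2 ^ t by apply: ltn_expl.
have l4 : 4 <= lmax by rewrite /lmax; lia.
have -> : 2 ^ (2 * t + 10) = 2 ^ t * 2 ^ t * 1024 by rewrite expnD mul2n -addnn expnD.
move: (2 ^ t) h h2 => T h h2.
have h3 : (2 * t + 10 + 4) * lmax.+1 <= (2 * T + 14) * T by apply: leq_mul; lia.
have h4 : 5 * T <= T * T by rewrite leq_mul2r; apply/orP; right; lia.
have h5 : (2 * T + 14) * T = 2 * (T * T) + 14 * T by ring.
lia.
Qed.

Lemma unt_big : 4 * (rnd * lmax.+1 + 5) + 100 <= unt.
Proof. by have := unt_huge; lia. Qed.

Lemma rnd_pow : 2 ^ rnd = wid.
Proof. by rewrite /rnd /wid /unt expnD mulnC. Qed.

Lemma fams_lmax : fams <= lmax.+2.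
Proof. rewrite /fams /lmax; lia. Qed.

Lemma wid_unt : wid = 16 * unt. Proof. by []. Qed.

Lemma lmax_lt_unt : lmax < unt.
Proof.
have := unt_big; have : lmax.+1 <= rnd * lmax.+1 by rewrite leq_pmull // /rnd; lia.
lia.
Qed.

Lemma wid_gt0 : 0 < wid. Proof. by rewrite muln_gt0 expn_gt0. Qed.
Opaque unt usz.
Lemma fams_gt0 : 0 < fams. Proof. by rewrite /fams addn_gt0 orbT. Qed.

Definition inrg lam f l p := [&& lam < lmax.+2, f < fams, l < wid & p < wid].

Lemma vn_div lam f l p : p < wid -> vn lam f l p %/ wid = cn lam f l.
Proof. by move=> hp; rewrite /vn divnMDl ?wid_gt0 // divn_small ?addn0. Qed.

Lemma cn_div lam f l : l < wid -> cn lam f l %/ wid = lam * fams + f.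
Proof. by move=> hl; rewrite /cn divnMDl ?wid_gt0 // divn_small ?addn0. Qed.

Lemma decK lam f l p : inrg lam f l p ->
  [/\ dlam (vn lam f l p) = lam, dfam (vn lam f l p) = f, dcop (vn lam f l p) = l
    & dpos (vn lam f l p) = p].
Proof.
case/and4P => hlam hf hl hp; rewrite /dlam /dfam /dcop /dpos vn_div // cn_div //.
by rewrite divnMDl ?fams_gt0 // divn_small // addn0 /cn /vn !modnMDl !modn_small.
Qed.

Lemma cn_lt lam f l : lam < lmax.+2 -> f < fams -> l < wid -> cn lam f l < chains.
Proof.
move=> hlam hf hl; rewrite /cn /chains.
apply: (@leq_trans ((lam * fams + f).+1 * wid)); first by rewrite mulSn; lia.
rewrite leq_mul2r; apply/orP; right.
apply: (@leq_trans (lam.+1 * fams)); first by rewrite mulSn; lia.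
by rewrite leq_mul2r hlam orbT.
Qed.

Lemma vn_lt lam f l p : inrg lam f l p -> vn lam f l p < ord_real.
Proof.
case/and4P => hlam hf hl hp; have := cn_lt hlam hf hl.
rewrite /vn /ord_real => h; apply: (@leq_trans ((cn lam f l).+1 * wid)).
  by rewrite mulSn; lia.
by rewrite leq_mul2r h orbT.
Qed.

Lemma decE v : v < ord_real ->
  inrg (dlam v) (dfam v) (dcop v) (dpos v) /\
  v = vn (dlam v) (dfam v) (dcop v) (dpos v).
Proof.
move=> hv; have hx : v %/ wid < chains by rewrite ltn_divLR ?wid_gt0.
split.
  rewrite /inrg /dlam /dfam /dcop /dpos !ltn_mod wid_gt0 fams_gt0 !andbT /=.
  by rewrite !ltn_divLR ?fams_gt0 ?wid_gt0.
by rewrite /vn /cn /dlam /dfam /dcop /dpos -!divn_eq.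
Qed.

Lemma gl_le lam f l : gl lam f l + 8 < wid.
Proof.
have := unt_big; rewrite /gl /gp /wid /nbr /nsml /nlit; case: live; last by lia.
by do ![case: ifP => _]; lia.
Qed.

(* Topological order; the plain towers and the literal gadgets lie below the
   position nodes and the towers of the tests. *)
Definition rk lam f : nat :=
  (if (f == 0) || (3 <= f <= 5) then 0 else 3 * lmax.+2) + 3 * lam + ((f == 3) || (f == 4)).
Definition rank v : nat :=
  if ord_real <= v then 0
  else if dpos v < dgl v then
    1 + ord_real + rk (dlam v) (dfam v) * wid + (wid - 1 - dpos v)
  else 1 + (v %/ wid) * wid + (wid - 1 - dpos v).

Definition brf lam f p : nat := if p < nbr then br0 lam f else br1 lam f.

Lemma isvarP lam : isvar lam -> exists i r,
  [/\ i < n, r < 3, lam = lmax - 3 * i - r, vi lam = i & vr lam = r].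
Proof.
rewrite /isvar => h; exists (vi lam), (vr lam); rewrite /vi /vr.
have := divn_eq (lmax - lam) 3; have := ltn_mod (lmax - lam) 3.
move: ((lmax - lam) %/ 3) ((lmax - lam) %% 3) h => i r; rewrite /lmax => h hr hd.
by split=> //; lia.
Qed.

Lemma var_level i r : i < n -> r < 3 ->
  [/\ isvar (lmax - 3 * i - r), vi (lmax - 3 * i - r) = i & vr (lmax - 3 * i - r) = r].
Proof.
move=> hi hr; rewrite /isvar /vi /vr.
have -> : lmax - (lmax - 3 * i - r) = i * 3 + r by rewrite /lmax; lia.
rewrite divnMDl // divn_small // addn0 modnMDl modn_small //; split=> //.
by rewrite /lmax; lia.
Qed.

Lemma nbrP : [/\ 0 < nsml, nsml < nlit, nlit < nbr, 2 * nbr < wid & 4 * nlit <= nbr].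
Proof. have := unt_big; rewrite /nsml /nlit /nbr /wid; split; lia. Qed.

Lemma fams6 f : 5 < f < fams -> exists2 t, f = 6 + t & t < 2 * n + c.
Proof. by rewrite /fams => h; exists (f - 6); lia. Qed.

Lemma rk_pred lam f f' : 0 < lam -> (f != 0) && ~~ (3 <= f <= 5) || (f' == 0) ->
  rk lam.-1 f' < rk lam f.
Proof. by rewrite /rk => h; do ?[case: eqP => //= ?]; do ?[case: ifP => //= ?]; lia. Qed.

Lemma var_neq_top i r : i < n -> (lmax - 3 * i - r == lmax.+1) = false.
Proof. by rewrite /lmax => ?; apply/eqP; lia. Qed.

Lemma live_var1 i r l : i < n -> r < 3 -> live (lmax - 3 * i - r) 1 l =
  if r == 1 then l < nbr else if r == 2 then l < nsml else nbr <= l < 2 * nbr.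
Proof.
by move=> hi hr; have [v1 v2 v3] := var_level hi hr; rewrite /live /= var_neq_top // v1 v3.
Qed.

Lemma live_var2 i r l : i < n -> r < 3 -> live (lmax - 3 * i - r) 2 l =
  if r == 1 then nbr <= l < 2 * nbr else (r == 2) && (l < nsml).
Proof. by move=> hi hr; have [v1 v2 v3] := var_level hi hr; rewrite /live /= v1 v3. Qed.

Lemma isvar_low lam : lam <= c + 4 -> isvar lam = false.
Proof. by rewrite /isvar ltnNge => ->. Qed.

Lemma live_low1 lam l : lam <= c + 4 -> live lam 1 l = (nbr <= l < 2 * nbr).
Proof.
move=> h; rewrite /live /= isvar_low //=; case: eqP => //.
by rewrite /lmax; lia.
Qed.

Lemma live_test t lam l : live lam (6 + t) l =
  ((lam < ul (6 + t)) && (l < 2 * nbr)) || ((lam == ul (6 + t)) && (l < nbr)).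
Proof. by []. Qed.

Lemma ul_var i b : i < n -> b < 2 -> ul (6 + (2 * i + b)) = lmax - 3 * i - 3.
Proof.
move=> hi hb; rewrite /ul addKn; case: ltnP; last by lia.
by move=> _; rewrite [2 * i]mulnC divnMDl // divn_small // addn0.
Qed.

Lemma ul_clause j : j < c -> ul (6 + (2 * n + j)) = c + 3 - j.
Proof. by move=> hj; rewrite /ul addKn; case: ltnP; [lia | rewrite addKn]. Qed.

Lemma next_pos lam l : lam <= lmax -> ~~ (isvar lam && (vr lam < 2)) -> 0 < lam ->
  live lam.-1 1 l = (nbr <= l < 2 * nbr).
Proof.
move=> hl; case v: (isvar lam) => /= hr l0; last first.
  by rewrite live_low1 //; move: v; rewrite /isvar hl andbT; lia.
have [i [r [hi hr' dl dvi dvr]]] := isvarP v; move: hr; rewrite dvr => hr.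
have [hi1|hi1] := ltnP i.+1 n; last by rewrite live_low1 // dl /lmax; lia.
by rewrite (_ : lam.-1 = lmax - 3 * i.+1 - 0) ?live_var1 // dl; rewrite /lmax; lia.
Qed.

Lemma live_br lam f l p : f < fams -> lam < lmax.+2 -> live lam f l -> kd lam f = 3 ->
  p < 2 * nbr -> [/\ live lam.-1 (brf lam f p) p, brf lam f p < fams, 0 < lam &
    (f != 0) && ~~ (3 <= f <= 5) || (brf lam f p == 0)].
Proof.
move=> hf hl; have [n1 n2 n3 n4 n5] := nbrP.
case: f hf => [|[|[|f]]] hf; rewrite /kd /=.
- case: eqP => // l0; rewrite /live /brf /br0 /br1 /= if_same /= => lv _ hp.
  by split=> //; lia.
- case: eqP => // ntop; case: eqP => // l0 lv hk hp.
  have hlm : lam <= lmax by lia.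
  suff : live lam.-1 (brf lam 1 p) p /\ brf lam 1 p < fams by case=> ? ?; split=> //; lia.
  rewrite /brf /br0 /br1 /= (negPf (introN eqP ntop)).
  move: hk; case v: (isvar lam) => /=; last first.
    have lc : lam <= c + 4 by move: v; rewrite /isvar hlm andbT; lia.
    rewrite lc => _; case: (ltnP p nbr) => pn; last first.
      have -> : live lam.-1 1 p by rewrite next_pos ?v ?pn ?hp //; lia.
      by split=> //; rewrite /fams; lia.
    case: (ltnP 4 lam) => l4; last first.
      split; last by rewrite /fams; lia.
      by rewrite /live /= hp andbT /lmax; lia.
    rewrite -addnA live_test ul_clause; last by lia.
    by split; [apply/orP; right; rewrite pn andbT; lia | rewrite /fams; lia].
  have [i [r [hi hr dl dvi dvr]]] := isvarP v; rewrite dvi dvr.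
  rewrite (_ : lam <= c + 4 = false) /=; last by move: v; rewrite /isvar; lia.
  case: eqP => // r1 _; case: eqP => r0; last first.
    case: (ltnP p nbr) => pn; last first.
      have -> : live lam.-1 1 p by rewrite next_pos ?v ?dvr ?pn ?hp //; lia.
      by split=> //; rewrite /fams; lia.
    rewrite -[2 * i]addn0 live_test ul_var //.
    by split; [apply/orP; right; rewrite pn andbT dl; lia | rewrite /fams; lia].
  have -> : lam.-1 = lmax - 3 * i - 1 by rewrite dl r0; lia.
  have f2 : 2 < fams by rewrite /fams; lia.
  by case: (ltnP p nbr) => pn; rewrite ?live_var1 ?live_var2 //= ?pn ?hp; split=> //; lia.
- case v: (isvar lam) => //; have [i [r [hi hr dl dvi dvr]]] := isvarP v; rewrite dvr.
  case: eqP => // r0; case: eqP => // r1 lv _ hp.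
  have l0 : 0 < lam by move: v; rewrite /isvar; lia.
  suff : live lam.-1 (brf lam 2 p) p /\ brf lam 2 p < fams by case=> ? ?; split=> //; lia.
  rewrite /brf /br0 /br1 /= dvi; case: (ltnP p nbr) => pn; last first.
    have -> : live lam.-1 1 p by rewrite next_pos ?v ?dvr ?pn ?hp //; lia.
    by split=> //; rewrite /fams; lia.
  rewrite (_ : 7 + 2 * i = 6 + (2 * i + 1)); last by lia.
  rewrite live_test ul_var //.
  by split; [apply/orP; right; rewrite pn andbT dl; lia | rewrite /fams; lia].
- case: (ltnP f 3) => hf5.
    rewrite (_ : f.+3 <= 5) //; case: ifP => // _; case: ifP => //.
  rewrite (_ : f.+3 <= 5 = false); last by lia.
  case: eqP => // l0; rewrite /brf /br0 /br1 /= if_same.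
  have [t -> ht] : exists2 t, f.+3 = 6 + t & t < 2 * n + c by apply: fams6; lia.
  rewrite !live_test => lv _ hp.
  by split; [move: lv; lia | rewrite /fams; lia | lia | lia].
Qed.

Lemma kd_ex lam f : kd lam f = 5 -> lam < lmax.+2 ->
  exists i b, [/\ i < n, b < 2, f = b.+1 & lam = lve i].
Proof.
rewrite /kd /lve => h hl; move: h; case: f => [|[|[|f]]] /=; first by case: ifP.
- case: eqP => // ntop; case: eqP => // l0; case: leqP => // hc; case: eqP => // hr _.
  have v : isvar lam by rewrite /isvar hc; lia.
  by have [i [r [hi _ dl _ dvr]]] := isvarP v; exists i, 0; rewrite dl -dvr hr; split.
- case: ifP => // v; case: eqP => // r0; case: eqP => // hr _.
  by have [i [r [hi _ dl _ dvr]]] := isvarP v; exists i, 1; rewrite dl -dvr hr; split.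
- case: ifP => _; last by case: ifP.
  by case: ifP => //; case: ifP.
Qed.

Lemma kd_item lam f : 5 < kd lam f -> lam < lmax.+2 -> exists2 i, i < n &
  lam = lve i /\ ((kd lam f = 6 /\ 2 < f < 5) \/ (kd lam f = 7 /\ f = 5)).
Proof.
rewrite /kd /lve => h hl; move: h; case: f => [|[|[|f]]] /=; first by case: ifP.
- by do ![case: ifP => _ //].
- by do ![case: ifP => _ //].
- case: ifP => hf; last by case: ifP.
  case: ifP => // /andP[v /eqP hr] _; have [i [r [hi _ dl _ dvr]]] := isvarP v.
  exists i => //; rewrite dl -dvr hr; split=> //.
  by case: eqP => h; [right | left; split=> //; lia].
Qed.

Lemma kd_root lam f : kd lam f = 4 -> lam = lmax.+1 /\ f = 1.
Proof.
rewrite /kd; case: f => [|[|[|f]]] /=; first by case: ifP.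
- by case: eqP => // _; do ![case: ifP => _ //].
- by do ![case: ifP => _ //].
- by do ![case: ifP => _ //].
Qed.

Lemma live_top l : live lmax.+1.-1 1 l = (nbr <= l < 2 * nbr).
Proof.
rewrite [_.-1]/=; have [n0|n0] := posnP n; first by rewrite live_low1 // /lmax n0.
by rewrite -[X in live X](subn0 lmax) -[X in live (lmax - X)](muln0 3) -[X in live X]subn0 live_var1.
Qed.

Lemma live_plain lam l : lam < lmax -> l < 2 * nbr -> live lam 0 l.
Proof. by rewrite /live /= => -> ->. Qed.

Lemma lveP i : i < n -> [/\ 0 < lve i, lve i < lmax, isvar (lve i), vr (lve i) = 1 & vi (lve i) = i].
Proof.
move=> hi; have [v1 v2 v3] := var_level (r := 1) hi isT.
by split=> //; rewrite /lve /lmax; lia.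
Qed.

Lemma live_item i f : i < n -> 2 < f < 6 -> live (lve i) f 0.
Proof.
move=> hi hf; have [l0 l1 v r _] := lveP hi.
by case: f hf => [|[|[|[|[|[|f]]]]]] //= _; rewrite /live /= v r.
Qed.

Lemma lve_pred i : i < n -> (lve i).-1 = lmax - 3 * i - 2.
Proof. by rewrite /lve; lia. Qed.

Lemma live_next i b l : i < n -> b < 2 -> l < nsml -> live (lve i).-1 b.+1 l.
Proof.
move=> hi hb hl; rewrite lve_pred //.
by case: b hb => [|[|b]] // _; rewrite ?live_var1 ?live_var2.
Qed.

(** The last chain lies on level [lmax.+1], where only the chain of the root is live. Through this
    leaf the root takes in the whole dead path. *)
Lemma root_dead : exists lam f l, [/\ chains.-1 = cn lam f l, inrg lam f l 0 & ~~ live lam f l].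
Proof.
exists lmax.+1, fams.-1, wid.-1; have w0 := wid_gt0; have f5 : 5 < fams by rewrite /fams; lia.
split.
- rewrite /cn /chains; move: wid fams w0 f5 => [|w] // [|f] // _ _.
  by apply: succn_inj; rewrite prednK ?muln_gt0 // -[f.+1.-1]/f -[w.+1.-1]/w; ring.
- by rewrite /inrg w0; lia.
- rewrite /live; case: eqP => [|_]; first by lia.
  case: eqP => [|_]; first by lia. case: eqP => [|_]; first by lia.
  rewrite /isvar [lmax.+1 <= lmax]ltnn !andbF /=; case: ifP => // hf.
  have : ul fams.-1 < lmax.+1 by rewrite /ul /lmax; case: ifP; lia.
  by case: ltngtP.
Qed.

Lemma gpE : (gp 1 = 3) * (gp 2 = 3) * (gp 3 = 2 * nbr) * (gp 4 = 2 * nbr + 1) *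
  (gp 5 = nbr + 3 + nsml) * (gp 6 = nlit + 1) * (gp 7 = nsml).
Proof. by []. Qed.

Lemma lfc_spec lam f l p : inrg lam f l p -> p < gl lam f l -> 2 < kd lam f ->
  exists lam' f' l', [/\ lfc lam f p = cn lam' f' l', inrg lam' f' l' 0 &
    (kd lam f = 4 /\ p = 0 /\ ~~ live lam' f' l') \/
    (live lam' f' l' /\ rk lam' f' < rk lam f)].
Proof.
have w0 := wid_gt0; have [n1 n2 n3 n4 n5] := nbrP; have ub := unt_big.
have f5 : 5 < fams by rewrite /fams; lia.
case/and4P => hl hf hc hp; rewrite /gl; case lv: live => //.
have kd8 : kd lam f < 8 by rewrite /kd; do ![case: ifP => _ //].
case kE: (kd lam f) kd8 => [|[|[|[|[|[|[|[|k]]]]]]]] // _; rewrite ?gpE => pG _.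
- have [a1 a2 a3 a4] := live_br hf hl lv kE pG.
  exists lam.-1, (brf lam f p), p; rewrite /lfc kE /= -/(brf lam f p); split=> //.
    by rewrite /inrg a2 w0; lia.
  by right; split=> //; apply: rk_pred.
- have [dl df] := kd_root kE; rewrite /lfc kE /=; case: eqP => [->|p0].
    by have [lam' [f' [l' [h1 h2 h3]]]] := root_dead; exists lam', f', l'; split=> //; left.
  exists lmax, (brf lam f p.-1), p.-1; rewrite /brf /br0 /br1 dl df /= eqxx /isvar ltnn !andbF /=.
  have pn : p.-1 < 2 * nbr by lia.
  split; first by [].
    by rewrite /inrg w0 /=; case: (p.-1 < nbr); lia.
  right; split; last by rewrite /rk; case: (p.-1 < nbr) => /=; lia.
  case: ltnP => h; first by rewrite /live /= eqxx h orbT.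
  by rewrite -[lmax]/(lmax.+1.-1) live_top // h pn.
- have [i [b [hi hb df dl]]] := kd_ex kE hl; have [l0 l1 v r _] := lveP hi.
  have fl : f < fams by [].
  rewrite /lfc kE /=; case: ltnP => pn.
    exists lam.-1, 0, (5 * unt + p); split=> //.
      by rewrite /inrg w0 /wid; move: pn; rewrite /nbr; lia.
    right; split; last by rewrite df; apply: rk_pred; lia.
    by apply: live_plain; [lia | move: pn; rewrite /nbr; lia].
  case: eqP => [_|p1].
    exists lam, 5, 0; rewrite /inrg w0 hl f5; split=> //; right; rewrite dl live_item //.
    by split=> //; rewrite /rk df; case: (b) hb => [|[|]] //=; lia.
  case: eqP => [_|p2].
    exists lam, 4, 0; rewrite /inrg w0 hl; split=> //; first by rewrite !andbT; lia.
    right; rewrite dl live_item //; split=> //; rewrite /rk df; case: (b) hb => [|[|]] //=; lia.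
  case: eqP => [_|p3].
    exists lam, 3, 0; rewrite /inrg w0 hl; split=> //; first by rewrite !andbT; lia.
    right; rewrite dl live_item //; split=> //; rewrite /rk df; case: (b) hb => [|[|]] //=; lia.
  have pm : p - (nbr + 3) < nsml by lia.
  exists lam.-1, f, (p - (nbr + 3)); split=> //.
    by rewrite /inrg w0 hf; lia.
  right; split; first by rewrite dl df live_next.
  by apply: rk_pred; rewrite ?df ?dl //; case: (b) hb => [|[|]].
- have k5 : 5 < kd lam f by rewrite kE.
  have [i hi [dl [[_ hf']|[h]]]] := kd_item k5 hl; last by rewrite kE in h.
  have [l0 l1 v r _] := lveP hi.
  rewrite /lfc kE /=; case: eqP => [_|p1].
    exists lam, 5, 0; rewrite /inrg w0 hl f5; split=> //; right; rewrite dl live_item //.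
    split=> //; rewrite /rk; case: (f) hf' => [|[|[|[|[|]]]]] //= _; lia.
  have pn : (f - 3) * (2 * unt) + p.-1 < 2 * nbr.
    by rewrite /nlit in pG; rewrite /nbr; case: (f) hf' => [|[|[|[|[|]]]]] //= _; lia.
  exists lam.-1, 0, ((f - 3) * (2 * unt) + p.-1); split=> //.
    by rewrite /inrg w0; lia.
  by right; split; [apply: live_plain => //; lia | apply: rk_pred; lia].
- have k5 : 5 < kd lam f by rewrite kE.
  have [i hi [dl [[h] _|[_ hf']]]] := kd_item k5 hl; first by rewrite kE in h.
  have [l0 l1 v r _] := lveP hi.
  rewrite /lfc kE /=; exists lam.-1, 0, (4 * unt + p).
  have pn : 4 * unt + p < 2 * nbr by rewrite /nsml in pG; rewrite /nbr; lia.
  split=> //; first by rewrite /inrg w0; lia.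
  by right; split; [apply: live_plain => //; lia | apply: rk_pred; lia].
Qed.

Lemma vnS lam f l p : (vn lam f l p).+1 = vn lam f l p.+1.
Proof. by rewrite /vn addnS. Qed.

Lemma inrg_pos lam f l p p' : inrg lam f l p -> p' < wid -> inrg lam f l p'.
Proof. by rewrite /inrg => /and4P[-> -> ->]. Qed.

Lemma pr_real lam f l p : inrg lam f l p -> p < gl lam f l ->
  (pr1 (vn lam f l p) =
     (if kd lam f <= 2 then
        (if p == 0 then vn lam f l 1 else if kd lam f == 2 then slotv (f - 6) p.-1 else ord_dag)
      else if p.+1 < gl lam f l then vn lam f l p.+1 else ord_dag)) *
  (pr2 (vn lam f l p) =
     (if kd lam f <= 2 then
        (if p == 0 then vn lam f l 2 else if kd lam f == 2 then slotv (f - 6) p else ord_dag)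
      else lfc lam f p * wid)).
Proof.
move=> hr hp; have [d1 d2 d3 d4] := decK hr; rewrite /pr1 /pr2 /dgl d1 d2 d3 d4 hp.
rewrite [ord_real <= _]leqNgt vn_lt //= !vnS.
by case: (eqVneq p 0) => [->|].
Qed.

Lemma chain_dec x : x < chains -> exists lam f l, inrg lam f l 0 /\ x = cn lam f l.
Proof.
move=> hx; have hv : x * wid < ord_real by rewrite /ord_real ltn_mul2r wid_gt0.
have [hr ev] := decE hv; exists (dlam (x * wid)), (dfam (x * wid)), (dcop (x * wid)).
split; first by apply: inrg_pos hr wid_gt0.
case/and4P: hr => _ _ _ hp; have := congr1 (fun y => y %/ wid) ev.
by rewrite vn_div // mulnK ?wid_gt0.
Qed.

Lemma pr_dead lam f l p : inrg lam f l p -> gl lam f l <= p ->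
  (p.+1 < wid /\ pr1 (vn lam f l p) = vn lam f l p.+1) \/
  (p.+1 = wid /\ cn lam f l = 0 /\ pr1 (vn lam f l p) = ord_real) \/
  (p.+1 = wid /\ exists lam' f' l', [/\ inrg lam' f' l' 0,
     cn lam f l = (cn lam' f' l').+1 & pr1 (vn lam f l p) = vn lam' f' l' (gl lam' f' l')]).
Proof.
move=> hr hp; have [d1 d2 d3 d4] := decK hr.
rewrite /pr1 /dgl d1 d2 d3 d4 [p < gl lam f l]ltnNge hp /= [ord_real <= _]leqNgt vn_lt //= vnS.
have w0 := wid_gt0; have [hl hf hc hpw] := and4P hr.
case: ltnP => h1; first by left.
have pw : p.+1 = wid by apply/eqP; rewrite eqn_leq h1 hpw.
right; have [c0|c0] := posnP (cn lam f l).
  by left; rewrite /vn c0 mul0n add0n hpw.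
right; split=> //; rewrite vn_div //.
rewrite (_ : vn lam f l p.+1 <= wid = false); last first.
  apply/negbTE; rewrite -ltnNge /vn pw; apply: leq_ltn_trans (leq_pmull wid c0) _.
  by rewrite -[X in X < _]addn0 ltn_add2l.
have hx : (cn lam f l).-1 < chains by rewrite (leq_ltn_trans (leq_pred _)) ?cn_lt.
have [lam' [f' [l' [hr' e']]]] := chain_dec hx; exists lam', f', l'; split=> //.
  by rewrite -e' prednK.
rewrite e' /= -[cn lam' f' l' * wid]addn0 -/(vn lam' f' l' 0).
by have [-> -> -> _] := decK hr'; rewrite /vn addn0.
Qed.

Lemma pr2_dead lam f l p : inrg lam f l p -> gl lam f l <= p ->
  pr2 (vn lam f l p) = if (vn lam f l p).+1 == wid then ord_real + 1
    else if (vn lam f l p).+2 == wid then ord_real + 2 else ord_dag.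
Proof.
move=> hr hp; have [d1 d2 d3 d4] := decK hr.
by rewrite /pr2 /dgl d1 d2 d3 d4 [p < gl lam f l]ltnNge hp /= [ord_real <= _]leqNgt vn_lt.
Qed.

Lemma rank_real lam f l p : inrg lam f l p -> p < gl lam f l ->
  rank (vn lam f l p) = 1 + ord_real + rk lam f * wid + (wid - 1 - p).
Proof.
move=> hr hp; have [d1 d2 d3 d4] := decK hr.
by rewrite /rank /dgl d1 d2 d3 d4 hp [ord_real <= _]leqNgt vn_lt.
Qed.

Lemma rank_dead lam f l p : inrg lam f l p -> gl lam f l <= p ->
  rank (vn lam f l p) = 1 + cn lam f l * wid + (wid - 1 - p).
Proof.
move=> hr hp; have [d1 d2 d3 d4] := decK hr; case/and4P: (hr) => _ _ _ hpw.
by rewrite /rank /dgl d1 d2 d3 d4 [p < gl lam f l]ltnNge hp /= [ord_real <= _]leqNgt vn_lt //= vn_div.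
Qed.

Lemma rank_dead_le lam f l p : inrg lam f l p -> gl lam f l <= p ->
  rank (vn lam f l p) <= ord_real.
Proof.
move=> hr hp; rewrite rank_dead //; case/and4P: (hr) => hl hf hc hpw.
have := cn_lt hl hf hc; rewrite /ord_real => h.
apply: (@leq_trans ((cn lam f l).+1 * wid)); first by rewrite mulSn; lia.
by rewrite leq_mul2r h orbT.
Qed.

Lemma rank_dummy k : rank (ord_real + k) = 0.
Proof. by rewrite /rank leq_addr. Qed.

Lemma lcode_le t k : t < 2 * n + c -> lcode t k <= 2 * n.
Proof.
rewrite /lcode => ht; case: ifP => ht2; last by case: ifP => // /and3P[/andP[]].
by case: ifP => _; case: ifP => //; lia.
Qed.

Lemma slotv_spec t k : t < 2 * n + c ->
  (lcode t k = 0 /\ slotv t k = ord_real + k) \/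
  exists i b, [/\ i < n, b < 2, lcode t k = 2 * i + b + 1 & slotv t k = vn (lve i) (3 + b) 0 0].
Proof.
move=> ht; have := lcode_le k ht; rewrite /slotv; case: (lcode t k) => [|x] hx; first by left.
right; exists (x %/ 2), (x %% 2); split=> //=; [lia | by rewrite ltn_mod |].
by rewrite addn1 mulnC -divn_eq.
Qed.

Lemma inrg_item i f : i < n -> f < 6 -> inrg (lve i) f 0 0.
Proof.
move=> hi hf; have [l0 l1 _ _ _] := lveP hi.
by rewrite /inrg wid_gt0 /fams; lia.
Qed.

Lemma gl_item i f : i < n -> 2 < f < 6 -> gl (lve i) f 0 = if f == 5 then nsml else nlit + 1.
Proof.
move=> hi hf; rewrite /gl live_item // /kd; have [_ _ -> -> _] := lveP hi.
by case: f hf => [|[|[|[|[|[|]]]]]] //= _; rewrite gpE.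
Qed.

Lemma rk_rank a b p : a < b -> p < wid ->
  1 + ord_real + a * wid + (wid - 1 - 0) < 1 + ord_real + b * wid + (wid - 1 - p).
Proof.
move=> ab hp; have : a.+1 * wid <= b * wid by rewrite leq_mul2r ab orbT.
rewrite mulSn; lia.
Qed.

(** Acyclicity follows, and also that the root, whose rank is largest, has no successor. *)
Lemma pr_rank v u : v < ord_dag -> (u = pr1 v \/ u = pr2 v) -> u < ord_dag -> rank u < rank v.
Proof.
move=> hv hu hud; have [hvr|hvr] := ltnP v ord_real; last first.
  by move: hu; rewrite /pr1 /pr2 hvr => -[] hu; move: hud; rewrite hu ltnn.
have w0 := wid_gt0; have [hr ev] := decE hvr; rewrite {}ev in hv hu hvr *.
move: (dlam v) (dfam v) (dcop v) (dpos v) hr hv hu hvr => lam f l p hr hv hu hvr {v}.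
have [hl hf hc hpw] := and4P hr; have nd : ord_dag < ord_dag = false by rewrite ltnn.
have [hp|hp] := ltnP p (gl lam f l); last first.
  case: hu => hu; last first.
    move: hu; rewrite pr2_dead //; case: ifP => _; first by move=> ->; rewrite rank_dummy rank_dead.
    case: ifP => _; first by move=> ->; rewrite rank_dummy rank_dead.
    by move=> hu; rewrite hu nd in hud.
  have [[h1 h2]|[[h1 [h2 h3]]|[h1 [lam' [f' [l' [h2 h3 h4]]]]]]] := pr_dead hr hp.
  - rewrite hu h2 !rank_dead //; [by lia | exact: inrg_pos hr h1 | exact: leqW].
  - by rewrite hu h3 -[ord_real]addn0 rank_dummy rank_dead.
  - have hg := gl_le lam' f' l'; have hg' : gl lam' f' l' < wid by lia.
    rewrite hu h4 rank_dead //; last exact: inrg_pos h2 hg'.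
    by rewrite rank_dead // h3 mulSn; lia.
have rr := rank_real hr hp; have gle := gl_le lam f l.
move: hu; rewrite !pr_real //; case: ifP => hk.
  have hg : gl lam f l = 3.
    move: hp; rewrite /gl; case: ifP => // _; move: hk.
    by case: (kd lam f) => [|[|[|]]].
  have sl k : kd lam f == 2 -> u = slotv (f - 6) k -> rank u < rank (vn lam f l p).
    move=> /eqP k2 ->; rewrite rr.
    have [f5 l0] : 5 < f /\ lam = 0.
      move: k2; rewrite /kd; do ![case: ifP => //]; lia.
    have ht : f - 6 < 2 * n + c by move: hf; rewrite /fams; lia.
    have [[_ ->]|[i [b [hi hb _ ->]]]] := slotv_spec k ht; first by rewrite rank_dummy.
    have g0 : 0 < gl (lve i) (3 + b) 0.
      by rewrite gl_item //; [case: ifP => _; have [] := nbrP; lia | lia].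
    rewrite rank_real //; last by apply: inrg_item => //; lia.
    have [i0 i1 _ _ _] := lveP hi.
    have rf : 3 * lmax.+2 <= rk lam f.
      rewrite /rk ifN; last by lia.
      by rewrite -addnA leq_addr.
    apply: rk_rank => //; apply: leq_trans rf; rewrite /rk.
    by case: b hb {g0} => [|[|]] //= _; lia.
  case: eqP => [p0|p0].
    case=> hu; subst u p.
      by rewrite rr rank_real ?hg //; [lia | apply: inrg_pos hr _; lia].
    by rewrite rr rank_real ?hg //; [lia | apply: inrg_pos hr _; lia].
  case: ifP => k2 [] hu; try exact: sl k2 hu; by rewrite hu nd in hud.
case=> hu.
  move: hu; case: ifP => hp1 hu; last by rewrite hu nd in hud.
  rewrite hu rr rank_real //; last by apply: inrg_pos hr _; lia.
  lia.
have k3 : 2 < kd lam f by rewrite ltnNge hk.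
have [lam' [f' [l' [h1 h2 [[h3 [h4 h5]]|[h3 h4]]]]]] := lfc_spec hr hp k3.
  rewrite hu h1 -[cn _ _ _ * wid]addn0 rr; have g0 : gl lam' f' l' = 0 by rewrite /gl (negPf h5).
  have := rank_dead_le h2; rewrite g0 => /(_ isT); rewrite /vn; lia.
rewrite hu h1 -[cn _ _ _ * wid]addn0 -/(vn lam' f' l' 0) rr.
have [g0|g0] := posnP (gl lam' f' l').
  by have := rank_dead_le h2; rewrite g0 => /(_ isT); lia.
by rewrite rank_real //; apply: rk_rank.
Qed.

Lemma cn_inj lam f l lam' f' l' : inrg lam f l 0 -> inrg lam' f' l' 0 ->
  cn lam f l = cn lam' f' l' -> [/\ lam = lam', f = f' & l = l'].
Proof.
move=> h h' e; have [d1 d2 d3 _] := decK h; have [d1' d2' d3' _] := decK h'.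
have ev : vn lam f l 0 = vn lam' f' l' 0 by rewrite /vn e.
by split; [rewrite -d1 ev d1' | rewrite -d2 ev d2' | rewrite -d3 ev d3'].
Qed.

Lemma kd_br_lfc lam f p : kd lam f = 3 -> lfc lam f p = cn lam.-1 (brf lam f p) p.
Proof. by rewrite /lfc => ->. Qed.

Lemma kd_brE lam f l : live lam f l -> kd lam f = 3 -> gl lam f l = 2 * nbr.
Proof. by rewrite /gl => -> ->; rewrite gpE. Qed.

Lemma kd_exE i b l : i < n -> b < 2 -> kd (lve i) b.+1 = 5 /\
  (live (lve i) b.+1 l -> gl (lve i) b.+1 l = nbr + 3 + nsml).
Proof.
move=> hi hb; have [l0 l1 v r _] := lveP hi.
have k : kd (lve i) b.+1 = 5.
  rewrite /kd; case: b hb => [|[|]] //= _; rewrite ?v ?r //.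
  have [c4 _] := andP v; rewrite (gtn_eqF l0) [lve i <= c + 4]leqNgt c4 /=.
  by rewrite (ltn_eqF (leqW l1)).
by split=> // lv; rewrite /gl lv k gpE.
Qed.

Lemma root_range : inrg lmax.+1 1 0 0.
Proof. by rewrite /inrg ltnSn wid_gt0 /fams addnC. Qed.

Lemma kd_rootE : kd lmax.+1 1 = 4 /\ gl lmax.+1 1 0 = 2 * nbr + 1.
Proof.
have k : kd lmax.+1 1 = 4 by rewrite /kd /= eqxx.
by split=> //; rewrite /gl /live /= eqxx /= k gpE.
Qed.

Lemma lfc_rootE p : lfc lmax.+1 1 p =
  if p == 0 then chains.-1 else cn lmax (if p.-1 < nbr then 0 else 1) p.-1.
Proof.
rewrite /lfc (proj1 kd_rootE) /=; case: (p == 0) => //.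
by rewrite /br0 /br1 /= eqxx /isvar ltnn andbF.
Qed.

Lemma kd_var1 i r : i < n -> r < 3 -> kd (lmax - 3 * i - r) 1 = if r == 1 then 5 else 3.
Proof.
move=> hi hr; have [v1 v2 v3] := var_level hi hr.
have [c4 _] := andP v1; have h : (lmax - 3 * i - r <= c + 4) = false by rewrite leqNgt c4.
have h0 : (lmax - 3 * i - r == 0) = false by rewrite gtn_eqF // (leq_trans _ c4).
by rewrite /kd v3 var_neq_top // h h0.
Qed.

Lemma kd_var2 i r : i < n -> r < 3 ->
  kd (lmax - 3 * i - r) 2 = if r == 0 then 0 else if r == 1 then 5 else 3.
Proof. by move=> hi hr; have [v1 v2 v3] := var_level hi hr; rewrite /kd v1 v3. Qed.

Lemma brf_var1 i r p : i < n -> r < 3 -> r != 1 -> brf (lmax - 3 * i - r) 1 p =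
  if p < nbr then (if r == 0 then 1 else 6 + 2 * i) else (if r == 0 then 2 else 1).
Proof.
move=> hi hr r1; have [v1 v2 v3] := var_level hi hr.
have [c4 _] := andP v1; have h : (lmax - 3 * i - r <= c + 4) = false by rewrite leqNgt c4.
rewrite /brf /br0 /br1 var_neq_top // v1 v2 v3 h /=.
by case: (r) hr r1 => [|[|[|]]].
Qed.

Lemma brf_var2 i r p : i < n -> r < 3 ->
  brf (lmax - 3 * i - r) 2 p = if p < nbr then 7 + 2 * i else 1.
Proof. by move=> hi hr; have [_ v2 _] := var_level hi hr; rewrite /brf /br0 /br1 v2. Qed.

(** A live top without a successor would be a second sink, so [live] may mark nothing beyond what is
    referred to. *)
Lemma live_used lam f l : inrg lam f l 0 -> live lam f l -> vn lam f l 0 != root ->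
  exists lam' f' l' p, [/\ inrg lam' f' l' p, p < gl lam' f' l', 2 < kd lam' f' &
    lfc lam' f' p = cn lam f l].
Proof.
move=> hr lv nroot; have [n1 n2 n3 n4 n5] := nbrP; have w0 := wid_gt0.
have f5 : 5 < fams by rewrite /fams; lia.
have [hl hf hc _] := and4P hr.
have byBr lam' f' l' p : inrg lam' f' l' 0 -> live lam' f' l' -> kd lam' f' = 3 ->
    p < 2 * nbr -> lam'.-1 = lam -> brf lam' f' p = f -> p = l ->
  exists lam' f' l' p, [/\ inrg lam' f' l' p, p < gl lam' f' l', 2 < kd lam' f' &
    lfc lam' f' p = cn lam f l].
  move=> h1 h2 h3 h4 h5 h6 h7; exists lam', f', l', p; split.
  - by apply: inrg_pos h1 _; lia.
  - by rewrite kd_brE.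
  - by rewrite h3.
  - by rewrite kd_br_lfc // h5 h6 h7.
have byRoot : lam = lmax -> l < 2 * nbr -> (if l < nbr then 0 else 1) = f ->
  exists lam' f' l' p, [/\ inrg lam' f' l' p, p < gl lam' f' l', 2 < kd lam' f' &
    lfc lam' f' p = cn lam f l].
  move=> h1 h2 h3; exists lmax.+1, 1, 0, l.+1; rewrite lfc_rootE /= h3 h1.
  have [-> ->] := kd_rootE; split=> //; last by lia.
  by apply: inrg_pos root_range _; lia.
have byEx i b l' p : i < n -> b < 2 -> live (lve i) b.+1 l' -> l' < wid ->
    p < nbr + 3 + nsml -> lfc (lve i) b.+1 p = cn lam f l ->
  exists lam' f' l' p, [/\ inrg lam' f' l' p, p < gl lam' f' l', 2 < kd lam' f' &
    lfc lam' f' p = cn lam f l].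
  move=> hi hb h1 h2 h3 h4; have [k g] := kd_exE l' hi hb; have [l0 l1 _ _ _] := lveP hi.
  exists (lve i), b.+1, l', p; rewrite k g //; split=> //.
  by rewrite /inrg h2 ltnW 1?ltnW //=; lia.
have exL i b p : i < n -> b < 2 -> lfc (lve i) b.+1 p =
    if p < nbr then cn (lve i).-1 0 (5 * unt + p) else
     if p == nbr then cn (lve i) 5 0 else if p == nbr + 1 then cn (lve i) 4 0 else
     if p == nbr + 2 then cn (lve i) 3 0 else cn (lve i).-1 b.+1 (p - (nbr + 3)).
  by move=> hi hb; have [k _] := kd_exE 0 hi hb; rewrite /lfc k.
case: f hf lv hr nroot byBr byRoot byEx => [|[|[|f]]] hf lv hr nroot byBr byRoot byEx.
- move: (lv); rewrite {1}/live /= => /orP[]/andP[h1 h2]; last by apply: byRoot => //; [apply/eqP | lia | rewrite h2].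
  apply: (byBr lam.+1 0 0 l) => //.
  + by rewrite /inrg w0; lia.
  + by rewrite /live /=; move: h1; rewrite leq_eqVlt => /orP[/eqP->|->]; rewrite ?eqxx; lia.
  + by rewrite /brf /br0 /br1 /= if_same.
- move: (lv); rewrite {1}/live /=; case: eqP => [dl /eqP l0|ntop].
    by rewrite /root dl l0 eqxx in nroot.
  have hlm : lam <= lmax by lia.
  case v: (isvar lam) => /=; last first.
    move=> /andP[h1 h2]; have [dl|nl] := eqVneq lam lmax.
      by apply: byRoot => //; rewrite ltnNge h1.
    have lc : lam <= c + 4 by move: v; rewrite /isvar hlm andbT; lia.
    have [lc1|lc1] := leqP lam.+1 (c + 4).
      apply: (byBr lam.+1 1 nbr l) => //.
      * by rewrite /inrg w0; lia.
      * by rewrite live_low1 // leqnn; lia.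
      * by rewrite /kd /= lc1; case: eqP => //; lia.
      * by rewrite /brf ltnNge h1 /= /br1 /= isvar_low.
    have n0 : n.-1 < n by move: nl; rewrite /lmax; lia.
    have dl : lam.+1 = lmax - 3 * n.-1 - 2 by rewrite /lmax; lia.
    have [v1 v2 v3] := var_level (r := 2) n0 isT.
    apply: (byBr lam.+1 1 0 l) => //.
    + by rewrite /inrg w0; lia.
    + by rewrite dl live_var1.
    + by rewrite dl kd_var1.
    + by rewrite dl brf_var1 // ltnNge h1.
  have [i [r [hi hr' dl dvi dvr]]] := isvarP v; rewrite dvr.
  case: eqP => [r1|r1].
    move=> h; have [v1 v2 v3] := var_level (r := 0) hi isT.
    have dl1 : lam.+1 = lmax - 3 * i - 0 by rewrite dl r1 /lmax; lia.
    apply: (byBr lam.+1 1 nbr l) => //; [| | |lia|].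
    + by rewrite /inrg w0; lia.
    + by rewrite dl1 live_var1 //= leqnn; lia.
    + by rewrite dl1 kd_var1.
    + by rewrite dl1 brf_var1 // h.
  case: eqP => [r2|r2].
    move=> h; have dl2 : lam = (lve i).-1 by rewrite lve_pred // dl r2.
    apply: (byEx i 0 0 (nbr + 3 + l)) => //; [|lia|].
      by rewrite /lve live_var1 //=; lia.
    rewrite exL // !ifN; try lia.
    by rewrite dl2 addKn.
  have r0 : r = 0 by lia.
  move=> /andP[h1 h2]; have [dlm|nl] := eqVneq lam lmax.
    by apply: byRoot => //; rewrite ltnNge h1.
  have hi0 : 0 < i by move: nl; rewrite dl r0; lia.
  have hi1 : i.-1 < n by lia.
  have dl3 : lam.+1 = lmax - 3 * i.-1 - 2 by rewrite dl /lmax; lia.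
  have [v1 v2 v3] := var_level (r := 2) hi1 isT.
  apply: (byBr lam.+1 1 0 l) => //.
  + by rewrite /inrg w0; lia.
  + by rewrite dl3 live_var1.
  + by rewrite dl3 kd_var1.
  + by rewrite dl3 brf_var1 // ltnNge h1.
- move: (lv); rewrite {1}/live /= => /andP[v].
  have [i [r [hi hr' dl dvi dvr]]] := isvarP v; rewrite dvr.
  case: eqP => [r1 /andP[h1 h2]|r1 /andP[/eqP r2 h]].
    have [v1 v2 v3] := var_level (r := 0) hi isT.
    have dl1 : lam.+1 = lmax - 3 * i - 0 by rewrite dl r1 /lmax; lia.
    apply: (byBr lam.+1 1 nbr l) => //.
    + by rewrite /inrg w0; lia.
    + by rewrite dl1 live_var1 //= leqnn; lia.
    + by rewrite dl1 kd_var1.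
    + by rewrite dl1 brf_var1 // ltnNge h1.
  have dl2 : lam = (lve i).-1 by rewrite lve_pred // dl r2.
  apply: (byEx i 1 nbr (nbr + 3 + l)) => //; [|lia|lia|].
    by rewrite /lve live_var2 //= leqnn; lia.
  rewrite exL // !ifN; try lia.
  by rewrite dl2 addKn.
- have [f2|f2] := ltnP f.+3 6.
    move: (lv); rewrite {1}/live /= (_ : f.+3 <= 5) // => /and3P[v /eqP hr1 /eqP l0].
    have [i [r [hi hr' dl dvi dvr]]] := isvarP v.
    have {}dl : lam = lve i by rewrite dl -dvr hr1.
    apply: (byEx i 0 0 (nbr + (2 - f))) => //; [|lia|].
      by rewrite /lve live_var1 //=; lia.
    by rewrite exL // dl l0; case: f f2 {hf lv hr nroot byBr byRoot byEx} => [|[|[|]]] //= _;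
      do ?[case: ltnP => ?; first by lia]; do ![case: eqP => ?]; (by [] || lia).
  have [t ft ht] : exists2 t, f.+3 = 6 + t & t < 2 * n + c by apply: fams6; lia.
  rewrite ft live_test in lv.
  have kt lam' : kd lam'.+1 (6 + t) = 3 by [].
  case/orP: (lv) => /andP[h1 h2].
    apply: (byBr lam.+1 (6 + t) 0 l) => //.
    + by rewrite /inrg w0 -ft hf; move: h1; rewrite /ul /lmax; case: ifP => _; lia.
    + by rewrite live_test; move: h1; rewrite leq_eqVlt => /orP[/eqP->|->]; rewrite ?eqxx; lia.
    + by rewrite /brf /br0 /br1 /= if_same ft.
  have [tn|tn] := ltnP t (2 * n).
    have [hi hb] : t %/ 2 < n /\ t %% 2 < 2 by rewrite ltn_mod; split=> //; lia.
    have et : t = 2 * (t %/ 2) + t %% 2 by rewrite mulnC -divn_eq.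
    move: (t %/ 2) (t %% 2) hi hb et => i b hi hb et.
    have [v1 v2 v3] := var_level (r := 2) hi isT.
    have dl3 : lam.+1 = lmax - 3 * i - 2 by move: h1; rewrite et ul_var // => /eqP->; rewrite /lmax; lia.
    have kv : (lam.+1 <= c + 4) = false by case/andP: v1; rewrite dl3 ltnNge => /negPf-> _.
    apply: (byBr lam.+1 b.+1 0 l) => //; [| | |lia|].
    + by rewrite /inrg w0; move: ht; rewrite /fams; lia.
    + by rewrite dl3; case: (b) hb => [|[|]] // _; rewrite ?live_var1 ?live_var2.
    + by rewrite dl3; case: (b) hb => [|[|]] // _; rewrite ?kd_var1 ?kd_var2.
    + by rewrite dl3 ft et; case: (b) hb => [|[|]] // _; rewrite ?brf_var1 ?brf_var2 ?h2 //=; lia.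
  have [j tj hj] : exists2 j, t = 2 * n + j & j < c by exists (t - 2 * n); lia.
  move: h1; rewrite tj ul_clause // => /eqP dl4.
  have kv : lam.+1 <= c + 4 by lia.
  apply: (byBr lam.+1 1 nbr l) => //; [| | |lia|].
  + by rewrite /inrg w0; rewrite /lmax; lia.
  + by rewrite live_low1 // leqnn; lia.
  + by rewrite /kd /= kv; case: eqP => //; rewrite /lmax; lia.
  + rewrite /brf h2 /br0 /= kv; case: eqP => [|_]; first by rewrite /lmax; lia.
    by rewrite ft tj ifT; lia.
Qed.

End Graph.

End Layout.

(** * The single-sink DAG of fan-in two *)

Module Dag.
Import Game Reaching Layout Lib.

Arguments lmax : simpl never. Arguments usz : simpl never. Arguments unt : simpl never.
Arguments rnd : simpl never. Arguments wid : simpl never. Arguments fams : simpl never.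
Arguments chains : simpl never. Arguments ord_real : simpl never. Arguments ord_dag : simpl never.
Arguments nbr : simpl never. Arguments nlit : simpl never. Arguments nsml : simpl never.
Arguments Layout.gl : simpl never. Arguments Layout.live : simpl never. Arguments Layout.vi : simpl never.
Arguments Layout.vr : simpl never. Arguments Layout.lfc : simpl never. Arguments Layout.kd : simpl never.
Arguments Layout.cn : simpl never. Arguments Layout.vn : simpl never. Arguments Layout.brf : simpl never.
Arguments lve : simpl never. Arguments slotv : simpl never. Arguments lcode : simpl never.
Arguments Layout.pr1 : simpl never. Arguments Layout.pr2 : simpl never. Arguments Layout.edge : simpl never.
Arguments Layout.root : simpl never. Arguments inrg : simpl never. Arguments Layout.rank : simpl never.
Arguments Layout.ul : simpl never. Arguments Layout.isvar : simpl never.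
Opaque Layout.unt Layout.usz.

Section GraphB.
Variables (n c : nat) (q : nat -> bool) (lf : nat -> nat -> nat).
Notation lmax := (lmax n c). Notation wid := (wid n c). Notation chains := (chains n c).
Notation ord_real := (ord_real n c). Notation ord_dag := (ord_dag n c). Notation vn := (vn n c).
Notation kd := (kd n c). Notation live := (live n c). Notation gl := (gl n c). Notation pr1 := (pr1 n c q lf).
Notation pr2 := (pr2 n c q lf). Notation edge := (edge n c q lf). Notation root := (Layout.root n c).
Notation inrg := (inrg n c). Notation rank := (Layout.rank n c). Notation inrg_pos := (@inrg_pos n c).

Lemma dag_case v : v < ord_dag -> (exists2 k, k < 3 & v = ord_real + k) \/
  (exists lam f l p, inrg lam f l p /\ v = vn lam f l p).
Proof.
move=> hv; have [h|h] := ltnP v ord_real.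
  by right; have [h1 h2] := decE h; do 4 eexists; split; [exact: h1 | exact: h2].
by left; exists (v - ord_real); move: hv; rewrite /Layout.ord_dag; lia.
Qed.

Lemma vn_ord lam f l p : inrg lam f l p -> vn lam f l p < ord_dag.
Proof. by move=> /vn_lt h; rewrite /Layout.ord_dag; lia. Qed.

Lemma root_lt : root < ord_dag.
Proof. by apply: vn_ord; exact: root_range. Qed.

Lemma chain_cases x : x < chains ->
  x.+1 < chains \/ x = chains.-1.
Proof. lia. Qed.

(** The successor is explicit: the sources feed the end of chain 0, the first dead vertex of a chain
    feeds the last vertex of the following chain, and a live top feeds a chain that refers to it. *)
Lemma edge_to v : v < ord_dag -> v != root -> exists2 w, w < ord_dag & edge v w.
Proof.
have w0 := wid_gt0 n c; have [n1 n2 n3 n4 n5] := nbrP n c.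
have f0 := fams_gt0 n c; have ub := unt_big n c.
move=> /dag_case[[k k3 ->]|[lam [f [l [p [hr ->]]]]]] nroot.
  have r0 p : p < wid -> inrg 0 0 0 p by rewrite /Layout.inrg w0 f0 => ->.
  have g0 : gl 0 0 0 = 3.
    by rewrite /Layout.gl live_plain // /Layout.lmax; lia.
  have w16 : 16 < wid by rewrite wid_unt; lia.
  have [k2|k2] := ltnP k 2.
    exists (vn 0 0 0 (wid - 1)); first by apply/vn_ord/r0; lia.
    have hr : inrg 0 0 0 (wid - 1) by apply: r0; lia.
    rewrite /Layout.edge; case: k k2 {k3 nroot} => [|[|]] // _.
      have := pr_dead q lf hr; rewrite g0 => -[|[h ->]|[[_ [_ ->]]|[_ [a [b [d [_ h _]]]]]]].
      + lia.
      + by move: h; lia.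
      + by rewrite addn0 eqxx.
      + by move: h; rewrite /Layout.cn.
    rewrite orbC pr2_dead ?g0 //; last by lia.
    by rewrite ifT ?eqxx // /Layout.vn /Layout.cn; apply/eqP; lia.
  have -> : k = 2 by lia.
  have hr : inrg 0 0 0 (wid - 2) by apply: r0; lia.
  exists (vn 0 0 0 (wid - 2)); first exact: vn_ord.
  rewrite /Layout.edge orbC pr2_dead ?g0 //; last by lia.
  rewrite ifF; last by apply/eqP; rewrite /Layout.vn /Layout.cn; lia.
  by rewrite ifT ?eqxx // /Layout.vn /Layout.cn; apply/eqP; lia.
have [hl hf hc hp] := and4P hr; have hg := gl_le n c lam f l.
have [pg|pg] := eqVneq p (gl lam f l).
  have hx := cn_lt hl hf hc; have [h|h] := chain_cases hx.
    have [lam' [f' [l' [hr' e']]]] := chain_dec h.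
    have hrw : inrg lam' f' l' (wid - 1) by apply: inrg_pos hr' _; lia.
    exists (vn lam' f' l' (wid - 1)); first exact: vn_ord.
    have hg' := gl_le n c lam' f' l'.
    have := pr_dead q lf hrw; case; first by lia.
      by move=> [h1 _]; lia.
    move=> [[_ [h1 _]]|[_ [a [b [d [h1 h2 h3]]]]]]; first by rewrite -e' in h1.
    rewrite -e' in h2; case: h2 => h2.
    have hr0 := inrg_pos hr w0; have [ea eb ed] := cn_inj hr0 h1 h2.
    by rewrite /Layout.edge h3 -ea -eb -ed pg eqxx.
  exists root; first exact: root_lt.
  have hrr := root_range n c; have [k4 g4] := kd_rootE n c.
  rewrite /Layout.edge /Layout.root !pr_real ?g4 ?k4 //=; try by rewrite addn1.
  rewrite lfc_rootE /= -h /Layout.vn pg; apply/orP; right.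
  have [lam' [f' [l' [e1 e2 e3]]]] := root_dead n c; rewrite -h in e1.
  have [-> -> ->] := cn_inj (inrg_pos hr w0) e2 e1.
  by rewrite /Layout.gl (negPf e3) addn0.
case: p hr hp pg nroot => [|p] hr hp pg nroot.
  have lv : live lam f l by move: pg; rewrite /Layout.gl; case: live.
  have [lam' [f' [l' [p [h1 h2 h3 h4]]]]] := live_used hr lv nroot.
  exists (vn lam' f' l' p); first exact: vn_ord.
  by rewrite /Layout.edge !pr_real // leqNgt h3 /= h4 /Layout.vn addn0 eqxx orbT.
have hr' : inrg lam f l p by apply: inrg_pos hr _; lia.
have [pg2|pg2] := ltnP p (gl lam f l); last first.
  exists (vn lam f l p); first exact: vn_ord.
  rewrite /Layout.edge; have [[_ ->]|[[h _]|[h _]]] := pr_dead q lf hr' pg2; first by rewrite eqxx.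
    lia.
  lia.
have pg3 : p.+1 < gl lam f l by lia.
have [k2|k2] := leqP (kd lam f) 2; last first.
  exists (vn lam f l p); first exact: vn_ord.
  by rewrite /Layout.edge pr_real // leqNgt k2 pg3 eqxx.
have g3 : gl lam f l = 3.
  move: pg2; rewrite /Layout.gl; case: ifP => // _; move: k2.
  by case: (kd lam f) => [|[|[|]]].
exists (vn lam f l 0); first by apply/vn_ord/(inrg_pos hr).
rewrite /Layout.edge !pr_real ?g3 ?k2 //=; try by apply: inrg_pos hr _.
by move: pg3; rewrite g3; case: (p) => [|[|]] //= _; rewrite eqxx ?orbT.
Qed.

Definition ov v : 'I_ord_dag := insubd (Ordinal root_lt) v.
Definition ed : rel 'I_ord_dag := fun u v => edge u v.

Lemma ovK v : v < ord_dag -> ov v = v :> nat.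
Proof. by move=> h; rewrite /ov val_insubd h. Qed.

Lemma ov_ord (v : 'I_ord_dag) : ov v = v.
Proof. by apply: val_inj; rewrite /= ovK. Qed.

Lemma ed_rank (u v : 'I_ord_dag) : ed u v -> rank u < rank v.
Proof.
by move=> /orP[]/eqP h; apply: (@pr_rank n c q lf); rewrite ?ltn_ord //; [left | right].
Qed.

Lemma ed_acyclic : acyclic ed.
Proof.
move=> [|v s] //= h; exfalso.
have tr : transitive (fun u v : 'I_ord_dag => rank u < rank v).
  by move=> a b d; apply: ltn_trans.
have := sub_path ed_rank h; rewrite (path_sortedE tr) all_rcons ltnn.
by [].
Qed.

Lemma ed_sink v : is_sink ed v = (v == Ordinal root_lt).
Proof.
apply/forallP/eqP => [h|-> w]; last first.
  (* A successor of the root would have larger rank, but no rank exceeds that of the root. *)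
  apply/negP => h; have := ed_rank h; rewrite /= => hh.
  have hr := root_range n c; have [k4 g4] := kd_rootE n c; have [n1 n2 n3 n4 n5] := nbrP n c.
  have w0 := wid_gt0 n c.
  move: hh; rewrite [rank root]rank_real ?g4; [|by []|lia].
  have [[k k3 ->]|[lam [f [l [p [hr' ->]]]]]] := dag_case (ltn_ord w); first by rewrite rank_dummy.
  have [hl hf hc hp] := and4P hr'.
  have [pg|pg] := ltnP p (gl lam f l); last by have := rank_dead_le hr' pg; lia.
  rewrite rank_real // subn0; suff : rk n c lam f * wid <= rk n c lmax.+1 1 * wid by lia.
  rewrite leq_mul2r; apply/orP; right; rewrite /rk.
  case: ifP => h5; first by have := leq_b1 ((f == 3) || (f == 4)); rewrite /=; lia.
  have -> : (f == 3) || (f == 4) = false by move: h5; lia.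
  by rewrite /=; lia.
apply: val_inj; apply/eqP; apply: contraT => nr; have [w hw hvw] := edge_to (ltn_ord v) nr.
by have := h (Ordinal hw); rewrite /ed hvw.
Qed.

Definition pdag : ssdag := SSDag ed_acyclic ed_sink.

Lemma pdag_fanin : fanin_le 2 pdag.
Proof.
move=> v; apply: leq_trans (subset_leq_card (B := [set ov (pr1 v); ov (pr2 v)]) _) _; last first.
  by rewrite cards2; case: eqP.
apply/subsetP => u; rewrite !inE => /orP[]/eqP h; apply/orP; [left|right];
by rewrite -h ov_ord.
Qed.

End GraphB.

End Dag.

(** * Strategies of the pebbler *)

Module UpperBound.
Import Game Reaching Layout Dag Lib.

Section GraphB.
Variables (n c : nat) (q : nat -> bool) (lf : nat -> nat -> nat).
Notation lmax := (lmax n c). Notation usz := (usz n c). Notation unt := (unt n c). Notation rnd := (rnd n c).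
Notation wid := (wid n c). Notation fams := (fams n c). Notation ord_real := (ord_real n c).
Notation ord_dag := (ord_dag n c). Notation nbr := (nbr n c). Notation nlit := (nlit n c).
Notation nsml := (nsml n c). Notation isvar := (isvar n c). Notation vi := (vi n c). Notation vr := (vr n c).
Notation vn := (vn n c). Notation kd := (kd n c). Notation brf := (brf n c). Notation lfc := (lfc n c).
Notation live := (live n c). Notation gl := (gl n c). Notation lcode := (lcode n q lf). Notation lve := (lve n c).
Notation slotv := (slotv n c q lf). Notation pr1 := (pr1 n c q lf). Notation pr2 := (pr2 n c q lf).
Notation root := (Layout.root n c). Notation inrg := (inrg n c). Notation rank := (Layout.rank n c).
Notation inrg_pos := (@inrg_pos n c). Notation br0 := (Layout.br0 n c). Notation br1 := (Layout.br1 n c).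
Notation ov := (ov n c). Notation ed := (@ed n c q lf). Notation V := 'I_ord_dag. Notation VS := {set 'I_ord_dag}.

Definition nd lam f l p : V := ov (vn lam f l p).
Definition lft lam f p : V := ov (lfc lam f p * wid).
(** [oo i b] and [xx i b] are the first two positions of the literal chain of [(i, b)], and [tt i]
    is the other predecessor of [oo i b], common to both literals. The value [b] is recorded by
    pebbles on [oo i b], [xx i (~~ b)] and [tt i]: the true literal is then pebbled, and the false
    one can be placed in one move. *)
Definition oo i b : V := nd (lve i) (3 + b) 0 0.
Definition xx i b : V := nd (lve i) (3 + b) 0 1.
Definition tt i : V := nd (lve i) 5 0 0.
Definition sl t k : V := ov (slotv t k).
(** The value of a tower of level [lam]; the summand 3 is the value of its bottom gadget. *)
Definition H lam := 3 + rnd * lam.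
Definition upd (r : nat -> bool) i b := fun j => if j == i then b else r j.
Definition tst t (r : nat -> bool) : bool := [exists k : 'I_3,
  (lcode t k != 0) && (r ((lcode t k).-1 %/ 2) == (lcode t k).-1 %% 2 :> nat)].
(** Truth of a tower under the values chosen above it. A fork is a conjunction since the challenger
    picks the half, a choice chain a disjunction since the pebbler picks the value. *)
Fixpoint tr lam f (r : nat -> bool) : bool :=
  if f == 0 then true else if 5 < f then tst (f - 6) r else
  if lam is lam'.+1 then
    if kd lam f == 5 then tr lam' f (upd r (vi lam) false) || tr lam' f (upd r (vi lam) true)
    else tr lam' (br0 lam f) r && tr lam' (br1 lam f) r
  else true.

(* The cost of making [t] available to whoever needs it. *)
Definition Abs k (D : VS) (t : V) : Prop := forall (D' : VS) v,
  D \subset D' -> pred_set ed v \subset t |: D' -> win ed k D' v.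

Lemma AbsW k (D D' : VS) t : D \subset D' -> Abs k D t -> Abs k D' t.
Proof. by move=> s h D'' v s' hv; apply: h hv; apply: subset_trans s s'. Qed.

Lemma Abs_leq k k' (D : VS) t : k <= k' -> Abs k D t -> Abs k' D t.
Proof. by move=> le h D' v s' hv; apply: win_leq le _; apply: h hv. Qed.

Lemma Abs_in k (D : VS) t : t \in D -> Abs k D t.
Proof.
move=> tD D' v s' hv; apply: win0; apply: subset_trans hv _.
by rewrite subUset sub1set subxx (subsetP s').
Qed.

Lemma Abs_win k (D : VS) t : (forall D' : VS, D \subset D' -> win ed k D' t) -> Abs k.+1 D t.
Proof.
move=> h D' v s hv; apply: (@winS _ _ t); first exact: win0.
by apply: h; apply: subset_trans s (subsetUr _ _).
Qed.

Lemma pred_sub v (D : VS) : (pr1 v < ord_dag -> ov (pr1 v) \in D) ->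
  (pr2 v < ord_dag -> ov (pr2 v) \in D) -> v < ord_dag -> pred_set ed (ov v) \subset D.
Proof.
move=> h1 h2 hv; apply/subsetP => u; rewrite inE /Dag.ed ovK // => /orP[]/eqP h.
  by rewrite -(ov_ord u) h h1 // -h.
by rewrite -(ov_ord u) h h2 // -h.
Qed.

Lemma pred_nd lam f l p (D : VS) : inrg lam f l 0 -> p < gl lam f l -> 2 < kd lam f ->
  ((p.+1 == gl lam f l) || (nd lam f l p.+1 \in D)) -> lft lam f p \in D ->
  pred_set ed (nd lam f l p) \subset D.
Proof.
move=> hr hp k2 h1 h2; have hw : p < wid by have := gl_le n c lam f l; lia.
have hr' := inrg_pos hr hw.
have k2' : (kd lam f <= 2) = false by rewrite leqNgt k2.
apply: pred_sub; last exact: vn_ord; rewrite !pr_real // k2' //.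
case: ifP => hp1; last by rewrite ltnn.
by move=> _; case/orP: h1 => // /eqP h; rewrite h ltnn in hp1.
Qed.

Lemma seg_win lam f l p0 p1 k s (D : VS) : inrg lam f l 0 -> 2 < kd lam f ->
  p1 < p0 <= gl lam f l -> (p0 == gl lam f l) || (nd lam f l p0 \in D) ->
  (forall p, p1 <= p < p0 -> Abs k D (lft lam f p)) -> p0 - p1 <= 2 ^ s ->
  win ed (k + s) D (nd lam f l p1).
Proof.
move=> hr k2 /andP[hp hg] h0 ha le.
pose g j := nd lam f l (p0 - j).
have -> : nd lam f l p1 = g (p0 - p1) by rewrite /g subKn // ltnW.
apply: (@chain_search _ ed g (p0 - p1) k s D 0 (p0 - p1)) => //; [|lia|by rewrite subn0].
move=> D' j s' hj hg'; rewrite /g.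
have e : (p0 - j.+1).+1 = p0 - j by lia.
apply: (ha (p0 - j.+1) _ D' _ s'); first by lia.
apply: pred_nd => //; [by lia | | by rewrite setU11].
rewrite e; case/orP: hg' => [/eqP->|h]; last by rewrite !inE h !orbT.
by rewrite subn0; case/orP: h0 => [->|/(subsetP s') h] //; rewrite !inE h !orbT.
Qed.

(** The vertex [v] that asks for the top is treated as one more position of the chain, whence the
    strict bound in place of the weak one of [seg_win]. *)
Lemma seg_abs lam f l p0 p1 k s (D : VS) : inrg lam f l 0 -> 2 < kd lam f ->
  p1 < p0 <= gl lam f l -> (p0 == gl lam f l) || (nd lam f l p0 \in D) ->
  (forall p, p1 <= p < p0 -> Abs k D (lft lam f p)) -> p0 - p1 < 2 ^ s ->
  Abs (k + s) D (nd lam f l p1).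
Proof.
move=> hr k2 /andP[hp hg] h0 ha le D1 v s1 hv.
pose g j := if j <= p0 - p1 then nd lam f l (p0 - j) else v.
have -> : v = g (p0 - p1).+1 by rewrite /g ltnn.
apply: (@chain_search _ ed g (p0 - p1).+1 k s D1 0 (p0 - p1).+1) => //; [|lia].
move=> D' j s' hj; rewrite /g; case: (leqP j.+1 (p0 - p1)) => hj1 hg'; last first.
  have ej : j = p0 - p1 by lia.
  move: hg'; rewrite ej leqnn subKn; last by lia.
  rewrite (_ : (p0 - p1 == 0) = false) /=; last by lia.
  move=> h; apply: win0; apply: subset_trans hv _.
  by rewrite subUset sub1set h.
have e : (p0 - j.+1).+1 = p0 - j by lia.
apply: (ha (p0 - j.+1) _ D' _ (subset_trans s1 s')); first by lia.
apply: pred_nd => //; [by lia | | by rewrite setU11].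
rewrite e; move: hg'; rewrite (_ : j <= p0 - p1); last by lia.
case/orP => [/eqP->|h]; last by rewrite !inE h !orbT.
rewrite subn0; case/orP: h0 => [->|/(subsetP s1)/(subsetP s') h] //.
by rewrite !inE h !orbT.
Qed.

Definition vset (r : nat -> bool) (D : VS) i :=
  [/\ oo i (r i) \in D, xx i (~~ r i) \in D & tt i \in D].
Definition tcond t (r : nat -> bool) (D : VS) :=
  forall k, k < 3 -> lcode t k <> 0 -> vset r D ((lcode t k).-1 %/ 2).
Definition ubc lam f (r : nat -> bool) (D : VS) : Prop :=
  if f == 0 then True else if 5 < f then tcond (f - 6) r D else
  forall i, i < n -> lam < lve i -> vset r D i.

Lemma vsetW r (D D' : VS) i : D \subset D' -> vset r D i -> vset r D' i.
Proof. by move=> /subsetP s [h1 h2 h3]; split; apply: s. Qed.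

Lemma ubcW lam f r (D D' : VS) : D \subset D' -> ubc lam f r D -> ubc lam f r D'.
Proof.
move=> s; rewrite /ubc; case: ifP => // _; case: ifP => _ h.
  by move=> k h1 h2; apply: vsetW s (h k h1 h2).
by move=> i h1 h2; apply: vsetW s (h i h1 h2).
Qed.

Lemma item_kd i f : i < n -> 2 < f < 6 -> kd (lve i) f = if f == 5 then 7 else 6.
Proof.
move=> hi hf; have [_ _ v r _] := lveP c hi; rewrite /Layout.kd v r.
by case: f hf => [|[|[|[|[|[|]]]]]].
Qed.

Lemma lft_item0 i b : i < n -> b < 2 -> lft (lve i) (3 + b) 0 = tt i.
Proof.
move=> hi hb; rewrite /lft /Layout.lfc item_kd; [|by []|lia].
have -> : (3 + b == 5) = false by apply/eqP; lia.
by rewrite /= /tt /nd /Layout.vn addn0.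
Qed.

(* Free means pebbled or placeable at once. *)
Definition free (D : VS) x := forall D' : VS, D \subset D' -> (x \in D') || win ed 0 D' x.

Lemma freeW (D D' : VS) x : D \subset D' -> free D x -> free D' x.
Proof. by move=> s h D'' s'; apply: h; apply: subset_trans s s'. Qed.

Lemma free_oo r (D : VS) i b : i < n -> b < 2 -> vset r D i -> free D (oo i b).
Proof.
move=> hi hb hv D' s; have [h1 h2 h3] := vsetW s hv.
have [e|ne] := eqVneq b (r i); first by rewrite e h1.
have e : b = ~~ r i by move: ne; case: (r i) => /=; lia.
apply/orP; right; apply: win0; have g := gl_item c hi (f := 3 + b).
have hf : 2 < 3 + b < 6 by lia.
apply: pred_nd.
- by apply: inrg_item => //; lia.
- by rewrite g //; case: ifP => _; have [] := nbrP n c; lia.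
- by rewrite item_kd //; case: ifP.
- by move: h2; rewrite -e /xx => ->; rewrite orbT.
- by rewrite lft_item0.
Qed.

Lemma free_abs (D : VS) x : free D x -> Abs 1 D x.
Proof.
move=> h D' v s hv; have := h D' s; case/orP => hx.
  by apply: Abs_in hx _ _ (subxx _) hv.
apply: (@winS _ _ x); first exact: win0.
by apply: win_subset hx; apply: subsetUr.
Qed.

Lemma pair_win (D : VS) x y z : pred_set ed x \subset [set y; z] -> free D y -> free D z ->
  win ed 2 D x /\ ((y \in D) || (z \in D) -> win ed 1 D x).
Proof.
move=> hx hy hz; have one (D' : VS) u w : pred_set ed x \subset [set u; w] -> u \in D' -> free D' w ->
  win ed 1 D' x.
  move=> h hu hw; apply: (free_abs hw (subxx _)); apply: subset_trans h _.
  by rewrite subUset !sub1set !inE hu eqxx orbT.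
have h12 : (y \in D) || (z \in D) -> win ed 1 D x.
  by case/orP => h; [apply: one hx h hz | apply: one h hy; rewrite setUC].
split=> //; have := hy _ (subxx _) => /orP[h|h].
  by apply: (@win_leq _ _ 1) => //; apply: h12; rewrite h.
apply: (@winS _ _ y).
  by apply: one hx _ _; rewrite ?setU11 //; apply: freeW hz; apply: subsetUr.
by apply: (@win_leq _ _ 0) => //; apply: win_subset h; apply: subsetUr.
Qed.

(** Three rounds put pebbles on [a], [b] and [p]. With three rounds in all, the vertex placed second
    must be won in one round when challenged, which requires a pebble on one of its slots; the order
    of [a] and [b] is chosen so that this holds. Without a pebbled slot a fourth round is spent. *)
Lemma gadget (D : VS) p a b s0 s1 s2 : pred_set ed p \subset [set a; b] ->
  pred_set ed a \subset [set s0; s1] -> pred_set ed b \subset [set s1; s2] ->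
  free D s0 -> free D s1 -> free D s2 ->
  Abs 4 D p /\ ([|| s0 \in D, s1 \in D | s2 \in D] -> Abs 3 D p).
Proof.
move=> hp ha hb f0 f1 f2.
have pp (D' : VS) : a \in D' -> b \in D' -> win ed 0 D' p.
  by move=> h1 h2; apply: win0; apply: subset_trans hp _; rewrite subUset !sub1set h1.
have sU (x : V) (D' : VS) : D' \subset x |: D' by apply: subsetUr.
split.
  move=> D' v s hv; have F x : free D x -> free D' x by apply: freeW.
  have F' x y : free D x -> free (y |: D') x.
    by apply: freeW; apply: subset_trans s _; apply: subsetUr.
  apply: (@winS _ _ a); last first.
    by apply: win_leq (pair_win ha (F' _ _ f0) (F' _ _ f1)).1.
  have FF x : free D x -> free (b |: (a |: D')) x.
    by move=> /(F' x a); apply: freeW.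
  apply: (@winS _ _ b); last first.
    by have [] := pair_win hb (FF _ f1) (FF _ f2).
  apply: (@winS _ _ p); first by apply: win0; apply: subset_trans hv _; rewrite setUS //; apply: subset_trans (sU _ _).
  by apply: (@win_leq _ _ 0) => //; apply: pp; rewrite !inE eqxx ?orbT.
move=> hs D' v s hv.
have gen a' b' : a' \in [set a; b] -> pred_set ed p \subset [set a'; b'] ->
    (forall D'' : VS, D' \subset D'' -> win ed 1 D'' b') -> (forall D'' : VS, D' \subset D'' -> win ed 2 D'' a') ->
    win ed 3 D' v.
  move=> _ hp' hb' ha'; apply: (@winS _ _ a'); last exact: ha'.
  apply: (@winS _ _ b'); last by apply: hb'; apply: subset_trans (sU _ _) (sU _ _).
  apply: (@winS _ _ p).
    by apply: win0; apply: subset_trans hv _; rewrite setUS //; apply: subset_trans (sU _ _).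
  by apply: win0; apply: subset_trans hp' _; rewrite subUset !sub1set !inE !eqxx ?orbT.
have F x (D'' : VS) : free D x -> D' \subset D'' -> free D'' x.
  by move=> h s'; apply: freeW h; apply: subset_trans s s'.
have [h12|h0] := boolP ((s1 \in D) || (s2 \in D)).
  apply: (gen a b); rewrite ?inE ?eqxx // => D'' s'.
    apply: (pair_win hb (F _ _ f1 s') (F _ _ f2 s')).2.
    by case/orP: h12 => h; rewrite (subsetP s' _ (subsetP s _ h)) ?orbT.
  by have [] := pair_win ha (F _ _ f0 s') (F _ _ f1 s').
have {}h0 : s0 \in D by move: hs; rewrite (negPf h0) orbF.
apply: (gen b a); rewrite ?inE ?eqxx ?orbT // 1?setUC // => D'' s'.
  apply: (pair_win ha (F _ _ f0 s') (F _ _ f1 s')).2.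
  by rewrite (subsetP s' _ (subsetP s _ h0)).
by have [] := pair_win hb (F _ _ f1 s') (F _ _ f2 s').
Qed.

Lemma no_pred v (D : VS) : v < ord_dag -> ord_dag <= pr1 v -> ord_dag <= pr2 v ->
  pred_set ed (ov v) \subset D.
Proof. by move=> h h1 h2; apply: pred_sub => //; rewrite ltnNge ?h1 ?h2. Qed.

Lemma lt_dummy k : k < 3 -> ord_real + k < ord_dag.
Proof. by move=> h; rewrite /Layout.ord_dag ltn_add2l. Qed.

Lemma free_slot t k r (D : VS) : t < 2 * n + c -> k < 3 -> tcond t r D -> free D (sl t k).
Proof.
move=> ht hk h; rewrite /sl; have [[h1 ->]|[i [b [hi hb e ->]]]] := @slotv_spec n c q lf t k ht.
  move=> D' _; apply/orP; right; apply/win0/no_pred; first exact: lt_dummy.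
    by rewrite /Layout.pr1 leq_addr.
  by rewrite /Layout.pr2 leq_addr.
apply: (free_oo hi hb); rewrite -/(lcode t k).
have := h k hk; rewrite e addn1 /= mulnC divnMDl // divn_small // addn0; apply; lia.
Qed.

(** The flag [c0], carried through all upper bounds, grants one more round and in return drops the
    demand that the test be true. *)
Lemma ub_bottom2 t l r (D : VS) (c0 : bool) : inrg 0 (6 + t) l 0 -> live 0 (6 + t) l ->
  tcond t r D -> c0 || tst t r -> Abs (H 0 + c0) D (nd 0 (6 + t) l 0).
Proof.
move=> hr lv tc hc; have ht : t < 2 * n + c by case/and4P: hr => _; rewrite /Layout.fams; lia.
have g3 : gl 0 (6 + t) l = 3 by rewrite /Layout.gl lv.
have w8 := gl_le n c 0 (6 + t) l; rewrite g3 in w8.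
have hr1 : inrg 0 (6 + t) l 1 by apply: inrg_pos hr _; lia.
have hr2 : inrg 0 (6 + t) l 2 by apply: inrg_pos hr _; lia.
have k2 : kd 0 (6 + t) = 2 by [].
have [] := @gadget D (nd 0 (6 + t) l 0) (nd 0 (6 + t) l 1) (nd 0 (6 + t) l 2)
  (sl t 0) (sl t 1) (sl t 2).
- apply: pred_sub; last exact: vn_ord; rewrite !pr_real ?g3 // k2 /= => _; by rewrite !inE eqxx ?orbT.
- apply: pred_sub; last exact: vn_ord; rewrite !pr_real ?g3 // k2 addKn /= => _; by rewrite !inE eqxx ?orbT.
- apply: pred_sub; last exact: vn_ord; rewrite !pr_real ?g3 // k2 addKn /= => _; by rewrite !inE eqxx ?orbT.
- exact: free_slot tc.
- exact: free_slot tc.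
- exact: free_slot tc.
rewrite /H muln0; case: c0 hc => /= [_ h _|/existsP[k /andP[h1 h2]] _ h]; first exact: h.
apply: h; have hk := ltn_ord k; have /eqP h1' := h1; have [v1 v2 v3] := tc k hk h1'.
have : sl t k \in D.
  rewrite /sl; have [[h3 _]|[i [b [hi hb e ->]]]] := @slotv_spec n c q lf t k ht; first by [].
  move: v1 h2; rewrite e addn1 /= mulnC divnMDl // divn_small // addn0 modnMDl modn_small // => v1 /eqP<-.
  exact: v1.
by case: k hk {h1 h2 h1' v1 v2 v3} => [[|[|[|]]]] //= _ _ ->; rewrite ?orbT.
Qed.

Lemma ub_bottom1 f l (D : VS) k : f < 2 -> inrg 0 f l 0 -> live 0 f l ->
  3 <= k -> Abs k D (nd 0 f l 0).
Proof.
move=> hf hr lv hk; have k1 : kd 0 f = 1 by case: f hf {hr lv} => [|[|]].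
have g3 : gl 0 f l = 3 by rewrite /Layout.gl lv k1.
have w8 := gl_le n c 0 f l; rewrite g3 in w8.
have hr1 : inrg 0 f l 1 by apply: inrg_pos hr _; lia.
have hr2 : inrg 0 f l 2 by apply: inrg_pos hr _; lia.
apply: Abs_leq hk _; apply: Abs_win => D' _.
have f1 p : 0 < p < 3 -> free D' (nd 0 f l p).
  move=> hp D'' _; have hrp : inrg 0 f l p by apply: inrg_pos hr _; lia.
  apply/orP; right; apply/win0/no_pred; [exact: vn_ord | |];
  by rewrite !pr_real ?g3 ?k1 //; [rewrite /= ifF; lia | lia].
have hp : pred_set ed (nd 0 f l 0) \subset [set nd 0 f l 1; nd 0 f l 2].
  by apply: pred_sub; last exact: vn_ord; rewrite !pr_real ?g3 // k1 /= => _; rewrite !inE eqxx ?orbT.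
exact: (pair_win hp (f1 1 isT) (f1 2 isT)).1.
Qed.

Definition isnode lam f := kd lam f \in [:: 1; 2; 3; 5].

Lemma live_node lam f l : live lam f l -> lam <= lmax -> ~~ (2 < f < 6) -> isnode lam f.
Proof.
rewrite /Layout.live /isnode /Layout.kd !inE; case: f => [|[|[|f]]] /=.
- by case: (lam == 0).
- move=> lv hl _; have -> : (lam == lmax.+1) = false by lia.
  by case: (lam == 0); case: (lam <= c + 4); case: (vr lam == 1).
- by case: (isvar lam) => //=; case: (vr lam) => [|[|]].
- move=> lv _ h; have -> : (f.+3 <= 5) = false by lia.
  by case: (lam == 0).
Qed.

Lemma brf_fam lam f p : ~~ (2 < f < 6) -> ~~ (2 < brf lam f p < 6).
Proof.
rewrite /Layout.brf /Layout.br0 /Layout.br1; case: f => [|[|[|f]]] /=; by do ![case: ifP => _ //]; lia.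
Qed.

Lemma H_pred lam : 0 < lam -> H lam = H lam.-1 + rnd.
Proof. by case: lam => // lam _; rewrite /H /= mulnS; lia. Qed.

Lemma plain_abs lam l D : lam < lmax -> l < 2 * nbr -> Abs (H lam) D (nd lam 0 l 0).
Proof.
have [n1 n2 n3 n4 n5] := nbrP n c; have w0 := wid_gt0 n c; have f0 := fams_gt0 n c.
have ub := unt_big n c.
elim: lam l D => [|lam IH] l D hl hc.
  apply: ub_bottom1 => //; first by rewrite /Layout.inrg f0 w0; lia.
  exact: live_plain.
have hr : inrg lam.+1 0 l 0 by rewrite /Layout.inrg f0 w0; lia.
have g : gl lam.+1 0 l = 2 * nbr by rewrite /Layout.gl live_plain.
rewrite (@H_pred lam.+1) //; apply: (seg_abs (p0 := 2 * nbr)); rewrite ?g ?eqxx //.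
- lia.
- move=> p /= hp; rewrite /lft kd_br_lfc // -[_ * wid]addn0 /Layout.brf /Layout.br0 /Layout.br1 /= if_same.
  by apply: IH => //; lia.
- by rewrite rnd_pow subn0.
Qed.

(** When a fork turns to the tower of a test, the variables of the test have been set: the test of a
    variable hangs from the level below its choice, and the clauses come after all choices. *)
Lemma ubc_br lam f p r D : inrg lam f 0 0 -> kd lam f = 3 -> ~~ (2 < f < 6) ->
  ubc lam f r D -> ubc lam.-1 (brf lam f p) r D.
Proof.
move=> hr k3 hf; have [hl hfa _ _] := and4P hr.
rewrite {1}/ubc; case: eqP => [-> _|f0].
  by rewrite /Layout.brf /Layout.br0 /Layout.br1 /= if_same /ubc.
case: ifP => [f5 h|f5 h].
  have e : brf lam f p = f.
    by rewrite /Layout.brf /Layout.br0 /Layout.br1; case: f f5 {hr k3 hf hfa f0 h} => [|[|[|]]] //= *; rewrite if_same.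
  by rewrite e /ubc (introF eqP f0) f5.
have f12 : f = 1 \/ f = 2 by lia.
have lam0 : 0 < lam.
  by case: lam k3 {hr hl h} => // k3; case: f12 k3 => ->.
rewrite /ubc; case: eqP => // b0; case: ifP => [b5|b5]; last first.
  move=> i hi; rewrite leq_eqVlt => /orP[/eqP e|]; last by move=> hh; apply: h => //; lia.
  apply: h => //; exfalso; have [l0 l1 _ _ _] := lveP c hi.
  have e' : lve i = lam by lia.
  case: f12 => e2; move: k3; rewrite e2 -e'.
    by have [-> _] := @kd_exE n c i 0 0 hi isT.
  by have [-> _] := @kd_exE n c i 1 0 hi isT.
move=> k hk hk0; have hb6 : 5 < brf lam f p by [].
case v: (isvar lam); last first.
  have lc : lam <= c + 4.
    move: v; rewrite /Layout.isvar; case: (ltnP (c + 4) lam) => //= h1 h2.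
    have h3 : lam = lmax.+1 by move: h2; lia.
    by case: f12 k3 => ->; rewrite h3 /Layout.kd /= ?eqxx // /Layout.isvar ltnn andbF.
  have ht : brf lam f p - 6 < 2 * n + c.
    move: hb6; rewrite /Layout.brf /Layout.br0 /Layout.br1.
    case: f12 k3 => ->; last by rewrite /Layout.kd /= v.
    move=> _; rewrite /= lc v /=; case: eqP => [|_]; first by rewrite /Layout.lmax in lc *; lia.
    by case: ifP => _ //; case: ifP => //; lia.
  have := @lcode_le n c q lf _ k ht; move: hk0.
  move: (lcode _ _) => x x0 hx; have hi : x.-1 %/ 2 < n by lia.
  by apply: h => //; rewrite /Layout.lve /Layout.lmax; lia.
have [i [s [hi hs dl dvi dvr]]] := isvarP v.
have s2 : s = 2.
  case: f12 hb6 k3 => ->; rewrite dl.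
    rewrite kd_var1 //; case: eqP => // s1 hb6 _; move: hb6; rewrite brf_var1 //; last by apply/eqP.
    by case: eqP => [_|]; [case: ifP | lia].
  by rewrite kd_var2 //; case: eqP => // s0; case: eqP => //; lia.
have [b hb et] : exists2 b, b < 2 & brf lam f p = 6 + (2 * i + b).
  move: hb6; case: f12 => ->; rewrite dl ?brf_var1 ?brf_var2 ?s2 //; case: ifP => // _ _; first by exists 0; rewrite // addn0.
  by exists 1 => //; lia.
have e : (lcode (brf lam f p - 6) k).-1 %/ 2 = i.
  move: hk0; rewrite et addKn /Layout.lcode.
  have -> : 2 * i + b < 2 * n by lia.
  have -> : (2 * i + b) %/ 2 = i by lia.
  by case: ifP => _; case: ifP => //; lia.
by rewrite e; apply: h => //; rewrite /Layout.lve dl; move: (lveP c hi); rewrite /Layout.lve => -[]; lia.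
Qed.

Lemma ubc_upd lam f r D i b : i < n -> b < 2 -> lam = lve i -> f = b.+1 ->
  ubc lam f r D -> forall v : bool, oo i v \in D -> xx i (~~ v) \in D -> tt i \in D ->
  ubc lam.-1 f (upd r i v) D.
Proof.
move=> hi hb -> -> h v h1 h2 h3; move: h; rewrite /ubc /=.
have -> : (5 < b.+1) = false by lia.
move=> h j hj; rewrite /vset /upd; case: eqP => [-> _|ne hl]; first by [].
by have [] := h j hj; [move: hl ne; rewrite /Layout.lve; lia |].
Qed.

Lemma tr_br lam f p r : kd lam f = 3 -> 0 < lam -> ~~ (2 < f < 6) -> tr lam f r -> tr lam.-1 (brf lam f p) r.
Proof.
case: lam => // lam k3 _ hf; rewrite /= k3 /=; case: eqP => [-> _|f0].
  by rewrite /Layout.brf /Layout.br0 /Layout.br1 /= if_same; case: (lam).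
case: ifP => [f5 h|f5 /andP[h1 h2]]; last by rewrite /Layout.brf; case: ifP.
have e : brf lam.+1 f p = f.
  by rewrite /Layout.brf /Layout.br0 /Layout.br1; case: f f5 {k3 hf f0 h} => [|[|[|]]] //= *; rewrite if_same.
by rewrite e; case: (lam) => /= [|?]; rewrite (introF eqP f0) f5.
Qed.

Lemma tr_ex i b r : i < n -> b < 2 -> tr (lve i) b.+1 r =
  tr (lve i).-1 b.+1 (upd r i false) || tr (lve i).-1 b.+1 (upd r i true).
Proof.
move=> hi hb; have [l0 l1 _ _ v] := lveP c hi; have [k _] := @kd_exE n c i b 0 hi hb.
case: (lve i) l0 k v => // lam _ k v /=; rewrite k v /=.
by have -> : (5 < b.+1) = false by lia.
Qed.

Arguments nd : simpl never. Arguments lft : simpl never. Arguments oo : simpl never. Arguments xx : simpl never.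
Arguments tt : simpl never. Arguments sl : simpl never. Arguments H : simpl never.

Lemma usz_pow k : 2 ^ (usz + k) = unt * 2 ^ k.
Proof. by rewrite expnD. Qed.

Lemma pow_unt : 2 ^ usz = unt. Proof. by []. Qed.

Lemma tt_abs i (D : VS) : i < n -> Abs (H (lve i).-1 + usz) D (tt i).
Proof.
move=> hi; have [n1 n2 n3 n4 n5] := nbrP n c; have ub := unt_big n c.
have [l0 l1 _ _ _] := lveP c hi.
have g := gl_item c hi (f := 5) isT; have k := item_kd hi (f := 5) isT.
apply: (seg_abs (p0 := nsml)); rewrite ?g ?k ?eqxx ?n1 ?leqnn //.
- by apply: inrg_item.
- move=> p hp; rewrite /lft /Layout.lfc k /=.
  rewrite -[_ * wid]addn0; apply: plain_abs; first by lia.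
  by move: hp; rewrite /Layout.nsml /Layout.nbr; lia.
- by rewrite pow_unt /Layout.nsml; lia.
Qed.

Lemma oo_win i b k (D : VS) : i < n -> b < 2 -> xx i b \in D -> Abs k D (tt i) -> win ed k D (oo i b).
Proof.
move=> hi hb hx ht; have hf : 2 < 3 + b < 6 by lia.
have f5 : (3 + b == 5) = false by apply/eqP; lia.
have g := gl_item c hi hf; rewrite f5 in g; have kk := item_kd hi hf; rewrite f5 in kk.
apply: ht (subxx _) _; apply: pred_nd; rewrite ?g ?kk ?lft_item0 ?setU11 //.
- by apply: inrg_item => //; lia.
- by rewrite addn1.
- by rewrite -/(xx i b) !inE hx !orbT.
Qed.

Lemma lft_ex i b p : i < n -> b < 2 -> lft (lve i) b.+1 p =
  if p < nbr then nd (lve i).-1 0 (5 * unt + p) 0 else if p == nbr then tt i else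
  if p == nbr + 1 then oo i 1 else if p == nbr + 2 then oo i 0 else
  nd (lve i).-1 b.+1 (p - (nbr + 3)) 0.
Proof.
move=> hi hb; have [k _] := @kd_exE n c i b 0 hi hb.
rewrite /lft /Layout.lfc k /= /nd /tt /oo /nd /Layout.vn.
by do ![case: ifP => _ //]; rewrite addn0.
Qed.

(** The pebbler plays position [nbr], then [oo i v], [xx i (~~ v)] and [tt i]. Whenever the
    challenger follows, the part that he enters has at most about 8, 2, 2 or 1 units of plain
    leaves, and [usz + 3], [usz + 2], [usz + 1] or [usz] rounds are left; if he always stays, only
    one unit of next towers remains. *)
Lemma ub_ex i b l (D : VS) (v : bool) h : i < n -> b < 2 ->
  inrg (lve i) b.+1 l 0 -> live (lve i) b.+1 l -> H (lve i).-1 <= h ->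
  (forall p (D' : VS), p < nsml -> D \subset D' -> oo i v \in D' -> xx i (~~ v) \in D' -> tt i \in D' ->
     Abs h D' (nd (lve i).-1 b.+1 p 0)) ->
  Abs (h + rnd) D (nd (lve i) b.+1 l 0).
Proof.
move=> hi hb hr lv hh hz; have [n1 n2 n3 n4 n5] := nbrP n c; have ub := unt_big n c.
have [l0 l1 _ _ _] := lveP c hi; have [k g] := @kd_exE n c i b l hi hb; have {}g := g lv.
have h1 : 1 <= h by apply: leq_trans hh; rewrite /H.
have bv (w : bool) : w < 2 by case: w.
have k2 : 2 < kd (lve i) b.+1 by rewrite k.
move=> D' x s hv; rewrite /Layout.rnd; set u0 := nd (lve i) b.+1 l nbr.
have cc a (A B : VS) t : a <= h + usz -> Abs a A t -> A \subset B -> Abs (h + usz) B t.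
  by move=> le /(Abs_leq le) ha sb; apply: AbsW ha.
rewrite (_ : h + (usz + 4) = (h + (usz + 3)).+1); last by lia.
apply: (@winS _ _ u0).
  have A : Abs (h + (usz + 3)) (u0 |: D') (nd (lve i) b.+1 l 0); last first.
    by apply: A (subxx _) _; rewrite (subset_trans hv) // setUS // subsetUr.
  apply: (seg_abs (p0 := nbr)) => //.
  - by rewrite g; lia.
  - by rewrite setU11 orbT.
  - move=> p /andP[_ hp]; rewrite lft_ex // hp; apply: Abs_leq hh _.
    by apply: plain_abs; [lia | move: hp; rewrite /Layout.nbr; lia].
  - by rewrite subn0 usz_pow /Layout.nbr; lia.
set D1 := u0 |: D'; have sD1 : D \subset D1 by apply: subset_trans s (subsetUr _ _).
rewrite (_ : h + (usz + 3) = (h + (usz + 2)).+1); last by lia.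
have lx w : H (lve i).-1 + (usz + w) <= h + (usz + w) by lia.
apply: (@winS _ _ (oo i v)); last first.
  (* Challenged at [oo i v], the pebbler answers with [xx i v]: staying then costs only the middle
     item, following a binary search in the literal chain. *)
  rewrite (_ : h + (usz + 2) = (h + (usz + 1)).+1); last by lia.
  apply: (@winS _ _ (xx i v)).
    apply: oo_win => //; first by rewrite setU11.
    by apply: (Abs_leq _ (@tt_abs i _ hi)); lia.
  apply: win_leq (lx 1) _.
  have hf : 2 < 3 + v < 6 by have := bv v; lia.
  have f5 : (3 + v == 5) = false by apply/eqP; have := bv v; lia.
  have g' := gl_item c hi hf; rewrite f5 in g'; have k' := item_kd hi hf; rewrite f5 in k'.
  apply: (seg_win (p0 := (nlit + 1))); rewrite ?g' ?eqxx //.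
  - by apply: inrg_item => //; lia.
  - by rewrite k'.
  - by rewrite leqnn andbT; lia.
  - move=> p hp; rewrite /lft /Layout.lfc k' /= ifF; last by lia.
    rewrite -[_ * wid]addn0; apply: plain_abs; first by lia.
    by move: hp; rewrite addKn /Layout.nlit /Layout.nbr; have := bv v; case: (v : nat) => [|[|]] // _; lia.
  - by rewrite usz_pow /Layout.nlit; lia.
set D2 := oo i v |: D1.
rewrite (_ : h + (usz + 2) = (h + (usz + 1)).+1); last by lia.
apply: (@winS _ _ (xx i (~~ v))); last first.
  apply: win_leq (lx 1) _.
  have hf : 2 < 3 + ~~ v < 6 by have := bv (~~ v); lia.
  have f5 : (3 + ~~ v == 5) = false by apply/eqP; have := bv (~~ v); lia.
  have g' := gl_item c hi hf; rewrite f5 in g'; have k' := item_kd hi hf; rewrite f5 in k'.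
  apply: (seg_win (p0 := (nlit + 1))); rewrite ?g' ?eqxx //.
  - by apply: inrg_item => //; lia.
  - by rewrite k'.
  - by rewrite leqnn andbT; lia.
  - move=> p hp; rewrite /lft /Layout.lfc k' /= ifF; last by lia.
    rewrite -[_ * wid]addn0; apply: plain_abs; first by lia.
    by move: hp; rewrite addKn /Layout.nlit /Layout.nbr; have := bv (~~ v); case: (~~ v : nat) => [|[|]] // _; lia.
  - by rewrite usz_pow /Layout.nlit; lia.
set D3 := xx i (~~ v) |: D2.
rewrite (_ : h + (usz + 1) = (h + usz).+1); last by lia.
apply: (@winS _ _ (tt i)); last first.
  have g' := gl_item c hi (f := 5) isT; have k' := item_kd hi (f := 5) isT.
  apply: (@win_leq _ _ (H (lve i).-1 + usz)); first by lia.
  apply: (seg_win (p0 := nsml)); rewrite ?g' ?k' ?eqxx ?n1 ?leqnn //.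
  - by apply: inrg_item.
  - move=> p hp; rewrite /lft /Layout.lfc k' /=.
    rewrite -[_ * wid]addn0; apply: plain_abs; first by lia.
    by move: hp; rewrite /Layout.nsml /Layout.nbr; lia.
  - by rewrite pow_unt /Layout.nsml; lia.
set D4 := tt i |: D3.
have m1 : oo i v \in D4 by rewrite !inE eqxx !orbT.
have m2 : xx i (~~ v) \in D4 by rewrite !inE eqxx !orbT.
have m3 : tt i \in D4 by rewrite setU11.
have sD4 : D \subset D4.
  by apply: subset_trans sD1 _; rewrite /D4 /D3 /D2; do 3 apply: subset_trans (subsetUr _ _).
(* Both literal tops are cheap leaves by now: the chosen one is pebbled, and the other has both
   predecessors pebbled. *)
have fr w : w < 2 -> Abs h D4 (oo i w).
  move=> hw; have [e|ne] := eqVneq w (v : nat); first by apply: Abs_in; rewrite e.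
  have e : w = ~~ v by move: ne hw {hz m1 m2 D2 D3 D4 m3 sD4}; case: v; case: w => [|[|]].
  apply: Abs_leq h1 _; apply: Abs_win => D'' s''; apply: oo_win => //.
    by rewrite e (subsetP s'').
  by apply: Abs_in; rewrite (subsetP s'').
apply: (seg_win (p0 := (nbr + 3 + nsml))); rewrite ?g ?eqxx //.
- by rewrite leqnn andbT; lia.
- move=> p hp; rewrite lft_ex // ifF; last by lia.
  case: eqP => [_|p1]; first exact: Abs_in.
  case: eqP => [_|p2]; first exact: fr.
  case: eqP => [_|p3]; first exact: fr.
  by apply: hz => //; lia.
- by rewrite pow_unt /Layout.nsml; lia.
Qed.

(** Every chain is a binary search over leaves whose value is known from the level below. In a fork
    all leaves inherit truth; in a choice chain the value that makes the next tower true is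
    taken. *)
Theorem ub_main lam f l r (D : VS) (c0 : bool) : inrg lam f l 0 -> lam <= lmax -> live lam f l ->
  ~~ (2 < f < 6) -> ubc lam f r D -> c0 || tr lam f r -> Abs (H lam + c0) D (nd lam f l 0).
Proof.
have [n1 n2 n3 n4 n5] := nbrP n c; have w0 := wid_gt0 n c.
elim: lam f l r D => [|lam IH] f l r D hr hl lv hf hu ht.
  have [f5|f5] := ltnP 5 f.
    have [t ft] : exists t, f = 6 + t by exists (f - 6); lia.
    move: hr lv hu ht; rewrite ft => hr lv hu ht.
    apply: (@ub_bottom2 t l r) => //; first by move: hu; rewrite /ubc -[_ == 0]/false -[5 < _]/true addKn.
    by case/orP: ht => [->//|]; rewrite /= addKn => ->; rewrite orbT.
  have f1 : f < 2.
    have : isnode 0 f := live_node lv hl hf; case: f hf f5 {hr lv hu ht} => [|[|[|[|[|[|f]]]]]] //= _ _; by rewrite /isnode /Layout.kd /Layout.isvar ltn0.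
  by apply: ub_bottom1 => //; rewrite /H; lia.
have nd_ := live_node lv hl hf; have [hl' hfa hc _] := and4P hr.
have k35 : kd lam.+1 f = 3 \/ kd lam.+1 f = 5.
  move: nd_; rewrite /isnode !inE => /or4P[]/eqP h; [| |by left|by right];
  by exfalso; move: h; rewrite /Layout.kd; do ![case: ifP => _ //].
rewrite (@H_pred lam.+1) // -/(lam.+1.-1) -addnA [rnd + c0]addnC addnA [lam.+1.-1]/=.
case: k35 => k.
  have g := kd_brE lv k.
  apply: (seg_abs (p0 := 2 * nbr)); rewrite ?g ?eqxx ?k //.
  - lia.
  - move=> p /= hp; rewrite /lft kd_br_lfc // -[_ * wid]addn0.
    have [a1 a2 a3 a4] := live_br hfa hl' lv k hp.
    apply: (IH (brf lam.+1 f p) p r D) => //.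
    + by rewrite /Layout.inrg a2 w0 andbT /=; apply/andP; split; lia.
    + exact: brf_fam.
    + by apply: (@ubc_br lam.+1 f p r D) => //; rewrite /Layout.inrg hl' hfa w0.
    + by case/orP: ht => [->//|ht]; rewrite (tr_br (lam := lam.+1)) ?orbT.
  - by rewrite rnd_pow subn0.
have [i [b [hi hb fb lb]]] := kd_ex k hl'.
have el : lam = (lve i).-1 by rewrite -lb.
have [v hv] : exists v : bool, c0 || tr lam f (upd r i v).
  case/orP: ht => [->|]; first by exists true.
  by rewrite lb fb tr_ex // -lb -fb [_.-1]/= => /orP[] h; [exists false | exists true]; rewrite h orbT.
rewrite lb fb in hr lv hu *; rewrite fb in hv; rewrite el in hv *; apply: (@ub_ex i b l D v); rewrite ?leq_addr //.
move=> p D' hp s h1 h2 h3.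
have lz := @live_next n c i b p hi hb hp; have [i0 i1 _ _ _] := lveP c hi.
have el' : (lve i).-1.+1 = lam.+1 by rewrite -el.
rewrite -el; apply: (IH b.+1 p (upd r i v) D'); rewrite ?el //.
- by rewrite /Layout.inrg w0 -fb hfa; lia.
- by lia.
- by lia.
- by apply: (@ubc_upd (lve i) b.+1 r D' i b) => //; apply: ubcW hu.
Qed.

Arguments win : simpl never.

(** The path [g] climbs from the sources up to the given dead vertex. One round per step suffices,
    since the only other predecessor of a dead vertex is one of the sources. *)
Lemma dead_path r lam f l p : inrg lam f l p -> gl lam f l <= p -> rank (vn lam f l p) <= r ->
  exists N (g : nat -> V), [/\ 0 < N <= r.+1, g N = nd lam f l p &
    forall (D : VS) k, k < N -> (k == 0) || (g k \in D) -> win ed 1 D (g k.+1)].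
Proof.
elim: r lam f l p => [|r IH] lam f l p hr hp; first by rewrite rank_dead.
move=> hrk; have vr := vn_ord hr.
have step (D : VS) u : u < ord_dag -> pr1 (vn lam f l p) = u -> ov u \in D -> win ed 1 D (nd lam f l p).
  move=> hu e uD; have : pr2 (vn lam f l p) = ord_dag \/ exists2 j, j < 3 & pr2 (vn lam f l p) = ord_real + j.
    rewrite pr2_dead //; case: ifP => _; first by right; exists 1.
    by case: ifP => _; [right; exists 2 | left].
  case=> [e2|[j hj e2]].
    by apply/win0/pred_sub; rewrite ?e ?e2 ?ltnn.
  apply: (@winS _ _ (ov (ord_real + j))).
    by apply/win0/pred_sub; rewrite ?e ?e2 // => _; rewrite !inE ?eqxx ?uD ?orbT.
  by apply/win0/no_pred; [exact: lt_dummy | rewrite /Layout.pr1 leq_addr | rewrite /Layout.pr2 leq_addr].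
have ext lam' f' l' p' : inrg lam' f' l' p' -> gl lam' f' l' <= p' ->
    pr1 (vn lam f l p) = vn lam' f' l' p' -> exists N (g : nat -> V), [/\ 0 < N <= r.+2, g N = nd lam f l p &
    forall (D : VS) k, k < N -> (k == 0) || (g k \in D) -> win ed 1 D (g k.+1)].
  move=> hr' hp' e; have lt : rank (vn lam' f' l' p') < rank (vn lam f l p).
    by apply: (@pr_rank n c q lf); [exact: vn_ord | left | exact: vn_ord].
  have [|N [g [hN gN hg]]] := IH _ _ _ _ hr' hp'; first by lia.
  exists N.+1, (fun k => if k == N.+1 then nd lam f l p else g k); rewrite eqxx; split=> //; first by lia.
  move=> D k hk; rewrite eqSS; have -> : (k == N.+1) = false by lia.
  have [->|ne] := eqVneq k N.
    rewrite gN (_ : (N == 0) = false) /=; last by lia.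
    by move=> h; apply: (step _ (vn lam' f' l' p')) => //; exact: vn_ord.
  by apply: hg; lia.
have [[h1 h2]|[[h1 [h2 h3]]|[h1 [lam' [f' [l' [h2 h3 h4]]]]]]] := pr_dead q lf hr hp.
- by apply: (ext lam f l p.+1) => //; [apply: inrg_pos hr h1 | lia].
- exists 2, (fun k => if k == 2 then nd lam f l p else ov ord_real); split=> //.
  move=> D [|[|k]] // _ /=.
    move=> _; apply: win0; apply: no_pred; first by rewrite -[ord_real]addn0; exact: lt_dummy.
      by rewrite /Layout.pr1 leqnn.
    by rewrite /Layout.pr2 leqnn.
  by move=> h; apply: step h3 h; rewrite -[ord_real]addn0; exact: lt_dummy.
- have hg := gl_le n c lam' f' l'.
  by apply: ext h4; [apply: inrg_pos h2 _; lia | exact: leqnn].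
Qed.

(** There are at most [unt * unt * wid * wid] vertices in chains, so a binary search along the dead
    path fits into the rounds of four levels. *)
Lemma ord_real_pow : ord_real.+1 < 2 ^ (4 * rnd).
Proof.
have ub := unt_big n c; have hl := lmax_lt_unt n c; have hf := fams_lmax n c.
rewrite mulnC expnM rnd_pow /Layout.ord_real /Layout.chains.
have e1 : lmax.+2 <= unt.
  apply: leq_trans ub; have : lmax.+1 <= rnd * lmax.+1 by rewrite leq_pmull // /Layout.rnd addn4.
  lia.
have e2 : lmax.+2 * fams <= unt * unt by apply: leq_mul => //; apply: leq_trans e1.
have e3 : lmax.+2 * fams * wid * wid <= unt * unt * wid * wid by rewrite !leq_mul2r e2 !orbT.
have e4 : wid ^ 4 = 256 * (unt * unt * wid * wid) by rewrite /Layout.wid; ring.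
have e5 : 0 < unt * unt * wid * wid by have := wid_gt0 n c; rewrite !muln_gt0; lia.
lia.
Qed.

Definition root_true := tr lmax 1 (fun _ => false).

Lemma root_win (c0 : bool) : c0 || root_true -> win ed (H lmax.+1 + c0) set0 (ov root).
Proof.
move=> ht; have [n1 n2 n3 n4 n5] := nbrP n c; have w0 := wid_gt0 n c.
have [k4 g4] := kd_rootE n c; have hrr := root_range n c; have f0 := fams_gt0 n c.
rewrite (@H_pred lmax.+1) // [lmax.+1.-1]/= -addnA [rnd + c0]addnC addnA.
apply: (seg_win (p0 := 2 * nbr + 1)); rewrite ?g4 ?k4 ?eqxx //.
- lia.
- move=> p hp; rewrite /lft lfc_rootE; case: eqP => [_|p0].
    (* The first leaf of the root is the top of the dead path. It costs [4 * rnd + 2] rounds, which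
       is within [H lmax] because [lmax] is at least 4. *)
    have [lam [f [l [e1 e2 e3]]]] := root_dead n c.
    have g0 : gl lam f l = 0 by rewrite /Layout.gl (negPf e3).
    have hr := rank_dead_le e2 (eq_leq g0).
    have [N [g [hN gN hg]]] := dead_path e2 (eq_leq g0) hr.
    have l4 : 4 <= lmax by rewrite /Layout.lmax; lia.
    have le : (1 + 4 * rnd).+1 <= H lmax + c0.
      have : rnd * 4 <= rnd * lmax by rewrite leq_mul2l l4 orbT.
      by rewrite /H; lia.
    rewrite e1 -[_ * wid]addn0 -/(vn lam f l 0) -/(nd lam f l 0) -gN.
    apply: Abs_leq le _; apply: Abs_win => D' _.
    apply: (@chain_search _ ed g N 1 (4 * rnd) D' 0 N) => //; first by move=> D'' k _; apply: hg.
      by lia.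
    by rewrite subn0; have := ord_real_pow; lia.
  rewrite -[_ * wid]addn0; case: ltnP => hp1.
    have hr0 : inrg lmax 0 p.-1 0 by rewrite /Layout.inrg f0 w0; lia.
    apply: (ub_main (r := fun _ => false)) => //; last by case: (lmax) => //=; rewrite orbT.
    by rewrite /Layout.live /= eqxx hp1 orbT.
  have hr0 : inrg lmax 1 p.-1 0 by rewrite /Layout.inrg w0 /Layout.fams; lia.
  apply: (ub_main (r := fun _ => false)) => //.
    by rewrite -[lmax]/(lmax.+1.-1) live_top; lia.
  by move=> i hi; rewrite /Layout.lve; lia.
- by rewrite rnd_pow subn0; lia.
Qed.

Lemma price_ub (c0 : bool) : c0 || root_true -> rev_price (pdag n c q lf) <= (H lmax.+1 + c0).+1.
Proof.
move=> /root_win h; rewrite rev_price_le /=.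
by rewrite (_ : Ordinal _ = ov root) //; apply: val_inj; rewrite /= ovK // root_lt.
Qed.
End GraphB.

End UpperBound.

(** * Strategies of the challenger *)

Module LowerBound.
Import Game Reaching Layout Dag UpperBound Lib.

Arguments UpperBound.nd : simpl never. Arguments UpperBound.lft : simpl never. Arguments UpperBound.oo : simpl never.
Arguments UpperBound.xx : simpl never. Arguments UpperBound.tt : simpl never. Arguments UpperBound.sl : simpl never.
Arguments UpperBound.H : simpl never.
Arguments win : simpl never.

Section Small.
Variables (V : finType) (e : rel V) (E0 : seq (nat * nat)) (m : nat) (phi : nat -> V).

Definition prd v := [seq p.1 | p <- E0 & p.2 == v].
(** A computable game on a small graph with edge list [E0], in which the pebbler may also pass; it
    settles the bottom gadgets by evaluation. *)
Fixpoint wl k (d : seq nat) v : bool := all (fun u => u \in d) (prd v) ||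
  (if k is k'.+1 then wl k' d v || has (fun u => wl k' (u :: d) v && wl k' (u :: d) u) (iota 0 m)
   else false).

Hypothesis E0P : forall i j, (i, j) \in E0 -> i < m /\ e (phi i) (phi j).

Hypothesis phi_inj : forall i j, i < m -> j < m -> phi i = phi j -> i = j.

(** Moves outside the image of [phi] become passes, and edges missing from [E0] only help the
    pebbler, so a win in the large graph is inherited by the small one. *)
Lemma wlP k (D : {set V}) d v : (forall j, j < m -> phi j \in D -> j \in d) ->
  win e k D (phi v) -> wl k d v.
Proof.
elim: k D d v => [|k IH] D d v hd /winP[/subsetP sub|[k' [u [ek w1 w2]]]] //.
- rewrite /= orbF; apply/allP => u /mapP[[a b]]; rewrite mem_filter /= => /andP[/eqP-> h] ->.
  by have [h1 h2] := E0P h; apply: hd => //; apply: sub; rewrite inE.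
- rewrite /=; apply/orP; left; apply/allP => u /mapP[[a b]]; rewrite mem_filter /= => /andP[/eqP-> h] ->.
  by have [h1 h2] := E0P h; apply: hd => //; apply: sub; rewrite inE.
case: ek w1 w2 => <- w1 w2 /=; apply/orP; right.
have [[j hj uj]|no] := EM (exists2 j, j < m & u = phi j).
  apply/orP; right; apply/hasP; exists j; first by rewrite mem_iota.
  have hd2 i : i < m -> phi i \in u |: D -> i \in j :: d.
    rewrite in_setU1 uj inE => hi /orP[/eqP/phi_inj->//|h]; first by rewrite eqxx.
    by rewrite hd ?orbT.
  by rewrite (IH _ _ _ hd2 w1) (IH _ _ j hd2) // -uj.
apply/orP; left; apply: IH w1 => i hi; rewrite in_setU1 => /orP[/eqP ee|]; last exact: hd.
by case: no; exists i.
Qed.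
End Small.

Section GraphB.
Variables (n c : nat) (q : nat -> bool) (lf : nat -> nat -> nat).
Notation lmax := (lmax n c). Notation usz := (usz n c). Notation unt := (unt n c). Notation rnd := (rnd n c).
Notation wid := (wid n c). Notation fams := (fams n c). Notation chains := (chains n c).
Notation ord_real := (ord_real n c). Notation ord_dag := (ord_dag n c). Notation nbr := (nbr n c).
Notation nlit := (nlit n c). Notation nsml := (nsml n c). Notation cn := (cn n c). Notation vn := (vn n c).
Notation kd := (kd n c). Notation brf := (brf n c). Notation lfc := (lfc n c). Notation live := (live n c).
Notation gl := (gl n c). Notation lcode := (lcode n q lf). Notation lve := (lve n c).
Notation slotv := (slotv n c q lf). Notation pr1 := (pr1 n c q lf). Notation pr2 := (pr2 n c q lf).
Notation root := (Layout.root n c). Notation inrg := (inrg n c). Notation inrg_pos := (@inrg_pos n c).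
Notation br0 := (Layout.br0 n c). Notation br1 := (Layout.br1 n c). Notation ov := (ov n c).
Notation ed := (@ed n c q lf). Notation V := 'I_ord_dag. Notation VS := {set 'I_ord_dag}. Notation nd := (nd n c).
Notation lft := (lft n c). Notation oo := (oo n c). Notation sl := (sl n c q lf). Notation H := (H n c).
Notation tst := (tst n q lf). Notation tr := (tr n c q lf). 
(** One less than [H lam]: too few rounds even for a true tower. *)
Definition hh lam := 2 + rnd * lam.
(** A bound, kept throughout the game, on the pebbles placed plus the rounds left. *)
Definition RR := H lmax.+1 + 1.

Lemma HhE lam : H lam = (hh lam).+1. Proof. by []. Qed.
Lemma hh_pred lam : 0 < lam -> hh lam = hh lam.-1 + rnd.
Proof. by case: lam => // lam _; rewrite /hh /= mulnS; lia. Qed.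

Definition ch x : VS := [set v : V | v %/ wid == x].
Definition topc x : V := ov (x * wid).
Definition tops (Fs : seq nat) : VS := [set v : V | (v %% wid == 0) && (v %/ wid \in Fs)].
Definition locs (Ls : seq nat) : VS := [set v : V | v %/ wid \in Ls].
Definition Pc (y : V) : VS := ch (y %/ wid).

Lemma topc_lt x : x < chains -> x * wid < ord_dag.
Proof. by move=> h; have := wid_gt0 n c; rewrite /Layout.ord_dag /Layout.ord_real; nia. Qed.

Lemma topcE x : x < chains -> (topc x : nat) = x * wid.
Proof. by move=> h; rewrite ovK // topc_lt. Qed.

Lemma topc_div x : x < chains -> topc x %/ wid = x.
Proof. by move=> h; rewrite topcE // mulnK ?wid_gt0. Qed.

Lemma topc_divK (y : V) : y %% wid = 0 -> y %/ wid < chains -> topc (y %/ wid) = y.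
Proof. by move=> m h; apply: val_inj; rewrite /= topcE //; have := divn_eq y wid; rewrite m addn0. Qed.

Lemma topc_ch x : x < chains -> topc x \in ch x.
Proof. by move=> h; rewrite inE topc_div. Qed.

Lemma Pc_self y : y \in Pc y. Proof. by rewrite inE. Qed.

Lemma ndE lam f l p : inrg lam f l p -> (nd lam f l p : nat) = vn lam f l p.
Proof. by move=> h; rewrite ovK // vn_ord. Qed.

Lemma nd_div lam f l p : inrg lam f l p -> nd lam f l p %/ wid = cn lam f l.
Proof. by move=> h; rewrite ndE // vn_div //; case/and4P: h. Qed.

Lemma nd_mod lam f l p : inrg lam f l p -> nd lam f l p %% wid = p.
Proof. by move=> h; rewrite ndE // /Layout.vn modnMDl modn_small //; case/and4P: h. Qed.

Lemma nd0_topc lam f l : nd lam f l 0 = topc (cn lam f l).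
Proof. by rewrite /UpperBound.nd /Layout.vn addn0. Qed.

Lemma lft_topc lam f p : lft lam f p = topc (lfc lam f p). Proof. by []. Qed.

Lemma nd_inj lam f l p p' : inrg lam f l p -> inrg lam f l p' -> nd lam f l p = nd lam f l p' -> p = p'.
Proof. by move=> h h' e; rewrite -(nd_mod h) -(nd_mod h') e. Qed.

Section Wrap.
Variables (Ls Fs : seq nat).
Hypothesis LF : forall x, x \in Fs -> x \notin Ls.

Lemma P_outc y x : y \in tops Fs -> x \in Pc y -> x \notin locs Ls.
Proof. by rewrite !inE => /andP[_ h] /eqP->; apply: LF. Qed.

Lemma P_uniqc y y' x : y \in tops Fs -> y' \in tops Fs -> x \in Pc y -> x \in Pc y' -> y = y'.
Proof.
rewrite !inE => /andP[/eqP m1 _] /andP[/eqP m2 _] /eqP-> /eqP e; apply: val_inj => /=.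
by rewrite (divn_eq y wid) (divn_eq y' wid) m1 m2 e.
Qed.

Definition rbl (D : VS) v (Bs : seq nat) :=
  forall x, x \in Bs -> [disjoint ch x & D] -> reach ed (locs Ls) D v (topc x).

Lemma card_tops (Bs : seq nat) : uniq Bs -> (forall x, x \in Bs -> x < chains) -> #|tops Bs| = size Bs.
Proof.
move=> u h; rewrite -(size_map topc) -(card_uniqP _); last first.
  rewrite map_inj_in_uniq // => x y hx hy e.
  by rewrite -(topc_div (h x hx)) e topc_div // h.
apply: eq_card => v; rewrite inE; apply/andP/mapP => [[/eqP m hv]|[x hx ->]].
  exists (v %/ wid) => //; apply: val_inj; rewrite /= topcE ?h //.
  by rewrite {1}(divn_eq v wid) m addn0.
by rewrite topc_div ?h // topcE ?h // modnMl.
Qed.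

Lemma rbl_rb D v Bs : (forall x, x \in Bs -> x < chains) -> rbl D v Bs ->
  rb ed (locs Ls) Pc D v (tops Bs).
Proof.
move=> hB h y; rewrite inE => /andP[/eqP m hy] dj.
have -> : y = topc (y %/ wid).
  by apply: val_inj; rewrite /= topcE ?hB // {1}(divn_eq y wid) m addn0.
exact: h.
Qed.

Lemma tops_sub Bs : {subset Bs <= Fs} -> tops Bs \subset tops Fs.
Proof. by move=> h; apply/subsetP => v; rewrite !inE => /andP[-> /h]. Qed.

Lemma cnt h qq (D : VS) v Bs :
  (forall (D' : VS) x z, x \in Fs -> [disjoint ch x & D'] -> ed (topc x) z -> #|D'| + h <= RR -> ~~ win ed h D' z) ->
  (forall x, x \in Fs -> x < chains) ->
  v \notin tops Fs -> #|D| + (h + qq) <= RR -> win ed (h + qq) D v -> {subset Bs <= Fs} -> uniq Bs ->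
  rbl D v Bs -> 2 * size Bs <= 2 ^ qq + 2 * RR.
Proof.
move=> hard hF vF hD w sB uB hr; have hB x : x \in Bs -> x < chains by move/sB; apply: hF.
rewrite -(card_tops uB hB).
apply: (@count_bound _ ed (locs Ls) (tops Fs) Pc _ _ _ RR h _ qq D v) => //.
- by move=> *; apply: Pc_self.
- exact: P_outc.
- exact: P_uniqc.
- move=> D' x y; rewrite inE => /andP[/eqP m hy] dj eyx; have hy' := hF _ hy; apply: hard hy dj _.
  by rewrite topc_divK.
- exact: tops_sub.
- exact: rbl_rb.
Qed.

Lemma cnt_good (bad : pred V) h qq (D : VS) v Bs :
  (forall (D' : VS) x z, x \in Fs -> [disjoint ch x & D'] -> ed (topc x) z -> #|D'| + h <= RR -> ~~ win ed h D' z) ->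
  (forall u, bad u -> u %/ wid \notin Ls /\ u %/ wid \notin Fs) ->
  (forall (D' : VS) x z, (forall u, u \in D' -> ~~ bad u) -> x \in Fs -> [disjoint ch x & D'] -> ed (topc x) z ->
     #|D'| + h.+1 <= RR -> ~~ win ed h.+1 D' z) ->
  (forall x, x \in Fs -> x < chains) -> (forall u, u \in D -> ~~ bad u) ->
  v \notin tops Fs -> #|D| + (h.+1 + qq) <= RR -> win ed (h.+1 + qq) D v -> {subset Bs <= Fs} -> uniq Bs ->
  rbl D v Bs -> 2 * size Bs <= 2 ^ qq + 2 * RR.
Proof.
move=> hard0 hbad hard hF gD vF hD w sB uB hr; have hB x : x \in Bs -> x < chains by move/sB; apply: hF.
rewrite -(card_tops uB hB).
apply: (@count_good_bound _ ed (locs Ls) (tops Fs) Pc _ _ _ RR h _ (fun D' => forall u, u \in D' -> ~~ bad u) _ _ qq D v) => //.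
- by move=> *; apply: Pc_self.
- exact: P_outc.
- exact: P_uniqc.
- move=> D' x y; rewrite inE => /andP[/eqP m hy] dj eyx; have hy' := hF _ hy; apply: hard0 hy dj _.
  by rewrite topc_divK.
- move=> D' x y g; rewrite inE => /andP[/eqP m hy] dj eyx; have hy' := hF _ hy; apply: hard hy dj _ => //.
  by rewrite topc_divK.
- move=> D' u g ng; have bu : bad u.
    apply: contrapT => nb; apply: ng => w'; rewrite !inE => /orP[/eqP->|]; last exact: g.
    by apply/negP.
  have [b1 b2] := hbad u bu; split; first by rewrite inE.
  move=> y; rewrite !inE => /andP[_ hy]; apply/negP => /eqP e.
  by rewrite e hy in b2.
- exact: tops_sub.
- exact: rbl_rb.
Qed.

Lemma reach_pos lam f l a b (D : VS) : cn lam f l \in Ls -> inrg lam f l 0 -> 2 < kd lam f ->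
  a <= b -> b < gl lam f l -> (forall p, a < p <= b -> nd lam f l p \notin D) ->
  reach ed (locs Ls) D (nd lam f l a) (nd lam f l b).
Proof.
move=> hL hr k2; elim: b => [|b IH]; first by rewrite leqn0 => /eqP-> _ _; apply: connect0.
rewrite leq_eqVlt => /orP[/eqP-> _ _|hab hb hD]; first exact: connect0.
apply: connect_trans (IH hab (ltnW hb) _) _ => [p hp|]; first by apply: hD; lia.
have hg := gl_le n c lam f l; have rb' : inrg lam f l b by apply: inrg_pos hr _; lia.
have rb1 : inrg lam f l b.+1 by apply: inrg_pos hr _; lia.
have k2' : (kd lam f <= 2) = false by rewrite leqNgt k2.
apply: connect1; apply/and3P; split; last by rewrite inE nd_div.
  by rewrite /Dag.ed !ndE // /Layout.edge pr_real ?(ltnW hb) // k2' hb eqxx.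
by apply: hD; rewrite hab leqnn.
Qed.

Lemma reach_lft lam f l p (D : VS) : cn lam f l \in Ls -> inrg lam f l 0 -> 2 < kd lam f ->
  p < gl lam f l -> lfc lam f p < chains -> lft lam f p \notin D ->
  reach ed (locs Ls) D (nd lam f l p) (lft lam f p).
Proof.
move=> hL hr k2 hp hc hD; have hg := gl_le n c lam f l.
have rp : inrg lam f l p by apply: inrg_pos hr _; lia.
have k2' : (kd lam f <= 2) = false by rewrite leqNgt k2.
apply: connect1; apply/and3P; split => //; last by rewrite inE nd_div.
by rewrite /Dag.ed lft_topc topcE // ndE // /Layout.edge !pr_real // k2' eqxx orbT.
Qed.

Lemma clean_top x (D : VS) : x < chains -> [disjoint ch x & D] -> topc x \notin D.
Proof. by move=> h /disjointFr->//; rewrite topc_ch. Qed.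

Lemma rbl_seg lam f l a m (D : VS) v : cn lam f l \in Ls -> inrg lam f l 0 -> 2 < kd lam f ->
  a + m <= gl lam f l -> (forall p, p < gl lam f l -> lfc lam f p < chains) ->
  (0 < m -> reach ed (locs Ls) D v (nd lam f l a)) ->
  (forall p, a < p < a + m -> nd lam f l p \notin D) ->
  rbl D v [seq lfc lam f p | p <- iota a m].
Proof.
move=> hL hr k2 hm hc hv hD x /mapP[p]; rewrite mem_iota => /andP[h1 h2] -> dj.
have m0 : 0 < m by lia.
have hp : p < gl lam f l by lia.
apply: connect_trans (hv m0) _; apply: connect_trans (reach_pos hL hr k2 h1 hp _) _.
  by move=> p' h'; apply: hD; lia.
by apply: reach_lft => //; [apply: hc | apply: clean_top => //; apply: hc].
Qed.

Lemma rbl_cat D v B1 B2 : rbl D v B1 -> rbl D v B2 -> rbl D v (B1 ++ B2).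
Proof. by move=> h1 h2 x; rewrite mem_cat => /orP[]; [apply: h1 | apply: h2]. Qed.
End Wrap.

Arguments hh : simpl never. Arguments RR : simpl never.

Definition items i := [:: cn (lve i) 3 0; cn (lve i) 4 0; cn (lve i) 5 0].
(** The pebbles that could falsify the account of the values in [r]: the sources, the items of
    variables whose choice lies at level [mu] or below, and the tops of the literals false under
    [r]. Without them a test that fails under [r] has no pebbled slot ([sl_bad]). *)
Definition bad mu (r : nat -> bool) (v : V) : bool := [|| ord_real <= v,
  [exists i : 'I_n, (lve i <= mu) && (v %/ wid \in items i)] | [exists i : 'I_n, v == oo i (~~ r i)]].

Lemma bad_item mu r v : bad mu r v -> ord_real <= v \/ exists2 i, i < n & v %/ wid \in items i.
Proof.
case/or3P => [h|/existsP[i /andP[_ h]]|/existsP[i /eqP->]]; [by left | by right; exists i |].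
right; exists i => //; have hb : ~~ r i < 2 by case: (r i).
rewrite /UpperBound.oo nd_div; last by apply: inrg_item => //; lia.
by case: (r i); rewrite !inE eqxx ?orbT.
Qed.

Lemma div_real (v : V) : v %/ wid < chains -> v < ord_real.
Proof. by rewrite ltn_divLR ?wid_gt0. Qed.

(** Bad vertices lie in no fork, choice or bottom chain, so the move that places one is a lost round
    in the sense of [count_good]. *)
Lemma bad_node mu r v lam f l : inrg lam f l 0 -> ~~ (2 < f < 6) -> bad mu r v -> v %/ wid != cn lam f l.
Proof.
move=> hr hf /bad_item hb; apply/eqP => e; have [hl hfa hc _] := and4P hr.
have hx := cn_lt hl hfa hc; case: hb => [h|[i hi]]; first by have := div_real (v := v); rewrite e hx => /(_ isT); lia.
rewrite e !inE => h; have ii f' : f' < 6 -> inrg (lve i) f' 0 0 by apply: inrg_item.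
by case/or3P: h => /eqP e2;
  [have [_ ef _] := cn_inj hr (ii 3 isT) e2 | have [_ ef _] := cn_inj hr (ii 4 isT) e2
  |have [_ ef _] := cn_inj hr (ii 5 isT) e2]; rewrite ef in hf.
Qed.

Lemma bad_mono mu mu' r v : mu <= mu' -> bad mu r v -> bad mu' r v.
Proof.
move=> le /or3P[h|/existsP[i /andP[h1 h2]]|h]; apply/or3P; [by apply: Or31 | | by apply: Or33].
by apply: Or32; apply/existsP; exists i; rewrite h2 (leq_trans h1 le).
Qed.

Definition okn lam f l := [&& inrg lam f l 0, lam <= lmax, live lam f l & ~~ (2 < f < 6)].
(** The pebbles of [D] may lie anywhere outside the chain itself: those further down spoil too few
    of its leaves to matter. This bound holds for true and false towers alike. *)
Definition rob lam := forall f l (D : VS) x, okn lam f l -> [disjoint ch (cn lam f l) & D] ->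
  ed (topc (cn lam f l)) x -> #|D| + hh lam <= RR -> ~~ win ed (hh lam) D x.
(** The bound for false towers, one round better than [rob] and valid only in the absence of bad
    pebbles. *)
Definition cond lam := forall f l r (D : VS) x, okn lam f l -> [disjoint ch (cn lam f l) & D] ->
  (forall u, u \in D -> ~~ bad lam r u) -> tr lam f r = false ->
  ed (topc (cn lam f l)) x -> #|D| + (hh lam).+1 <= RR -> ~~ win ed (hh lam).+1 D x.

Lemma okn_lt lam f l : okn lam f l -> cn lam f l < chains.
Proof. by case/and4P => /and4P[h1 h2 h3 _] _ _ _; apply: cn_lt. Qed.

Lemma RR_le : 32 * RR <= unt.
Proof. by have := unt_huge n c; rewrite /RR /UpperBound.H; lia. Qed.

Lemma cardU1_le (D : VS) u : #|u |: D| <= #|D| + 1.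
Proof. by rewrite cardsU1 addnC leq_add2l leq_b1. Qed.

Section Fork.
Variables (lam f l o : nat).
Hypotheses (hr : inrg lam f l 0) (hf : ~~ (2 < f < 6)) (l0 : 0 < lam) (k2 : 2 < kd lam f) (o1 : o <= 1).
Hypothesis hg : gl lam f l = 2 * nbr + o.
Hypothesis hlf : forall p, p < 2 * nbr -> lfc lam f (p + o) = cn lam.-1 (brf lam f p) p /\ okn lam.-1 (brf lam f p) p.
Hypothesis hc : forall p, p < gl lam f l -> lfc lam f p < chains.
(** The offset [o] is 1 at the root, whose first leaf is the dead path, and 0 at all other forks. *)
Let leaves a m := [seq lfc lam f p | p <- iota (a + o) m].

Lemma fork_mem a m x : a + m <= 2 * nbr -> x \in leaves a m ->
  exists2 p, a <= p < a + m & x = cn lam.-1 (brf lam f p) p /\ okn lam.-1 (brf lam f p) p.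
Proof.
move=> ham /mapP[p]; rewrite mem_iota => hp ->; exists (p - o); first by lia.
have hp' : p - o < 2 * nbr by lia.
by have [e ok] := hlf hp'; rewrite -e subnK //; lia.
Qed.

Lemma fork_ne p : p < 2 * nbr -> cn lam.-1 (brf lam f p) p != cn lam f l.
Proof.
move=> hp; have [_ /and4P[h _ _ _]] := hlf hp; apply/eqP => /(cn_inj h hr)[e _ _]; lia.
Qed.

Lemma fork_uniq a m : a + m <= 2 * nbr -> uniq (leaves a m).
Proof.
move=> ham; rewrite map_inj_in_uniq ?iota_uniq // => p p'; rewrite !mem_iota => hp hp' e.
have h : p - o < 2 * nbr by lia.
have h' : p' - o < 2 * nbr by lia.
have [e1 /and4P[i1 _ _ _]] := hlf h; have [e2 /and4P[i2 _ _ _]] := hlf h'.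
rewrite !subnK in e1 e2; try lia.
by move: e; rewrite e1 e2 => /(cn_inj i1 i2)[_ _]; lia.
Qed.

Lemma fork_rbl a m (D : VS) v : a + m <= 2 * nbr ->
  (0 < m -> reach ed (locs [:: cn lam f l]) D v (nd lam f l (a + o))) ->
  (forall p, a + o < p < a + o + m -> nd lam f l p \notin D) -> rbl [:: cn lam f l] D v (leaves a m).
Proof. by move=> ham hv hD; apply: (rbl_seg (l := l)) => //; rewrite ?inE ?eqxx ?hg //; lia. Qed.

Lemma fork_LF a m x : a + m <= 2 * nbr -> x \in leaves a m -> x \notin [:: cn lam f l].
Proof.
move=> ham /(fork_mem ham)[p hp [-> _]]; rewrite inE.
by apply: fork_ne; lia.
Qed.

Lemma fork_nd p : p < gl lam f l -> nd lam f l p %/ wid = cn lam f l.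
Proof. by move=> hp; rewrite nd_div //; apply: inrg_pos hr _; have := gl_le n c lam f l; lia. Qed.

Lemma fork_vF a m p : a + m <= 2 * nbr -> p < gl lam f l -> nd lam f l p \notin tops (leaves a m).
Proof.
move=> ham hp; rewrite inE fork_nd //; apply/negP => /andP[_ /(fork_LF ham)].
by rewrite inE eqxx.
Qed.

Lemma fork_cnt a m qq p (D : VS) : rob lam.-1 -> a + m <= 2 * nbr -> #|D| + (hh lam.-1 + qq) <= RR ->
  p < gl lam f l -> win ed (hh lam.-1 + qq) D (nd lam f l p) ->
  (0 < m -> reach ed (locs [:: cn lam f l]) D (nd lam f l p) (nd lam f l (a + o))) ->
  (forall p, a + o < p < a + o + m -> nd lam f l p \notin D) -> 2 * m <= 2 ^ qq + 2 * RR.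
Proof.
move=> rb ham hD hp w hv hfr.
have := @cnt [:: cn lam f l] (leaves a m) _ (hh lam.-1) qq D (nd lam f l p) (leaves a m).
rewrite size_map size_iota; apply=> //.
- by move=> x; apply: fork_LF.
- by move=> D' x z /(fork_mem ham)[p' hp' [-> ok]] dj e le; apply: (rb (brf lam f p') p').
- by move=> x /(fork_mem ham)[p' hp' [-> ok]]; apply: okn_lt.
- exact: fork_vF.
- exact: fork_uniq.
- exact: fork_rbl.
Qed.

Lemma fork_cntg a m qq p r (D : VS) : rob lam.-1 -> cond lam.-1 -> a + m <= 2 * nbr ->
  #|D| + ((hh lam.-1).+1 + qq) <= RR -> (forall u, u \in D -> ~~ bad lam.-1 r u) ->
  (forall p, a <= p < a + m -> tr lam.-1 (brf lam f p) r = false) ->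
  p < gl lam f l -> win ed ((hh lam.-1).+1 + qq) D (nd lam f l p) ->
  (0 < m -> reach ed (locs [:: cn lam f l]) D (nd lam f l p) (nd lam f l (a + o))) ->
  (forall p, a + o < p < a + o + m -> nd lam f l p \notin D) -> 2 * m <= 2 ^ qq + 2 * RR.
Proof.
move=> rb cd ham hD gD ht hp w hv hfr.
have := @cnt_good [:: cn lam f l] (leaves a m) _ (bad lam.-1 r) (hh lam.-1) qq D (nd lam f l p) (leaves a m).
rewrite size_map size_iota; apply=> //.
- by move=> x; apply: fork_LF.
- by move=> D' x z /(fork_mem ham)[p' hp' [-> ok]] dj e le; apply: (rb (brf lam f p') p').
- move=> u bu; rewrite inE (bad_node hr hf bu); split=> //; apply/negP => /(fork_mem ham)[p' hp' [e ok]].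
  by case/and4P: ok => ir _ _ f6; have := bad_node ir f6 bu; rewrite e eqxx.
- move=> D' x z g /(fork_mem ham)[p' hp' [-> ok]] dj e le; apply: (cd (brf lam f p') p' r) => //.
  exact: ht.
- by move=> x /(fork_mem ham)[p' hp' [-> ok]]; apply: okn_lt.
- exact: fork_vF.
- exact: fork_uniq.
- exact: fork_rbl.
Qed.

Lemma fork_clean (D : VS) p : [disjoint ch (cn lam f l) & D] -> p < gl lam f l -> nd lam f l p \notin D.
Proof. by move=> dj hp; rewrite (disjointFr dj) // inE fork_nd. Qed.

Lemma fork_reach (D : VS) a b : a <= b -> b < gl lam f l ->
  (forall p, a < p <= b -> nd lam f l p \notin D) ->
  reach ed (locs [:: cn lam f l]) D (nd lam f l a) (nd lam f l b).
Proof. by move=> h1 h2 h3; apply: reach_pos; rewrite ?inE. Qed.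

(** All [2 * nbr] leaves are visible from the top, about twice as many as [rnd] rounds can cope
    with. *)
Lemma fork_rob (D : VS) : rob lam.-1 -> [disjoint ch (cn lam f l) & D] -> #|D| + hh lam <= RR ->
  ~~ win ed (hh lam) D (nd lam f l 0).
Proof.
move=> rb dj; rewrite hh_pred // => le; apply/negP => w.
have [n1 n2 n3 n4 n5] := nbrP n c; have ub := unt_big n c; have rl := RR_le.
have fr p : 0 < p < gl lam f l -> nd lam f l p \notin D by move=> hp; apply: fork_clean => //; lia.
have := @fork_cnt 0 (2 * nbr) rnd 0 D rb; rewrite rnd_pow wid_unt.
suff : 2 * (2 * nbr) <= 16 * unt + 2 * RR -> False by move=> h1 h2; apply/h1/h2 => //;
  [rewrite hg; lia | move=> _; apply: fork_reach; rewrite ?hg; [lia|lia|move=> p hp; apply: fr; rewrite hg; lia]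
   | move=> p hp; apply: fr; rewrite hg; lia].
by rewrite /Layout.nbr; lia.
Qed.

(** The first pebble must fall near the middle of the chain: anywhere else, staying or following
    shows the challenger too many leaves for the robust bound. The half that is false then still has
    almost [nbr] leaves in view, each of them harder by one, and only [usz + 3] rounds are left for
    them. *)
Lemma fork_cond (D : VS) r : rob lam.-1 -> cond lam.-1 -> [disjoint ch (cn lam f l) & D] ->
  (forall u, u \in D -> ~~ bad lam r u) -> tr lam.-1 (Layout.br0 n c lam f) r && tr lam.-1 (Layout.br1 n c lam f) r = false ->
  #|D| + (hh lam).+1 <= RR -> ~~ win ed (hh lam).+1 D (nd lam f l 0).
Proof.
move=> rb cd dj gD ht le; apply/negP => /winP.
have [n1 n2 n3 n4 n5] := nbrP n c; have ub := unt_big n c; have rl := RR_le.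
have hw := gl_le n c lam f l; have rp p : p < gl lam f l -> inrg lam f l p by move=> hp; apply: inrg_pos hr _; lia.
have fr p : p < gl lam f l -> nd lam f l p \notin D by apply: fork_clean.
case=> [/subsetP sub|[k' [u [ek w1 w2]]]].
  have h1 : nd lam f l 1 \in D.
    apply: sub; have k2' : (kd lam f <= 2) = false by rewrite leqNgt k2.
    by rewrite inE /Dag.ed !ndE ?rp /Layout.edge ?pr_real ?rp ?k2' ?hg; [rewrite ifT ?eqxx //; lia | lia..].
  by have := fr 1; rewrite h1 hg => /(_ _)/implyP; lia.
case: ek w1 w2 => <-; rewrite hh_pred // => w1 w2.
have le2 : #|u |: D| + (hh lam.-1 + rnd) <= RR.
  by move: le (cardU1_le D u) (hh_pred l0); move: #|_ |: _| #|_|; lia.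
have [[p hp up]|no] := EM (exists2 p, p < gl lam f l & u = nd lam f l p); last first.
  have fr' p : p < gl lam f l -> nd lam f l p \notin u |: D.
    move=> hp; rewrite in_setU1 negb_or fr // andbT; apply/eqP => e; by apply: no; exists p.
  have := @fork_cnt 0 (2 * nbr) rnd 0 (u |: D) rb; rewrite rnd_pow wid_unt.
  suff : 2 * (2 * nbr) <= 16 * unt + 2 * RR -> False by move=> h1 h2; apply/h1/h2 => //;
    [rewrite hg; lia | move=> _; apply: fork_reach; rewrite ?hg; [lia|lia|move=> p hp; apply: fr'; rewrite hg; lia]
     | move=> p hp; apply: fr'; rewrite hg; lia].
  by rewrite /Layout.nbr; lia.
have fr' p' : p' < gl lam f l -> p' <> p -> nd lam f l p' \notin u |: D.
  move=> hp' ne; rewrite in_setU1 negb_or fr // andbT up; apply/eqP => e.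
  by apply: ne; apply: nd_inj e; apply: rp.
(* The leaves before the pebble are seen by staying, those after it by following. Neither part may
   exceed [8 * unt] by more than [RR], which confines [p] to the neighbourhood of the middle. *)
have pu : 2 * minn (p - o) (2 * nbr) <= 16 * unt + 2 * RR.
  rewrite -wid_unt -rnd_pow; apply: (@fork_cnt 0 _ rnd 0 (u |: D) rb) => //.
  + exact: geq_minr.
  + by rewrite hg; lia.
  + move=> hm; apply: fork_reach => //; [by rewrite hg; lia | move=> p' hp'; apply: fr'; [rewrite hg; lia | lia]].
  + by move=> p' hp'; apply: fr'; [rewrite hg; lia | lia].
have pd : 2 * (2 * nbr - (p - o)) <= 16 * unt + 2 * RR.
  rewrite -wid_unt -rnd_pow; apply: (@fork_cnt (p - o) _ rnd p (u |: D) rb) => //.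
  + lia.
  + by rewrite -up.
  + move=> hm; apply: fork_reach => //; [lia | rewrite hg; lia |].
    by move=> p' hp'; apply: fr'; [rewrite hg; lia | lia].
  + by move=> p' hp'; apply: fr'; [rewrite hg; lia | lia].
have gD' v : v \in u |: D -> ~~ bad lam.-1 r v.
  rewrite in_setU1 => /orP[/eqP->|/gD]; last by apply: contra; apply: bad_mono; lia.
  by apply/negP => /(bad_node hr hf); rewrite up fork_nd ?eqxx.
(* One of the [rnd] rounds is credited to the leaves of the false half. *)
have ek : hh lam.-1 + rnd = (hh lam.-1).+1 + (usz + 3) by rewrite /Layout.rnd; lia.
rewrite ek in w1 w2 le2.
have pw : 2 ^ (usz + 3) = 8 * unt by rewrite usz_pow mulnC.
move: ht; case h0 : (tr _ _ _) => /= h1.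
  have := @fork_cntg (maxn nbr (p - o)) (2 * nbr - maxn nbr (p - o)) (usz + 3) p r (u |: D) rb cd.
  rewrite pw => h; suff : 2 * (2 * nbr - maxn nbr (p - o)) <= 8 * unt + 2 * RR by move: pu pd; rewrite /Layout.nbr; lia.
  apply: h => //.
  - by move: pu pd; rewrite /Layout.nbr; lia.
  - by move=> p' hp'; rewrite /Layout.brf ifF //; lia.
  - by rewrite -up.
  - move=> hm; apply: fork_reach => //; [lia | rewrite hg; lia |].
    by move=> p' hp'; apply: fr'; [rewrite hg; lia | lia].
  - by move=> p' hp'; apply: fr'; [rewrite hg; lia | lia].
have := @fork_cntg 0 (minn nbr (p - o)) (usz + 3) 0 r (u |: D) rb cd.
rewrite pw => h; suff : 2 * minn nbr (p - o) <= 8 * unt + 2 * RR by move: pu pd; rewrite /Layout.nbr; lia.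
apply: h => //.
- by lia.
- by move=> p' hp'; rewrite /Layout.brf ifT //; lia.
- by rewrite hg; lia.
- move=> hm; apply: fork_reach => //; [by rewrite hg; lia |].
  by move=> p' hp'; apply: fr'; [rewrite hg; lia | lia].
- by move=> p' hp'; apply: fr'; [rewrite hg; lia | lia].
Qed.
End Fork.

(** The evaluation in [bottom_cond] takes the three slots to be different vertices; for this reason
    repeated literals are dropped. *)
Lemma lcode_neq t k k' : k < 3 -> k' < 3 -> k != k' -> lcode t k != 0 -> lcode t k != lcode t k'.
Proof.
rewrite /Layout.lcode; case: ifP => _.
  case: ifP => _.
    by case: k k' => [|[|[|]]] // [|[|[|]]].
  have h2 : 2 * (t %/ 2) + 0 + 1 != 2 * (t %/ 2) + 1 + 1 by apply/eqP; lia.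
  case: k k' => [|[|[|]]] // [|[|[|]]] //= _ _ _ _; by [rewrite ?addn0 in h2 *; lia | rewrite addn1].
case: k k' => [|[|[|]]] // [|[|[|]]] //= _ _ _; rewrite ?andbT ?orbT /=;
  do ![case: ifP => //]; move=> *; apply/eqP; lia.
Qed.

Lemma sl_item t k : t < 2 * n + c -> k < 3 -> sl t k = ov (ord_real + k) /\ lcode t k = 0 \/
  exists i b, [/\ i < n, b < 2, lcode t k = 2 * i + b + 1 & sl t k = oo i b].
Proof.
move=> ht hk; rewrite /UpperBound.sl; have [[h1 ->]|[i [b [hi hb e ->]]]] := @slotv_spec n c q lf t k ht; first by left.
by right; exists i, b.
Qed.

Lemma oo_div i b : i < n -> b < 2 -> oo i b %/ wid = cn (lve i) (3 + b) 0.
Proof. by move=> hi hb; rewrite nd_div //; apply: inrg_item => //; lia. Qed.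

Lemma oo_inj i b j b' : i < n -> b < 2 -> j < n -> b' < 2 -> oo i b = oo j b' -> i = j /\ b = b'.
Proof.
move=> hi hb hj hb' e; have := oo_div hi hb; rewrite e oo_div // => /esym e2.
have h1 : inrg (lve i) (3 + b) 0 0 by apply: inrg_item => //; lia.
have h2 : inrg (lve j) (3 + b') 0 0 by apply: inrg_item => //; lia.
have [e3 e4 _] := cn_inj h1 h2 e2; split; last by lia.
by move: e3; rewrite /Layout.lve /Layout.lmax; lia.
Qed.

Lemma oo_real i b : i < n -> b < 2 -> oo i b < ord_real.
Proof.
move=> hi hb; have h : inrg (lve i) (3 + b) 0 0 by apply: inrg_item => //; lia.
by rewrite ndE //; apply: vn_lt.
Qed.

Lemma dummy_val k : k < 3 -> (ov (ord_real + k) : nat) = ord_real + k.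
Proof. by move=> h; rewrite ovK // lt_dummy. Qed.

Lemma sl_inj t k k' : t < 2 * n + c -> k < 3 -> k' < 3 -> sl t k = sl t k' -> k = k'.
Proof.
move=> ht hk hk' e; apply/eqP; apply: contraT => ne.
have [[s1 l1]|[i [b [hi hb l1 s1]]]] := sl_item ht hk;
have [[s2 l2]|[j [b' [hj hb' l2 s2]]]] := sl_item ht hk'.
- move: e; rewrite s1 s2 => /(congr1 (@nat_of_ord _)); rewrite !dummy_val // => /addnI e.
  by rewrite e eqxx in ne.
- by have := oo_real hj hb'; rewrite -s2 -e s1 dummy_val //; lia.
- by have := oo_real hi hb; rewrite -s1 e s2 dummy_val //; lia.
- rewrite s1 s2 in e; have [e1 e2] := oo_inj hi hb hj hb' e.
  have := @lcode_neq t k k' hk hk' ne; rewrite l1 l2 e1 e2 eqxx addn1 /=.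
  by move=> /(_ isT).
Qed.

Lemma sl_bad t k r : t < 2 * n + c -> k < 3 -> tst t r = false -> bad 0 r (sl t k).
Proof.
move=> ht hk hf; have [[-> _]|[i [b [hi hb l1 ->]]]] := sl_item ht hk.
  by apply/or3P; apply: Or31; rewrite dummy_val // leq_addr.
apply/or3P; apply: Or33; apply/existsP; exists (Ordinal hi) => /=.
have -> : b = ~~ r i; last by rewrite eqxx.
move/negbT: hf; rewrite negb_exists => /forallP/(_ (Ordinal hk)) /=.
rewrite l1 addn1 /= mulnC divnMDl // divn_small // addn0 modnMDl modn_small //.
by case: (r i) => /=; lia.
Qed.

Lemma nd_neq lam f l p lam' f' l' p' : inrg lam f l p -> inrg lam' f' l' p' ->
  nd lam f l p = nd lam' f' l' p' -> [/\ lam = lam', f = f', l = l' & p = p'].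
Proof.
move=> h h' e; have e1 := nd_div h; have e2 := nd_mod h.
move: e1 e2; rewrite e nd_div // nd_mod // => e1 e2.
have w0 := wid_gt0 n c.
by have [] := cn_inj (inrg_pos h w0) (inrg_pos h' w0) (esym e1).
Qed.

Lemma pr_eq1 lam f l p u : inrg lam f l p -> u = pr1 (vn lam f l p) -> u < ord_dag -> ed (ov u) (nd lam f l p).
Proof. by move=> h e hu; rewrite /Dag.ed ndE // ovK // /Layout.edge -e eqxx. Qed.
Lemma pr_eq2 lam f l p u : inrg lam f l p -> u = pr2 (vn lam f l p) -> u < ord_dag -> ed (ov u) (nd lam f l p).
Proof. by move=> h e hu; rewrite /Dag.ed ndE // ovK // /Layout.edge -e eqxx orbT. Qed.

Lemma bottom_rob : rob 0.
Proof.
move=> f l D x /and4P[hr _ lv hf] dj ex _; apply/negP => w.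
have k12 : 0 < kd 0 f <= 2.
  rewrite /Layout.kd /Layout.isvar; move: lv; rewrite /Layout.live /Layout.isvar; case: (f) hf => [|[|[|[|[|[|f']]]]]] //=.
have g3 : gl 0 f l = 3 by rewrite /Layout.gl lv /Layout.gp; case: (kd 0 f) k12 => [|[|[|]]].
have hw := gl_le n c 0 f l; rewrite g3 in hw.
have rp p : p < 3 -> inrg 0 f l p by move=> hp; apply: inrg_pos hr _; lia.
have k2 : kd 0 f <= 2 by case/andP: k12.
pose phi j := if j < 3 then nd 0 f l j else x.
(* Vertices 0, 1, 2 are the bottom gadget and 6 is the successor [x] of its top, which is outside
   the range of moves. *)
suff : wl [:: (0, 6); (1, 0); (2, 0)] 3 2 [::] 6 by [].
apply: (@wlP _ ed _ 3 phi _ _ 2 D [::] 6) => //.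
- move=> i j; rewrite !inE => /or3P[]/eqP[-> ->]; split=> //; rewrite /phi /=.
  + by rewrite nd0_topc.
  + by apply: pr_eq1; rewrite ?pr_real ?g3 ?k2 ?rp //; apply: vn_ord; apply: rp.
  + by apply: pr_eq2; rewrite ?pr_real ?g3 ?k2 ?rp //; apply: vn_ord; apply: rp.
- move=> i j hi hj; rewrite /phi hi hj => e.
  by apply: nd_inj e; apply: rp.
- move=> j hj; rewrite /phi hj => hD; have := disjointFl dj hD.
  by rewrite inE nd_div ?eqxx //; apply: rp.
- by move: w; rewrite /hh muln0.
Qed.

Lemma bottom_cond : cond 0.
Proof.
move=> f l r D x /and4P[hr hl0 lv hf] dj gD ht ex _; apply/negP => w.
have [f5 ht'] : 5 < f /\ tst (f - 6) r = false.
  move: ht; rewrite /=; case: eqP => // f0; case: ifP => // f5 _.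
have [t ft] : exists t, f = 6 + t by exists (f - 6); lia.
subst f; rewrite addKn in ht'; have htn : t < 2 * n + c by case/and4P: hr => _; rewrite /Layout.fams; lia.
have kk : kd 0 (6 + t) = 2 by [].
have g3 : gl 0 (6 + t) l = 3 by rewrite /Layout.gl lv kk.
have hw := gl_le n c 0 (6 + t) l; rewrite g3 in hw.
have rp p : p < 3 -> inrg 0 (6 + t) l p by move=> hp; apply: inrg_pos hr _; lia.
pose phi j := if j < 3 then nd 0 (6 + t) l j else if j < 6 then sl t (j - 3) else x.
(* Vertices 3 to 5 are the slots. They are modelled as sources, in favour of the pebbler, and carry
   no pebble initially because such a pebble would be bad. *)
suff : wl [:: (0, 6); (1, 0); (2, 0); (3, 1); (4, 1); (4, 2); (5, 2)] 6 3 [::] 6 by [].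
have nds p k : p < 3 -> k < 3 -> nd 0 (6 + t) l p <> sl t k.
  move=> hp hk e; have [[s1 _]|[i [b [hi hb _ s1]]]] := sl_item htn hk; rewrite s1 in e.
    by have := vn_lt (rp _ hp); rewrite -ndE ?rp // e dummy_val //; lia.
  have [e1 _ _ _] := nd_neq (rp _ hp) (inrg_item c hi (ltac:(lia) : 3 + b < 6)) e.
  by have [i0 _ _ _ _] := lveP c hi; lia.
have slt k : k < 3 -> slotv t k < ord_dag.
  move=> hk; have [[_ ->]|[i [b [hi hb _ ->]]]] := @slotv_spec n c q lf t k htn; first exact: lt_dummy.
  by apply: vn_ord; apply: inrg_item => //; lia.
apply: (@wlP _ ed _ 6 phi _ _ 3 D [::] 6) => //.
- have nu p : p < 3 -> vn 0 (6 + t) l p < ord_dag by move=> hp; apply/vn_ord/rp.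
  move=> i j; rewrite !inE => /or4P[|||/or4P[]] /eqP[-> ->]; split=> //; rewrite /phi /= /UpperBound.sl ?nd0_topc //.
  + by rewrite -nd0_topc; apply: pr_eq1; rewrite ?pr_real ?g3 ?kk ?rp ?nu.
  + by rewrite -nd0_topc; apply: pr_eq2; rewrite ?pr_real ?g3 ?kk ?rp ?nu.
  + by apply: pr_eq1; rewrite ?pr_real ?g3 ?kk ?rp ?slt ?addKn.
  + by apply: pr_eq2; rewrite ?pr_real ?g3 ?kk ?rp ?slt ?addKn.
  + by apply: pr_eq1; rewrite ?pr_real ?g3 ?kk ?rp ?slt ?addKn.
  + by apply: pr_eq2; rewrite ?pr_real ?g3 ?kk ?rp ?slt ?addKn.
- move=> i j hi hj; rewrite /phi hi hj; case: ltnP => i3; case: ltnP => j3 e.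
  + by apply: nd_inj e; apply: rp.
  + by case: (nds i (j - 3)) => //; lia.
  + by case: (nds j (i - 3)) => //; lia.
  + have : i - 3 = j - 3 by apply: sl_inj e => //; lia.
    lia.
- move=> j hj; rewrite /phi hj; case: ltnP => j3 hD.
    by have := disjointFl dj hD; rewrite inE nd_div ?eqxx //; apply: rp.
  have hk : j - 3 < 3 by lia.
  by have := gD _ hD; rewrite sl_bad.
- by move: w; rewrite /hh muln0.
Qed.

Lemma cat_sep (s1 s2 : seq nat) m : uniq s1 -> uniq s2 -> (forall x, x \in s1 -> x < m) ->
  (forall x, x \in s2 -> m <= x) -> uniq (s1 ++ s2).
Proof.
move=> u1 u2 h1 h2; rewrite cat_uniq u1 u2 andbT /=; apply/hasPn => x /h2 hx.
by apply/negP => /h1; rewrite ltnNge hx.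
Qed.

Section Ex.
Variables (i b l : nat).
Hypotheses (hi : i < n) (hb : b < 2) (hok : okn (lve i) b.+1 l).
Local Notation lam := (lve i).-1.
(** The four chains of a choice are numbered 0 for the choice chain, 1 for the negative literal, 2
    for the positive literal and 3 for the middle item. *)
Definition exf c := nth 0 [:: b.+1; 3; 4; 5] c.
Definition exl c := if c == 0 then l else 0.
Local Notation fc := exf. Local Notation lc := exl.
Definition exg c := if c == 0 then nbr + 3 + nsml else if c == 3 then nsml else nlit + 1.
Local Notation xg := exg.
Definition vx c p := nd (lve i) (fc c) (lc c) p.
Definition cv c := cn (lve i) (fc c) (lc c).
Definition exL := [:: cv 0; cv 1; cv 2; cv 3].

Local Notation Ls := exL.

Lemma xfacts k : k < 4 -> [/\ inrg (lve i) (fc k) (lc k) 0, gl (lve i) (fc k) (lc k) = xg k,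
  2 < kd (lve i) (fc k) & cv k \in Ls].
Proof.
move=> hk; have [hr hl lv hf] := and4P hok; have [kk g] := @kd_exE n c i b l hi hb.
have Lk : cv k \in Ls by case: k hk => [|[|[|[|]]]] // _; rewrite !inE eqxx ?orbT.
case: k hk Lk => [|[|[|[|]]]] // _ Lk; first by split=> //; [rewrite g | rewrite /exf /= kk].
- by split=> //; [apply: inrg_item | rewrite gl_item | rewrite item_kd].
- by split=> //; [apply: inrg_item | rewrite gl_item | rewrite item_kd].
- by split=> //; [apply: inrg_item | rewrite gl_item | rewrite item_kd].
Qed.

Lemma xr k p : k < 4 -> p < xg k -> inrg (lve i) (fc k) (lc k) p.
Proof.
move=> hk hp; have [hr g _ _] := xfacts hk; apply: inrg_pos hr _.
by have := gl_le n c (lve i) (fc k) (lc k); rewrite g; lia.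
Qed.

Lemma xfc_inj k k' : k < 4 -> k' < 4 -> fc k = fc k' -> k = k'.
Proof. by rewrite /exf; case: k k' => [|[|[|[|]]]] // [|[|[|[|]]]] //= _ _; lia. Qed.

Lemma vx_inj k p k' p' : k < 4 -> k' < 4 -> p < xg k -> p' < xg k' -> vx k p = vx k' p' -> k = k' /\ p = p'.
Proof.
move=> hk hk' hp hp' /(nd_neq (xr hk hp) (xr hk' hp'))[_ e _ ->]; split=> //.
exact: xfc_inj.
Qed.

Lemma vx_div k p : k < 4 -> p < xg k -> vx k p %/ wid = cv k.
Proof. by move=> hk hp; rewrite nd_div //; apply: xr. Qed.

Lemma lam_lt : lam.+1 = lve i /\ lam < lmax.
Proof. by have [l0 l1 _ _ _] := lveP c hi; split; lia. Qed.

Lemma lf_plain k p : k < 4 -> (if k == 0 then p < nbr else if k == 3 then p < nsml else 0 < p <= nlit) ->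
  lfc (lve i) (fc k) p = cn lam 0 (nth 0 [:: 5 * unt + p; p.-1; 2 * unt + p.-1; 4 * unt + p] k).
Proof.
have [kk _] := @kd_exE n c i b l hi hb; rewrite /Layout.lfc /exf.
case: k => [|[|[|[|]]]] //= _ hp; first by rewrite kk /= hp.
- by rewrite item_kd //= ifF; [|lia].
- by rewrite item_kd //= ifF; [rewrite mul1n | lia].
- by rewrite item_kd.
Qed.

Lemma lf_z p : p < nsml -> lfc (lve i) (fc 0) (nbr + 3 + p) = cn lam b.+1 p.
Proof.
move=> hp; have [kk _] := @kd_exE n c i b l hi hb; rewrite /Layout.lfc /exf /= kk /=.
rewrite !ifF; try lia; by rewrite addKn.
Qed.

Lemma lf_t k : k < 3 -> lfc (lve i) (fc k) (if k == 0 then nbr else 0) = cv 3.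
Proof.
have [kk _] := @kd_exE n c i b l hi hb; rewrite /Layout.lfc /exf.
by case: k => [|[|[|]]] // _; rewrite /= ?kk ?item_kd //= ltnn eqxx.
Qed.

Lemma lf_o k : 0 < k < 3 -> lfc (lve i) (fc 0) (nbr + 3 - k) = cv k.
Proof.
have [kk _] := @kd_exE n c i b l hi hb; rewrite /Layout.lfc /exf /= kk /=.
move=> hk; case: ltnP => [|_]; first by lia.
case: eqP => [|_]; first by lia.
case: k hk => [|[|[|]]] // _; case: eqP => [e|e] //; try by lia.
by case: eqP => [e'|e'] //; lia.
Qed.

Lemma lfc_lt k p : k < 4 -> p < xg k -> lfc (lve i) (fc k) p < chains.
Proof.
move=> hk hp; have [hr g k2 _] := xfacts hk; have hp' : p < gl (lve i) (fc k) (lc k) by rewrite g.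
by have [lam' [f' [l' [-> /and4P[h1 h2 h3 _] _]]]] := lfc_spec (xr hk hp) hp' k2; apply: cn_lt.
Qed.

(** The leaves in view: the flags stand for the two literal chains, the middle item and the plain
    part of the choice chain; [a] and [m] delimit a stretch of next towers. *)
Definition blk (e1 e2 e3 e4 : bool) a m :=
  (if e1 then [seq lfc (lve i) (fc 1) p | p <- iota 1 nlit] else [::]) ++
  (if e2 then [seq lfc (lve i) (fc 2) p | p <- iota 1 nlit] else [::]) ++
  (if e3 then [seq lfc (lve i) (fc 3) p | p <- iota 0 nsml] else [::]) ++
  (if e4 then [seq lfc (lve i) (fc 0) p | p <- iota 0 nbr] else [::]) ++
  [seq lfc (lve i) (fc 0) p | p <- iota (nbr + 3 + a) m].

Lemma seg_plain k s m x : k < 4 -> s = (if (k == 0) || (k == 3) then 0 else 1) ->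
  m = (if k == 0 then nbr else if k == 3 then nsml else nlit) ->
  x \in [seq lfc (lve i) (fc k) p | p <- iota s m] -> exists2 j, j < m &
  x = cn lam 0 (nth 0 [:: 5; 0; 2; 4] k * unt + j).
Proof.
move=> hk es em /mapP[p]; rewrite mem_iota => hp ->; exists (p - s); first by lia.
rewrite lf_plain //; last by case: k hk es em => [|[|[|[|]]]] //= _ es em; subst; lia.
by congr (cn _ _ _); case: k hk es em => [|[|[|[|]]]] //= _ es em; subst; lia.
Qed.

Lemma cn_mono f j j' : (cn lam f j < cn lam f j') = (j < j').
Proof. by rewrite /Layout.cn ltn_add2l. Qed.

Lemma seg_uniq k s m : k < 4 -> s = (if (k == 0) || (k == 3) then 0 else 1) ->
  m = (if k == 0 then nbr else if k == 3 then nsml else nlit) ->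
  uniq [seq lfc (lve i) (fc k) p | p <- iota s m].
Proof.
move=> hk es em; rewrite map_inj_in_uniq ?iota_uniq // => p p'; rewrite !mem_iota => hp hp'.
rewrite !lf_plain //; try by case: k hk es em => [|[|[|[|]]]] //= _ es em; subst; lia.
by rewrite /Layout.cn => /addnI; case: k hk es em => [|[|[|[|]]]] //= _ es em; subst; lia.
Qed.

Lemma z_uniq a m : a + m <= nsml -> uniq [seq lfc (lve i) (fc 0) p | p <- iota (nbr + 3 + a) m].
Proof.
move=> ha; rewrite map_inj_in_uniq ?iota_uniq // => p p'; rewrite !mem_iota => hp hp'.
rewrite -(subnKC (_ : nbr + 3 <= p)) ?lf_z; [|lia|lia].
rewrite -(subnKC (_ : nbr + 3 <= p')) ?lf_z; [|lia|lia].
by rewrite /Layout.cn => /addnI ->.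
Qed.

Lemma mem_z a m x : a + m <= nsml -> x \in [seq lfc (lve i) (fc 0) p | p <- iota (nbr + 3 + a) m] ->
  exists2 j, a <= j < a + m & x = cn lam b.+1 j.
Proof.
move=> ha /mapP[p]; rewrite mem_iota => hp ->; exists (p - (nbr + 3)); first by lia.
by rewrite -{1}(subnKC (_ : nbr + 3 <= p)) ?lf_z //; lia.
Qed.

Lemma ifsize (e : bool) (s : seq nat) : size (if e then s else [::]) = e * size s.
Proof. by case: e; rewrite ?mul1n. Qed.
Lemma ifmem (e : bool) (s : seq nat) x : x \in (if e then s else [::]) -> e /\ x \in s.
Proof. by case: e. Qed.
Lemma ifuniq (e : bool) (s : seq nat) : uniq s -> uniq (if e then s else [::]).
Proof. by case: e. Qed.

Lemma blk_size e1 e2 e3 e4 a m : size (blk e1 e2 e3 e4 a m) = e1 * nlit + e2 * nlit + e3 * nsml + e4 * nbr + m.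
Proof. by rewrite !size_cat !ifsize !size_map !size_iota !addnA. Qed.

(** The plain towers of the four chains come from the ranges that start at [0], [2 * unt], [4 * unt]
    and [5 * unt]; the next towers belong to another family, with larger chain numbers. *)
Lemma blk_uniq e1 e2 e3 e4 a m : a + m <= nsml -> uniq (blk e1 e2 e3 e4 a m).
Proof.
move=> ha; have ub := unt_big n c.
have P1 := @seg_plain 1 1 nlit _ isT erefl erefl; have P2 := @seg_plain 2 1 nlit _ isT erefl erefl.
have P3 := @seg_plain 3 0 nsml _ isT erefl erefl; have P0 := @seg_plain 0 0 nbr _ isT erefl erefl.
rewrite /= in P0 P1 P2 P3.
have big x : x \in [seq lfc (lve i) (fc 0) p | p <- iota (nbr + 3 + a) m] -> cn lam 0 wid <= x.
  by move=> /(mem_z ha)[j _ ->]; rewrite /Layout.cn addn0; lia.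
have wu : 16 * unt <= wid by [].
apply: (@cat_sep _ _ (cn lam 0 (2 * unt))).
- by apply: ifuniq; apply: (@seg_uniq 1).
- apply: (@cat_sep _ _ (cn lam 0 (4 * unt))).
  + by apply: ifuniq; apply: (@seg_uniq 2).
  + apply: (@cat_sep _ _ (cn lam 0 (5 * unt))).
    * by apply: ifuniq; apply: (@seg_uniq 3).
    * apply: (@cat_sep _ _ (cn lam 0 wid)).
      - by apply: ifuniq; apply: (@seg_uniq 0).
      - exact: z_uniq.
      - by move=> x /ifmem[_ /P0[j hj ->]]; rewrite cn_mono; move: hj; rewrite /Layout.nbr; lia.
      - exact: big.
    * by move=> x /ifmem[_ /P3[j hj ->]]; rewrite cn_mono; move: hj; rewrite /Layout.nsml; lia.
    * move=> x; rewrite mem_cat => /orP[/ifmem[_ /P0[j hj ->]]|/big]; rewrite /Layout.cn; lia.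
  + by move=> x /ifmem[_ /P2[j hj ->]]; rewrite cn_mono; move: hj; rewrite /Layout.nlit; lia.
  + move=> x; rewrite !mem_cat => /or3P[/ifmem[_ /P3[j hj ->]]|/ifmem[_ /P0[j hj ->]]|/big]; rewrite /Layout.cn; lia.
- by move=> x /ifmem[_ /P1[j hj ->]]; rewrite cn_mono; move: hj; rewrite /Layout.nlit; lia.
- move=> x; rewrite !mem_cat => /or4P[/ifmem[_ /P2[j hj ->]]|/ifmem[_ /P3[j hj ->]]|/ifmem[_ /P0[j hj ->]]|/big];
    rewrite /Layout.cn; lia.
Qed.

Lemma blk_mem e1 e2 e3 e4 a m x : a + m <= nsml -> x \in blk e1 e2 e3 e4 a m ->
  exists f' l', x = cn lam f' l' /\ okn lam f' l'.
Proof.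
move=> ha; have ub := unt_big n c; have [n1 n2 n3 n4 n5] := nbrP n c.
have P1 := @seg_plain 1 1 nlit x isT erefl erefl; have P2 := @seg_plain 2 1 nlit x isT erefl erefl.
have P3 := @seg_plain 3 0 nsml x isT erefl erefl; have P0 := @seg_plain 0 0 nbr x isT erefl erefl.
rewrite /= in P0 P1 P2 P3; have [e1' l1] := lam_lt; have f0 := fams_gt0 n c; have w0 := wid_gt0 n c.
have pl j : j < 2 * nbr -> okn lam 0 j.
  by move=> hj; rewrite /okn live_plain // /Layout.inrg f0 w0 andbT /=; lia.
rewrite !mem_cat => /orP[/ifmem[_ /P1[j hj ->]]|/or4P[/ifmem[_ /P2[j hj ->]]|/ifmem[_ /P3[j hj ->]]|/ifmem[_ /P0[j hj ->]]|/(mem_z ha)[j hj ->]]].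
- by do 2 eexists; split; first reflexivity; apply: pl; move: hj; rewrite /Layout.nlit /Layout.nbr; lia.
- by do 2 eexists; split; first reflexivity; apply: pl; move: hj; rewrite /Layout.nlit /Layout.nbr; lia.
- by do 2 eexists; split; first reflexivity; apply: pl; move: hj; rewrite /Layout.nsml /Layout.nbr; lia.
- by do 2 eexists; split; first reflexivity; apply: pl; move: hj; rewrite /Layout.nbr; lia.
- exists b.+1, j; split=> //; rewrite /okn (@live_next n c i b j hi hb); last by lia.
  have : b.+1 < fams by have /and4P[/and4P[_ hh' _ _] _ _ _] := hok.
  by rewrite /Layout.inrg w0 => -> /=; lia.
Qed.

Lemma blk_LF e1 e2 e3 e4 a m x : a + m <= nsml -> x \in blk e1 e2 e3 e4 a m -> x \notin Ls.
Proof.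
move=> ha /(blk_mem ha)[f' [l' [-> /and4P[h1 _ _ _]]]]; have [e1' l1] := lam_lt.
have ne k : k < 4 -> cn lam f' l' != cv k.
  by move=> hk; have [h2 _ _ _] := xfacts hk; apply/eqP => /(cn_inj h1 h2)[e _ _]; lia.
by rewrite !inE (negPf (ne 0 isT)) (negPf (ne 1 isT)) (negPf (ne 2 isT)) (negPf (ne 3 isT)).
Qed.

Lemma v_notin (v : V) a m : a + m <= nsml -> v %/ wid \in Ls -> v \notin tops (blk true true true true a m).
Proof. by move=> ha hv; rewrite inE; apply/negP => /andP[_ /(blk_LF ha)]; rewrite hv. Qed.

Lemma blk_sub e1 e2 e3 e4 a m : a + m <= nsml -> {subset blk e1 e2 e3 e4 a m <= blk true true true true 0 nsml}.
Proof.
move=> ha x; rewrite !mem_cat => /orP[/ifmem[_ ->]|/or4P[/ifmem[_ ->]|/ifmem[_ ->]|/ifmem[_ ->]|]]; rewrite ?orbT //.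
move=> /mapP[p hp ->]; rewrite [in X in _ || (_ || (_ || (_ || X)))]map_f ?orbT //.
by move: hp; rewrite !mem_iota; lia.
Qed.

Hypothesis rb : rob lam.

Lemma ex_cnt (D : VS) v qq (e1 e2 e3 e4 : bool) a m : win ed (hh lam + qq) D v -> #|D| + (hh lam + qq) <= RR ->
  v %/ wid \in Ls -> a + m <= nsml ->
  (e1 -> rbl Ls D v [seq lfc (lve i) (fc 1) p | p <- iota 1 nlit]) ->
  (e2 -> rbl Ls D v [seq lfc (lve i) (fc 2) p | p <- iota 1 nlit]) ->
  (e3 -> rbl Ls D v [seq lfc (lve i) (fc 3) p | p <- iota 0 nsml]) ->
  (e4 -> rbl Ls D v [seq lfc (lve i) (fc 0) p | p <- iota 0 nbr]) ->
  rbl Ls D v [seq lfc (lve i) (fc 0) p | p <- iota (nbr + 3 + a) m] ->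
  2 * (e1 * nlit + e2 * nlit + e3 * nsml + e4 * nbr + m) <= 2 ^ qq + 2 * RR.
Proof.
move=> w le hv ha h1 h2 h3 h4 h5; rewrite -(blk_size e1 e2 e3 e4 a m).
apply: (@cnt Ls (blk true true true true 0 nsml) _ (hh lam) qq D v) => //.
- by move=> x; apply: blk_LF.
- by move=> D' x z /(@blk_mem _ _ _ _ 0 nsml _ (leqnn _))[f' [l' [-> ok]]] dj e le'; apply: (rb ok).
- by move=> x /(@blk_mem _ _ _ _ 0 nsml _ (leqnn _))[f' [l' [-> ok]]]; apply: okn_lt ok.
- exact: v_notin.
- exact: blk_sub.
- exact: blk_uniq.
- have ib (e : bool) s : (e -> rbl Ls D v s) -> rbl Ls D v (if e then s else [::]).
    by case: e => [h|_]; [exact: h | move=> x].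
  by do ![apply: rbl_cat] => //; apply: ib.
Qed.

(** The gadget is cut down to the choice chain itself, because the top of the false literal of this
    very variable is a bad vertex and has to lie outside for the move onto it to count as lost. *)
Lemma ex_cntg (D : VS) v qq a m r : cond lam -> win ed ((hh lam).+1 + qq) D v -> #|D| + ((hh lam).+1 + qq) <= RR ->
  v %/ wid = cv 0 -> a + m <= nsml -> (forall u, u \in D -> ~~ bad lam r u) -> tr lam b.+1 r = false ->
  rbl [:: cv 0] D v [seq lfc (lve i) (fc 0) p | p <- iota (nbr + 3 + a) m] ->
  2 * m <= 2 ^ qq + 2 * RR.
Proof.
move=> cd w le hv ha gD ht h5.
pose Fs := [seq lfc (lve i) (fc 0) p | p <- iota (nbr + 3 + a) m].
have eF : Fs = blk false false false false a m by [].
rewrite -[m](_ : size Fs = m); last by rewrite size_map size_iota.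
have [hr _ _ hf] := and4P hok.
have LF x : x \in Fs -> x \notin [:: cv 0].
  by rewrite eF => /(blk_LF ha); rewrite !inE negb_or => /andP[].
apply: (@cnt_good [:: cv 0] Fs _ (bad lam r) (hh lam) qq D v Fs) => //.
- by move=> D' x z; rewrite eF => /(blk_mem ha)[f' [l' [-> ok]]] dj e le'; apply: (rb ok).
- move=> u bu; split; first by rewrite inE; exact: bad_node hr hf bu.
  apply/negP; rewrite eF => /(blk_mem ha)[f' [l' [e ok]]].
  by case/and4P: ok => ir _ _ f6; have := bad_node ir f6 bu; rewrite e eqxx.
- move=> D' x z g hx; have [j hj ex] := mem_z ha hx; rewrite ex => dj e le'; apply: (cd b.+1 j r) => //.
  have : x \in blk false false false false a m by [].
  case/(blk_mem ha) => f' [l' [ex' ok]]; move: (ok) => /and4P[ir _ _ _].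
  have : inrg lam b.+1 j 0.
    have [ir' _ _ _] := and4P hok; have [e1' l1] := lam_lt; have [n1 n2 n3 n4 n5] := nbrP n c.
    case/and4P: ir' => h1 h2 _ _; rewrite /Layout.inrg h2 wid_gt0 andbT /=.
    by clear - h1 hj ha n2 n3 n4; lia.
  by move=> ir'; have [_ -> ->] := cn_inj ir' ir (etrans (esym ex) ex').
- by move=> x; rewrite eF => /(blk_mem ha)[f' [l' [-> ok]]]; apply: okn_lt ok.
- by rewrite inE hv; apply/negP => /andP[_ /LF]; rewrite inE eqxx.
- by rewrite eF; apply: blk_uniq.
Qed.

Definition exF (D : VS) k p := vx k p \notin D.

Local Notation F := exF.

Lemma Kreach L (D : VS) a p : cv 0 \in L -> a <= p -> p < xg 0 -> (forall p', a < p' <= p -> F D 0 p') ->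
  reach ed (locs L) D (vx 0 a) (vx 0 p).
Proof.
move=> hL hap hp h; have [hr g k2 _] := @xfacts 0 isT.
by apply: reach_pos; rewrite ?g.
Qed.

Lemma jump (D : VS) v k k' p : k < 4 -> 0 < k' < 4 -> p < xg k -> lfc (lve i) (fc k) p = cv k' ->
  reach ed (locs Ls) D v (vx k p) -> F D k' 0 -> reach ed (locs Ls) D v (vx k' 0).
Proof.
move=> hk hk' hp e hv hF; have [hr g k2 hL] := xfacts hk; apply: connect_trans hv _.
have e0 : vx k' 0 = lft (lve i) (fc k) p by rewrite lft_topc e /vx nd0_topc.
rewrite /exF e0 in hF *; apply: reach_lft => //; [by rewrite g | exact: lfc_lt].
Qed.

Lemma rblX (D : VS) v k : k < 4 -> 0 < k -> reach ed (locs Ls) D v (vx k 0) ->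
  (forall p, 0 < p < xg k -> F D k p) ->
  rbl Ls D v [seq lfc (lve i) (fc k) p | p <- iota (k < 3) (xg k - (k < 3))].
Proof.
move=> hk k0 hv hF; have [hr g k2 hL] := xfacts hk; have [n1 n2 n3 n4 n5] := nbrP n c.
have x2 : 1 < xg k by rewrite /exg (gtn_eqF k0); case: eqP => _; rewrite /Layout.nsml /Layout.nlit; have := unt_big n c; lia.
apply: (rbl_seg (l := lc k)) => //.
- by rewrite g; case: (k < 3) => /=; lia.
- by rewrite g => p hp; apply: lfc_lt.
- move=> _; apply: connect_trans hv _; apply: reach_pos; rewrite ?g //; first by case: (k < 3); lia.
  by move=> p hp; apply: hF; move: hp; case: (k < 3) => /=; lia.
- by move=> p hp; apply: hF; move: hp; case: (k < 3) => /=; lia.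
Qed.

Lemma rblK L (D : VS) v s m : cv 0 \in L -> s + m <= xg 0 -> (0 < m -> reach ed (locs L) D v (vx 0 s)) ->
  (forall p, s < p < s + m -> F D 0 p) -> rbl L D v [seq lfc (lve i) (fc 0) p | p <- iota s m].
Proof.
move=> hL hs hv hF; have [hr g k2 _] := @xfacts 0 isT.
apply: (rbl_seg (l := lc 0)) => //; first by rewrite g.
by rewrite g => p hp; apply: lfc_lt.
Qed.

Lemma xg_facts : [/\ xg 0 = nbr + 3 + nsml, xg 1 = nlit + 1, xg 2 = nlit + 1 & xg 3 = nsml].
Proof. by []. Qed.

Definition freeK (D : VS) a p1 := forall p, a < p <= p1 -> F D 0 p.
Definition clean (D : VS) k := forall p, p < xg k -> F D k p.

(** Locates a move: [k1] is the chain that it hits and [p1] the position there, with [k1 = 4] for a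
    move outside the four chains. *)
Lemma uc (u : V) (D : VS) : exists k1 p1, [/\ k1 <= 4, k1 < 4 -> p1 < xg k1 /\ u = vx k1 p1 &
  forall k p, k < 4 -> p < xg k -> F D k p -> k <> k1 \/ p <> p1 -> F (u |: D) k p].
Proof.
have [[k1 [p1 [h1 h2 h3]]]|no] := EM (exists k1 p1, [/\ k1 < 4, p1 < xg k1 & u = vx k1 p1]).
  exists k1, p1; split=> //; first by lia.
  move=> k p hk hp hF hne; rewrite /exF in_setU1 negb_or -/(exF D k p) hF andbT h3.
  by apply/eqP => /(vx_inj hk h1 hp h2); case=> ? ?; lia.
exists 4, 0; split=> // k p hk hp hF _; rewrite /exF in_setU1 negb_or -/(exF D k p) hF andbT.
by apply/eqP => e; apply: no; exists k, p.
Qed.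

(* What is visible from the position [p0] of the chain. *)
Lemma see_t (D : VS) p0 p1 : p0 <= nbr <= p1 -> p1 < xg 0 -> freeK D p0 p1 -> clean D 3 ->
  reach ed (locs Ls) D (vx 0 p0) (vx 3 0).
Proof.
move=> h1 h2 fk c3; have [_ _ _ hL] := @xfacts 0 isT; have [n1 _ _ _ _] := nbrP n c.
apply: (@jump D _ 0 3 nbr) => //; [by lia | exact: (@lf_t 0) | | by apply: c3].
by apply: Kreach => //; [lia | lia | move=> p hp; apply: fk; lia].
Qed.

Lemma see_o (D : VS) k p0 p1 : 0 < k < 3 -> p0 <= nbr + 3 - k <= p1 -> p1 < xg 0 -> freeK D p0 p1 -> F D k 0 ->
  reach ed (locs Ls) D (vx 0 p0) (vx k 0).
Proof.
move=> hk h1 h2 fk c3; have [_ _ _ hL] := @xfacts 0 isT.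
apply: (@jump D _ 0 k (nbr + 3 - k)) => //; [by lia | by lia | exact: lf_o | ].
by apply: Kreach => //; [lia | lia | move=> p hp; apply: fk; lia].
Qed.

Lemma see_ot (D : VS) v k : 0 < k < 3 -> reach ed (locs Ls) D v (vx k 0) -> clean D 3 ->
  reach ed (locs Ls) D v (vx 3 0).
Proof.
move=> hk hv c3; have [n1 n2 n3 _ _] := nbrP n c.
apply: (@jump D _ k 3 0) => //; try lia; first by case: k hk {hv} => [|[|[|]]] // _; rewrite /exg addn1.
  by have := @lf_t k; case: k hk {hv} => [|[|[|]]] // _; apply.
by apply: c3.
Qed.

Lemma see_T (D : VS) v : reach ed (locs Ls) D v (vx 3 0) -> clean D 3 ->
  rbl Ls D v [seq lfc (lve i) (fc 3) p | p <- iota 0 nsml].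
Proof.
move=> h c3; have := @rblX D v 3 isT isT h; rewrite subn0; apply=> p hp; apply: c3; lia.
Qed.

Lemma see_X (D : VS) v k : 0 < k < 3 -> reach ed (locs Ls) D v (vx k 0) -> clean D k ->
  rbl Ls D v [seq lfc (lve i) (fc k) p | p <- iota 1 nlit].
Proof.
move=> hk h ck; have := @rblX D v k; have -> : xg k - (k < 3) = nlit.
  by case: k hk {h ck} => [|[|[|]]] // _; rewrite /exg addnK.
have -> : (k < 3) = true :> bool by lia.
by move=> hh'; apply: hh' => //; [lia | lia | move=> p hp; apply: ck; lia].
Qed.

Lemma see_Z (D : VS) L p0 a m : cv 0 \in L -> p0 <= nbr + 3 + a -> a + m <= nsml ->
  (forall p, p0 < p < nbr + 3 + a + m -> F D 0 p) ->
  rbl L D (vx 0 p0) [seq lfc (lve i) (fc 0) p | p <- iota (nbr + 3 + a) m].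
Proof.
move=> hL h1 h2 fk; apply: rblK => //; first by rewrite /exg /=; lia.
  move=> m0; apply: Kreach => //; first by rewrite /exg /=; lia.
  by move=> p hp; apply: fk; lia.
by move=> p hp; apply: fk; lia.
Qed.

Lemma see_P (D : VS) : (forall p, 0 < p < nbr -> F D 0 p) ->
  rbl Ls D (vx 0 0) [seq lfc (lve i) (fc 0) p | p <- iota 0 nbr].
Proof.
move=> fk; have [_ _ _ hL] := @xfacts 0 isT; apply: rblK => //; first by rewrite /exg /=; lia.
by move=> _; apply: connect0.
Qed.

Lemma vxL k p : k < 4 -> p < xg k -> vx k p %/ wid \in Ls.
Proof. by move=> hk hp; rewrite vx_div //; have [_ _ _ ->] := xfacts hk. Qed.

(* If the challenger stays at [v] after a move and sees the given blocks, then they are few. *)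
Lemma ex_rob (D : VS) x : [disjoint ch (cv 0) & D] -> ed (vx 0 0) x -> #|D| + hh (lve i) <= RR ->
  ~~ win ed (hh (lve i)) D x.
Proof.
move=> dj ex le; apply/negP => w; have [e1 l1] := lam_lt; have [n1 n2 n3 n4 n5] := nbrP n c.
have ub := unt_big n c; have rl := RR_le; have [hr g k2 hL] := @xfacts 0 isT.
have fr p : p < xg 0 -> F D 0 p.
  move=> hp; apply/negP => hD; have := disjointFl dj hD; rewrite inE vx_div //.
  by rewrite eqxx.
have w' : win ed (hh lam + rnd) D (vx 0 0).
  have x0 : 0 < xg 0 by rewrite /exg /=; lia.
  by have := win_down ex (fr 0 x0) w; rewrite hh_pred // -e1.
rewrite hh_pred in le; last by rewrite -e1.
(* The plain part has nearly the [8 * unt] leaves that [rnd] rounds permit; the additional unit of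
   next towers exceeds this. *)
have := @ex_cnt D (vx 0 0) rnd false false false true 0 nsml w' le.
rewrite rnd_pow wid_unt => h.
suff : 2 * (0 + nsml) + 2 * nbr <= 16 * unt + 2 * RR by rewrite /Layout.nsml /Layout.nbr; lia.
have {}h : 2 * (false * nlit + false * nlit + false * nsml + true * nbr + nsml) <= 16 * unt + 2 * RR.
  apply: h => //; first by apply: vxL => //; rewrite /exg /=; lia.
  - by move=> _; apply: see_P => p hp; apply: fr; rewrite /exg /=; lia.
  - by apply: see_Z => //; move=> p hp; apply: fr; rewrite /exg /=; lia.
by rewrite !mul0n mul1n in h; lia.
Qed.

Ltac qlia := first [by repeat match goal with
  | H : ?T |- _ => match T with forall _, _ => clear H | is_true (win _ _ _ _) => clear H
    | is_true (exF _ _ _) => clear H end end; lia | lia].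

Hypothesis cd : cond lam.
Variables (r : nat -> bool) (D0 : VS).
Hypothesis gD0 : forall u, u \in D0 -> ~~ bad (lve i) r u.
Hypothesis fal : forall w, tr lam b.+1 (upd r i w) = false.

(** A move outside the four chains loses at once, so these are the only configurations that survive
    from stage to stage. *)
Definition grown (D : VS) := forall u, u \in D -> u \in D0 \/ exists2 k, k < 4 & u %/ wid = cv k.

Lemma grownU (D : VS) k p : k < 4 -> p < xg k -> grown D -> grown (vx k p |: D).
Proof.
move=> hk hp gD u; rewrite in_setU1 => /orP[/eqP->|/gD //].
by right; exists k => //; apply: vx_div.
Qed.

(** A free top of the literal false under [w] means that the pebbles are consistent with the value
    [w] of this variable. Here the pebbling is translated into a choice of value. *)
Lemma grown_good (D : VS) (w : bool) : grown D -> F D (2 - w) 0 -> forall u, u \in D -> ~~ bad lam (upd r i w) u.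
Proof.
move=> gD hF u uD; apply/negP => bu; have [e1 l1] := lam_lt.
have [hr _ _ hf] := and4P hok.
have vo (w' : bool) : oo i w' = vx w'.+1 0 by case: w'.
have own k : k < 4 -> cv k = u %/ wid -> k = 0 \/ cv k \in items i.
  by case: k => [|[|[|[|]]]] // _ _; [left | right; rewrite !inE eqxx ?orbT..].
have nb : ~~ bad (lve i) r u -> (forall k, k < 4 -> u %/ wid <> cv k) /\ (forall w' : bool, u <> oo i w').
  move=> nb; split=> [k hk e|w' e].
    case: (own k hk (esym e)) => [k0|it].
      by move: bu; rewrite k0 in e => /(bad_node hr hf); rewrite e eqxx.
    by move/negP: nb; apply; apply/or3P; apply: Or32; apply/existsP; exists (Ordinal hi); rewrite leqnn e.
  move/negP: nb; apply; apply/or3P; apply: Or32; apply/existsP; exists (Ordinal hi).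
  have hw : w' < 2 by case: (w').
  by rewrite /= leqnn e oo_div //; case: (w'); rewrite !inE eqxx ?orbT.
have ooF : u <> oo i (~~ w).
  move=> e; move/negP: hF; apply; rewrite -/(vx (2 - w) 0) -[vx _ _](_ : u = _) //.
  by rewrite e vo; case: (w).
case/or3P: (bu) => [h|/existsP[j /andP[h1 h2]]|/existsP[j /eqP e]].
- case: (gD u uD) => [/gD0/negP[]|[k hk e]]; first by apply/or3P; apply: Or31.
  have [hk' _ _ _] := xfacts hk; have [a1 a2 a3 _] := and4P hk'.
  by have := div_real (v := u); rewrite e (cn_lt a1 a2 a3) => /(_ isT); lia.
- have lj : lve j <= lve i by lia.
  case: (gD u uD) => [/gD0/negP[]|[k hk e]].
    by apply/or3P; apply: Or32; apply/existsP; exists j; rewrite lj.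
  have [hk' _ _ _] := xfacts hk; rewrite e in h2.
  have ij f' : f' < 6 -> inrg (lve j) f' 0 0 by apply: inrg_item.
  move: h2; rewrite !inE => /or3P[]/eqP ee;
    [have [e2 _ _] := cn_inj hk' (ij 3 isT) ee|have [e2 _ _] := cn_inj hk' (ij 4 isT) ee
    |have [e2 _ _] := cn_inj hk' (ij 5 isT) ee]; lia.
- have [eji|nji] := eqVneq (j : nat) i; first by apply: ooF; rewrite e /upd eji eqxx.
  have e' : u = oo j (~~ r j) by rewrite e /upd (negPf nji).
  have bj : ~~ r j < 2 by case: (r j).
  case: (gD u uD) => [/gD0/negP[]|[k hk ek]].
    by apply/or3P; apply: Or33; apply/existsP; exists j; rewrite e'.
  have [hk' _ _ _] := xfacts hk; rewrite e' oo_div // in ek.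
  have ij : inrg (lve j) (3 + ~~ r j) 0 0 by apply: inrg_item => //; lia.
  have [e2 _ _] := cn_inj ij hk' ek.
  by move/eqP: nji; apply; move: e2; rewrite /Layout.lve /Layout.lmax; have := ltn_ord j; lia.
Qed.

(** The value [w] is consistent and the next tower is false under it. So one of the [usz + 1] rounds
    goes to the leaves, and the other [usz] cannot cope with nearly [unt] of them. *)
Lemma ex_final (D : VS) p0 (w : bool) a m : grown D -> F D (2 - w) 0 -> p0 < xg 0 ->
  win ed (hh lam + (usz + 1)) D (vx 0 p0) -> #|D| + (hh lam + (usz + 1)) <= RR ->
  a + m <= nsml -> p0 <= nbr + 3 + a -> (forall p, p0 < p < nbr + 3 + a + m -> F D 0 p) ->
  2 * m <= unt + 2 * RR.
Proof.
rewrite (_ : hh lam + (usz + 1) = (hh lam).+1 + usz); last by lia.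
move=> gD hF hp w1 le ha hp0 fk; rewrite -[unt]/(2 ^ usz).
apply: (ex_cntg cd w1 le _ ha (grown_good gD hF) (fal w) _); first exact: vx_div.
by apply: see_Z => //; rewrite inE.
Qed.

Lemma ex_moves (D : VS) k v y : win ed k D v -> ed y v -> y \notin D -> exists k' u,
  [/\ k = k'.+1, win ed k' (u |: D) v & win ed k' (u |: D) u].
Proof. by move=> /winP[/subsetP/(_ y)|//]; rewrite inE => h e /negP[]; apply: h. Qed.

Lemma vx_edge p : p.+1 < xg 0 -> ed (vx 0 p.+1) (vx 0 p).
Proof.
move=> hp; have [hr g k2 hL] := @xfacts 0 isT; have r1 := @xr 0 _ isT hp.
have r0 : inrg (lve i) (fc 0) (lc 0) p by apply: (@xr 0) => //; lia.
apply: pr_eq1 => //; last exact: vn_ord.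
by rewrite pr_real ?g //; [rewrite leqNgt k2 hp | lia].
Qed.

Lemma budget (D : VS) u k : #|D| + k.+1 <= RR -> #|u |: D| + k <= RR.
Proof. by have := cardU1_le D u; lia. Qed.

Lemma unt100 : 100 <= unt. Proof. by have := unt_big n c; lia. Qed.

(** A literal block is in view when its attachment in the choice chain is reachable. The middle item
    is reached at its own position [nbr], case [t = 0], or at position [nbr + t] through the top of
    literal chain [3 - t]. *)
Lemma vis (D : VS) p0 qq (e1 e2 e3 : bool) a m :
  win ed (hh lam + qq) D (vx 0 p0) -> #|D| + (hh lam + qq) <= RR -> p0 < xg 0 ->
  (e1 -> [/\ p0 <= nbr + 2, freeK D p0 (nbr + 2) & clean D 1]) ->
  (e2 -> [/\ p0 <= nbr + 1, freeK D p0 (nbr + 1) & clean D 2]) ->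
  (e3 -> clean D 3 /\ exists2 t, t <= 2 & [/\ p0 <= nbr + t, freeK D p0 (nbr + t) & t = 0 \/ F D (3 - t) 0]) ->
  a + m <= nsml -> (0 < m -> p0 <= nbr + 3 + a) -> (0 < m -> forall p, p0 < p < nbr + 3 + a + m -> F D 0 p) ->
  2 * (e1 * nlit + e2 * nlit + e3 * nsml + m) <= 2 ^ qq + 2 * RR.
Proof.
move=> w le hp h1 h2 h3 ha hpa hz; have ub := unt_big n c.
have [x0 x1 x2 x3] := xg_facts; have es : nsml = unt - 8 by [].
rewrite -[e1 * nlit + _ + _]addn0 -{1}(mul0n nbr).
apply: (@ex_cnt D (vx 0 p0) qq e1 e2 e3 false a m) => //; first by apply: vxL.
- case/h1 => a1 a2 a3; apply: see_X => //; apply: (@see_o _ 1 p0 (nbr + 2)) => //; try qlia; apply: a3; qlia.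
- case/h2 => a1 a2 a3; apply: see_X => //; apply: (@see_o _ 2 p0 (nbr + 1)) => //; try qlia; apply: a3; qlia.
- case/h3 => c3 [t ht [a1 a2 a3]]; apply: see_T => //; case: t ht a1 a2 a3 => [|t] ht a1 a2 a3.
    by apply: (@see_t _ p0 nbr) => //; [qlia | qlia | move: a2; rewrite addn0].
  case: a3 => [//|a3]; apply: (@see_ot _ _ (3 - t.+1)) => //; first by qlia.
  by apply: (@see_o _ (3 - t.+1) p0 (nbr + t.+1)) => //; qlia.
- case: m ha hpa hz => [|m] ha hpa hz; first by move=> x.
  by apply: see_Z => //; [rewrite inE eqxx | apply: hpa | apply: hz].
Qed.

(* After the third pebble the challenger needs only the blocks of the middle item and of the leaves at
   the bottom; [k] is the literal chain whose top is still free. *)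
Lemma stage3 (D : VS) p0 k : grown D -> 0 < k < 3 ->
  p0 <= nbr \/ [/\ p0 = nbr + 2, k = 1 & F D 2 0] -> freeK D p0 (xg 0).-1 -> F D k 0 -> clean D 3 ->
  #|D| + (hh lam + (usz + 2)) <= RR -> win ed (hh lam + (usz + 2)) D (vx 0 p0) -> False.
Proof.
move=> gD hk hp fk fo c3 le w; have ub := @unt100; have rl := RR_le.
have [x0 x1 x2 x3] := xg_facts; have xk : xg k = nlit + 1 by case: k hk {hp fo} => [|[|[|]]].
have en : nbr = 8 * unt - 8 by []. have el : nlit = 2 * unt - 8 by []. have es : nsml = unt - 8 by [].
have hp' : p0.+1 < xg 0 by case: hp => [|[]]; qlia.
have F0 p : p0 < p < xg 0 -> F D 0 p by move=> h; apply: fk; qlia.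
have [k' [u [ek w1 w2]]] := ex_moves w (vx_edge hp') (F0 p0.+1 (ltac:(qlia))).
have ek' : k' = hh lam + (usz + 1) by qlia.
rewrite {}ek' {ek} in w1 w2; have leu : #|u |: D| + (hh lam + (usz + 1)) <= RR by apply: budget; rewrite -addnS -addnS.
have p2 : 2 ^ (usz + 1) = 2 * unt by rewrite usz_pow mulnC.
have [k1 [p1 [k14 hu fu]]] := uc u D.
have gDu : k1 < 4 -> grown (u |: D) by move=> h; have [h1 ->] := hu h; apply: grownU.
have p0x : p0 < xg 0 by qlia.
have fu0 p : p0 < p < xg 0 -> k1 <> 0 \/ p <> p1 -> F (u |: D) 0 p.
  by move=> h1 h2; apply: fu; try qlia; apply: F0.
have fuk : k1 <> k \/ p1 <> 0 -> F (u |: D) k 0 by move=> h; apply: fu; try qlia.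
have fu3 : k1 <> 3 -> clean (u |: D) 3 by move=> h p hpp; apply: fu => //; [apply: c3 | qlia].
(* If the move does not separate [p0] from the middle item and the next towers, they offer two units
   of leaves, while [usz + 1] rounds permit one. *)
have stay m : m <= nsml -> k1 <> 3 ->
   (k1 = 0 -> p1 <= p0 \/ nbr + 3 + m <= p1) -> (p0 <= nbr \/ k1 <> k \/ p1 <> 0) ->
   2 * (nsml + m) <= 2 * unt + 2 * RR.
  move=> hm k3 hst ho; have := @vis _ p0 (usz + 1) false false true 0 m w1 leu p0x.
  rewrite p2 mul1n !mul0n; apply=> //; last by move=> _ p hpp; apply: fu0; qlia.
    move=> _; split; first exact: fu3.
    case: (leqP p0 nbr) => hpn.
      exists 0 => //; split; [qlia | | by left].
      by move=> p hpp; apply: fu0; qlia.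
    case: hp => [|[hp0 hk1 f2]]; first by qlia.
    exists 2 => //; split; [qlia | by move=> p; qlia | right].
    by rewrite (_ : 3 - 2 = k) ?hk1 // -hk1; apply: fuk; qlia.
  by move=> _; case: hp => [|[]]; qlia.
have [w' kw] : exists w' : bool, k = 2 - w' by case: k hk {hp fo xk stay fuk} => [|[|[|]]] // _; [exists true | exists false].
have k1c : k1 = 0 \/ k1 = 3 \/ k1 = 4 \/ 0 < k1 < 3 by qlia.
case: k1c => [k10|[k13|[k14'|k112]]].
- have [hle|hlt] := leqP p1 p0; first by have := stay nsml; qlia.
  have [h1 eu] := hu (ltac:(qlia)); rewrite k10 in h1 eu.
  have fuk' : F (u |: D) (2 - w') 0 by rewrite -kw; apply: fuk; qlia.
  rewrite {2}eu in w2.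
  have fz p : p1 < p < xg 0 -> F (u |: D) 0 p by move=> hpp; apply: fu0; qlia.
  have [hle1|hgt1] := leqP p1 (nbr + 1).
    have hpn : p0 <= nbr by case: hp => [|[]]; qlia.
    have := @vis _ p1 (usz + 1) false false true 0 nsml w2 leu h1.
    rewrite p2 mul1n !mul0n => h; suff : 2 * (nsml + nsml) <= 2 * unt + 2 * RR by qlia.
    apply: h => //; [|qlia|by move=> _ p hpp; apply: fz; qlia].
    move=> _; split; first by apply: fu3; qlia.
    exists (3 - k); [qlia | split; [qlia | by move=> p hpp; apply: fz; qlia |]].
    by right; rewrite subKn; [apply: fuk; qlia | qlia].
  have [hle2|hgt2] := leqP p1 (nbr + 2).
    have h := @ex_final _ p1 w' 0 nsml (gDu (ltac:(qlia))) fuk' h1 w2 leu.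
    suff : 2 * nsml <= unt + 2 * RR by qlia.
    by apply: h; [qlia | qlia | move=> p hpp; apply: fz; qlia].
  (* The move cuts the stretch of next towers. Staying shows that the part before the cut is short,
     so following leaves almost all of the stretch. *)
  have hm : 2 * (nsml + (p1 - (nbr + 3))) <= 2 * unt + 2 * RR by apply: stay; qlia.
  have h := @ex_final _ p1 w' (p1 - (nbr + 3)) (nsml - (p1 - (nbr + 3))) (gDu (ltac:(qlia))) fuk' h1 w2 leu.
  suff : 2 * (nsml - (p1 - (nbr + 3))) <= unt + 2 * RR by qlia.
  by apply: h; [qlia | qlia | move=> p hpp; apply: fz; qlia].
- have fuk' : F (u |: D) (2 - w') 0 by rewrite -kw; apply: fuk; qlia.
  have h := @ex_final _ p0 w' 0 nsml (gDu (ltac:(qlia))) fuk' p0x w1 leu.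
  suff : 2 * nsml <= unt + 2 * RR by qlia.
  by apply: h; [qlia | case: hp => [|[]]; qlia | move=> p hpp; apply: fu0; qlia].
- by have := stay nsml; qlia.
- have [hc|hc] := EM (p0 <= nbr \/ k1 <> k \/ p1 <> 0); first by have := stay nsml; qlia.
  case: hp => [|[hp0 hk1 f2]]; first by qlia.
  have fuk' : F (u |: D) (2 - false) 0 by rewrite (_ : 2 - false = 2) //; apply: fu => //; qlia.
  have h := @ex_final _ p0 false 0 nsml (gDu (ltac:(qlia))) fuk' p0x w1 leu.
  suff : 2 * nsml <= unt + 2 * RR by qlia.
  by apply: h; [qlia | qlia | move=> p hpp; apply: fu0; qlia].
Qed.

(** The third pebble must fall inside the clean literal chain [k], below its top. Any other move
    leaves in view at least that chain together with the middle item or the next towers, three units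
    against the two that [usz + 2] rounds permit. *)
Lemma stage2 (D : VS) p0 k : grown D -> 0 < k < 3 ->
  p0 <= nbr \/ [/\ p0 = nbr + 2, k = 1 & clean D 2] -> freeK D p0 (xg 0).-1 -> clean D k -> clean D 3 ->
  #|D| + (hh lam + (usz + 3)) <= RR -> win ed (hh lam + (usz + 3)) D (vx 0 p0) -> False.
Proof.
move=> gD hk hp fk ck c3 le w; have ub := @unt100; have rl := RR_le.
have [x0 x1 x2 x3] := xg_facts; have xk : xg k = nlit + 1 by case: k hk {hp ck} => [|[|[|]]].
have en : nbr = 8 * unt - 8 by []. have el : nlit = 2 * unt - 8 by []. have es : nsml = unt - 8 by [].
have hp' : p0.+1 < xg 0 by case: hp => [|[]]; qlia.
have F0 p : p0 < p < xg 0 -> F D 0 p by move=> h; apply: fk; qlia.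
have [k' [u [ek w1 w2]]] := ex_moves w (vx_edge hp') (F0 p0.+1 (ltac:(qlia))).
have ek' : k' = hh lam + (usz + 2) by qlia.
rewrite {}ek' {ek} in w1 w2; have leu : #|u |: D| + (hh lam + (usz + 2)) <= RR by apply: budget; rewrite -addnS -addnS.
have p2 : 2 ^ (usz + 2) = 4 * unt by rewrite usz_pow mulnC.
have [k1 [p1 [k14 hu fu]]] := uc u D.
have p0x : p0 < xg 0 by qlia.
have fu0 p : p0 < p < xg 0 -> k1 <> 0 \/ p <> p1 -> F (u |: D) 0 p.
  by move=> h1 h2; apply: fu; try qlia; apply: F0.
have fuk : k1 <> k -> clean (u |: D) k by move=> h p hpp; apply: fu; try qlia; apply: ck.
have fuk0 : k1 <> k \/ p1 <> 0 -> F (u |: D) k 0 by move=> h; apply: fu; try qlia; apply: ck; qlia.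
have fu3 : k1 <> 3 -> clean (u |: D) 3 by move=> h p hpp; apply: fu => //; [apply: c3 | qlia].
have ksum : (k == 1) * nlit + (k == 2) * nlit = nlit by case: k hk {hp ck xk fuk fuk0} => [|[|[|]]] //= _; qlia.
have stay (e3 : bool) m : m <= nsml -> k1 <> k -> (e3 -> k1 <> 3) ->
   (k1 = 0 -> p1 <= p0 \/ (nbr + 2 < p1 /\ (0 < m -> nbr + 3 + m <= p1)) \/ (m = 0 /\ k = 2 /\ nbr + 1 < p1)) ->
   2 * (nlit + e3 * nsml + m) <= 4 * unt + 2 * RR.
  move=> hm kk k3 hst; have := @vis _ p0 (usz + 2) (k == 1) (k == 2) e3 0 m w1 leu p0x.
  rewrite p2 ksum; apply=> //.
  - move=> /eqP k1'; split; [by case: hp => [|[]]; qlia | by move=> p hpp; apply: fu0; qlia |].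
    by rewrite -k1'; apply: fuk; qlia.
  - move=> /eqP k2'; split; [by case: hp => [|[]]; qlia | by move=> p hpp; apply: fu0; qlia |].
    by rewrite -k2'; apply: fuk; qlia.
  - move=> e3'; split; first by apply: fu3; apply: k3.
    case: (leqP p0 nbr) => hpn.
      exists 0 => //; split; [qlia | | by left].
      by move=> p hpp; apply: fu0; qlia.
    case: hp => [|[hp0 hk1 f2]]; first by qlia.
    exists 2 => //; split; [qlia | by move=> p; qlia | right].
    by rewrite (_ : 3 - 2 = k) ?hk1 // -hk1; apply: fuk0; qlia.
  - by move=> _; case: hp => [|[]]; qlia.
  - by move=> m0 p hpp; apply: fu0; qlia.
have k1c : k1 = 0 \/ k1 = 3 \/ k1 = 4 \/ 0 < k1 < 3 by qlia.
case: k1c => [k10|[k13|[k14'|k112]]].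
- have [hle|hlt] := leqP p1 p0; first by have := stay true nsml; qlia.
  have [h1 eu] := hu (ltac:(qlia)); rewrite k10 in h1 eu; rewrite {2}eu in w2.
  have fz p : p1 < p < xg 0 -> F (u |: D) 0 p by move=> hpp; apply: fu0; qlia.
  have [hgt|hle2] := ltnP (nbr + 2) p1; first by have := stay true 0; qlia.
  have hpn : p0 <= nbr by case: hp => [|[]]; qlia.
  have [[p12 k2]|hc] := EM (p1 = nbr + 2 /\ k = 2); first by have := stay true 0; qlia.
  have := @vis _ p1 (usz + 2) (k == 1) (k == 2) true 0 nsml w2 leu h1.
  rewrite p2 ksum mul1n => h; suff : 2 * (nlit + nsml + nsml) <= 4 * unt + 2 * RR by qlia.
  apply: h => //.
  + move=> /eqP k1'; split; [by qlia | by move=> p hpp; apply: fz; qlia |].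
    by rewrite -k1'; apply: fuk; qlia.
  + move=> /eqP k2'; split; [by qlia | by move=> p hpp; apply: fz; qlia |].
    by rewrite -k2'; apply: fuk; qlia.
  + move=> _; split; first by apply: fu3; qlia.
    exists (3 - k); [qlia | split; [qlia | by move=> p hpp; apply: fz; qlia |]].
    by right; rewrite subKn; [apply: fuk0; qlia | qlia].
  + qlia.
  + by move=> _ p hpp; apply: fz; qlia.
- by have := stay false nsml; qlia.
- by have := stay true nsml; qlia.
- have [ek|nk] := eqVneq k1 k; last by have := stay true nsml; qlia.
  have [h1 eu] := hu (ltac:(qlia)).
  have [p10|p1p] := posnP p1; last first.
    apply: (@stage3 (u |: D) p0 k) => //.
    + by rewrite eu; apply: grownU => //; qlia.
    + case: hp => [|[a1 a2 a3]]; [by left | right; split=> //].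
      by apply: fu; try qlia; apply: a3; qlia.
    + by move=> p hpp; apply: fu0; qlia.
    + by apply: fuk0; qlia.
    + by apply: fu3; qlia.
  rewrite {2}eu ek p10 in w2.
  have c3' : clean (u |: D) 3 by apply: fu3; qlia.
  have rX : rbl Ls (u |: D) (vx k 0) [seq lfc (lve i) (fc k) p | p <- iota 1 nlit].
    have := @rblX (u |: D) (vx k 0) k; rewrite xk.
    have -> : (k < 3) = true :> bool by qlia.
    rewrite addnK => h; apply: h; [qlia | qlia | exact: connect0 |].
    by move=> p hpp; apply: fu; [qlia | qlia | apply: ck; qlia | qlia].
  have := @ex_cnt (u |: D) (vx k 0) (usz + 2) (k == 1) (k == 2) true false 0 0 w2 leu.
  rewrite p2 ksum mul1n mul0n => h; suff : 2 * (nlit + nsml + 0 + 0) <= 4 * unt + 2 * RR by qlia.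
  apply: h => //.
  + by apply: vxL; qlia.
  + by move=> /eqP k1'; rewrite k1' in rX *.
  + by move=> /eqP k1'; rewrite k1' in rX *.
  + by move=> _; apply: see_T => //; apply: (@see_ot _ _ k) => //; apply: connect0.
Qed.

(** The second pebble must hit a literal chain or fall at position [nbr + 2], which separates the
    two literals. Any other move leaves both literals and one more block in view, five units against
    the four that [usz + 3] rounds permit. *)
Lemma stage1 (D : VS) p0 : grown D -> p0 <= nbr -> freeK D p0 (xg 0).-1 -> clean D 1 -> clean D 2 -> clean D 3 ->
  #|D| + (hh lam + (usz + 4)) <= RR -> win ed (hh lam + (usz + 4)) D (vx 0 p0) -> False.
Proof.
move=> gD hp fk ck1 ck2 c3 le w; have ub := @unt100; have rl := RR_le.
have [x0 x1 x2 x3] := xg_facts.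
have en : nbr = 8 * unt - 8 by []. have el : nlit = 2 * unt - 8 by []. have es : nsml = unt - 8 by [].
have hp' : p0.+1 < xg 0 by qlia.
have F0 p : p0 < p < xg 0 -> F D 0 p by move=> h; apply: fk; qlia.
have [k' [u [ek w1 w2]]] := ex_moves w (vx_edge hp') (F0 p0.+1 (ltac:(qlia))).
have ek' : k' = hh lam + (usz + 3) by qlia.
rewrite {}ek' {ek} in w1 w2; have leu : #|u |: D| + (hh lam + (usz + 3)) <= RR by apply: budget; rewrite -addnS -addnS.
have p2 : 2 ^ (usz + 3) = 8 * unt by rewrite usz_pow mulnC.
have [k1 [p1 [k14 hu fu]]] := uc u D.
have p0x : p0 < xg 0 by qlia.
have fu0 p : p0 < p < xg 0 -> k1 <> 0 \/ p <> p1 -> F (u |: D) 0 p.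
  by move=> h1 h2; apply: fu; try qlia; apply: F0.
have fuk k : 0 < k < 4 -> k1 <> k -> clean (u |: D) k.
  move=> hk h p hpp; apply: fu; try qlia.
  by case: k hk hpp {h} => [|[|[|[|]]]] // _; [apply: ck1 | apply: ck2 | apply: c3].
have stay (e3 : bool) m : m <= nsml -> k1 = 0 \/ 2 < k1 -> (e3 -> k1 <> 3) ->
   (k1 = 0 -> p1 <= p0 \/ (nbr + 2 < p1 /\ (0 < m -> nbr + 3 + m <= p1))) ->
   2 * (nlit + nlit + e3 * nsml + m) <= 8 * unt + 2 * RR.
  move=> hm kk k3 hst; have := @vis _ p0 (usz + 3) true true e3 0 m w1 leu p0x.
  rewrite p2 mul1n; apply=> //.
  - by move=> _; split; [qlia | by move=> p hpp; apply: fu0; qlia | apply: fuk; qlia].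
  - by move=> _; split; [qlia | by move=> p hpp; apply: fu0; qlia | apply: fuk; qlia].
  - move=> e3'; split; first by apply: fuk => //; apply: k3.
    exists 0 => //; split; [qlia | | by left].
    by move=> p hpp; apply: fu0; qlia.
  - qlia.
  - by move=> m0 p hpp; apply: fu0; qlia.
have k1c : k1 = 0 \/ k1 = 3 \/ k1 = 4 \/ 0 < k1 < 3 by qlia.
case: k1c => [k10|[k13|[k14'|k112]]].
- have [hle|hlt] := leqP p1 p0; first by have := stay true nsml; qlia.
  have [h1 eu] := hu (ltac:(qlia)); rewrite k10 in h1 eu; rewrite {2}eu in w2.
  have fz p : p1 < p < xg 0 -> F (u |: D) 0 p by move=> hpp; apply: fu0; qlia.
  have [hgt|hle2] := ltnP (nbr + 2) p1; first by have := stay true 0; qlia.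
  have [p12|p12] := eqVneq p1 (nbr + 2).
    rewrite p12 in w2 fz; apply: (@stage2 (u |: D) (nbr + 2) 1) => //.
    + by rewrite eu; apply: grownU.
    + by right; split=> //; apply: fuk; qlia.
    + by move=> p hpp; apply: fz; qlia.
    + by apply: fuk; qlia.
    + by apply: fuk; qlia.
  have := @vis _ p1 (usz + 3) true true true 0 nsml w2 leu h1.
  rewrite p2 mul1n => h; suff : 2 * (nlit + nlit + 1 * nsml + nsml) <= 8 * unt + 2 * RR by qlia.
  apply: h => //.
  + by move=> _; split; [qlia | by move=> p hpp; apply: fz; qlia | apply: fuk; qlia].
  + by move=> _; split; [qlia | by move=> p hpp; apply: fz; qlia | apply: fuk; qlia].
  + move=> _; split; first by apply: fuk; qlia.
    exists 1 => //; split; [qlia | by move=> p hpp; apply: fz; qlia |].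
    by right; apply: (fuk 2); qlia.
  + qlia.
  + by move=> _ p hpp; apply: fz; qlia.
- by have := stay false nsml; qlia.
- by have := stay true nsml; qlia.
- have [h1 eu] := hu (ltac:(qlia)).
  apply: (@stage2 (u |: D) p0 (3 - k1)) => //.
  + by rewrite eu; apply: grownU => //; qlia.
  + qlia.
  + by left.
  + by move=> p hpp; apply: fu0; qlia.
  + by apply: fuk; qlia.
  + by apply: fuk; qlia.
Qed.

(** The first pebble must fall in the choice chain at a position up to [nbr]; otherwise the plain
    part and one more block are in view, nine units against eight. The challenger follows it, and
    the stages deal with the remaining three pebbles. *)
Lemma ex_cond x : [disjoint ch (cv 0) & D0] -> ed (vx 0 0) x -> #|D0| + (hh (lve i)).+1 <= RR ->
  ~~ win ed (hh (lve i)).+1 D0 x.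
Proof.
move=> dj ex; have [e1 l1] := lam_lt; rewrite hh_pred => [le|]; last by rewrite -e1.
apply/negP => w; have ub := @unt100; have rl := RR_le.
have [x0 x1 x2 x3] := xg_facts.
have en : nbr = 8 * unt - 8 by []. have el : nlit = 2 * unt - 8 by []. have es : nsml = unt - 8 by [].
have fr p : p < xg 0 -> F D0 0 p.
  move=> hp; apply/negP => hD; have := disjointFl dj hD.
  by rewrite inE (@vx_div 0) // eqxx.
have ci k : 0 < k < 4 -> clean D0 k.
  move=> hk p hp; apply/negP => /gD0/negP[]; apply/or3P; apply: Or32; apply/existsP; exists (Ordinal hi).
  by rewrite leqnn vx_div //=; [case: k hk hp => [|[|[|[|]]]] // _ _; rewrite !inE eqxx ?orbT | qlia].
have {}w := win_down ex (fr 0 (ltac:(qlia))) w.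
have [k' [u [ek w1 w2]]] := ex_moves w (@vx_edge 0 (ltac:(qlia))) (fr 1 (ltac:(qlia))).
have ek' : k' = hh lam + (usz + 4) by move: ek => [->].
rewrite {}ek' {ek} in w1 w2; have leu : #|u |: D0| + (hh lam + (usz + 4)) <= RR by apply: budget.
have p2 : 2 ^ (usz + 4) = 16 * unt by rewrite usz_pow mulnC.
have [k1 [p1 [k14 hu fu]]] := uc u D0.
have fu0 p : p < xg 0 -> k1 <> 0 \/ p <> p1 -> F (u |: D0) 0 p.
  by move=> h1 h2; apply: fu; try qlia; apply: fr.
have fuk k : 0 < k < 4 -> k1 <> k -> clean (u |: D0) k.
  by move=> hk h p hpp; apply: fu; try qlia; apply: ci.
have g0 : grown D0 by move=> v; left.
have stay (e3 : bool) m : m <= nsml -> (e3 -> k1 <> 3) -> (k1 = 0 -> nbr < p1) -> (0 < m -> k1 <> 0) ->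
   2 * (e3 * nsml + nbr + m) <= 16 * unt + 2 * RR.
  move=> hm h3 h0 hz.
  have := @ex_cnt (u |: D0) (vx 0 0) (usz + 4) false false e3 true 0 m w1 leu.
  rewrite p2 mul1n !mul0n; apply=> //.
  - by apply: vxL; qlia.
  - move=> e3'; apply: see_T; last by apply: fuk => //; apply: h3.
    apply: (@see_t _ 0 nbr) => //; [qlia | qlia | by move=> p hpp; apply: fu0; qlia |].
    by apply: fuk => //; apply: h3.
  - by move=> _; apply: see_P => p hpp; apply: fu0; qlia.
  - case: m hm hz => [|m] hm hz; first by move=> x'.
    by apply: see_Z => //; [rewrite inE eqxx | move=> p hpp; apply: fu0; qlia].
have [k10|k1p] := posnP k1; last by have := stay false nsml; qlia.
have [h1 eu] := hu (ltac:(qlia)); rewrite k10 in h1 eu; rewrite {2}eu in w2.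
have [hle|hgt] := leqP p1 nbr; last by have := stay true 0; qlia.
apply: (@stage1 (u |: D0) p1) => //; try by apply: fuk; qlia.
- by rewrite eu; apply: grownU.
- by move=> p hpp; apply: fu0; qlia.
Qed.
End Ex.

Lemma okn_top lam f l (D : VS) x : okn lam f l -> [disjoint ch (cn lam f l) & D] -> ed (topc (cn lam f l)) x ->
  ed (nd lam f l 0) x /\ nd lam f l 0 \notin D.
Proof.
move=> ok dj ex; rewrite nd0_topc; split=> //; apply: clean_top dj.
exact: okn_lt ok.
Qed.

Lemma okn_kd lam f l : 0 < lam -> okn lam f l -> kd lam f = 3 \/ kd lam f = 5.
Proof.
move=> l0 /and4P[hr hl lv hf]; have := live_node lv hl hf.
rewrite /UpperBound.isnode !inE => /or4P[]/eqP h; [| |by left|by right];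
by exfalso; move: h; rewrite /Layout.kd (gtn_eqF l0); do ![case: ifP => _ //].
Qed.

Lemma fork_node lam f l : 0 < lam -> okn lam f l -> kd lam f = 3 -> forall p, p < 2 * nbr ->
  lfc lam f (p + 0) = cn lam.-1 (brf lam f p) p /\ okn lam.-1 (brf lam f p) p.
Proof.
move=> l0 /and4P[hr hl lv hf] k p hp; rewrite addn0 kd_br_lfc //; split=> //.
have [h1 h2 h3 h4] := and4P hr; have [n1 n2 n3 n4 n5] := nbrP n c; have w0 := wid_gt0 n c.
have [a1 a2 a3 a4] := live_br h2 h1 lv k hp.
apply/and4P; split=> //; [| by lia | exact: brf_fam].
by rewrite /Layout.inrg a2 w0 andbT /=; apply/andP; split; lia.
Qed.

Lemma fork_lt lam f l : inrg lam f l 0 -> 2 < kd lam f -> forall p, p < gl lam f l -> lfc lam f p < chains.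
Proof.
move=> hr k2 p hp; have hpw : p < wid by have := gl_le n c lam f l; lia.
have [lam' [f' [l' [-> /and4P[h1 h2 h3 _] _]]]] := lfc_spec (inrg_pos hr hpw) hp k2.
exact: cn_lt.
Qed.

Theorem rob_all lam : rob lam.
Proof.
elim: lam => [|lam IH]; first exact: bottom_rob.
move=> f l D x ok dj ex le; have [ex' nD] := okn_top ok dj ex; have [hr hl lv hf] := and4P ok.
case: (@okn_kd lam.+1 f l isT ok) => k.
  apply/negP => w; have := win_down ex' nD w; apply/negP.
  apply: (@fork_rob lam.+1 f l 0) => //.
  - by rewrite k.
  - by rewrite kd_brE // addn0.
  - by move=> p hp; apply: (fork_node (l := l)).
  - by move=> p; apply: fork_lt => //; rewrite k.
have [h1 h2 h3 h4] := and4P hr.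
have [i [b [hi hb fb lb]]] := kd_ex k h1; subst f; rewrite lb in ok dj ex' le *.
have el : lam = (lve i).-1 by rewrite -lb.
by apply: (@ex_rob i b l) => //; rewrite -el.
Qed.

Theorem cond_all lam : cond lam.
Proof.
elim: lam => [|lam IH]; first exact: bottom_cond.
move=> f l r D x ok dj gD ht ex le; have [ex' nD] := okn_top ok dj ex; have [hr hl lv hf] := and4P ok.
have [h1 h2 h3 h4] := and4P hr; have rb := @rob_all lam.
case: (@okn_kd lam.+1 f l isT ok) => k.
  apply/negP => w; have := win_down ex' nD w; apply/negP.
  apply: (@fork_cond lam.+1 f l 0 _ _ _ _ _ _ _ _ D r) => //.
  - by rewrite k.
  - by rewrite kd_brE // addn0.
  - by move=> p hp; apply: (fork_node (l := l)).
  - by move=> p; apply: fork_lt => //; rewrite k.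
  - move: ht; rewrite [tr _ _ _]/= k /=; case: eqP => // f0; case: ifP => // f5.
    have e br : br = f -> tr lam br r = tst (f - 6) r by move=> ->; case: (lam) => /=; rewrite (introF eqP f0) f5.
    have [-> ->] : br0 lam.+1 f = f /\ br1 lam.+1 f = f.
      by clear - f5; rewrite /Layout.br0 /Layout.br1; case: f f5 => [|[|[|]]].
    by rewrite !e ?andbb.
have [i [b [hi hb fb lb]]] := kd_ex k h1; subst f; rewrite lb in ok dj ex' le gD ht *.
have el : lam = (lve i).-1 by rewrite -lb.
rewrite (@tr_ex n c q lf i b r hi hb) -el in ht; case/norP: (negbT ht) => f1 f2.
rewrite el in rb IH f1 f2; apply: (@ex_cond i b l hi hb ok rb IH r D) => //.
by case; apply/negbTE.
Qed.

Lemma root_lb (c0 : bool) : ~~ (c0 && root_true n c q lf) ->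
  ~~ win ed (hh lmax.+1 + ~~ c0 * 0 + c0) set0 (ov root).
Proof.
have [k4 g4] := kd_rootE n c; have hrr := root_range n c; have [n1 n2 n3 n4 n5] := nbrP n c.
have w0 := wid_gt0 n c; have f0 := fams_gt0 n c.
have hlf p : p < 2 * nbr -> lfc lmax.+1 1 (p + 1) = cn lmax (brf lmax.+1 1 p) p /\ okn lmax (brf lmax.+1 1 p) p.
  move=> hp; have eb : brf lmax.+1 1 p = if p < nbr then 0 else 1.
    by rewrite /Layout.brf /Layout.br0 /Layout.br1 /= eqxx /Layout.isvar ltnn andbF.
  rewrite lfc_rootE addn1 /= eb; split=> //; case: ltnP => h.
    rewrite /okn /Layout.inrg f0 w0 leqnn !andbT /=.
    by rewrite /Layout.live /= eqxx h orbT andbT; lia.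
  rewrite /okn /Layout.inrg w0 leqnn !andbT /= -[lmax]/(lmax.+1.-1) live_top h hp /=.
  by rewrite /Layout.fams; lia.
have hc p : p < gl lmax.+1 1 0 -> lfc lmax.+1 1 p < chains.
  by apply: fork_lt => //; rewrite k4.
have dj : [disjoint ch (cn lmax.+1 1 0) & (set0 : VS)] by rewrite disjoint_sym; apply/pred0P => v; rewrite /= inE.
have e : ov root = nd lmax.+1 1 0 0 by [].
rewrite e; case: c0 => /= ht; rewrite ?mul1n ?muln0 ?mul0n ?addn0 ?addn1.
  apply: (@fork_cond lmax.+1 1 0 1 _ _ _ _ _ _ _ _ set0 (fun _ => false)) => //.
  - by rewrite k4.
  - exact: rob_all.
  - exact: cond_all.
  - by move=> u; rewrite inE.
  - have [-> ->] : br0 lmax.+1 1 = 0 /\ br1 lmax.+1 1 = 1.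
      by rewrite /Layout.br0 /Layout.br1 /= eqxx /Layout.isvar ltnn andbF.
    by rewrite -[tr lmax 1 _]/(root_true n c q lf) (negbTE ht) andbF.
  - by rewrite cards0 /RR /UpperBound.H /hh; lia.
apply: (@fork_rob lmax.+1 1 0 1) => //.
- by rewrite k4.
- exact: rob_all.
- by rewrite cards0 /RR /UpperBound.H /hh; lia.
Qed.

Theorem pdag_price : rev_price (pdag n c q lf) = H lmax.+1 + 1 + ~~ root_true n c q lf.
Proof.
have sk : dag_sink (pdag n c q lf) = ov root by apply: val_inj; rewrite /= ovK // root_lt.
apply/eqP; rewrite eqn_leq; apply/andP; split.
  have := @price_ub n c q lf (~~ root_true n c q lf); rewrite orNb => /(_ isT).
  by rewrite addn1 addSn.
case ht : (root_true n c q lf); rewrite /= ?addn0 addn1.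
  have := @root_lb false isT; rewrite /= mul1n !addn0 => h; rewrite HhE.
  by rewrite ltnNge rev_price_le /= -[Ordinal _]/(dag_sink (pdag n c q lf)) sk.
have := @root_lb true; rewrite ht /= mul0n addn0 => /(_ isT) h; rewrite HhE addn1.
by rewrite ltnNge rev_price_le /= -[Ordinal _]/(dag_sink (pdag n c q lf)) sk -addn1.
Qed.
End GraphB.

End LowerBound.

(** * Structured programs as Turing machines *)

Module Tape.

Section Prog.
Variables (K : nat).
Notation A := void.
Notation tapes := ('I_K.+1 -> tape A).
Notation heads := {ffun 'I_K.+1 -> symbol A}.
Notation action := ('I_K.+1 -> symbol A * move).

Inductive prog :=
| Act of (heads -> action)
| Seq of prog & prog
| If of (heads -> bool) & prog & prog
| While of (heads -> bool) & prog.

Definition hds (t : tapes) : heads := [ffun i => tape_head (t i)].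
Definition act (a : action) (t : tapes) : tapes := fun i => tape_act (t i) (a i).1 (a i).2.
Definition tspace (t : tapes) := \sum_i tape_size (t i).
Definition stay (h : heads) : action := fun i => (h i, MoveN).

Lemma act_stay t : act (stay (hds t)) t = t.
Proof. by apply/funext => i; rewrite /act /stay ffunE; case: (t i). Qed.

(** Big-step runs: [m] counts machine steps, each test costing one, and [S] bounds the space at
    every intermediate configuration. *)
Inductive ev (S : nat) : prog -> tapes -> nat -> tapes -> Prop :=
| EvAct a t : tspace t <= S -> tspace (act (a (hds t)) t) <= S -> ev S (Act a) t 1 (act (a (hds t)) t)
| EvSeq p q t m t' k t'' : ev S p t m t' -> ev S q t' k t'' -> ev S (Seq p q) t (m + k) t''
| EvIf (b : heads -> bool) p q t m t' : tspace t <= S -> ev S (if b (hds t) then p else q) t m t' -> ev S (If b p q) t m.+1 t'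
| EvStop (b : heads -> bool) p t : tspace t <= S -> ~~ b (hds t) -> ev S (While b p) t 1 t
| EvLoop (b : heads -> bool) p t m t' k t'' : tspace t <= S -> b (hds t) -> ev S p t m t' -> ev S (While b p) t' k t'' ->
    ev S (While b p) t (m + k).+1 t''.

Fixpoint st (p : prog) : finType :=
  match p with
  | Act _ => unit
  | Seq p q => (st p + st q)%type
  | If _ p q => option (st p + st q)
  | While _ p => option (st p)
  end.

Fixpoint start (p : prog) : st p :=
  match p with
  | Act _ => tt
  | Seq p q => inl (start p)
  | If _ p q => None
  | While _ p => None
  end.

(* [None] as next state means that the program is left. *)
Fixpoint step (p : prog) : st p -> heads -> option (st p) * action :=
  match p return st p -> heads -> option (st p) * action with
  | Act a => fun _ h => (None, a h)
  | Seq p q => fun s h => match s with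
      | inl s => let: (o, a) := step s h in (Some (if o is Some s' then inl s' else inr (start q)), a)
      | inr s => let: (o, a) := step s h in (omap inr o, a)
      end
  | If b p q => fun s h => match s with
      | None => (Some (Some (if b h then inl (start p) else inr (start q))), stay h)
      | Some (inl s) => let: (o, a) := step s h in (omap (fun s' => Some (inl s')) o, a)
      | Some (inr s) => let: (o, a) := step s h in (omap (fun s' => Some (inr s')) o, a)
      end
  | While b p => fun s h => match s with
      | None => (if b h then Some (Some (start p)) else None, stay h)
      | Some s => let: (o, a) := step s h in (Some o, a)
      end
  end.

Inductive rn (S : nat) (p : prog) : st p -> tapes -> nat -> tapes -> Prop :=
| RnExit s t a : tspace t <= S -> step s (hds t) = (None, a) -> tspace (act a t) <= S -> rn S s t 1 (act a t)
| RnNext s t a s' m t' : tspace t <= S -> step s (hds t) = (Some s', a) -> rn S s' (act a t) m t' ->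
    rn S s t m.+1 t'.

Lemma rn_seq_r S p q (s : st q) t m t' : rn S s t m t' -> rn S (inr s : st (Seq p q)) t m t'.
Proof.
elim=> [{}s {}t a sp e sp'|{}s {}t a s' {}m {}t' sp e _ IH].
  by apply: RnExit => //=; rewrite e.
by apply: RnNext IH => //=; rewrite e.
Qed.

Lemma rn_seq S p q (s : st p) t m t' k t'' : rn S s t m t' -> rn S (start q) t' k t'' ->
  rn S (inl s : st (Seq p q)) t (m + k) t''.
Proof.
move=> h hq; elim: h hq => [{}s {}t a sp e sp'|{}s {}t a s' {}m {}t' sp e _ IH] hq.
  by apply: RnNext (rn_seq_r p hq) => //=; rewrite e.
by apply: RnNext (IH hq) => //=; rewrite e.
Qed.

Lemma rn_if_l S b p q (s : st p) t m t' : rn S s t m t' -> rn S (Some (inl s) : st (If b p q)) t m t'.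
Proof.
elim=> [{}s {}t a sp e sp'|{}s {}t a s' {}m {}t' sp e _ IH].
  by apply: RnExit => //=; rewrite e.
by apply: RnNext IH => //=; rewrite e.
Qed.

Lemma rn_if_r S b p q (s : st q) t m t' : rn S s t m t' -> rn S (Some (inr s) : st (If b p q)) t m t'.
Proof.
elim=> [{}s {}t a sp e sp'|{}s {}t a s' {}m {}t' sp e _ IH].
  by apply: RnExit => //=; rewrite e.
by apply: RnNext IH => //=; rewrite e.
Qed.

Lemma rn_while S b p (s : st p) t m t' k t'' : rn S s t m t' -> rn S (None : st (While b p)) t' k t'' ->
  rn S (Some s : st (While b p)) t (m + k) t''.
Proof.
move=> h hq; elim: h hq => [{}s {}t a sp e sp'|{}s {}t a s' {}m {}t' sp e _ IH] hq.
  by apply: RnNext hq => //=; rewrite e.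
by apply: RnNext (IH hq) => //=; rewrite e.
Qed.

Lemma ev_rn S p t m t' : ev S p t m t' -> rn S (start p) t m t'.
Proof.
elim=> {p t m t'}.
- by move=> a t s1 s2; apply: RnExit.
- by move=> p q t m t' k t'' _ h1 _ h2; apply: rn_seq h1 h2.
- move=> b p q t m t' sp _ h; apply: (@RnNext S (If b p q) None t (stay (hds t))
    (Some (if b (hds t) then inl (start p) else inr (start q)))) => //; rewrite act_stay.
  by case: (b _) h => h; [apply: rn_if_l | apply: rn_if_r].
- move=> b p t sp hb; rewrite -{2}(act_stay t); apply: RnExit => //=; first by rewrite (negPf hb).
  by rewrite act_stay.
- move=> b p t m t' k t'' sp hb _ h1 _ h2; apply: (@RnNext S (While b p) None t (stay (hds t)) (Some (start p))) => //=.
    by rewrite hb.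
  by rewrite act_stay; apply: rn_while h1 h2.
Qed.

(* After leaving the program one step inspects the heads to decide. *)
Definition tm_of (p : prog) (b : heads -> bool) : tm :=
  @TM K A (st p + option bool)%type (inl (start p)) (fun s => s == inr (Some true))
    (fun s h => match s with
      | inl s => let: (o, a) := step s h in Some (if o is Some s' then inl s' else inr None, a)
      | inr None => Some (inr (Some (b h)), stay h)
      | inr (Some _) => None
      end).

Lemma iter_halt M (c : config M) k : halted c -> iter k (@conf_next M) c = c.
Proof.
move=> h; elim: k => //= k ->; rewrite /conf_next.
by move: h; rewrite /halted; case: (conf_trans c).
Qed.

Lemma tm_ofP S p b w t0 m t' : t0 = conf_tape (conf_init (tm_of p b) w) -> rn S (start p) t0 m t' ->
  [/\ forall k, conf_space (conf_run (tm_of p b) w k) <= S,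
      conf_run (tm_of p b) w m.+1 = @Config (tm_of p b) (inr (Some (b (hds t')))) t' &
      halted (conf_run (tm_of p b) w m.+1)].
Proof.
move=> e0 hrn; pose M := tm_of p b; pose cfg (s : tm_state M) t := @Config M s t.
have gen (s : st p) t : rn S s t m t' -> (forall k, conf_space (iter k (@conf_next M) (cfg (inl s) t)) <= S) /\
    iter m.+1 (@conf_next M) (cfg (inl s) t) = cfg (inr (Some (b (hds t')))) t'.
  elim=> {m t' hrn t s} [s t a sp e sp'|s t a s' m t' sp e _ [IH1 IH2]].
    have n1 : conf_next (cfg (inl s) t) = cfg (inr None) (act a t).
      by rewrite /conf_next /conf_trans /= -/(hds t) e.
    have n2 : conf_next (cfg (inr None) (act a t)) = cfg (inr (Some (b (hds (act a t))))) (act a t).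
      by rewrite /conf_next /conf_trans /= -/(hds (act a t)); congr Config; apply: act_stay.
    split; last by rewrite !iterSr n1 n2.
    case=> [//|[|k]]; first by rewrite /= n1.
    by rewrite !iterSr n1 n2 iter_halt.
  have n1 : conf_next (cfg (inl s) t) = cfg (inl s') (act a t).
    by rewrite /conf_next /conf_trans /= -/(hds t) e.
  by split=> [[//|k]|]; rewrite iterSr n1.
have [h1 h2] := gen _ _ hrn; have ei : conf_init M w = cfg (inl (start p)) t0 by rewrite e0.
by rewrite /conf_run ei; split=> //; rewrite h2.
Qed.
End Prog.

End Tape.

(** * Binary counters on tapes *)

Module Registers.
Import Tape Lib.

Section Reg.
Variables (K Z : nat).
Notation A := void.
Notation sym := (symbol A).
Notation tapes := ('I_K.+1 -> tape A).
Notation prog := (prog K).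
Notation bit := (@bit A).

Definition bnd (t : tapes) := forall j, tape_size (t j) <= Z.
Definition setTp (t : tapes) i y : tapes := fun j => if j == i then y else t j.
Notation ev := (@ev K (K.+1 * Z)).

Lemma bndS t : bnd t -> tspace t <= K.+1 * Z.
Proof.
move=> h; rewrite /tspace -[X in _ <= X * _](card_ord K.+1) -sum_nat_const.
exact: leq_sum.
Qed.

Lemma setTT t i x y : setTp (setTp t i x) i y = setTp t i y.
Proof. by apply/funext => j; rewrite /setTp; case: eqP. Qed.
Lemma setT_id t i : setTp t i (t i) = t.
Proof. by apply/funext => j; rewrite /setTp; case: eqP => [->|]. Qed.
Lemma setT_eq t i x : setTp t i x i = x. Proof. by rewrite /setTp eqxx. Qed.
Lemma setT_ne t i x j : j != i -> setTp t i x j = t j. Proof. by rewrite /setTp => /negPf->. Qed.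
Lemma bnd_set t i y : bnd t -> tape_size y <= Z -> bnd (setTp t i y).
Proof. by move=> h hy j; rewrite /setTp; case: eqP. Qed.

Definition act1 (i : 'I_K.+1) (f : sym -> sym * move) : prog :=
  Act (fun h j => if j == i then f (h i) else (h j, MoveN)).
Definition tst1 (i : 'I_K.+1) (b : sym -> bool) : {ffun 'I_K.+1 -> sym} -> bool := fun h => b (h i).

(** A specification of one tape that is valid for all contents of the others within the size bound,
    so that it can be used inside any larger program. *)
Definition E1 i (p : prog) x m y := forall t, bnd t -> t i = x -> ev p t m (setTp t i y).

Definition mv (f : sym -> sym * move) (x : tape A) := tape_act x (f (tape_head x)).1 (f (tape_head x)).2.

Lemma E1_act i f x : tape_size (mv f x) <= Z -> E1 i (act1 i f) x 1 (mv f x).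
Proof.
move=> hs t hb ht.
have e : setTp t i (mv f x) = act (fun j => if j == i then f (hds t i) else (hds t j, MoveN)) t.
  apply/funext => j; rewrite /setTp /act !ffunE; case: eqP => [->|_]; first by rewrite ht.
  by case: (t j).
rewrite e; apply: EvAct; first exact: bndS.
by rewrite -e; apply: bndS; apply: bnd_set.
Qed.

Lemma E1_actE i f x y : y = mv f x -> tape_size y <= Z -> E1 i (act1 i f) x 1 y.
Proof. by move=> ->; apply: E1_act. Qed.

Lemma E1_seq i p q x m y k z : tape_size y <= Z -> E1 i p x m y -> E1 i q y k z -> E1 i (Seq p q) x (m + k) z.
Proof.
move=> hy h1 h2 t hb ht; apply: EvSeq (h1 _ hb ht) _; rewrite -(setTT t i y z).
by apply: h2; [apply: bnd_set | rewrite setT_eq].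
Qed.

Lemma E1_if i (b : sym -> bool) p q x m y : E1 i (if b (tape_head x) then p else q) x m y -> E1 i (If (tst1 i b) p q) x m.+1 y.
Proof.
move=> h t hb ht; apply: EvIf; first exact: bndS.
by rewrite /tst1 ffunE ht; apply: h.
Qed.

Lemma E1_stop i (b : sym -> bool) p x : ~~ b (tape_head x) -> E1 i (While (tst1 i b) p) x 1 x.
Proof.
move=> h t hb ht; rewrite -ht setT_id; apply: EvStop; first exact: bndS.
by rewrite /tst1 ffunE ht.
Qed.

Lemma E1_loop i (b : sym -> bool) p x m y k z : tape_size y <= Z -> b (tape_head x) -> E1 i p x m y ->
  E1 i (While (tst1 i b) p) y k z -> E1 i (While (tst1 i b) p) x (m + k).+1 z.
Proof.
move=> hy h h1 h2 t hb ht; apply: EvLoop (h1 _ hb ht) _; first exact: bndS.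
  by rewrite /tst1 ffunE ht.
by rewrite -(setTT t i y z); apply: h2; [apply: bnd_set | rewrite setT_eq].
Qed.

Definition val (l : seq bool) := foldr (fun (b : bool) v => b + 2 * v) 0 l.
Definition canon (l : seq bool) := last true l.
Fixpoint incb l := match l with [::] => [:: true] | false :: l => true :: l | true :: l => false :: incb l end.
Fixpoint decb l := match l with [::] => [::] | true :: [::] => [::] | true :: l => false :: l | false :: l => true :: decb l end.

Lemma val_inc l : val (incb l) = (val l).+1.
Proof. by elim: l => [|[] l IH] //=; rewrite ?IH; lia. Qed.

Lemma canon_inc l : canon l -> canon (incb l).
Proof.
rewrite /canon; elim: l => [|[] l IH] //=; last by case: l {IH}.
by move=> h; have := IH h; case: (incb l) (val_inc l).
Qed.

Lemma canon_pos l : canon l -> l != [::] -> 0 < val l.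
Proof.
rewrite /canon; elim: l => [|b l IH] // h _; case: l IH h => [|a l] IH h; first by rewrite /= in h; rewrite /= h.
have e : val (b :: a :: l) = b + 2 * val (a :: l) by [].
by move: (IH h isT); rewrite e; lia.
Qed.

Lemma val_dec l : 0 < val l -> val (decb l) = (val l).-1.
Proof. by elim: l => [|[] l IH] //=; [case: l {IH} => //= *; lia | move=> h; rewrite IH; lia]. Qed.

Lemma canon_dec l : canon l -> canon (decb l).
Proof.
rewrite /canon; elim: l => [|[] l IH] //=; first by case: l {IH}.
by case: l IH => [|a l] //= IH h; case: (decb _) (IH h).
Qed.

Lemma size_canon l k : canon l -> val l < 2 ^ k -> size l <= k.
Proof.
rewrite /canon; elim: l k => [|b l IH] [|k] //= h.
  by case: l h IH => [|a l] /= h IH; [rewrite h | have := canon_pos (h : canon (a :: l)) isT => /=; lia].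
rewrite expnS => hv; case: l h IH hv => [|a l] //= h IH hv; apply: (IH k h); lia.
Qed.

Definition mk k (s : seq sym) : tape A := Tape (nseq k None) (head None s) (behead s).
(** Digits with the least significant one under the head and no leading zeros, so that zero is
    recognised by a blank head. The [j] trailing blanks are cells visited before, and [k] accounts
    for the cell on the left that rewinding touches; both enter the size of the tape. *)
Definition num L (x : tape A) v := exists l k j, [/\ val l = v, canon l, k <= 1, size l <= L
  & x = mk k (map bit l ++ nseq j None) /\ size l + j <= L.+1].

Definition keepL (c : sym) : sym * move := (c, MoveL).
Definition keepR (c : sym) : sym * move := (c, MoveR).
Definition isb b (c : sym) := c == bit b.
Definition nonb (c : sym) := c != None :> sym.

Definition rew i : prog := Seq (While (tst1 i nonb) (act1 i keepL)) (act1 i keepR).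
Definition inc i : prog := Seq (While (tst1 i (isb true)) (act1 i (fun _ => (bit false, MoveR))))
  (Seq (act1 i (fun _ => (bit true, MoveL))) (rew i)).
(** After the borrow the program peeks at the next digit. If there is none, the digit to be cleared
    was the leading one and is erased instead of becoming a leading zero. *)
Definition dec i : prog := Seq (While (tst1 i (isb false)) (act1 i (fun _ => (bit true, MoveR))))
  (Seq (act1 i keepR) (Seq (If (tst1 i nonb) (Seq (act1 i keepL) (act1 i (fun _ => (bit false, MoveL))))
     (Seq (act1 i keepL) (act1 i (fun _ => (None, MoveL))))) (rew i))).

Lemma tsz (l : seq sym) h r : tape_size (Tape l h r) = size l + size r + 1.
Proof. by rewrite /tape_size /= addn1. Qed.

(* [zip xs k ys] has the bits [rev xs] and then the cells [ys], of which the first is scanned. *)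
Definition zip (xs : seq bool) k (ys : seq sym) : tape A := Tape (map bit xs ++ nseq k None) (head None ys) (behead ys).

Lemma zip_size xs k ys : tape_size (zip xs k ys) = size xs + k + maxn 1 (size ys).
Proof. by rewrite tsz size_cat size_map size_nseq size_behead; lia. Qed.

Definition lft k (ys : seq sym) : tape A := Tape (nseq k.-1 None) None ys.
Definition mvl (xs : seq bool) k (ys : seq sym) := if xs is x :: xs' then zip xs' k (bit x :: ys) else lft k ys.

Lemma mvlE a xs k ys : mv (fun _ => (a, MoveL)) (zip xs k ys) = mvl xs k (a :: behead ys).
Proof. by case: xs k => [|x xs] [|k]. Qed.

Lemma mvl_size xs k (ys : seq sym) : tape_size (mvl xs k ys) <= size xs + k + size ys + 2.
Proof. by case: xs => [|x xs] /=; rewrite ?zip_size ?tsz ?size_nseq /=; lia. Qed.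

Lemma keepLE c xs k ys : mv keepL (zip xs k (c :: ys)) = mvl xs k (c :: ys).
Proof. by case: xs k => [|x xs] [|k]. Qed.

Lemma keepRE b xs k ys : mv keepR (zip xs k (bit b :: ys)) = zip (b :: xs) k ys.
Proof. by []. Qed.

Lemma back_loop i xs k (c : sym) (r : seq sym) : size xs + k + size r + 3 <= Z -> c != None ->
  E1 i (While (tst1 i nonb) (act1 i keepL)) (zip xs k (c :: r)) (2 * size xs + 3) (lft k (catrev (map bit xs) (c :: r))).
Proof.
elim: xs c r => [|x xs IH] c r hz hc.
  apply: (@E1_loop _ _ _ _ 1 (lft k (c :: r)) 1) => //.
  - by rewrite tsz size_nseq /=; move: hz => /=; lia.
  - rewrite -[lft _ _](_ : mv keepL (zip [::] k (c :: r)) = _); last by rewrite keepLE.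
    by apply: E1_act; rewrite keepLE tsz size_nseq /=; move: hz => /=; lia.
  - exact: E1_stop.
rewrite (_ : 2 * size (x :: xs) + 3 = (1 + (2 * size xs + 3)).+1); last by rewrite /=; lia.
apply: (@E1_loop _ _ _ _ 1 (zip xs k (bit x :: c :: r))) => //.
- by rewrite zip_size /=; move: hz => /=; lia.
- rewrite -[zip xs _ _](_ : mv keepL (zip (x :: xs) k (c :: r)) = _); last by rewrite keepLE.
  by apply: E1_act; rewrite keepLE /= zip_size /=; move: hz => /=; lia.
- by apply: IH => //=; move: hz => /=; lia.
Qed.

Lemma rewP i xs k (ys : seq sym) : k <= 1 -> size xs + size ys + 4 <= Z -> exists2 m, m <= 2 * size xs + 4 &
  E1 i (rew i) (mvl xs k ys) m (mk 1 (catrev (map bit xs) ys)).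
Proof.
move=> k1 hz.
have fin zs : size zs + 4 <= Z -> E1 i (act1 i keepR) (lft k zs) 1 (mk 1 zs).
  move=> hzs; have e : mv keepR (lft k zs) = mk 1 zs by case: k k1 => [|[|]].
  by rewrite -e; apply: E1_act; rewrite e tsz size_nseq size_behead; lia.
case: xs hz => [|x xs] hz.
  exists (1 + 1) => //; apply: (E1_seq (y := lft k ys)).
  - by rewrite tsz size_nseq; move: hz => /=; lia.
  - exact: E1_stop.
  - by apply: fin; move: hz => /=; lia.
exists ((2 * size xs + 3) + 1); first by rewrite /=; lia.
apply: (E1_seq (y := lft k (catrev (map bit xs) (bit x :: ys)))).
- by rewrite tsz size_nseq catrevE size_cat size_rev size_map /=; move: hz => /=; lia.
- by apply: back_loop => //; move: hz => /=; lia.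
- by apply: fin; rewrite catrevE size_cat size_rev size_map /=; move: hz => /=; lia.
Qed.

Lemma split_b b (l : seq bool) : exists t rest, l = nseq t b ++ rest /\ head (~~ b) rest = ~~ b.
Proof.
elim: l => [|a l [t [rest [-> h]]]]; first by exists 0, [::].
have [->|ne] := eqVneq a b; first by exists t.+1, rest.
by exists 0, (a :: nseq t b ++ rest); split=> //=; case: a b ne {h} => [] [].
Qed.

Lemma run_b i b t xs k (ys : seq sym) : head None ys != bit b -> size xs + k + t + size ys + 2 <= Z ->
  E1 i (While (tst1 i (isb b)) (act1 i (fun _ => (bit (~~ b), MoveR)))) (zip xs k (nseq t (bit b) ++ ys)) (2 * t + 1)
    (zip (nseq t (~~ b) ++ xs) k ys).
Proof.
elim: t xs => [|t IH] xs hy hz; first by apply: E1_stop; rewrite /= /isb.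
rewrite (_ : 2 * t.+1 + 1 = (1 + (2 * t + 1)).+1); last by lia.
apply: (@E1_loop _ _ _ _ 1 (zip (~~ b :: xs) k (nseq t (bit b) ++ ys))) => //.
- by rewrite zip_size size_cat size_nseq /=; lia.
- by rewrite /= /isb eqxx.
- by apply: E1_actE => //; rewrite zip_size size_cat size_nseq /=; lia.
- rewrite -[~~ b :: xs]cat1s (_ : nseq t.+1 (~~ b) ++ xs = nseq t (~~ b) ++ (~~ b :: xs)).
    by apply: IH => //=; lia.
  by rewrite -cat1s catA; congr (_ ++ _); elim: (t) => //= ? ->.
Qed.

Lemma incb_split t rest : head false rest = false -> incb (nseq t true ++ rest) = nseq t false ++ true :: behead rest.
Proof. by elim: t => [|t IH] h /=; [case: rest h => [|[]] | rewrite IH]. Qed.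

Lemma decb_split t rest : decb (nseq t false ++ true :: rest) = nseq t true ++ (if rest is [::] then [::] else false :: rest).
Proof. by elim: t => [|t IH] /=; [case: rest | rewrite IH]. Qed.

Lemma revn t (a : sym) ys : catrev (nseq t a) ys = nseq t a ++ ys.
Proof. by rewrite catrevE rev_nseq. Qed.

Lemma map_nseqb t b : map bit (nseq t b) = nseq t (bit b). Proof. by rewrite map_nseq. Qed.

Lemma head_bit rest j b : head (~~ b) rest = ~~ b -> head None (map bit rest ++ nseq j None) != bit b.
Proof. by case: rest j => [|a r] [|j] //=; case: a b => [] []. Qed.

Lemma mk_zip k s : mk k s = zip [::] k s. Proof. by []. Qed.

Lemma num_size L x v : num L x v -> tape_size x <= L + 3.
Proof.
case=> l [k [j [_ _ k1 sl [-> h]]]]; rewrite tsz size_nseq size_behead size_cat size_map size_nseq; lia.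
Qed.

Lemma num0 L x v : num L x v -> (tape_head x == None) = (v == 0).
Proof.
case=> l [k [j [<- c k1 sl [-> h]]]]; case: l c {h sl} => [|b l] c /=; first by case: j.
by apply/esym/negbTE; rewrite -lt0n; exact: (canon_pos c isT).
Qed.

Lemma incP L i x v : num L x v -> v.+1 < 2 ^ L -> L + 6 <= Z ->
  exists m x', [/\ m <= 6 * L + 20, num L x' v.+1 & E1 i (inc i) x m x'].
Proof.
case=> l [k [j [hv c k1 sl [-> hj]]]] hvL hz; rewrite mk_zip.
have [t [rest [el hr]]] := split_b true l.
have ei : incb l = nseq t false ++ true :: behead rest by rewrite el incb_split.
have si : size (incb l) <= L by apply: size_canon; rewrite ?canon_inc ?val_inc ?hv.
have sl' : t + size rest <= L by rewrite -(size_nseq t true) -size_cat -el.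
have si' : t + (size (behead rest)).+1 <= L by move: si; rewrite ei size_cat size_nseq.
set ys : seq sym := map bit rest ++ nseq j None.
have hys : size ys = size rest + j by rewrite size_cat size_map size_nseq.
have [m hm hrew] := @rewP i (nseq t false) k (bit true :: behead ys) k1 (ltac:(rewrite size_nseq /= size_behead hys; move: hj; rewrite el size_cat size_nseq; lia)).
exists (2 * t + 1 + (1 + m)), (mk 1 (catrev (map bit (nseq t false)) (bit true :: behead ys))); split.
- by move: hm; rewrite size_nseq; lia.
- exists (incb l), 1, (if rest is [::] then j.-1 else j); split=> //; first by rewrite val_inc hv.
    exact: canon_inc.
  rewrite ei !map_cat !map_nseqb revn -catA; split.
    by congr (mk _ (_ ++ _)); rewrite /ys /=; case: (rest) => //=; case: (j).
  rewrite size_cat size_nseq /= size_behead; move: hj si'; rewrite el size_cat size_nseq size_behead.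
  by case: (rest) => [|a r] /=; lia.
- have e1 : zip [::] k (map bit l ++ nseq j None) = zip [::] k (nseq t (bit true) ++ ys).
    by rewrite el map_cat map_nseqb -catA.
  have sm : tape_size (mvl (nseq t false) k (bit true :: behead ys)) <= Z.
    apply: leq_trans (mvl_size _ _ _) _; rewrite size_nseq /= size_behead hys.
    by move: hj; rewrite el size_cat size_nseq; lia.
  rewrite e1 /inc; apply: (E1_seq (y := zip (nseq t false ++ [::]) k ys)).
  + by rewrite zip_size size_cat size_nseq hys; move: hj; rewrite el size_cat size_nseq /=; lia.
  + apply: (@run_b i true t [::]); first exact: head_bit hr.
    by rewrite hys; move: hj; rewrite el size_cat size_nseq /=; lia.
  rewrite cats0; apply: (E1_seq (y := mvl (nseq t false) k (bit true :: behead ys))) => //.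
  + by rewrite -mvlE; apply: E1_act; rewrite mvlE.
Qed.

Lemma decP L i x v : num L x v -> 0 < v -> L + 6 <= Z ->
  exists m x', [/\ m <= 6 * L + 20, num L x' v.-1 & E1 i (dec i) x m x'].
Proof.
case=> l [k [j [hv c k1 sl [-> hj]]]] v0 hz; rewrite mk_zip.
have [t [rest [el hr]]] := split_b false l.
case: rest el hr => [|b rest] el hr.
  have v00 : val (nseq t false) = 0 by elim: (t) => //= ? ->.
  by move: hv; rewrite el cats0 v00; lia.
rewrite /= in hr; subst b.
have ei : decb l = nseq t true ++ (if rest is [::] then [::] else false :: rest) by rewrite el decb_split.
have sl' : t + (size rest).+1 <= L by move: sl; rewrite el size_cat size_nseq.
set ys : seq sym := map bit rest ++ nseq j None.
have hys : size ys = size rest + j by rewrite size_cat size_map size_nseq.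
have hj' : t + (size rest).+1 + j <= L.+1 by move: hj; rewrite el size_cat size_nseq.
pose w : sym := if rest is [::] then None else bit false.
pose zs : seq sym := if rest is [::] then None :: behead ys else ys.
have hzs : size zs <= (size ys).+1 by rewrite /zs; case: (rest) => [|? ?]; rewrite /= ?size_behead; lia.
have [m hm hrew] := @rewP i (nseq t true) k (w :: zs) k1 (ltac:(rewrite size_nseq /=; lia)).
have sm a (us : seq sym) : size us <= (size ys).+2 -> tape_size (mvl (nseq t true) k (a :: us)) <= Z.
  by move=> hus; apply: leq_trans (mvl_size _ _ _) _; rewrite size_nseq /=; lia.
exists (2 * t + 1 + (1 + ((1 + 1).+1 + m))), (mk 1 (catrev (map bit (nseq t true)) (w :: zs))); split.
- by move: hm; rewrite size_nseq; lia.
- exists (decb l), 1, (if rest is [::] then j.-1.+2 else j); split=> //.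
  + by rewrite val_dec ?hv.
  + exact: canon_dec.
  + by rewrite ei size_cat size_nseq; case: (rest) sl' => [|a r] /=; lia.
  rewrite ei !map_cat !map_nseqb revn -catA /w /zs /ys; split.
    by case: (rest) => [|a r] //=; case: (j).
  by rewrite size_cat size_nseq; case: (rest) hj' => [|a r] /=; lia.
- have e1 : zip [::] k (map bit l ++ nseq j None) = zip [::] k (nseq t (bit false) ++ bit true :: ys).
    by rewrite el map_cat map_nseqb -catA.
  rewrite e1 /dec; apply: (E1_seq (y := zip (nseq t true ++ [::]) k (bit true :: ys))).
  + by rewrite zip_size size_cat size_nseq /=; lia.
  + by apply: (@run_b i false t [::]) => //=; lia.
  rewrite cats0; apply: (E1_seq (y := zip (true :: nseq t true) k ys)).
  + by rewrite zip_size /= size_nseq; lia.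
  + rewrite -keepRE; apply: E1_act; rewrite keepRE zip_size /= size_nseq; lia.
  apply: (E1_seq (y := mvl (nseq t true) k (w :: zs))) => //; first by apply: sm; lia.
  apply: E1_if; rewrite -[tape_head _]/(head None ys).
  have -> : nonb (head None ys) = (rest != [::]) by rewrite /ys; case: (rest) => [|a r] //=; case: (j).
  have st1 us : us = zs \/ us = ys -> True by [].
  have kl (u : seq sym) : mv keepL (zip (true :: nseq t true) k u) = zip (nseq t true) k (bit true :: head None u :: behead u) by [].
  have goL (f : sym) : E1 i (Seq (act1 i keepL) (act1 i (fun _ => (f, MoveL)))) (zip (true :: nseq t true) k ys) (1 + 1)
      (mvl (nseq t true) k (f :: head None ys :: behead ys)).
    apply: (E1_seq (y := zip (nseq t true) k (bit true :: head None ys :: behead ys))).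
    + by rewrite zip_size size_nseq /= size_behead; lia.
    + by rewrite -kl; apply: E1_act; rewrite kl zip_size size_nseq /= size_behead; lia.
    rewrite -[mvl _ _ _](mvlE f (nseq t true) k (bit true :: head None ys :: behead ys)); apply: E1_act.
    by rewrite mvlE; apply: sm; rewrite /= size_behead; lia.
  have := goL w; rewrite /w /zs /ys; case: (rest) => [|a r] //=.
  by case: (j).
Qed.
End Reg.

End Registers.

(** * A language of bounded recursion and its compilation *)

Module Exprs.
Import Tape Registers Lib.

(* [ERec kn ka g] iterates [g] for [env_kn] rounds from [env_ka]; the environment of [g] is extended by the
   number of remaining rounds, the index and the current value. *)
Inductive exp :=
| EVar of nat | EZero | ESucc of exp | ELet of exp & exp | EInp of exp | ERec of nat & nat & exp.

Fixpoint rc a n (G : nat -> nat -> nat -> nat) i :=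
  if i is i'.+1 then G (n - i) i' (rc a n G i') else a.

Fixpoint wf e d := match e with
  | EVar i => i < d | EZero => true | ESucc e => wf e d | ELet a b => wf a d && wf b d.+1
  | EInp e => wf e d | ERec kn ka g => [&& kn < d, ka < d & wf g (d + 3)]
  end.
Fixpoint need e d := match e with
  | EVar i => d + 2 | EZero => d + 1 | ESucc e => need e d | ELet a b => maxn (need a d) (need b d.+1)
  | EInp e => need e d | ERec kn ka g => maxn (d + 5) (need g (d + 3))
  end.
(** The exponent of the running time: [comp_ok] bounds the number of steps by [X ^ kt e]. *)
Fixpoint kt e := match e with
  | EVar i => 4 | EZero => 3 | ESucc e => (kt e).+1 | ELet a b => (maxn (maxn (kt a) (kt b)) 3).+1
  | EInp e => (maxn (kt e) 4).+1 | ERec kn ka g => maxn (kt g) 5 + 3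
  end.

Section Spec.
Variables (K Z L : nat) (w : seq bool).
Hypothesis hLZ : L + 6 <= Z.
Hypothesis hwZ : size w + 6 <= Z.
Notation A := void.
Notation sym := (symbol A).
Notation tapes := ('I_K.+3 -> tape A).
Notation prog := (prog K.+2).
Notation bit := (@bit A).
Notation ev := (@ev K.+2 (K.+3 * Z)).

(* Tape 0 is for the output, tape 1 for the input, and register [r] is on tape [r + 2]. *)
Definition rx r : 'I_K.+3 := inord r.+2.
Definition t0 : 'I_K.+3 := inord 0.
Definition t1 : 'I_K.+3 := inord 1.

Definition inpAt p (x : tape A) := exists k j, [/\ k <= 1, j <= 1, p <= size w
  & x = Registers.zip (rev (take p w)) k (map bit (drop p w) ++ nseq j None)].
Definition Rp (t : tapes) x p (reg : nat -> nat) := [/\ bnd Z t, t t0 = x, inpAt p (t t1) &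
  forall r, r <= K -> num L (t (rx r)) (reg r)].
Definition spp (c : prog) p reg p' reg' N := forall t x, Rp t x p reg ->
  exists m t', [/\ m <= N, Rp t' x p' reg' & ev c t m t'].
Definition sp c reg reg' N := spp c 0 reg 0 reg' N.
Definition ur (reg : nat -> nat) r v := fun j => if j == r then v else reg j.

Lemma rx_inj r s : r <= K -> s <= K -> rx r = rx s -> r = s.
Proof. by move=> hr hs /(congr1 val); rewrite /= !inordK; lia. Qed.
Lemma rx_t0 r : r <= K -> t0 != rx r.
Proof. by move=> hr; apply/eqP => /(congr1 val); rewrite /= !inordK; lia. Qed.
Lemma rx_t1 r : r <= K -> t1 != rx r.
Proof. by move=> hr; apply/eqP => /(congr1 val); rewrite /= !inordK; lia. Qed.
Lemma t01 : t0 != t1.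
Proof. by apply/eqP => /(congr1 val); rewrite /= !inordK; lia. Qed.

Lemma spp_leq c p reg p' reg' N N' : N <= N' -> spp c p reg p' reg' N -> spp c p reg p' reg' N'.
Proof. by move=> le h t x /h[m [t' [h1 h2 h3]]]; exists m, t'; split=> //; apply: leq_trans h1 le. Qed.

Lemma spp_seq c1 c2 p reg p1 reg1 p2 reg2 N1 N2 : spp c1 p reg p1 reg1 N1 -> spp c2 p1 reg1 p2 reg2 N2 ->
  spp (Seq c1 c2) p reg p2 reg2 (N1 + N2).
Proof.
move=> h1 h2 t x /h1[m [t' [l1 r1 e1]]]; have [k [t'' [l2 r2 e2]]] := h2 _ _ r1.
by exists (m + k), t''; split; [apply: leq_add | | apply: EvSeq e1 e2].
Qed.

Lemma spp_if b c1 c2 p reg p' reg' N : (forall t x, Rp t x p reg -> spp (if b (hds t) then c1 else c2) p reg p' reg' N) ->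
  spp (If b c1 c2) p reg p' reg' N.+1.
Proof.
move=> h t x rt; have [m [t' [l1 r1 e1]]] := h t x rt t x rt; exists m.+1, t'; split=> //.
by apply: EvIf e1; apply: bndS; case: rt.
Qed.

Lemma spp_while b c (p : nat -> nat) (f : nat -> nat -> nat) n N :
  (forall i, i < n -> spp c (p i) (f i) (p i.+1) (f i.+1) N) ->
  (forall i t x, i <= n -> Rp t x (p i) (f i) -> b (hds t) = (i < n)) ->
  spp (While b c) (p 0) (f 0) (p n) (f n) (n * N.+1 + 1).
Proof.
elim: n p f => [|n IH] p f hc hb.
  move=> t x rt; exists 1, t; split=> //; apply: EvStop; first by apply: bndS; case: rt.
  by rewrite (hb 0 _ _ _ rt).
move=> t x rt; have [m [t' [l1 r1 e1]]] := hc 0 isT _ _ rt.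
have [||k [t'' [l2 r2 e2]]] := IH (fun i => p i.+1) (fun i => f i.+1) _ _ _ _ r1.
- by move=> i hi; apply: hc.
- by move=> i s y hi rs; rewrite (hb i.+1 s y) //.
exists (m + k).+1, t''; split=> //; first by move: l1 l2; nia.
by apply: EvLoop e1 e2; [apply: bndS; case: rt | rewrite (hb 0 _ _ _ rt)].
Qed.

Definition nz r := tst1 (rx r) nonb.

Lemma nzE t x p reg r : r <= K -> Rp t x p reg -> nz r (hds t) = (reg r != 0).
Proof. by move=> hr [_ _ _ /(_ r hr)/num0 h]; rewrite /nz /tst1 ffunE /nonb h. Qed.

Lemma Rp_set t x p reg r y v : r <= K -> Rp t x p reg -> num L y v -> Rp (setTp t (rx r) y) x p (ur reg r v).
Proof.
move=> hr [h1 h2 h3 h4] hy; split.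
- by apply: bnd_set => //; apply: leq_trans (num_size hy) _; lia.
- by rewrite setT_ne // rx_t0.
- by rewrite setT_ne // rx_t1.
- move=> s hs; rewrite /ur; case: eqP => [->|ne]; first by rewrite setT_eq.
  by rewrite setT_ne; [apply: h4 | apply/eqP => /(rx_inj hs hr)].
Qed.

Lemma Rp_set1 t x p reg y p' : Rp t x p reg -> tape_size y <= Z -> inpAt p' y -> Rp (setTp t t1 y) x p' reg.
Proof.
move=> [h1 h2 h3 h4] hs hy; split; first exact: bnd_set.
- by rewrite setT_ne // t01.
- by rewrite setT_eq.
- by move=> s hs'; rewrite setT_ne; [apply: h4 | rewrite eq_sym rx_t1].
Qed.

Definition U := 6 * L + 20.

Lemma inc_sp p reg r : r <= K -> (reg r).+1 < 2 ^ L -> spp (inc (rx r)) p reg p (ur reg r (reg r).+1) U.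
Proof.
move=> hr hv t x rt; have [h1 h2 h3 h4] := rt.
have [m [y [l1 n1 e1]]] := incP (rx r) (h4 r hr) hv hLZ.
by exists m, (setTp t (rx r) y); split=> //; [apply: Rp_set | apply: e1].
Qed.

Lemma dec_sp p reg r : r <= K -> 0 < reg r -> spp (dec (rx r)) p reg p (ur reg r (reg r).-1) U.
Proof.
move=> hr hv t x rt; have [h1 h2 h3 h4] := rt.
have [m [y [l1 n1 e1]]] := Registers.decP (rx r) (h4 r hr) hv hLZ.
by exists m, (setTp t (rx r) y); split=> //; [apply: Rp_set | apply: e1].
Qed.

Definition skip : prog := Act (@stay K.+2).
Lemma skip_sp p reg : spp skip p reg p reg 1.
Proof.
move=> t x rt; exists 1, t; split=> //; rewrite -{2}(act_stay t); apply: EvAct.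
  by apply: bndS; case: rt.
by rewrite act_stay; apply: bndS; case: rt.
Qed.

Definition clear r : prog := While (nz r) (dec (rx r)).
Definition move_ r s : prog := While (nz r) (Seq (dec (rx r)) (inc (rx s))).
Definition copy r s u : prog := Seq (While (nz r) (Seq (dec (rx r)) (Seq (inc (rx s)) (inc (rx u))))) (move_ u r).

(** Positions beyond the input yield 0, which lets expressions detect the end of the word. *)
Definition inpv v := if v < size w then (if nth false w v then 2 else 1) else 0.

Fixpoint ee e (env : seq nat) : nat := match e with
  | EVar i => nth 0 env i
  | EZero => 0
  | ESucc e => (ee e env).+1
  | ELet a b => ee b (rcons env (ee a env))
  | EInp e => inpv (ee e env)
  | ERec kn ka g => rc (nth 0 env ka) (nth 0 env kn)
      (fun r i x => ee g (env ++ [:: r; i; x])) (nth 0 env kn)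
  end.

(** Bounds the intermediate values only; the value of the whole expression is bounded by whoever
    uses it. *)
Fixpoint okb bd e (env : seq nat) : Prop := match e with
  | EVar i => True | EZero => True
  | ESucc e => okb bd e env
  | ELet a b => [/\ okb bd a env, ee a env <= bd & okb bd b (rcons env (ee a env))]
  | EInp e => okb bd e env /\ ee e env <= bd
  | ERec kn ka g => forall i, i < nth 0 env kn ->
      let env' := env ++ [:: nth 0 env kn - i.+1; i; rc (nth 0 env ka) (nth 0 env kn)
      (fun r i x => ee g (env ++ [:: r; i; x])) i] in okb bd g env' /\ ee g env' <= bd
  end.

Variable (X B : nat).
Hypotheses (hX : U + 10 <= X) (hB : B.+1 < 2 ^ L) (hBX : B <= X) (hwX : size w <= X).

Lemma spp_eq c p reg p' reg' N reg1 reg1' : spp c p reg p' reg' N -> reg =1 reg1 -> reg' =1 reg1' ->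
  spp c p reg1 p' reg1' N.
Proof. by move=> h /funext<- /funext<-. Qed.

Ltac urs := let j := fresh "j" in move=> j; rewrite /ur; do ?[case: eqP => ? //]; subst; try lia.

Lemma Xpow k k' : k <= k' -> X ^ k <= X ^ k'.
Proof. by move=> h; apply: leq_pexp2l => //; move: hX; lia. Qed.

Lemma clear_sp p reg r : r <= K -> reg r <= B -> spp (clear r) p reg p (ur reg r 0) (X ^ 3).
Proof.
move=> hr hv; have := @spp_while (nz r) (dec (rx r)) (fun _ => p) (fun i => ur reg r (reg r - i)) (reg r) U.
move=> h; apply: (@spp_leq _ _ _ _ _ (reg r * U.+1 + 1)); first by rewrite !expnS expn0 muln1; nia.
apply: (spp_eq (h _ _)) => [i hi|i t x hi rt| |].
- apply: (spp_eq (dec_sp (p := p) (reg := ur reg r (reg r - i)) hr _)) => [||j] //.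
    by rewrite /ur eqxx; lia.
  by rewrite /ur eqxx; case: eqP => // _; lia.
- by rewrite (nzE hr rt) /ur eqxx; lia.
- by urs; rewrite subn0.
- by urs; rewrite subnn.
Qed.

Lemma move_sp p reg r s : r <= K -> s <= K -> r != s -> reg r <= B -> reg r + reg s <= B ->
  spp (move_ r s) p reg p (ur (ur reg s (reg r + reg s)) r 0) (X ^ 3).
Proof.
move=> hr hs /eqP ne hv hv2; have := @spp_while (nz r) (Seq (dec (rx r)) (inc (rx s))) (fun _ => p)
  (fun i => ur (ur reg s (reg s + i)) r (reg r - i)) (reg r) (U + U).
move=> h; apply: (@spp_leq _ _ _ _ _ (reg r * (U + U).+1 + 1)); first by rewrite !expnS expn0 muln1; nia.
apply: (spp_eq (h _ _)) => [i hi|i t x hi rt| |]; last first.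
- by urs; rewrite subnn.
- by urs; rewrite ?subn0 ?addn0.
- by rewrite (nzE hr rt) /ur eqxx; lia.
- set f0 := ur _ _ _; have e1 : f0 r = reg r - i by rewrite /f0 /ur eqxx.
  have e2 : f0 s = reg s + i by rewrite /f0 /ur; case: eqP => [/esym//|_]; rewrite eqxx.
  have e3 : ur f0 r (f0 r).-1 s = reg s + i by rewrite /ur; case: eqP => [/esym//|_].
  apply: (spp_eq (spp_seq (dec_sp (p := p) hr _) (inc_sp (p := p) (reg := ur f0 r (f0 r).-1) hs _))) => [|||j] //.
  + by rewrite e1; lia.
  + by rewrite e3; apply: leq_ltn_trans hB; lia.
  by rewrite e3 e1 /f0 /ur; do ?[case: eqP => ? //]; subst; lia.
Qed.

Lemma copy_sp p reg r s u : r <= K -> s <= K -> u <= K -> r != s -> r != u -> s != u -> reg r <= B ->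
  reg s = 0 -> reg u = 0 -> spp (copy r s u) p reg p (ur reg s (reg r)) (X ^ 4).
Proof.
move=> hr hs hu /eqP rs /eqP ru /eqP su hv s0 u0.
have := @spp_while (nz r) (Seq (dec (rx r)) (Seq (inc (rx s)) (inc (rx u)))) (fun _ => p)
  (fun i => ur (ur (ur reg s i) u i) r (reg r - i)) (reg r) (U + (U + U)).
move=> h; apply: (@spp_leq _ _ _ _ _ ((reg r * (U + (U + U)).+1 + 1) + X ^ 3)).
  rewrite !expnS expn0 muln1; nia.
apply: (spp_seq (p1 := p) (reg1 := ur (ur (ur reg s (reg r)) u (reg r)) r 0)).
  apply: (spp_eq (h _ _)) => [i hi|i t x hi rt| |]; last first.
  - by urs; rewrite subnn.
  - by urs; rewrite ?subn0.
  - by rewrite (nzE hr rt) /ur eqxx; lia.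
  - set f0 := ur _ _ _; have e1 : f0 r = reg r - i by rewrite /f0 /ur eqxx.
    set f1 := ur f0 r (f0 r).-1; have e2 : f1 s = i by rewrite /f1 /f0 /ur; do ?[case: eqP => ? //]; lia.
    set f2 := ur f1 s (f1 s).+1; have e3 : f2 u = i by rewrite /f2 /f1 /f0 /ur; do ?[case: eqP => ? //]; lia.
    apply: (spp_eq (spp_seq (dec_sp (p := p) hr _) (spp_seq (inc_sp (p := p) (reg := f1) hs _) (inc_sp (p := p) (reg := f2) hu _)))) => [||||j] //.
    + by rewrite e1; lia.
    + by rewrite e2; apply: leq_ltn_trans hB; lia.
    + by rewrite e3; apply: leq_ltn_trans hB; lia.
    + by rewrite e3 /f2 e2 /f1 e1 /f0 /ur; do ?[case: eqP => ? //]; lia.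
set g := ur _ _ _; have g1 : g u = reg r by rewrite /g /ur; do ?[case: eqP => ? //]; lia.
have g2 : g r = 0 by rewrite /g /ur eqxx.
apply: (spp_eq (move_sp (p := p) (reg := g) hu hr _ _ _)) => [||||j] //; rewrite ?g1 ?g2 ?addn0 //.
  by apply/eqP => h'; apply: ru.
by rewrite /g /ur; do ?[case: eqP => ? //]; subst; lia.
Qed.

Definition readp r : prog := Seq (While (nz r) (Seq (dec (rx r)) (If (tst1 t1 nonb) (act1 t1 keepR) skip)))
  (Seq (If (tst1 t1 nonb) (If (tst1 t1 (isb true)) (Seq (inc (rx r)) (inc (rx r))) (inc (rx r))) skip)
  (Seq (act1 t1 keepL) (rew t1))).

Lemma inp_head p x : inpAt p x -> tape_head x = if p < size w then bit (nth false w p) else None.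
Proof.
case=> k [j [_ _ hp ->]] /=; case: ltnP => h; first by rewrite (drop_nth false h).
by rewrite drop_oversize //; case: (j).
Qed.

Lemma inp_head_Rp t x p reg : Rp t x p reg -> hds t t1 = if p < size w then bit (nth false w p) else None.
Proof. by case=> _ _ /inp_head h _; rewrite ffunE. Qed.

Lemma inp_R p x : inpAt p x -> p < size w -> inpAt p.+1 (mv keepR x) /\ tape_size (mv keepR x) <= Z.
Proof.
case=> k [j [k1 j1 hp ->]] h; rewrite (drop_nth false h).
rewrite -[mv _ _]/(Registers.zip (nth false w p :: rev (take p w)) k (map bit (drop p.+1 w) ++ nseq j None)); split.
  by exists k, j; split=> //; rewrite (take_nth false h) rev_rcons.
rewrite Registers.zip_size /= size_rev size_takel ?(ltnW h) // size_cat size_map size_nseq size_drop; lia.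
Qed.

Lemma keepL_mvl xs k (ys : seq sym) : mv keepL (Registers.zip xs k ys) = mvl xs k (head None ys :: behead ys).
Proof. by case: xs k => [|x xs] [|k]. Qed.

Lemma home_sp p reg : spp (Seq (act1 t1 keepL) (rew t1)) p reg 0 reg (X ^ 3).
Proof.
move=> t x rt; have [h1 h2 h3 h4] := rt; case: (h3) => k [j [k1 j1 hp e]].
set ys := map bit (drop p w) ++ nseq j None in e.
have sys : size ys = size w - p + j by rewrite size_cat size_map size_nseq size_drop.
have sr : size (rev (take p w)) = p by rewrite size_rev size_takel.
have [|m hm hrew] := @rewP K.+2 Z t1 (rev (take p w)) k (head None ys :: behead ys) k1.
  by rewrite sr /= size_behead sys; lia.
have hsz : tape_size (mvl (rev (take p w)) k (head None ys :: behead ys)) <= Z.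
  by apply: leq_trans (mvl_size _ _ _) _; rewrite sr /= size_behead sys; lia.
exists (1 + m), (setTp t t1 (mk 1 (catrev (map bit (rev (take p w))) (head None ys :: behead ys)))); split.
- move: hm; rewrite sr; have : X * X <= X ^ 3 by rewrite !expnS expn0 muln1 leq_mul2l; apply/orP; right; nia.
  nia.
- have ez : mk 1 (catrev (map bit (rev (take p w))) (head None ys :: behead ys)) =
      Registers.zip (rev (take 0 w)) 1 (map bit (drop 0 w) ++ nseq (if ys is [::] then 1 else j) None).
    rewrite take0 drop0 /= catrevE -map_rev revK -{2}(cat_take_drop p w) map_cat -catA /mk /Registers.zip /=.
    by congr (Tape _ (head _ _) (behead _)); congr (_ ++ _); move: sys; rewrite /ys; case: (map _ _) => [|a l] //; case: (j) j1 => [|[|]].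
  apply: Rp_set1 rt _ _.
    rewrite ez Registers.zip_size take0 drop0 size_cat size_map size_nseq /=.
    by case: (ys) => [|a l]; lia.
  by rewrite ez; exists 1, (if ys is [::] then 1 else j); split=> //; case: (ys).
- have ha : E1 Z t1 (Seq (act1 t1 keepL) (rew t1)) (t t1) (1 + m)
      (mk 1 (catrev (map bit (rev (take p w))) (head None ys :: behead ys))).
    apply: (E1_seq hsz _ hrew); apply: E1_actE hsz.
    by rewrite e keepL_mvl.
  exact: ha.
Qed.

Lemma read_sp reg r : r <= K -> reg r <= B -> 1 < B -> sp (readp r) reg (ur reg r (inpv (reg r))) (X ^ 4).
Proof.
move=> hr hv hB2.
pose f i := ur reg r (reg r - i); pose p i := minn i (size w).
have := @spp_while (nz r) (Seq (dec (rx r)) (If (tst1 t1 nonb) (act1 t1 keepR) skip)) p f (reg r) (U + 2).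
move=> h; have {}h : spp (While (nz r) (Seq (dec (rx r)) (If (tst1 t1 nonb) (act1 t1 keepR) skip)))
   (p 0) (f 0) (p (reg r)) (f (reg r)) (reg r * (U + 2).+1 + 1).
  apply: h => [i hi|i t x hi rt]; last by rewrite (nzE hr rt) /f /ur eqxx; lia.
  apply: (spp_seq (p1 := p i) (reg1 := f i.+1)).
    apply: (spp_eq (dec_sp (p := p i) (reg := f i) hr _)) => [||j] //; first by rewrite /f /ur eqxx; lia.
    by rewrite /f /ur eqxx; case: eqP => // _; lia.
  apply: spp_if => t x rt; rewrite /tst1 (inp_head_Rp rt); case: ltnP => hp /=.
    move=> s y rs; have [s1 s2 s3 s4] := rs; have [g1 g2] := inp_R s3 hp.
    exists 1, (setTp s t1 (mv keepR (s t1))); split=> //.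
      have -> : p i.+1 = (p i).+1 by move: hp; rewrite /p; lia.
      exact: Rp_set1 rs g2 g1.
    exact: (E1_act (i := t1) g2 s1).
  have -> : p i.+1 = p i by move: hp; rewrite /p; lia.
  exact: skip_sp.
have p0 : p 0 = 0 by rewrite /p min0n.
have f0 : f 0 = reg by apply/funext => j; rewrite /f /ur; case: eqP => [->|//]; rewrite subn0.
rewrite p0 f0 in h.
have fr : f (reg r) r = 0 by rewrite /f /ur eqxx subnn.
apply: (@spp_leq _ _ _ _ _ ((reg r * (U + 2).+1 + 1) + ((U + U).+2 + X ^ 3))).
  have h3 : X ^ 3 = X * X * X by rewrite !expnS expn0 muln1 mulnA.
  have h4 : X ^ 4 = X ^ 3 * X by rewrite expnSr.
  have a2 : X ^ 3 * 10 <= X ^ 4 by rewrite h4 leq_mul2l; apply/orP; right; lia.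
  have a1 : reg r * (U + 2).+1 + 1 <= X ^ 3 by rewrite h3; nia.
  have a3 : (U + U).+2 <= X ^ 3 by rewrite h3; nia.
  lia.
apply: spp_seq h _; apply: (spp_seq (p1 := p (reg r)) (reg1 := ur reg r (inpv (reg r)))); last first.
  exact: home_sp.
have hp : (p (reg r) < size w) = (reg r < size w) by rewrite /p; lia.
have fur v : ur (f (reg r)) r v =1 ur reg r v by move=> j; rewrite /f /ur; case: eqP.
apply: spp_if => t x rt; rewrite /tst1 (inp_head_Rp rt) hp /inpv; case: ltnP => hw /=; last first.
  apply: (@spp_leq _ _ _ _ _ 1); first by lia.
  by apply: (spp_eq (skip_sp (p := _) (reg := _))) => // j; rewrite /f /ur; case: eqP => // _; lia.
have -> : p (reg r) = reg r by rewrite /p; lia.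
apply: spp_if => s y rs; rewrite /tst1 (inp_head_Rp rs) hw /isb (inj_eq (@inj_comp _ _ _ Some inl _ _)); first last.
- by move=> a b [].
- by move=> a b [].
have e1 : (f (reg r) r).+1 < 2 ^ L by rewrite fr; apply: leq_ltn_trans hB; lia.
case: (nth false w (reg r)) => /=.
  apply: (spp_eq (spp_seq (inc_sp (p := reg r) hr e1) (inc_sp (p := reg r) (reg := ur (f (reg r)) r (f (reg r) r).+1) hr _))) => // [|j].
    by rewrite /ur eqxx fr; apply: leq_ltn_trans hB; lia.
  by rewrite /ur eqxx fr; case: eqP => // ne; rewrite /f /ur; case: eqP.
apply: (@spp_leq _ _ _ _ _ U); first by lia.
by apply: (spp_eq (inc_sp (p := reg r) hr e1)) => // j; rewrite fr fur.
Qed.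

Hypothesis hB2 : 1 < B.

(** The environment occupies the registers below [d], and those from [d] on are zero before the run.
    Afterwards register [d] holds the value and everything above it is zero again. *)
Fixpoint comp e d : prog := match e with
  | EVar i => copy i d (d + 1)
  | EZero => clear d
  | ESucc e => Seq (comp e d) (inc (rx d))
  | EInp e => Seq (comp e d) (readp d)
  | ELet a b => Seq (comp a d) (Seq (comp b d.+1) (Seq (clear d) (move_ d.+1 d)))
  | ERec kn ka g => Seq (copy kn d (d + 1)) (Seq (copy ka (d + 2) (d + 3))
      (Seq (While (nz d) (Seq (dec (rx d)) (Seq (comp g (d + 3)) (Seq (clear (d + 2))
          (Seq (move_ (d + 3) (d + 2)) (inc (rx (d + 1))))))))
      (Seq (clear (d + 1)) (move_ (d + 2) d))))
  end.

Definition regE (env : seq nat) := fun r => nth 0 env r.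

Lemma regE_cat env s j : regE (env ++ s) j = if j < size env then regE env j else nth 0 s (j - size env).
Proof. by rewrite /regE nth_cat. Qed.

Lemma regE_out env j : size env <= j -> regE env j = 0.
Proof. by move=> h; rewrite /regE nth_default. Qed.

(* Updates of the registers just above the environment. *)
Lemma size_off (env : seq nat) j : size env <= j -> exists k, j = size env + k.
Proof. by move=> h; exists (j - size env); rewrite subnKC. Qed.
Ltac noeq := repeat (let h := fresh in case: eqP; intro h; [try (exfalso; move: h; clear; lia)|try (exfalso; apply h; clear; lia)]; try clear h).
Ltac regs env := let j := fresh "j" in let h := fresh in let k := fresh in
  intro j; rewrite /ur -?cats1 -?catA ?regE_cat;
  case: (ltnP j (size env)); intro h;
  [repeat (let e := fresh in case: eqP; intro e; [exfalso; move: h e; clear; lia|try clear e]); by [] |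
   destruct (size_off h) as [k ->]; clear h;
   rewrite ?addKn ?regE_out ?leq_addr //; destruct k as [|[|[|[|[|k]]]]];
   noeq; rewrite /= ?nth_nil ?addn0 //; try lia].

Lemma X10 : 10 <= X. Proof. by move: hX; lia. Qed.

Lemma sum_pow k k' : k < k' -> 8 * X ^ k <= X ^ k'.
Proof.
move=> h; apply: (@leq_trans (X ^ k.+1)); last exact: Xpow.
by rewrite expnS leq_mul2r; apply/orP; right; have := X10; lia.
Qed.

Lemma comp_var i env : i < size env -> size env + 2 <= K.+1 -> all (leq^~ B) env ->
  sp (comp (EVar i) (size env)) (regE env) (regE (rcons env (nth 0 env i))) (X ^ 4).
Proof.
move=> hi hK /allP hall.
have v1 : nth 0 env i <= B by apply: hall; apply: mem_nth.
apply: (spp_eq (copy_sp (p := 0) (reg := regE env) (r := i) (s := size env) (u := size env + 1) _ _ _ _ _ _ _ _ _)) => //; try lia.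
- by rewrite regE_out.
- by rewrite regE_out // leq_addr.
- by move=> j; rewrite /ur /regE nth_rcons; case: ltngtP => // h; rewrite nth_default // ltnW.
Qed.

Lemma U_pow k : 0 < k -> U <= X ^ k.
Proof. by move=> h; apply: (@leq_trans (X ^ 1)); [rewrite expn1; move: hX; lia | exact: Xpow]. Qed.

Lemma loop_pow n k M : n <= B -> M <= X ^ k -> n * (7 * M).+1 + 1 + 6 * M <= X ^ (k + 3).
Proof.
move=> hn hM; have x10 := X10; rewrite !expnD !expnS expn0 muln1; set P := X ^ k in hM *.
have P0 : 0 < P by rewrite expn_gt0; lia.
have nX : n <= X by lia.
have h1 : n * (7 * M).+1 <= X * (7 * P + 1) by apply: leq_mul => //; lia.
have h2 : X * (7 * P + 1) + 1 + 6 * P <= P * (X * 10) by nia.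
have h3 : P * (X * 10) <= P * (X * (X * X)) by rewrite !leq_mul2l; apply/orP; right; apply/orP; right; nia.
lia.
Qed.

Lemma need_lt e d : d < need e d.
Proof. by elim: e d => [i||e IH|a IHa b IHb|e IH|kn ka g IH] d /=; rewrite ?addn1 ?addn2 //; [have := IHa d; lia | lia]. Qed.

Lemma comp_ok e env : wf e (size env) -> need e (size env) <= K.+1 -> all (leq^~ B) env ->
  okb B e env -> ee e env <= B -> sp (comp e (size env)) (regE env) (regE (rcons env (ee e env))) (X ^ kt e).
Proof.
have x10 := X10.
elim: e env => [i||e IH|a IHa b IHb|e IH|kn ka g IH] env /=.
- by move=> hi hK hall _ _; apply: comp_var.
- move=> _ hK hall _ _.
  apply: (spp_eq (clear_sp (p := 0) (reg := regE env) (r := size env) _ _)) => //; [by lia | by rewrite regE_out |].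
  by move=> j; rewrite /ur /regE nth_rcons; case: ltngtP => // h; rewrite nth_default // ltnW.
- move=> hw hK hall ho hv; have hv' : ee e env <= B by lia.
  apply: (@spp_leq _ _ _ _ _ (X ^ kt e + U)).
    have P0 : 0 < X ^ kt e by rewrite expn_gt0; lia.
    by rewrite [(X ^ (kt e).+1)]expnS; set Q := X ^ kt e in P0 *; move: hX P0; clear; nia.
  apply: spp_seq (IH _ hw hK hall ho hv') _.
  have er : regE (rcons env (ee e env)) (size env) = ee e env by rewrite /regE nth_rcons ltnn eqxx.
  have hK' : size env <= K by have : size env < need e (size env) := need_lt _ _; lia.
  apply: (spp_eq (inc_sp (p := 0) (reg := regE (rcons env (ee e env))) hK' _)) => //; rewrite er.
    by apply: leq_ltn_trans hB; lia.
  by move=> j; rewrite /ur /regE !nth_rcons; case: ltngtP.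
- case/andP => wa wb hK hall [oa va ob] hv.
  have hKa : need a (size env) <= K.+1 by lia.
  have hKb : need b (size env).+1 <= K.+1 by lia.
  have hKd : (size env).+1 <= K by have := need_lt b (size env).+1; lia.
  set va' := ee a env in va ob hv *; set vb := ee b _ in hv *.
  apply: (@spp_leq _ _ _ _ _ (X ^ kt a + (X ^ kt b + (X ^ 3 + X ^ 3)))).
    set M := maxn (maxn (kt a) (kt b)) 3; have := @sum_pow M M.+1 (leqnn _).
    have : X ^ kt a <= X ^ M by apply: Xpow; rewrite /M; lia.
    have : X ^ kt b <= X ^ M by apply: Xpow; rewrite /M; lia.
    have : X ^ 3 <= X ^ M by apply: Xpow; rewrite /M; lia.
    lia.
  apply: spp_seq (IHa _ wa hKa hall oa va) _.
  have hall' : all (leq^~ B) (rcons env va') by rewrite all_rcons hall va.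
  have := IHb (rcons env va'); rewrite size_rcons => /(_ wb hKb hall' ob hv) hb.
  apply: spp_seq hb _.
  have e1 : regE (rcons (rcons env va') vb) (size env) = va'.
    by rewrite /regE nth_rcons size_rcons ltnSn nth_rcons ltnn eqxx.
  apply: spp_seq (clear_sp (p := 0) (reg := regE (rcons (rcons env va') vb)) (r := size env) _ _) _; [lia | by rewrite e1 |].
  set g := ur _ _ _; have g1 : g (size env).+1 = vb.
    by rewrite /g /ur ifF; [rewrite /regE nth_rcons size_rcons ltnn eqxx | lia].
  have g2 : g (size env) = 0 by rewrite /g /ur eqxx.
  apply: (spp_eq (move_sp (p := 0) (reg := g) (r := (size env).+1) (s := size env) _ _ _ _ _)) => //; rewrite ?g1 ?g2 ?addn0; try lia.
  by clearbody vb va'; rewrite /g; regs env.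
- move=> hw hK hall [ho hv] hv'.
  apply: (@spp_leq _ _ _ _ _ (X ^ kt e + X ^ 4)).
    set M := maxn (kt e) 4; have := @sum_pow M M.+1 (leqnn _).
    have : X ^ kt e <= X ^ M by apply: Xpow; rewrite /M; lia.
    have : X ^ 4 <= X ^ M by apply: Xpow; rewrite /M; lia.
    lia.
  apply: spp_seq (IH _ hw hK hall ho hv) _.
  have er : regE (rcons env (ee e env)) (size env) = ee e env by rewrite /regE nth_rcons ltnn eqxx.
  have hK' : size env <= K by have : size env < need e (size env) := need_lt _ _; lia.
  apply: (spp_eq (read_sp (reg := regE (rcons env (ee e env))) hK' _ hB2)) => //; rewrite er //.
  by move=> j; rewrite /ur /regE !nth_rcons; case: ltngtP.
case/and3P => hn ha hwg hK hall ho hv; set d := size env in hn ha hwg hK *.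
set n := nth 0 env kn; set a := nth 0 env ka.
have mB i : i < d -> nth 0 env i <= B by move=> hi; apply: (allP hall); apply: mem_nth.
set G := (fun r i x => ee g (env ++ [:: r; i; x])) in ho hv *.
pose R i := rc a n G i.
have RB i : i <= n -> R i <= B by case: i => [_|i hi]; [exact: mB | have [] := ho i hi].
have hKd : d + 4 <= K by lia.
have hKg : need g (d + 3) <= K.+1 by lia.
set M := maxn (kt g) 5.
have Mg : X ^ kt g <= X ^ M by apply: Xpow; rewrite /M; lia.
have M5 k : k <= 5 -> X ^ k <= X ^ M by move=> hk; apply: Xpow; rewrite /M; lia.
have MU : U <= X ^ M by apply: U_pow; rewrite /M; lia.
have rE s j : regE (env ++ s) (d + j) = nth 0 s j by rewrite regE_cat ltnNge leq_addr /= addKn.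
have rD s : regE (env ++ s) d = nth 0 s 0 by have := rE s 0; rewrite addn0.
have rL s j : j < d -> regE (env ++ s) j = nth 0 env j by rewrite regE_cat => ->.
have body i : i < n -> sp (Seq (dec (rx d)) (Seq (comp g (d + 3)) (Seq (clear (d + 2))
          (Seq (move_ (d + 3) (d + 2)) (inc (rx (d + 1)))))))
    (regE (env ++ [:: n - i; i; R i])) (regE (env ++ [:: n - i.+1; i.+1; R i.+1])) (7 * X ^ M).
  move=> hi; have [og vg] := ho i hi; rewrite -/(R i) -/n in og vg.
  have nB : n <= B := mB _ hn.
  set env' := env ++ [:: n - i.+1; i; R i] in og vg; set v := ee g env' in vg.
  have se : size env' = d + 3 by rewrite size_cat.
  apply: (@spp_leq _ _ _ _ _ (U + (X ^ kt g + (X ^ 3 + (X ^ 3 + U))))).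
    have := M5 3 isT; have := M5 5 isT; lia.
  apply: (spp_seq (p1 := 0) (reg1 := regE env')).
    apply: (spp_eq (dec_sp (p := 0) (reg := regE (env ++ [:: n - i; i; R i])) (r := d) _ _)) => //; [lia | |].
      by rewrite rD /=; lia.
    rewrite rD [nth _ _ _]/= /d /env'; regs env.
  have hall' : all (leq^~ B) env' by rewrite all_cat hall /= RB ?(ltnW hi) // !andbT; apply/andP; split; lia.
  have := IH env'; rewrite se => /(_ hwg hKg hall' og vg) hg; apply: spp_seq hg _.
  have cv k : k <= d + 4 -> k <= K by lia.
  apply: (spp_seq (p1 := 0) (reg1 := regE (env ++ [:: n - i.+1; i; 0; v]))).
    apply: (spp_eq (clear_sp (p := 0) (reg := regE (rcons env' v)) (r := d + 2) _ _)) => //; [lia | |].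
      by rewrite /env' -cats1 -catA rE /= RB // ltnW.
    by rewrite /env' /d; regs env.
  apply: (spp_seq (p1 := 0) (reg1 := regE (env ++ [:: n - i.+1; i; R i.+1]))).
    apply: (spp_eq (move_sp (p := 0) (reg := regE (env ++ [:: n - i.+1; i; 0; v])) (r := d + 3) (s := d + 2) _ _ _ _ _)) => //; rewrite ?rE //=; try lia.
    by rewrite addn0 -[R i.+1]/v /d; regs env.
  apply: (spp_eq (inc_sp (p := 0) (reg := regE (env ++ [:: n - i.+1; i; R i.+1])) (r := d + 1) _ _)) => //; rewrite ?rE //=; try lia.
  by rewrite /d; regs env.
have loop : sp (While (nz d) (Seq (dec (rx d)) (Seq (comp g (d + 3)) (Seq (clear (d + 2))
          (Seq (move_ (d + 3) (d + 2)) (inc (rx (d + 1))))))))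
    (regE (env ++ [:: n - 0; 0; R 0])) (regE (env ++ [:: n - n; n; R n])) (n * (7 * X ^ M).+1 + 1).
  apply: (@spp_while _ _ (fun _ => 0) (fun i => regE (env ++ [:: n - i; i; R i]))) => [i hi|i t x hi rt].
    exact: body.
  have dK : d <= K by lia.
  by rewrite (nzE dK rt) rD /=; move: hi; clear; lia.
apply: (@spp_leq _ _ _ _ _ (X ^ 4 + (X ^ 4 + ((n * (7 * X ^ M).+1 + 1) + (X ^ 3 + X ^ 3))))).
  have := loop_pow (mB _ hn) (leqnn (X ^ M)); have := M5 3 isT; have := M5 4 isT; have := M5 5 isT; rewrite -/n -/M; lia.
have z0 j : regE env (d + j) = 0 by rewrite regE_out // leq_addr.
have z1 : regE env d = 0 by rewrite regE_out.
have nB k : k < d -> regE env k <= B by exact: mB.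
apply: (spp_seq (p1 := 0) (reg1 := regE (env ++ [:: n]))).
  apply: (spp_eq (copy_sp (p := 0) (reg := regE env) (r := kn) (s := d) (u := d + 1) _ _ _ _ _ _ _ (z1) (z0 1))) => //; try lia.
    exact: nB.
  by rewrite -[regE env kn]/n /d; regs env.
apply: (spp_seq (p1 := 0) (reg1 := regE (env ++ [:: n - 0; 0; R 0]))).
  have z2 : regE (env ++ [:: n]) (d + 2) = 0 by rewrite rE.
  have z3 : regE (env ++ [:: n]) (d + 3) = 0 by rewrite rE.
  have za : regE (env ++ [:: n]) ka = a by rewrite rL.
  apply: (spp_eq (copy_sp (p := 0) (reg := regE (env ++ [:: n])) (r := ka) (s := d + 2) (u := d + 3) _ _ _ _ _ _ _ z2 z3)) => //; try lia.
    by rewrite za; exact: mB.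
  by rewrite za subn0 -[R 0]/a /d; regs env.
apply: spp_seq loop _.
apply: (spp_seq (p1 := 0) (reg1 := regE (env ++ [:: 0; 0; R n]))).
  have z1' : regE (env ++ [:: n - n; n; R n]) (d + 1) <= B by rewrite rE; exact: mB.
  apply: (spp_eq (clear_sp (p := 0) (reg := regE (env ++ [:: n - n; n; R n])) (r := d + 1) _ z1')) => //; try lia.
  by rewrite subnn /d; regs env.
have y1 : regE (env ++ [:: 0; 0; R n]) (d + 2) = R n by rewrite rE.
have y2 : regE (env ++ [:: 0; 0; R n]) d = 0 by rewrite rD.
apply: (spp_eq (move_sp (p := 0) (reg := regE (env ++ [:: 0; 0; R n])) (r := d + 2) (s := d) _ _ _ _ _)) => //; rewrite ?y1 ?y2 ?addn0 //; try lia.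
by rewrite -[rc _ _ _ _]/(R n) /d; regs env.
Qed.
(** The input is moved to tape 1, which leaves tape 0 blank for the output. *)
Definition loadp : prog := While (tst1 t0 nonb)
  (Act (fun h i => if i == t0 then (None, MoveR) else if i == t1 then (h t0, MoveR) else (h i, MoveN))).

Definition lst (u v : seq bool) : tapes := fun i =>
  if i == t0 then Tape (nseq (size u) None) (head None (map bit v)) (behead (map bit v))
  else if i == t1 then Registers.zip (rev u) 0 [::] else Tape [::] None [::].

Lemma lst_bnd u v : size u + size v = size w -> bnd Z (lst u v).
Proof.
move=> h j; rewrite /lst; case: eqP => _; last case: eqP => _.
- by rewrite /tape_size /= size_nseq size_behead size_map; lia.
- by rewrite zip_size size_rev /=; lia.
- by rewrite /tape_size /=; lia.
Qed.

Lemma load_ev u v : size u + size v = size w -> ev loadp (lst u v) (2 * size v + 1) (lst (u ++ v) [::]).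
Proof.
elim: v u => [|b v IH] u h.
  rewrite cats0; apply: EvStop; first by apply: bndS; apply: lst_bnd.
  by rewrite /tst1 ffunE /lst eqxx.
rewrite [size _]/= (_ : 2 * (size v).+1 + 1 = (1 + (2 * size v + 1)).+1); last by lia.
have e : act (fun i => if i == t0 then (None, MoveR) else if i == t1 then (hds (lst u (b :: v)) t0, MoveR)
      else (hds (lst u (b :: v)) i, MoveN)) (lst u (b :: v)) = lst (rcons u b) v.
  apply/funext => i; rewrite /act /hds /lst; case: eqP => [_|n0].
    by rewrite /= size_rcons.
  case: eqP => [_|n1] /=; first by rewrite ffunE eqxx rev_rcons.
  by rewrite ffunE; do 2 (case: eqP => // _).
have h' : size (rcons u b) + size v = size w by rewrite size_rcons -h /= addSnnS.
rewrite -cat_rcons.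
have e1 : ev (Act (fun h i => if i == t0 then (None, MoveR) else if i == t1 then (h t0, MoveR) else (h i, MoveN)))
   (lst u (b :: v)) 1 (lst (rcons u b) v).
  by rewrite -e; apply: EvAct; rewrite ?e; apply: bndS; exact: lst_bnd.
apply: EvLoop e1 (IH _ h'); first by apply: bndS; exact: lst_bnd.
by rewrite /tst1 ffunE /lst eqxx.
Qed.

Definition homep : prog := Seq (act1 t1 keepL) (rew t1).

Lemma lst_Rp : Rp (lst w [::]) (Tape (nseq (size w) None) None [::]) (size w) (fun _ => 0).
Proof.
split; first by apply: lst_bnd; rewrite addn0.
- by rewrite /lst eqxx.
- rewrite /lst eq_sym (negPf t01) eqxx; exists 0, 0; split=> //.
  by rewrite take_size drop_size.
- move=> r hr; rewrite /lst eq_sym (negPf (rx_t0 hr)) eq_sym (negPf (rx_t1 hr)).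
  by exists [::], 0, 0; split.
Qed.

(** Runs [c] once for every bit of the input: incrementing yields the length, doubling yields
    [2 ^ size w]. *)
Definition countp (c : prog) : prog := Seq (While (tst1 t1 nonb) (Seq (act1 t1 keepR) c)) homep.

Lemma count_sp c (f : nat -> nat -> nat) N :
  (forall p i, i < size w -> spp c p (f i) p (f i.+1) N) ->
  spp (countp c) 0 (f 0) 0 (f (size w)) (size w * (1 + N).+1 + 1 + X ^ 3).
Proof.
move=> hc; rewrite /countp /homep; apply: (spp_seq (p1 := size w) (reg1 := f (size w))); last exact: home_sp.
apply: (@spp_while _ _ (fun i => i) f (size w) (1 + N)) => [i hi|i t x hi rt].
  apply: (spp_seq (p1 := i.+1) (reg1 := f i)); last exact: hc.
  move=> s y rs; have [s1 s2 s3 s4] := rs; have [g1 g2] := inp_R s3 hi.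
  exists 1, (setTp s t1 (mv keepR (s t1))); split=> //.
    exact: Rp_set1 rs g2 g1.
  exact: (E1_act (i := t1) g2 s1).
by rewrite /tst1 (inp_head_Rp rt); case: ltnP.
Qed.

Definition dblp : prog := Seq (copy 0 1 2) (move_ 1 0).

Lemma dbl_sp p v : 2 <= K -> v + v <= B ->
  spp dblp p (regE [:: v]) p (regE [:: v + v]) (X ^ 4 + X ^ 3).
Proof.
move=> hK hv.
apply: (spp_seq (p1 := p) (reg1 := regE [:: v; v])).
  apply: (spp_eq (copy_sp (p := p) (reg := regE [:: v]) (r := 0) (s := 1) (u := 2) _ _ _ _ _ _ _ _ _)) => //; try lia.
    by rewrite /regE /=; lia.
  by case=> [|[|[|j]]].
apply: (spp_eq (move_sp (p := p) (reg := regE [:: v; v]) (r := 1) (s := 0) _ _ _ _ _)) => //; try lia.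
  by rewrite /regE /=; lia.
by case=> [|[|[|j]]].
Qed.

Lemma num_count_sp p v : v.+1 <= B ->
  spp (inc (rx 0)) p (regE [:: v]) p (regE [:: v.+1]) (U).
Proof.
move=> hv; apply: (spp_eq (inc_sp (p := p) (reg := regE [:: v]) (r := 0) _ _)) => //.
  by rewrite /regE /=; lia.
by case=> [|[|j]].
Qed.

Variable el : exp.
Hypotheses (hK : 3 < K.+1) (hwl : wf el 1) (hneedl : need el 1 <= K.+1).

(** The expression receives [2 ^ size w], a number of linearly many digits that gives it
    exponentially many rounds. *)
Definition pspp : prog := Seq loadp (Seq homep (Seq (inc (rx 0)) (Seq (countp dblp) (comp el 1)))).

Lemma psp_run : (forall i, i <= size w -> 2 ^ i + 2 ^ i <= B) -> okb B el [:: 2 ^ size w] -> ee el [:: 2 ^ size w] <= B ->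
  exists m u, ev pspp (lst [::] w) m u /\ nz 1 (hds u) = (ee el [:: 2 ^ size w] != 0).
Proof.
move=> hb h1 h2.
have e1 := @load_ev [::] w (erefl _); rewrite cat0s in e1.
have [m2 [u2 [l2 r2 e2]]] := home_sp lst_Rp.
have z0 : (fun _ => 0) = regE [:: 0] by apply/funext => -[|[|j]].
rewrite z0 in r2.
have [m3 [u3 [l3 r3 e3]]] := @num_count_sp 0 0 (ltnW hB2) _ _ r2.
have hc p i : i < size w -> spp dblp p (regE [:: 2 ^ i]) p (regE [:: 2 ^ i.+1]) (X ^ 4 + X ^ 3).
  by move=> hi; rewrite expnS mul2n -addnn; apply: dbl_sp; [lia | apply: hb; apply: ltnW].
have [m4 [u4 [l4 r4 e4]]] := @count_sp _ (fun i => regE [:: 2 ^ i]) _ hc _ _ r3.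
have [|m5 [u5 [l5 r5 e5]]] := @comp_ok el [:: 2 ^ size w] hwl hneedl _ h1 h2 _ _ r4.
  by rewrite /= andbT; apply: leq_trans (hb _ (leqnn _)); apply: leq_addr.
do 2 eexists; split; first exact: EvSeq e1 (EvSeq e2 (EvSeq e3 (EvSeq e4 e5))).
by rewrite (nzE (_ : 1 <= K) r5) //; lia.
Qed.

Variables (eb : exp) (n : nat).
Hypotheses (hwf : wf eb 2) (hneed : need eb 2 <= K.+1) (hn : n <= B).
Variables (out : nat -> bool) (jm : nat).
Hypothesis hjm : jm <= B.
Hypothesis hout : forall j, j < jm -> [/\ okb B eb [:: n; j], ee eb [:: n; j] <= B & out j = (ee eb [:: n; j] != 0)].

Definition outp : prog := While (nz 1) (Seq (dec (rx 1)) (Seq (comp eb 2)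
  (Seq (If (nz 2) (act1 t0 (fun _ => (bit true, MoveL))) (act1 t0 (fun _ => (bit false, MoveL)))) (clear 2)))).

Definition otape a (ys : seq bool) : tape A := Tape (nseq a None) None (map bit ys).

Lemma out_ev j a ys t : j <= jm -> a + size ys + j + size w + 6 <= Z -> Rp t (otape a ys) 0 (regE [:: n; j]) ->
  exists m t' a', [/\ m <= j * (U + X ^ kt eb + 3 + X ^ 3) + 1, ev outp t m t',
    t' t0 = otape a' (mkseq out j ++ ys) & bnd Z t' /\ a' <= a].
Proof.
elim: j a ys t => [|j IH] a ys t hj ha rt.
  exists 1, t, a; have [h1 h2 h3 h4] := rt; split=> //.
  apply: EvStop; first exact: bndS.
  by rewrite (nzE _ rt) //; lia.
have hj' : j < jm by lia.
have [o1 o2 o3] := hout hj'.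
have s1 : spp (Seq (dec (rx 1)) (comp eb 2)) 0 (regE [:: n; j.+1]) 0 (regE [:: n; j; ee eb [:: n; j]]) (U + X ^ kt eb).
  apply: (spp_seq (p1 := 0) (reg1 := regE [:: n; j])).
    apply: (spp_eq (dec_sp (p := 0) (reg := regE [:: n; j.+1]) (r := 1) _ _)) => //; try lia.
    by case=> [|[|[|i]]].
  apply: (@comp_ok eb [:: n; j]) => //=.
  by rewrite hn; lia.
have [m1 [u [l1 r1 e1]]] := s1 _ _ rt.
set v := ee eb _ in o2 o3 r1.
have [h1 h2 h3 h4] := r1.
have K2 : 2 <= K by lia.
pose y := otape a.-1 (out j :: ys).
have ez : mv (fun _ => (bit (out j), MoveL)) (u t0) = y by rewrite h2 /otape /mv /= /y /otape; case: (a).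
have sy : tape_size y <= Z by rewrite /tape_size /= size_nseq /= size_map; lia.
have e2 : ev (If (nz 2) (act1 t0 (fun _ => (bit true, MoveL))) (act1 t0 (fun _ => (bit false, MoveL)))) u 2 (setTp u t0 y).
  apply: EvIf; first exact: bndS.
  rewrite (nzE K2 r1) -[regE _ 2]/v -o3 -ez.
  have sz : tape_size (mv (fun _ => (bit (out j), MoveL)) (u t0)) <= Z by rewrite ez.
  by case: (out j) sz ez => sz ez; apply: (E1_act (i := t0) sz h1).
have r2 : Rp (setTp u t0 y) y 0 (regE [:: n; j; v]).
  split; first exact: bnd_set.
  - by rewrite setT_eq.
  - by rewrite setT_ne // eq_sym t01.
  - by move=> r hr; rewrite setT_ne; [apply: h4 | rewrite eq_sym rx_t0].
have s3 : spp (clear 2) 0 (regE [:: n; j; v]) 0 (regE [:: n; j]) (X ^ 3).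
  apply: (spp_eq (clear_sp (p := 0) (reg := regE [:: n; j; v]) (r := 2) K2 _)) => //.
  by case=> [|[|[|[|i]]]].
have [m3 [u' [l3 r3 e3]]] := s3 _ _ r2.
have [||m4 [u4 [a' [l4 e4 t4 [b4 a4]]]]] := IH a.-1 (out j :: ys) u' _ _ r3; [lia | by rewrite /=; lia |].
exists ((m1 + (2 + m3)) + m4).+1, u4, a'; split=> //.
- by rewrite mulSn; lia.
- apply: EvLoop e4; first by apply: bndS; case: rt.
    by rewrite (nzE (_ : 1 <= K) rt) //; lia.
  have {e1} [m' [t'' [k' [em d1 d2]]]] : exists m' t'' k', [/\ m1 = m' + k', ev (dec (rx 1)) t m' t'' & ev (comp eb 2) t'' k' u].
    by move: e1; inversion 1; subst; do 3 eexists; split; eauto.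
  rewrite em -addnA; apply: EvSeq d1 _; apply: EvSeq d2 _; exact: EvSeq e2 e3.
- by rewrite t4 mkseqS cat_rcons.
- by split=> //; lia.
Qed.

Definition polyp : prog := Seq loadp (Seq homep (Seq (countp (inc (rx 0))) (Seq (comp el 1) (Seq outp (act1 t0 keepR))))).

Lemma poly_run o : n = size w -> okb B el [:: n] -> ee el [:: n] = size o -> size o = jm ->
  (forall j, out j = nth false o j) -> 2 * size w + size o + 6 <= Z ->
  exists m u a, [/\ m <= 2 * size w + 1 + (X ^ 3 + (size w * (1 + U).+1 + 1 + X ^ 3 + (X ^ kt el +
    (size o * (U + X ^ kt eb + 3 + X ^ 3) + 1 + 1)))), ev polyp (lst [::] w) m u & u t0 = mv keepR (otape a o)].
Proof.
move=> en h1 h2 h3 ho hz.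
have e1 := @load_ev [::] w (erefl _); rewrite cat0s in e1.
have [m2 [u2 [l2 r2 e2]]] := home_sp lst_Rp.
have z0 : (fun _ => 0) = regE [:: 0] by apply/funext => -[|[|j]].
rewrite z0 in r2.
have hc p i : i < size w -> spp (inc (rx 0)) p (regE [:: i]) p (regE [:: i.+1]) U.
  by move=> hi; apply: num_count_sp; move: hn; rewrite en; lia.
have [m3 [u3 [l3 r3 e3]]] := @count_sp _ (fun i => regE [:: i]) _ hc _ _ r2.
rewrite -en in r3.
have [||m4 [u4 [l4 r4 e4]]] := @comp_ok el [:: n] hwl hneedl _ h1 _ _ _ r3; [by rewrite /= hn | by rewrite h2 h3 |].
rewrite h2 in r4.
have [||m5 [u5 [a' [l5 e5 t5 [b5 a5]]]]] := @out_ev (size o) n [::] u4 _ _ r4; [by rewrite h3 | by rewrite /=; lia |].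
have eo : mkseq out (size o) = o by rewrite -[RHS](mkseq_nth false); apply: eq_mkseq.
rewrite cats0 eo in t5.
have sy : tape_size (mv keepR (u5 t0)) <= Z.
  by rewrite t5 /otape /mv /= /tape_size /= size_behead size_map size_nseq; lia.
have e6 := E1_act (i := t0) sy b5 (erefl _).
exists (2 * size w + 1 + (m2 + (m3 + (m4 + (m5 + 1))))), (setTp u5 t0 (mv keepR (u5 t0))), a'; split.
- by rewrite !leq_add.
- exact: EvSeq e1 (EvSeq e2 (EvSeq e3 (EvSeq e4 (EvSeq e5 e6)))).
- by rewrite -t5; exact: setT_eq.
Qed.

End Spec.

End Exprs.

(** * Time and space of compiled expressions *)

Module Compiled.
Import Tape Registers Exprs Lib.

Lemma poly_le f c k : (forall n, f n <= c * (n + 2) ^ k) -> poly_bounded f.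
Proof.
move=> h; have P a b : a <= b -> a ^ k <= b ^ k by move=> ab; case: (k) => // j; rewrite leq_exp2r.
exists (c * 3 ^ k), k => n; apply: leq_trans (h n) _; case: n => [|n].
  by apply: leq_trans (leq_addl _ _); rewrite leq_mul2l P ?orbT.
by apply: leq_trans (leq_addr _ _); rewrite -mulnA leq_mul2l -expnMn P ?orbT //; lia.
Qed.

(* The length and the bits of the output are computed in binary registers; the bits are written from the last
   one to the first, moving left over the cells of the erased input. *)
Theorem polytime_exp (T1 T2 : Type) (encA : T1 -> seq bool) (encB : T2 -> seq bool) (f : T1 -> T2) el eb K0 :
  wf el 1 -> wf eb 2 ->
  (forall a (w := encA a) (B := (size w + 2) ^ K0.+1), [/\ okb w B el [:: size w], ee w el [:: size w] = size (encB (f a)),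
     size (encB (f a)) <= B & forall j, j < size (encB (f a)) -> [/\ okb w B eb [:: size w; j], ee w eb [:: size w; j] <= B &
       nth false (encB (f a)) j = (ee w eb [:: size w; j] != 0)]]) ->
  polytime encA encB f.
Proof.
move=> wl wb H.
pose K := need el 1 + need eb 2 + 5.
pose prg : prog K.+2 := polyp K el eb.
(* [X] is [B] times a fifth power that is at least 32; this covers [U L + 10], which is
   [6 * B + 42]. *)
pose X n := (n + 2) ^ (K0 + 6).
pose kk := kt el + kt eb + 5.
exists (tm_of prg (fun _ => true)), (fun n => X n ^ (kk + 5)); split.
  by apply: (@poly_le _ 1 ((K0 + 6) * (kk + 5))) => n; rewrite mul1n expnM.
move=> a; have := H a; set w := encA a; set B := (size w + 2) ^ K0.+1; set o := encB (f a) => /=[[h1 h2 h3 h4]].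
have B2 : size w + 2 <= B by rewrite /B expnS leq_pmulr // expn_gt0 addn2.
(* Far more digits than [B] has, but still polynomially many. *)
set L := B + 2; set Z := L + 2 * B + 20 + 2 * size w.
have hLZ : L + 6 <= Z by rewrite /Z; lia.
have hwZ : size w + 6 <= Z by rewrite /Z; lia.
have hX : U L + 10 <= X (size w).
  have -> : X (size w) = (size w + 2) ^ 5 * B by rewrite /X /B -expnD; congr (_ ^ _); lia.
  have : 2 ^ 5 <= (size w + 2) ^ 5 by rewrite leq_exp2r //; lia.
  by move: B2; rewrite /U /L; set q := (size w + 2) ^ 5; rewrite (_ : 2 ^ 5 = 32) //; clear; nia.
have hB : B.+1 < 2 ^ L by rewrite /L; apply: leq_trans (ltn_expl _ (ltnSn 1)); lia.
have hBX : B <= X (size w) by move: hX; rewrite /U /L; lia.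
have hwX : size w <= X (size w) by lia.
have hB2 : 1 < B by lia.
set x := X (size w) in hX hBX hwX *.
have hK : need eb 2 <= K.+1 by rewrite /K; lia.
have hK3 : 3 < K.+1 by rewrite /K; lia.
have hKl : need el 1 <= K.+1 by rewrite /K; lia.
have hn : size w <= B by lia.
have hZ : 2 * size w + size o + 6 <= Z by rewrite /Z; lia.
have [m [u [a' [lm ev_ ut]]]] : exists m u a, [/\ m <= 2 * size w + 1 + (x ^ 3 + (size w * (1 + U L).+1 + 1 + x ^ 3 + (x ^ kt el +
    (size o * (U L + x ^ kt eb + 3 + x ^ 3) + 1 + 1)))), ev (K.+3 * Z) prg (@lst K [::] w) m u & u (t0 K) = mv keepR (otape a o)].
  exact: (poly_run hLZ hwZ hX hB hBX hwX hB2 hK3 wl hKl wb hK hn h3 h4 (erefl _) h1 h2 (erefl _) (fun j => erefl _) hZ).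
clearbody prg.
have hinit : @lst K [::] w = conf_tape (conf_init (tm_of prg (fun _ => true)) w).
  apply/funext => i; rewrite /lst /= (_ : t0 K = ord0) //; first by case: eqP => [_|_]; [case: (w) | case: eqP].
  by apply: val_inj; rewrite /= inordK.
have [_ f2 f3] := tm_ofP hinit (ev_rn ev_).
exists m.+1; split=> //; last first.
  rewrite f2 /conf_output /tape_word /=.
  rewrite (_ : ord0 = t0 K); last by apply: val_inj; rewrite /= inordK.
  rewrite ut /otape /mv /=.
  by elim: (o) => [|b s IH] //=; move: IH; case: s => [|c s] //= ->.
have x10 : 10 <= x by move: hX; lia.
have pw k k' : k <= k' -> x ^ k <= x ^ k' by move=> hk; rewrite leq_exp2l //; lia.
set P := x ^ kk.
have p1 : x ^ kt el <= P by apply: pw; rewrite /kk; lia.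
have p2 : x ^ kt eb <= P by apply: pw; rewrite /kk; lia.
have p3 : x ^ 3 <= P by apply: pw; rewrite /kk; lia.
have p4 : x * x <= P by apply: (leq_trans _ (pw 2 kk _)); rewrite ?expnS ?expn0 ?muln1 // /kk; lia.
rewrite expnD -/P !expnS expn0 muln1.
have : m.+1 <= 1 + (2 * size w + 1 + (P + (size w * (1 + U L).+1 + 1 + P + (P + (size o * (U L + P + 3 + P) + 1 + 1))))).
  have : size o * (U L + x ^ kt eb + 3 + x ^ 3) <= size o * (U L + P + 3 + P) by rewrite leq_mul2l; apply/orP; right; lia.
  by move: lm; lia.
have q1 : size w * (1 + U L).+1 <= P by apply: leq_trans p4; apply: leq_mul => //; lia.
have q0 : x <= P by apply: leq_trans p4; rewrite leq_pmulr; lia.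
have q2 : size o * (U L + P + 3 + P) <= x * (P * 4) by apply: leq_mul; [lia | move: hX q0; lia].
have q3 : P * 20 <= x * (P * 2) by rewrite mulnC [P * 2]mulnC mulnA; apply: leq_mul => //; lia.
have q4 : x * (P * 10) <= P * (x * (x * (x * (x * x)))).
  rewrite mulnC -mulnA leq_mul2l; apply/orP; right; rewrite mulnC leq_mul2l; apply/orP; right.
  by apply: leq_trans x10 _; rewrite leq_pmulr // !muln_gt0; lia.
move: hX q0 hwX; lia.
Qed.

Lemma ev_decides K (p : prog K.+2) (b : {ffun 'I_K.+3 -> symbol void} -> bool) S w m u (P : Prop) : ev S p (@lst K [::] w) m u -> (P <-> b (hds u)) ->
  (forall t, conf_space (conf_run (tm_of p b) w t) <= S) /\
  exists t, halted (conf_run (tm_of p b) w t) /\ (conf_accept (conf_run (tm_of p b) w t) <-> P).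
Proof.
move=> ev_ hP.
have hinit : @lst K [::] w = conf_tape (conf_init (tm_of p b) w).
  apply/funext => i; rewrite /lst /= (_ : t0 K = ord0) //; first by case: eqP => [_|_]; [case: (w) | case: eqP].
  by apply: val_inj; rewrite /= inordK.
have [f1 f2 f3] := tm_ofP hinit (ev_rn ev_).
split=> //; exists m.+1; split=> //.
by rewrite hP f2 /conf_accept /=; case: (b _).
Qed.

(** The registers hold numbers up to [2 ^ (K0.+1 * (size w).+1)] in linear space. The unit [x] of
    the running time is exponential here, which is harmless: it enters only into the step counts. *)
Theorem pspace_exp (Lg : language) e K0 : wf e 1 ->
  (forall w (B := 2 ^ (K0.+1 * (size w).+1)), [/\ okb w B e [:: 2 ^ size w], ee w e [:: 2 ^ size w] <= B &
     Lg w <-> ee w e [:: 2 ^ size w] != 0]) ->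
  in_PSPACE Lg.
Proof.
move=> we H.
pose K := need e 1 + 5.
pose prg : prog K.+2 := pspp K e.
pose LL n := K0.+1 * n.+1 + 2; pose ZZ n := LL n + 2 * n + 20.
exists (tm_of prg (@nz K 1)), (fun n => K.+3 * ZZ n); split.
  apply: (@poly_le _ (K.+3 * (K0.+1 * 30)) 1) => n; rewrite -mulnA leq_mul2l /=; rewrite /ZZ /LL expn1; nia.
move=> w; have [h1 h2 h3] := H w; move: h1 h2; set B := 2 ^ (K0.+1 * (size w).+1) => h1 h2.
have eB : B = 2 ^ (K0.+1 * (size w).+1) by [].
clearbody B.
set L := LL (size w); set Z := ZZ (size w).
have hLZ : L + 6 <= Z by rewrite /Z /ZZ -/L; lia.
have hwZ : size w + 6 <= Z by rewrite /Z /ZZ -/L; lia.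
have Bw : 2 ^ (size w).+1 <= B by rewrite eB leq_exp2l // mulSn leq_addr.
have wl : size w < 2 ^ size w by apply: ltn_expl.
have Bw2 i : i <= size w -> 2 ^ i + 2 ^ i <= B.
  by move=> hi; apply: leq_trans Bw; rewrite addnn -mul2n -expnS leq_exp2l.
have hB2 : 1 < B by have := Bw2 _ (leqnn _); lia.
have hB : B.+1 < 2 ^ L by rewrite /L /LL expnD -eB; lia.
pose x := U L + 10 + B + size w.
have hX : U L + 10 <= x by rewrite /x; lia.
have hBX : B <= x by rewrite /x; lia.
have hwX : size w <= x by rewrite /x; lia.
have hK : 3 < K.+1 by rewrite /K; lia.
have hKl : need e 1 <= K.+1 by rewrite /K; lia.
have [m [u [ev_ nzu]]] : exists m u, ev (K.+3 * Z) prg (@lst K [::] w) m u /\ @nz K 1 (hds u) = (ee w e [:: 2 ^ size w] != 0).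
  exact: (psp_run hLZ hwZ hX hB hBX hwX hB2 hK we hKl Bw2 h1 h2).
by apply: (ev_decides ev_); rewrite nzu.
Qed.

End Compiled.

(** * Expressible functions *)

Module Expressible.
Import Tape Registers Exprs Compiled Lib.

Fixpoint ctx d : Type := if d is d'.+1 then (ctx d' * nat)%type else unit.
Notation efun d := (seq bool -> ctx d -> nat).
Notation epred d := (seq bool -> ctx d -> bool).
Fixpoint env d : ctx d -> seq nat := if d is d'.+1 then fun x => rcons (env x.1) x.2 else fun _ => [::].

Definition le_env d (x : ctx d) X := 1 < X /\ all (leq^~ X) (env x).
Definition Bd d (f : efun d) := exists k, forall w x X, le_env x X -> f w x <= X ^ k.

(* Quantifying over all placements [s] of the arguments among the registers makes weakening immediate. *)
Definition E d (f : efun d) := forall D (s : seq nat), size s = d -> all (gtn D) s ->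
  exists e k, wf e D /\ forall w (x : ctx d) v X, size v = D -> env x = [seq nth 0 v i | i <- s] ->
    1 < X -> all (leq^~ X) v -> [/\ okb w (X ^ k) e v, ee w e v = f w x & f w x <= X ^ k].
Definition Eb d (P : epred d) := E (fun w x => P w x : nat).

Lemma size_env d (x : ctx d) : size (env x) = d.
Proof. by elim: d x => //= d IH x; rewrite size_rcons IH. Qed.

Lemma okb_mono w B B' e v : B <= B' -> okb w B e v -> okb w B' e v.
Proof.
move=> h; elim: e v => //= [a IHa b IHb|e IH|kn ka g IH] v.
- by case=> h1 h2 h3; split; [exact: IHa | exact: leq_trans h2 h | exact: IHb].
- by case=> h1 h2; split; [exact: IH | exact: leq_trans h2 h].
- by move=> h1 i hi; have [h2 h3] := h1 i hi; split; [exact: IH | exact: leq_trans h3 h].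
Qed.

Lemma powM X k k' : 1 < X -> k <= k' -> X ^ k <= X ^ k'.
Proof. by move=> h hk; rewrite leq_exp2l. Qed.
Lemma leX X k : 1 < X -> X <= X ^ k.+1.
Proof. by move=> h; rewrite -{1}(expn1 X); apply: powM. Qed.
Lemma gt1X X k : 1 < X -> 1 < X ^ k.+1.
Proof. by move=> h; apply: leq_trans (leX k h). Qed.
Lemma powD2 X a b : 1 < X -> X ^ a + X ^ b <= X ^ (a + b + 1).
Proof.
move=> h; have a0 : 0 < X ^ a by rewrite expn_gt0; lia.
have b0 : 0 < X ^ b by rewrite expn_gt0; lia.
rewrite !expnD expn1; apply: (@leq_trans (X ^ a * X ^ b * 2)); [nia | by rewrite leq_mul].

Qed.

Lemma E_bd d (f : efun d) : E f -> Bd f.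
Proof.
move=> h; have [|e [k [_ H]]] := h d (iota 0 d) (size_iota _ _).
  by apply/allP => i; rewrite mem_iota.
exists k => w x X [h1 h2]; have ex : env x = [seq nth 0 (env x) i | i <- iota 0 d] by rewrite map_nth_iota0 ?size_env // take_oversize ?size_env.
by have [_ _] := H w x (env x) X (size_env x) ex h1 h2.
Qed.

Lemma Bd_le d (f g : efun d) : (forall w x, f w x <= g w x) -> Bd g -> Bd f.
Proof. by move=> h [k H]; exists k => w x X hx; apply: leq_trans (h w x) (H w x X hx). Qed.

Lemma E_ext d (f g : efun d) : (forall w x, f w x = g w x) -> E f -> E g.
Proof. by move=> h; have -> : f = g by (apply/funext => w; apply/funext => x). Qed.

Lemma E_weak d (f : efun d) : E f -> E (fun w (x : ctx d.+1) => f w x.1).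
Proof.
move=> h D s; elim/last_ind: s => // s a _; rewrite size_rcons => -[hs].
rewrite all_rcons => /andP[ha hall]; have [e [k [hw H]]] := h D s hs hall.
exists e, k; split=> // w x v X hv; rewrite /= map_rcons => /rcons_inj[e1 e2]; exact: H.
Qed.

Lemma E_v0 d : E (fun w (x : ctx d.+1) => x.2).
Proof.
move=> D s; elim/last_ind: s => // s a _; rewrite size_rcons => -[hs].
rewrite all_rcons => /andP[ha hall]; exists (EVar a), 1; split=> // w x v X hv.
rewrite /= map_rcons => /rcons_inj[e1 e2] h1 /allP h2; split=> //.
by rewrite e2 expn1; apply: h2; apply: mem_nth; rewrite hv.
Qed.
Lemma E_v1 d : E (fun w (x : ctx d.+2) => x.1.2). Proof. exact: E_weak (@E_v0 _). Qed.
Lemma E_v2 d : E (fun w (x : ctx d.+3) => x.1.1.2). Proof. exact: E_weak (@E_v1 _). Qed.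
Lemma E_v3 d : E (fun w (x : ctx d.+4) => x.1.1.1.2). Proof. exact: E_weak (@E_v2 _). Qed.
Lemma E_v4 d : E (fun w (x : ctx d.+4.+1) => x.1.1.1.1.2). Proof. exact: E_weak (@E_v3 _). Qed.
Lemma E_v5 d : E (fun w (x : ctx d.+4.+2) => x.1.1.1.1.1.2). Proof. exact: E_weak (@E_v4 _). Qed.
Lemma E_v6 d : E (fun w (x : ctx d.+4.+3) => x.1.1.1.1.1.1.2). Proof. exact: E_weak (@E_v5 _). Qed.
Lemma E_v7 d : E (fun w (x : ctx d.+4.+4) => x.1.1.1.1.1.1.1.2). Proof. exact: E_weak (@E_v6 _). Qed.

Lemma E_0 d : E (fun w (x : ctx d) => 0).
Proof. by move=> D s _ _; exists EZero, 0; split. Qed.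

Lemma E_succ d (f : efun d) : E f -> E (fun w x => (f w x).+1).
Proof.
move=> h D s hs hall; have [e [k [hw H]]] := h D s hs hall.
exists (ESucc e), k.+1; split=> // w x v X hv ex h1 h2; have [o1 o2 o3] := H w x v X hv ex h1 h2.
have hk := powM h1 (leqnSn k); split; [exact: okb_mono o1 | by rewrite /= o2 |].
by rewrite expnS; have : 0 < X ^ k by [rewrite expn_gt0; lia]; nia.
Qed.

Lemma E_nat d n : E (fun w (x : ctx d) => n).
Proof. by elim: n => [|n IH]; [exact: E_0 | exact: E_succ]. Qed.

Lemma E_inp d (f : efun d) : E f -> E (fun w x => inpv w (f w x)).
Proof.
move=> h D s hs hall; have [e [k [hw H]]] := h D s hs hall.
exists (EInp e), k.+1; split=> // w x v X hv ex h1 h2; have [o1 o2 o3] := H w x v X hv ex h1 h2.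
have hk := powM h1 (leqnSn k); split.
- by split; [exact: okb_mono o1 | rewrite o2; exact: leq_trans o3 hk].
- by rewrite /= o2.
- apply: (@leq_trans 2); first by rewrite /inpv; case: ifP => // _; case: ifP.
  exact: gt1X.
Qed.

Lemma le_envS d (x : ctx d) a X : le_env x X -> a <= X -> @le_env d.+1 (x, a) X.
Proof. by case=> h1 h2 ha; split=> //=; rewrite all_rcons ha. Qed.

Lemma le_envX d (x : ctx d) X k : le_env x X -> le_env x (X ^ k.+1).
Proof.
case=> h1 h2; have l := leX k h1.
by split; [exact: leq_trans h1 l | apply: sub_all h2 => i /= hi; exact: leq_trans hi l].
Qed.

(** All iterates have to be bounded: a polynomial bound on [g] alone would permit repeated
    squaring. *)
Lemma E_iter d (n a : efun d) (g : efun d.+2) : E n -> E a -> E g ->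
  (exists k, forall w x X i, le_env x X -> i <= n w x -> iteri i (fun i y => g w (x, i, y)) (a w x) <= X ^ k) ->
  E (fun w x => iteri (n w x) (fun i y => g w (x, i, y)) (a w x)).
Proof.
move=> hn ha hg [kb hb].
have [kn hkn] := E_bd hn.
(* [ERec] takes the number of rounds and the start from variables; they are bound by [ELet] first,
   and [key] is about the recursion alone. *)
suff key : forall D s, size s = d -> all (gtn D) s -> exists e k, wf e D.+2 /\ forall w (x : ctx d) v X,
    size v = D -> env x = [seq nth 0 v i | i <- s] -> 1 < X -> all (leq^~ X) v ->
    okb w (X ^ k) e (rcons (rcons v (n w x)) (a w x)) /\ ee w e (rcons (rcons v (n w x)) (a w x)) = iteri (n w x) (fun i y => g w (x, i, y)) (a w x).
  move=> D s hs hall.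
  have [en [k1 [w1 H1]]] := hn D s hs hall.
  have hall1 : all (gtn D.+1) s by apply: sub_all hall => i /=; apply: leq_trans.
  have [ea [k2 [w2 H2]]] := ha D.+1 s hs hall1.
  have [e [k [w3 H3]]] := key D s hs hall.
  exists (ELet en (ELet ea e)), (k1 + k1.+1 * k2 + k + kb); split; first by rewrite /= w1 w2.
  move=> w x v X hv ex h1 h2; have [o1 o2 o3] := H1 w x v X hv ex h1 h2.
  have X1 : 1 < X ^ k1.+1 by exact: gt1X.
  have vX : all (leq^~ (X ^ k1.+1)) (rcons v (n w x)).
    rewrite all_rcons (leq_trans o3) ?powM //=; apply: sub_all h2 => i /= hi.
    exact: leq_trans hi (leX _ h1).
  have ex' : env x = [seq nth 0 (rcons v (n w x)) i | i <- s].
    by rewrite ex; apply/eq_in_map => i hi; rewrite nth_rcons hv (allP hall i hi : i < D).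
  have := H2 w x (rcons v (n w x)) _ _ ex' X1 vX; rewrite size_rcons hv -expnM => /(_ (erefl _))[p1 p2 p3].
  have [q1 q2] := H3 w x v X hv ex h1 h2.
  have le k' : k' <= k1 + k1.+1 * k2 + k + kb -> X ^ k' <= X ^ (k1 + k1.+1 * k2 + k + kb) by move=> hk; apply: powM.
  have hx : le_env x X.
    split=> //; rewrite ex all_map; apply/allP => i hi /=; apply: (allP h2); apply: mem_nth; rewrite hv.
    exact: (allP hall i hi).
  split.
  - rewrite /= o2 p2; split; [apply: okb_mono o1; apply: le; lia | apply: leq_trans o3 _; apply: le; lia |].
    split; [apply: okb_mono p1; apply: le; lia | apply: leq_trans p3 _; apply: le; lia | apply: okb_mono q1; apply: le; lia].
  - by rewrite /= o2 p2.
  - by apply: leq_trans (hb w x X (n w x) hx (leqnn _)) _; apply: le; lia.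
move=> D s hs hall.
have hs' : size (rcons (rcons s D.+3) D.+4) = d.+2 by rewrite !size_rcons hs.
have hall' : all (gtn (D.+2 + 3)) (rcons (rcons s D.+3) D.+4).
  rewrite !all_rcons /=; apply/and3P; split; try lia; apply: sub_all hall => i /=; lia.
have [eg [kg [wg Hg]]] := hg _ _ hs' hall'.
have [ka hka] := E_bd ha.
pose K := (kn + ka + kb).+1.
exists (ERec D D.+1 eg), (K * kg + kb); split; first by rewrite /= wg; lia.
move=> w x v X hv ex h1 h2.
have hx : le_env x X.
  split=> //; rewrite ex all_map; apply/allP => i hi /=; apply: (allP h2); apply: mem_nth; rewrite hv.
  exact: (allP hall i hi).
set v' := rcons (rcons v _) _.
have nn : nth 0 v' D = n w x by rewrite /v' !nth_rcons size_rcons hv ltnSn ltnn eqxx.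
have na : nth 0 v' D.+1 = a w x by rewrite /v' nth_rcons size_rcons hv ltnn eqxx.
have Kle k' : k' <= kn + ka + kb -> X ^ k' <= X ^ K by move=> h; apply: powM => //; rewrite /K; lia.
have X1 : 1 < X ^ K by exact: gt1X.
pose I i := iteri i (fun i y => g w (x, i, y)) (a w x).
have step i r : i < n w x -> r <= n w x -> [/\ okb w (X ^ (K * kg)) eg (v' ++ [:: r; i; I i]) & ee w eg (v' ++ [:: r; i; I i]) = I i.+1].
  move=> hi hr; have Ii := hb w x X i hx (ltnW hi).
  have := Hg w (x, i, I i) (v' ++ [:: r; i; I i]) (X ^ K); rewrite -expnM; case=> //.
  - by rewrite size_cat /v' !size_rcons hv.
  - rewrite /= !map_rcons; congr (rcons (rcons _ _) _).
    + rewrite ex; apply/eq_in_map => j hj; have jD : j < D := allP hall j hj.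
      by rewrite nth_cat /v' !size_rcons hv !nth_rcons !size_rcons hv jD !(leq_trans jD) //; lia.
    + by rewrite nth_cat /v' !size_rcons hv ifF; [rewrite (_ : D.+3 - D.+2 = 1) //; lia | lia].
    + by rewrite nth_cat /v' !size_rcons hv ifF; [rewrite (_ : D.+4 - D.+2 = 2) //; lia | lia].
  - have hnX := hkn w x X hx; have haX := hka w x X hx.
    rewrite all_cat /v' !all_rcons /= andbT -!andbA; apply/and5P; split.
    + by apply: leq_trans haX _; apply: Kle; lia.
    + by apply: leq_trans hnX _; apply: Kle; lia.
    + apply: sub_all h2 => j /= hj; exact: leq_trans hj (leX _ h1).
    + by apply: leq_trans hr _; apply: leq_trans hnX _; apply: Kle; lia.
    + apply/andP; split; first by apply: leq_trans (ltnW hi) _; apply: leq_trans hnX _; apply: Kle; lia.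
      by apply: leq_trans Ii _; apply: Kle; lia.
have rI i : i <= n w x -> rc (a w x) (n w x) (fun r i y => ee w eg (v' ++ [:: r; i; y])) i = I i.
  elim: i => [|i IH] hi //=; rewrite IH ?(ltnW hi) //.
  by have [] := step i (n w x - i.+1) hi (leq_subr _ _).
split; last by rewrite /= nn na rI.
rewrite /= nn na => i hi; rewrite rI ?(ltnW hi) //.
have [s1 s2] := step i (n w x - i.+1) hi (leq_subr _ _); split.
  by apply: okb_mono s1; apply: powM => //; apply: leq_addr.
by rewrite s2; apply: leq_trans (hb w x X i.+1 hx hi) _; apply: powM => //; apply: leq_addl.
Qed.

Notation c1 n := (tt, n).
Notation c2 n j := (tt, n, j).

Theorem polytime_E (T1 T2 : Type) (encA : T1 -> seq bool) (encB : T2 -> seq bool) (f : T1 -> T2)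
    (ln : efun 1) (bt : epred 2) : E ln -> Eb bt ->
  (forall a (w := encA a), encB (f a) = mkseq (fun j => bt w (c2 (size w) j)) (ln w (c1 (size w)))) ->
  polytime encA encB f.
Proof.
move=> h1 h2 h.
have [el [k1 [w1 H1]]] := h1 1 [:: 0] (erefl _) isT.
have [eb [k2 [w2 H2]]] := h2 2 [:: 0; 1] (erefl _) isT.
apply: (@polytime_exp _ _ _ _ _ el eb (k1 + (k1 + 1) * k2)) => // a w B.
have X1 : 1 < size w + 2 by lia.
have le k : k <= (k1 + (k1 + 1) * k2).+1 -> (size w + 2) ^ k <= B by apply: powM.
have [|o1 o2 o3] := H1 w (c1 (size w)) [:: size w] _ (erefl _) (erefl _) X1; first by rewrite /= leq_addr.
have so : size (encB (f a)) = ln w (c1 (size w)) by rewrite h size_mkseq.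
split.
- by apply: okb_mono o1; apply: le; lia.
- by rewrite o2 so.
- by rewrite so; apply: leq_trans o3 _; apply: le; lia.
move=> j hj; have X2 := gt1X k1 X1.
have [|p1 p2 p3] := H2 w (c2 (size w) j) [:: size w; j] _ (erefl _) (erefl _) X2.
  apply/and3P; split=> //; first by apply: leq_trans (leX k1 X1); apply: leq_addr.
  rewrite so in hj; apply: leq_trans (ltnW hj) _; apply: leq_trans o3 _; exact: powM.
rewrite -expnM in p1 p3; split.
- by apply: okb_mono p1; apply: le; nia.
- by rewrite p2; apply: leq_trans p3 _; apply: le; nia.
- by rewrite p2 h nth_mkseq ?eqb0 ?negbK // -so.
Qed.

(** With the argument [2 ^ size w], a polynomial bound on the values becomes a polynomial bound on
    their number of digits; so the same closure properties serve for time and for space. *)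
Theorem pspace_E (Lg : language) (P : epred 1) : Eb P ->
  (forall w, Lg w <-> P w (c1 (2 ^ size w))) -> in_PSPACE Lg.
Proof.
move=> h1 h; have [e [k [w1 H]]] := h1 1 [:: 0] (erefl _) isT.
apply: (@pspace_exp _ e k) => // w B.
have hs : 1 < 2 ^ (size w).+1 by apply: gt1X.
have [|o1 o2 o3] := H w (c1 (2 ^ size w)) [:: 2 ^ size w] _ (erefl _) (erefl _) hs; first by rewrite /= andbT; apply: powM.
rewrite -expnM in o1 o3.
have le : 2 ^ ((size w).+1 * k) <= B by apply: powM => //; rewrite mulnC leq_mul2r leqnSn orbT.
by split; [exact: okb_mono o1 | rewrite o2; exact: leq_trans o3 le | rewrite h o2 eqb0 negbK].
Qed.

End Expressible.

(** * Closure properties of expressible functions *)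

Module Closure.
Import Tape Registers Exprs Compiled Expressible Lib.



Section Subst.
Variable d : nat.
Implicit Types f g h : efun d.
End Subst.

Section Arith.
Variable d : nat.
Implicit Types f g h : efun d.
Implicit Types P Q : epred d.

Lemma E_weak2 f : E f -> E (fun w (x : ctx d.+2) => f w x.1.1). Proof. by move=> h; apply: E_weak (E_weak h). Qed.
Lemma E_weak3 f : E f -> E (fun w (x : ctx d.+3) => f w x.1.1.1). Proof. by move=> h; apply: E_weak (E_weak2 h). Qed.

Lemma E_iteri (n a : efun d) (G : seq bool -> ctx d -> nat -> nat -> nat) : E n -> E a ->
  E (fun w (x : ctx d.+2) => G w x.1.1 x.1.2 x.2) ->
  (exists k, forall w x X i, le_env x X -> i <= n w x -> iteri i (G w x) (a w x) <= X ^ k) ->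
  E (fun w x => iteri (n w x) (G w x) (a w x)).
Proof. by move=> h1 h2 h3 h4; apply: (E_iter h1 h2 h3 h4). Qed.

Lemma E_add f g : E f -> E g -> E (fun w x => f w x + g w x).
Proof.
move=> hf hg; have [kf bf] := E_bd hf; have [kg bg] := E_bd hg.
have e i a : iteri i (fun _ y => y.+1) a = a + i by elim: i => [|i IH] /=; rewrite ?addn0 // IH addnS.
apply: (E_ext (f := fun w x => iteri (g w x) (fun _ y => y.+1) (f w x))) => [w x|]; first by rewrite e.
apply: E_iteri => //; first exact: E_succ (@E_v0 _).
exists (kf + kg + 1) => w x X i hx hi; rewrite e; have [h1 _] := hx.
apply: leq_trans (powD2 kf kg h1); apply: leq_add; first exact: bf.
by apply: leq_trans hi _; apply: bg.
Qed.

Lemma E_pred f : E f -> E (fun w x => (f w x).-1).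
Proof.
move=> hf; have [kf bf] := E_bd hf.
have e i : iteri i (fun i _ => i) 0 = i.-1 by case: i.
apply: (E_ext (f := fun w x => iteri (f w x) (fun i _ => i) 0)) => [w x|]; first by rewrite e.
apply: E_iteri => //; [exact: E_0 | exact: E_v1 |].
by exists kf => w x X i hx hi; rewrite e; apply: leq_trans (leq_pred _) (leq_trans hi _); apply: bf.
Qed.
End Arith.

Section Arith2.
Variable d : nat.
Implicit Types f g h : efun d.
Implicit Types P Q : epred d.

Lemma E_sub f g : E f -> E g -> E (fun w x => f w x - g w x).
Proof.
move=> hf hg; have [kf bf] := E_bd hf.
have e i a : iteri i (fun _ y => y.-1) a = a - i by elim: i => [|i IH] /=; rewrite ?subn0 // IH subnS.
apply: (E_ext (f := fun w x => iteri (g w x) (fun _ y => y.-1) (f w x))) => [w x|]; first by rewrite e.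
apply: E_iteri => //; first by apply: E_pred; exact: E_v0.
by exists kf => w x X i hx hi; rewrite e; apply: leq_trans (leq_subr _ _) _; apply: bf.
Qed.

Lemma E_mul f g : E f -> E g -> E (fun w x => f w x * g w x).
Proof.
move=> hf hg; have [kf bf] := E_bd hf; have [kg bg] := E_bd hg.
have e i a : iteri i (fun _ y => y + a) 0 = a * i by elim: i => [|i IH] /=; rewrite ?muln0 // IH mulnS addnC.
apply: (E_ext (f := fun w x => iteri (g w x) (fun _ y => y + f w x) 0)) => [w x|]; first by rewrite e.
apply: (E_iteri (G := fun w x _ y => y + f w x)) => //; [exact: E_0 | by apply: E_add; [exact: E_v0 | exact: E_weak2] |].
exists (kf + kg) => w x X i hx hi; rewrite e expnD; apply: leq_mul; first exact: bf.
by apply: leq_trans hi _; apply: bg.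
Qed.

Lemma Eb_not P : Eb P -> Eb (fun w x => ~~ P w x).
Proof. by move=> h; apply: (E_ext (f := fun w x => 1 - P w x)) => [w x|]; [case: (P w x) | apply: E_sub => //; exact: E_nat]. Qed.
Lemma Eb_and P Q : Eb P -> Eb Q -> Eb (fun w x => P w x && Q w x).
Proof. by move=> h h'; apply: (E_ext (f := fun w x => P w x * Q w x)) => [w x|]; [case: (P w x); case: (Q w x) | apply: E_mul]. Qed.
Lemma Eb_or P Q : Eb P -> Eb Q -> Eb (fun w x => P w x || Q w x).
Proof.
move=> h h'; apply: (E_ext (f := fun w x => ~~ (~~ P w x && ~~ Q w x) : nat)) => [w x|].
  by rewrite negb_and !negbK.
by apply: Eb_not; apply: Eb_and; apply: Eb_not.
Qed.
Lemma Eb_imp P Q : Eb P -> Eb Q -> Eb (fun w x => P w x ==> Q w x).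
Proof.
move=> h h'; apply: (E_ext (f := fun w x => ~~ P w x || Q w x : nat)) => [w x|]; first by rewrite implybE.
by apply: Eb_or => //; apply: Eb_not.
Qed.
Lemma E_if (b : epred d) f g : Eb b -> E f -> E g -> E (fun w x => if b w x then f w x else g w x).
Proof.
move=> hb hf hg; apply: (E_ext (f := fun w x => b w x * f w x + (1 - b w x) * g w x)) => [w x|].
  by case: (b w x); rewrite ?mul1n ?mul0n ?addn0.
by apply: E_add; apply: E_mul => //; apply: E_sub => //; exact: E_nat.
Qed.
Lemma Eb_is0 f : E f -> Eb (fun w x => f w x == 0).
Proof.
move=> hf; have e i : iteri i (fun _ _ => 0) 1 = (i == 0) by case: i.
apply: (E_ext (f := fun w x => iteri (f w x) (fun _ _ => 0) 1)) => [w x|]; first by rewrite e.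
apply: E_iteri => //; [exact: E_nat | exact: E_0 |].
by exists 0 => w x X i hx hi; rewrite e; case: (_ == _).
Qed.
Lemma Eb_leq f g : E f -> E g -> Eb (fun w x => f w x <= g w x).
Proof. by move=> hf hg; apply: Eb_is0; apply: E_sub. Qed.
Lemma Eb_eq f g : E f -> E g -> Eb (fun w x => f w x == g w x).
Proof.
move=> hf hg; apply: (E_ext (f := fun w x => (f w x <= g w x) && (g w x <= f w x) : nat)) => [w x|].
  by rewrite -eqn_leq.
by apply: Eb_and; apply: Eb_leq.
Qed.
Lemma Eb_bool (b : bool) : Eb (fun w (x : ctx d) => b). Proof. exact: E_nat. Qed.
Lemma Eb_eqb P Q : Eb P -> Eb Q -> Eb (fun w x => P w x == Q w x).
Proof.
move=> h h'; apply: (E_ext (f := fun w x => (P w x : nat) == (Q w x : nat) : nat)) => [w x|]; first by case: (P w x); case: (Q w x).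
exact: Eb_eq.
Qed.
Lemma Eb_if (b : epred d) P Q : Eb b -> Eb P -> Eb Q -> Eb (fun w x => if b w x then P w x else Q w x).
Proof.
move=> hb hf hg; apply: (E_ext (f := fun w x => if b w x then P w x : nat else Q w x)) => [w x|]; first by case: (b w x).
exact: E_if.
Qed.
Lemma E_min f g : E f -> E g -> E (fun w x => minn (f w x) (g w x)).
Proof. by move=> hf hg; apply: E_if => //; apply: Eb_leq => //; apply: E_succ. Qed.
Lemma E_max f g : E f -> E g -> E (fun w x => maxn (f w x) (g w x)).
Proof. by move=> hf hg; apply: E_if => //; apply: Eb_leq => //; apply: E_succ. Qed.

Definition bsum n (F : nat -> nat) := \sum_(i <- iota 0 n) F i.
Definition exn n (P : pred nat) := has P (iota 0 n).
Definition alln n (P : pred nat) := all P (iota 0 n).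

Lemma bsumS n F : bsum n.+1 F = bsum n F + F n.
Proof. by rewrite /bsum -addn1 iotaD big_cat /= big_seq1 add0n. Qed.
Lemma bsumE n F : bsum n F = \sum_(i < n) F i.
Proof. by elim: n => [|n IH]; [rewrite /bsum /= big_nil big_ord0 | rewrite bsumS big_ord_recr /= IH]. Qed.

Lemma E_sum n (F : seq bool -> ctx d -> nat -> nat) : E n -> E (fun w (x : ctx d.+1) => F w x.1 x.2) ->
  E (fun w x => bsum (n w x) (F w x)).
Proof.
move=> hn hF; have [kn bn] := E_bd hn; have [k bF] := E_bd hF.
have e i w x : iteri i (fun i y => y + F w x i) 0 = bsum i (F w x).
  by elim: i => [|i IH] /=; [rewrite /bsum big_nil | rewrite bsumS IH].
apply: (E_ext (f := fun w x => iteri (n w x) (fun i y => y + F w x i) 0)) => [w x|]; first by rewrite e.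
apply: (E_iteri (G := fun w x i y => y + F w x i)) => //; first exact: E_0.
  by apply: E_add; [exact: E_v0 | exact: E_weak hF].
exists (kn + kn.+1 * k) => w x X i hx hi; rewrite e bsumE.
have [h1 _] := hx; have hni := bn w x X hx.
apply: (@leq_trans (\sum_(j < i) X ^ (kn.+1 * k))).
  apply: leq_sum => j _; rewrite expnM; apply: (bF w (x, nat_of_ord j)).
  apply: le_envS; first exact: le_envX.
  by apply: leq_trans (ltnW (leq_trans (ltn_ord j) hi)) _; apply: leq_trans hni _; apply: powM.
by rewrite sum_nat_const card_ord expnD leq_mul2r (leq_trans hi) ?orbT.
Qed.

Lemma exnP n (P : pred nat) : reflect (exists2 i, i < n & P i) (exn n P).
Proof. by apply: (iffP hasP) => -[i hi hP]; exists i => //; move: hi; rewrite mem_iota. Qed.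
Lemma allnP n (P : pred nat) : reflect (forall i, i < n -> P i) (alln n P).
Proof. by apply: (iffP allP) => h i hi; apply: h; move: hi; rewrite mem_iota. Qed.
Lemma exn_sum n (P : pred nat) : exn n P = (0 < bsum n (fun i => P i : nat)).
Proof. by rewrite /exn has_count /bsum -sum1_count big_mkcond; congr leq; apply: eq_bigr => i _; case: (P i). Qed.

Lemma Eb_ex n (P : seq bool -> ctx d -> nat -> bool) : E n -> Eb (fun w (x : ctx d.+1) => P w x.1 x.2) ->
  Eb (fun w x => exn (n w x) (P w x)).
Proof.
move=> hn hP; apply: (E_ext (f := fun w x => 0 < bsum (n w x) (fun i => P w x i : nat) : nat)) => [w x|].
  by rewrite exn_sum.
by apply: Eb_leq; [exact: E_nat | apply: (@E_sum _ (fun w x i => P w x i : nat))].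
Qed.
Lemma alln_ex n (P : pred nat) : alln n P = ~~ exn n (fun i => ~~ P i).
Proof. by rewrite /exn -all_predC; apply: eq_all => i /=; rewrite negbK. Qed.
End Arith2.

Lemma Eb_all d n (P : seq bool -> ctx d -> nat -> bool) : E n -> Eb (fun w (x : ctx d.+1) => P w x.1 x.2) ->
  Eb (fun w x => alln (n w x) (P w x)).
Proof.
move=> hn hP; apply: (E_ext (f := fun w x => ~~ exn (n w x) (fun i => ~~ P w x i) : nat)) => [w x|].
  by rewrite alln_ex.
by apply: Eb_not; apply: (@Eb_ex _ _ (fun w x i => ~~ P w x i)) => //; apply: Eb_not.
Qed.

Ltac Ehook := fail.
Ltac Evar := first [exact (@E_v0 _) | exact (@E_v1 _) | exact (@E_v2 _) | exact (@E_v3 _) | exact (@E_v4 _) | exact (@E_v5 _) | exact (@E_v6 _) | exact (@E_v7 _)].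
Ltac Estep := lazymatch goal with
  | |- Eb (fun w x => andb (@?f w x) (@?g w x)) => apply: (@Eb_and _ f g)
  | |- Eb (fun w x => orb (@?f w x) (@?g w x)) => apply: (@Eb_or _ f g)
  | |- Eb (fun w x => implb (@?f w x) (@?g w x)) => apply: (@Eb_imp _ f g)
  | |- Eb (fun w x => negb (@?f w x)) => apply: (@Eb_not _ f)
  | |- Eb (fun w x => leq (@?f w x) (@?g w x)) => apply: (@Eb_leq _ f g)
  | |- Eb (fun w x => eq_op (@?f w x) (@?g w x)) => first [apply: (@Eb_eq _ f g) | apply: (@Eb_eqb _ f g)]
  | |- Eb (fun w x => exn (@?n w x) (@?P w x)) => apply: (@Eb_ex _ n P)
  | |- Eb (fun w x => alln (@?n w x) (@?P w x)) => apply: (@Eb_all _ n P)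
  | |- Eb (fun _ _ => ?b) => exact (@Eb_bool _ b)
  | |- E (fun w x => nat_of_bool (@?P w x)) => change (Eb P); cbv beta
  | |- E (fun _ _ => ?n) => exact (@E_nat _ n)
  | |- E (fun w x => snd _) => Evar
  | |- E (fun w x => S (@?f w x)) => apply: (@E_succ _ f)
  | |- E (fun w x => addn (@?f w x) (@?g w x)) => apply: (@E_add _ f g)
  | |- E (fun w x => subn (@?f w x) (@?g w x)) => apply: (@E_sub _ f g)
  | |- E (fun w x => muln (@?f w x) (@?g w x)) => apply: (@E_mul _ f g)
  | |- E (fun w x => minn (@?f w x) (@?g w x)) => apply: (@E_min _ f g)
  | |- E (fun w x => maxn (@?f w x) (@?g w x)) => apply: (@E_max _ f g)
  | |- E (fun w x => predn (@?f w x)) => apply: (@E_pred _ f)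
  | |- E (fun w x => inpv w (@?f w x)) => apply: (@E_inp _ f)
  | |- E (fun w x => bsum (@?n w x) (@?F w x)) => apply: (@E_sum _ n F)
  end; cbv beta.
Ltac E1 := first [assumption | Ehook | Estep
  | apply: E_weak; assumption | apply: E_weak2; assumption | apply: E_weak3; assumption
  | lazymatch goal with |- Eb _ => apply: Eb_if | |- E _ => apply: E_if end ].
Ltac Es := repeat E1.

Lemma E_div d (f g : efun d) : E f -> E g -> E (fun w x => f w x %/ g w x).
Proof.
move=> hf hg; apply: (E_ext (f := fun w x => if 1 <= g w x then bsum (f w x) (fun i => (i.+1 * g w x <= f w x) : nat) else 0)) => [w x|]; last by Es.
case: ltnP => h; last by move: h; rewrite leqn0 => /eqP->; rewrite divn0.
have e m k : bsum m (fun i => (i < k) : nat) = minn m k.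
  by elim: m => [|m IH]; [rewrite /bsum big_nil min0n | rewrite bsumS IH; case: ltnP; lia].
rewrite -[RHS](@minn_idPr (f w x) _ (leq_div _ _)) -e; apply: eq_bigr => i _.
by rewrite leq_divRL.
Qed.
Lemma E_mod d (f g : efun d) : E f -> E g -> E (fun w x => f w x %% g w x).
Proof.
move=> hf hg; apply: (E_ext (f := fun w x => f w x - f w x %/ g w x * g w x)) => [w x|].
  by rewrite {1}(divn_eq (f w x) (g w x)) addKn.
by apply: E_sub => //; apply: E_mul => //; apply: E_div.
Qed.
Lemma E_pow d (f g : efun d) : E f -> E g -> Bd (fun w x => f w x ^ g w x) -> E (fun w x => f w x ^ g w x).
Proof.
move=> hf hg [k b]; have e i a : iteri i (fun _ y => y * a) 1 = a ^ i by elim: i => [|i IH] //=; rewrite IH expnSr.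
apply: (E_ext (f := fun w x => iteri (g w x) (fun _ y => y * f w x) 1)) => [w x|]; first by rewrite e.
apply: (E_iteri (G := fun w x _ y => y * f w x)) => //; [exact: E_nat | by Es |].
exists k => w x X i hx hi; rewrite e; have [h1 _] := hx.
have [f0|] := posnP (f w x).
  apply: (@leq_trans 1); last by rewrite expn_gt0 (ltnW h1).
  by rewrite f0; case: (i) => [|i'] //; rewrite exp0n.
by move=> f0; apply: leq_trans (b w x X hx); rewrite leq_pexp2l.
Qed.
(** The logarithm is the number of powers of two below [f]. The doubling is capped at [f] to keep
    all iterates bounded. *)
Lemma E_uplog d (f : efun d) : E f -> E (fun w x => up_log 2 (f w x)).
Proof.
move=> hf.
have e m i : iteri i (fun _ y => minn (y + y) m) (minn 1 m) = minn (2 ^ i) m.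
  by elim: i => [|i IH] //=; rewrite IH expnS; lia.
apply: (E_ext (f := fun w x => bsum (f w x) (fun i => (iteri i (fun _ y => minn (y + y) (f w x)) (minn 1 (f w x)) < f w x) : nat))) => [w x|].
  have s m k : bsum m (fun i => (i < k) : nat) = minn m k.
    by elim: m => [|m IH]; [rewrite /bsum big_nil min0n | rewrite bsumS IH; case: ltnP; lia].
  have ul : up_log 2 (f w x) <= f w x by apply: up_log_min => //; apply: ltnW; apply: ltn_expl.
  rewrite -[RHS](@minn_idPr (f w x) _ ul) -[RHS]s; apply: eq_bigr => i _; rewrite e gtn_min ltnn orbF; congr nat_of_bool.
  apply/idP/idP => h; last by rewrite ltnNge; apply: contraL h => h; rewrite -leqNgt up_log_min.
  by rewrite ltnNge; apply: contraL h => h; rewrite -leqNgt; apply: leq_trans (up_logP _ (ltnSn 1)) _; rewrite leq_exp2l.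
apply: E_sum => //; apply: Eb_leq; last by Es.
apply: E_succ; apply: (E_iteri (G := fun w (x : ctx d.+1) _ y => minn (y + y) (f w x.1))); [by Es | by Es | by Es |].
have [k b] := E_bd hf; exists k => w x X i [h1 h2] hi; rewrite e; apply: leq_trans (geq_minr _ _) _; apply: b.
by split=> //; move: h2; rewrite /= all_rcons => /andP[].
Qed.
(** A general power would violate the bound [Bd]; this one stays below [f + f + 2]. *)
Lemma E_pow2log d (f : efun d) : E f -> E (fun w x => 2 ^ up_log 2 (f w x)).
Proof.
move=> hf; apply: (E_pow (f := fun _ _ => 2)); [exact: E_nat | exact: E_uplog |].
have [k b] := E_bd (E_add (E_add hf hf) (@E_nat d 2)); exists k => w x X hx; apply: leq_trans (b w x X hx).
case: (leqP (f w x) 1) => h; first by rewrite (_ : up_log 2 _ = 0) ?expn0; [lia | move: h; case: (f w x) => [|[]]].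
by have := up_log_bounds (ltnSn 1) h => /andP[h1 h2]; move: h1; rewrite -{2}(prednK (_ : 0 < up_log 2 (f w x))) ?up_log_gt0 // expnS; lia.
Qed.

End Closure.

Module Exp.
Export Tape Registers Exprs Compiled Expressible Closure.
End Exp.

(** * Truth of towers and truth of formulas *)

Module Formulas.
Import Game Reaching Layout Dag UpperBound Lib.

Fixpoint pt (q : nat -> bool) (F : (nat -> bool) -> bool) k i (r : nat -> bool) : bool :=
  if k is k'.+1 then
    if q i then pt q F k' i.+1 (upd r i false) && pt q F k' i.+1 (upd r i true)
    else pt q F k' i.+1 (upd r i false) || pt q F k' i.+1 (upd r i true)
  else F r.

Definition lit_true n (r : nat -> bool) x := (0 < x <= 2 * n) && (r (x.-1 %/ 2) == x.-1 %% 2 :> nat).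
Definition clause_true n (lf : nat -> nat -> nat) r j :=
  [|| lit_true n r (lf j 0), lit_true n r (lf j 1) | lit_true n r (lf j 2)].
Definition form_true n c q lf := pt q (fun r => all (clause_true n lf r) (iota 0 c)) n 0 (fun _ => false).

Section Truth.
Variables (n c : nat) (q : nat -> bool) (lf : nat -> nat -> nat).
Notation lmax := (lmax n c). Notation tr := (tr n c q lf). Notation tst := (tst n q lf).
Notation kd := (kd n c). Notation br0 := (br0 n c). Notation br1 := (br1 n c).

Lemma tst3 t r : tst t r = [|| (lcode n q lf t 0 != 0) && (r ((lcode n q lf t 0).-1 %/ 2) == (lcode n q lf t 0).-1 %% 2 :> nat),
  (lcode n q lf t 1 != 0) && (r ((lcode n q lf t 1).-1 %/ 2) == (lcode n q lf t 1).-1 %% 2 :> nat) |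
  (lcode n q lf t 2 != 0) && (r ((lcode n q lf t 2).-1 %/ 2) == (lcode n q lf t 2).-1 %% 2 :> nat)].
Proof.
apply/existsP/idP => [[[[|[|[|k]]] hk]] /= h|].
- by rewrite h.
- by rewrite h orbT.
- by rewrite h !orbT.
- by [].
case/or3P => h; [exists (@Ordinal 3 0 isT) | exists (@Ordinal 3 1 isT) | exists (@Ordinal 3 2 isT)]; exact: h.
Qed.

Lemma tst_var i b r : i < n -> b < 2 -> tst (2 * i + b) r = (q i ==> (r i == b :> nat)).
Proof.
move=> hi hb; rewrite tst3 /lcode.
have h1 : 2 * i + b < 2 * n by move: hi hb; clear; lia.
have d1 : (2 * i + b) %/ 2 = i by move: hb; clear; lia.
have d2 : (2 * i + b) %% 2 = b by move: hb; clear; lia.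
have e0 : (2 * i) %/ 2 = i /\ (2 * i) %% 2 = 0 by clear; split; lia.
have e1 : (2 * i).+1 %/ 2 = i /\ (2 * i).+1 %% 2 = 1 by clear; split; lia.
case: e0 e1 => a1 a2 [a3 a4]; rewrite h1 d1.
case: (q i); first by rewrite /= d1 d2 !orbF.
rewrite ![_ == 0]/= ![_ < 2]/= !addn1 addn0 ![_.+1.-1]/= a1 a2 a3 a4 !implyFb.
by case: (r i).
Qed.

(** Dropping repeated or absent literals does not change a disjunction. *)
Lemma tst_cls j r : tst (2 * n + j) r = clause_true n lf r j.
Proof.
rewrite tst3 /lcode ltnNge leq_addr /= addKn /clause_true !andbT.
set A := lit_true n r.
have L (d1 d2 : bool) x : ((if [&& 0 < x <= 2 * n, d1 & d2] then x else 0) != 0) &&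
   (r ((if [&& 0 < x <= 2 * n, d1 & d2] then x else 0).-1 %/ 2) == (if [&& 0 < x <= 2 * n, d1 & d2] then x else 0).-1 %% 2 :> nat) = [&& d1, d2 & A x].
  rewrite /A /lit_true; case: d1; case: d2; rewrite /= ?andbF ?andbT //.
  by case h : (0 < x <= 2 * n) => //=; rewrite -lt0n; case/andP: h => ->.
have L2 (d1 : bool) x : ((if (0 < x <= 2 * n) && d1 then x else 0) != 0) &&
   (r ((if (0 < x <= 2 * n) && d1 then x else 0).-1 %/ 2) == (if (0 < x <= 2 * n) && d1 then x else 0).-1 %% 2 :> nat) = d1 && A x.
  by have := L d1 true x; rewrite !andbT /= => ->.
have L3 x : ((if (0 < x <= 2 * n) then x else 0) != 0) &&
   (r ((if (0 < x <= 2 * n) then x else 0).-1 %/ 2) == (if (0 < x <= 2 * n) then x else 0).-1 %% 2 :> nat) = A x.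
  by have := L true true x; rewrite !andbT /= => ->.
rewrite L3 L2 L.
case: (lf j 0 =P lf j 1) => [e1|n1] /=; case: (lf j 0 =P lf j 2) => [e2|n2] /=; case: (lf j 1 =P lf j 2) => [e3|n3] /=;
  try (exfalso; congruence);
  rewrite -?e1 -?e2 -?e3; move: (A (lf j 0)) (A (lf j 1)) (A (lf j 2)) => [] [] [] //=.
Qed.

Lemma tr3 lam f r : 0 < lam -> 0 < f <= 2 -> kd lam f = 3 ->
  tr lam f r = tr lam.-1 (br0 lam f) r && tr lam.-1 (br1 lam f) r.
Proof. by case: lam => // lam _ /andP[f0 f2] k /=; rewrite k /= (gtn_eqF f0) (_ : (5 < f) = false) //; lia. Qed.

Lemma tr_tst lam t r : tr lam (6 + t) r = tst t r.
Proof. by case: lam => [|lam] /=; rewrite addKn. Qed.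

(** Three levels realise one quantifier: a conjunction over [b], a disjunction over the value, and
    the test. For a universal variable the test forces the value to be [b]; for an existential one
    the two conjuncts coincide. *)
Lemma tr_B i r : i < n -> tr (lmax - 3 * i) 1 r =
  if q i then tr (lmax - 3 * i.+1) 1 (upd r i false) && tr (lmax - 3 * i.+1) 1 (upd r i true)
  else tr (lmax - 3 * i.+1) 1 (upd r i false) || tr (lmax - 3 * i.+1) 1 (upd r i true).
Proof.
move=> hi.
have L : lmax = 3 * n + c + 4 by [].
have v0 : vr n c (lmax - 3 * i) = 0 by rewrite /vr; lia.
have v2 : vr n c (lmax - 3 * i - 2) = 2 by rewrite /vr; lia.
have u2 : vi n c (lmax - 3 * i - 2) = i by rewrite /vi; lia.
have i0 : isvar n c (lmax - 3 * i) by rewrite /isvar; lia.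
have i2 : isvar n c (lmax - 3 * i - 2) by rewrite /isvar; lia.
have n1 : (lmax - 3 * i == lmax.+1) = false by lia.
have n2 : (lmax - 3 * i - 2 == lmax.+1) = false by lia.
have z0 : (lmax - 3 * i == 0) = false by lia.
have z2 : (lmax - 3 * i - 2 == 0) = false by lia.
have c0 : (lmax - 3 * i <= c + 4) = false by lia.
have c2 : (lmax - 3 * i - 2 <= c + 4) = false by lia.
have T b s : b < 2 -> tr (lmax - 3 * i - 2) b.+1 s = tst (2 * i + b) s && tr (lmax - 3 * i.+1) 1 s.
  move=> hb; rewrite tr3; [|lia|lia|]; last first.
    by rewrite /Layout.kd; case: b hb => [|[|b]] //= _; rewrite ?n2 ?z2 ?c2 ?i2 ?v2.
  have -> : (lmax - 3 * i - 2).-1 = lmax - 3 * i.+1 by lia.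
  have -> : br0 (lmax - 3 * i - 2) b.+1 = 6 + (2 * i + b).
    by rewrite /Layout.br0; case: b hb => [|[|b]] //= _; rewrite ?n2 ?c2 ?v2 ?u2 /=; lia.
  have -> : br1 (lmax - 3 * i - 2) b.+1 = 1.
    by rewrite /Layout.br1; case: b hb => [|[|b]] //= _; rewrite ?i2 ?v2.
  by rewrite tr_tst.
have X b : b < 2 -> tr (lmax - 3 * i).-1 b.+1 r =
   (tst (2 * i + b) (upd r i false) && tr (lmax - 3 * i.+1) 1 (upd r i false)) ||
   (tst (2 * i + b) (upd r i true) && tr (lmax - 3 * i.+1) 1 (upd r i true)).
  move=> hb; have -> : (lmax - 3 * i).-1 = lve n c i by rewrite /lve; lia.
  rewrite tr_ex // (_ : (lve n c i).-1 = lmax - 3 * i - 2); last by rewrite /lve; lia.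
  by rewrite !T.
rewrite tr3; [|lia|lia|by rewrite /Layout.kd /= n1 z0 c0 v0].
have -> : br0 (lmax - 3 * i) 1 = 1 by rewrite /Layout.br0 /= n1 c0 v0.
have -> : br1 (lmax - 3 * i) 1 = 2 by rewrite /Layout.br1 /= i0 v0.
rewrite (X 0) // (X 1) // !tst_var // /upd eqxx.
case: (q i) => /=; first by rewrite orbF.
by rewrite andbb.
Qed.

Lemma tr_cls k r : k <= c + 4 -> tr k 1 r = all (clause_true n lf r) (iota (c + 4 - k) (k - 4)).
Proof.
elim: k => [|k IH] hk; first by [].
have L : lmax = 3 * n + c + 4 by [].
have n1 : (k.+1 == lmax.+1) = false by lia.
have iv : isvar n c k.+1 = false by rewrite /isvar; lia.
rewrite tr3 //; last by rewrite /Layout.kd /= n1 hk.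
have -> : br1 k.+1 1 = 1 by rewrite /Layout.br1 /= iv.
rewrite /Layout.br0 /= n1 hk IH ?(ltnW hk) //.
case: ltnP => h4; last first.
  have -> : k.+1 - 4 = 0 by move: h4; clear; lia.
  have -> : k - 4 = 0 by move: h4; clear; lia.
  by case: (k).
have -> : k.+1 - 4 = (k - 4).+1 by move: h4; clear; lia.
rewrite -addnA tr_tst tst_cls.
by rewrite /= (_ : (c + 4 - k.+1).+1 = c + 4 - k) //; lia.
Qed.

Lemma root_trueE : root_true n c q lf = form_true n c q lf.
Proof.
rewrite /root_true /form_true; move: (fun _ : nat => false).
have key k i r : i + k = n -> tr (lmax - 3 * i) 1 r = pt q (fun r => all (clause_true n lf r) (iota 0 c)) k i r.
  elim: k i r => [|k IH] i r hik /=.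
    rewrite tr_cls; last by rewrite /lmax; lia.
    by congr (all _ (iota _ _)); rewrite /lmax; lia.
  by rewrite tr_B; [rewrite !IH //; lia | lia].
by move=> r; have := key n 0 r (add0n _); rewrite muln0 subn0.
Qed.

Theorem pdag_priceE : rev_price (pdag n c q lf) = H n c lmax.+1 + 1 + ~~ form_true n c q lf.
Proof. by rewrite LowerBound.pdag_price root_trueE. Qed.
End Truth.

Section QBF.
Variable phi : qbf.
Definition fn := qbf_size phi.
Definition fc := size (qbf_matrix phi).
Definition fq i := if nth QEx (qbf_prefix phi) i is QAll then true else false.
Definition fl j k := let C := nth [::] (qbf_matrix phi) j in
  if k < size C then nth 0 [seq (2 * nat_of_ord l.1 + nat_of_bool l.2 + 1)%N | l : literal (qbf_size phi) <- C] k else 0.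

Lemma clause_true_lit j r : j < fc ->
  clause_true fn fl r j = has (fun l : literal (qbf_size phi) => r l.1 == l.2) (nth [::] (qbf_matrix phi) j).
Proof.
move=> hj; rewrite /clause_true /fl.
have := allP (qbf_3cnf phi) _ (mem_nth [::] hj); set C := nth _ _ j.
have L (l : literal (qbf_size phi)) : lit_true fn r (2 * l.1 + l.2 + 1) = (r l.1 == l.2).
  case: l => i b; have hi : i < fn := ltn_ord i.
  have e : 0 < 2 * i + b + 1 <= 2 * fn by case: (b); lia.
  rewrite /lit_true e addn1 /=.
  have -> : (2 * i + b) %/ 2 = i by case: (b); lia.
  have -> : (2 * i + b) %% 2 = b by case: (b); lia.
  by case: (r i); case: (b).
have L0 : lit_true fn r 0 = false by [].
by case: C => [|l1 [|l2 [|l3 [|l4 C]]]] //= _; rewrite ?L ?L0 ?orbF.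
Qed.

Lemma prefix_pt qs F rho (Q : nat -> bool) : (forall i, i < size qs -> Q (size rho + i) = if nth QEx qs i is QAll then true else false) ->
  prefix_true qs F rho = pt Q F (size qs) (size rho) (nth false rho).
Proof.
elim: qs rho => [|a qs IH] rho hQ //=.
have u b : upd (nth false rho) (size rho) b = nth false (rcons rho b).
  by apply/funext => j; rewrite /upd nth_rcons; case: ltngtP => // h; rewrite nth_default // ltnW.
have s b : (size rho).+1 = size (rcons rho b) by rewrite size_rcons.
have I b : pt Q F (size qs) (size rho).+1 (nth false (rcons rho b)) = prefix_true qs F (rcons rho b).
  by rewrite (s b) -IH // => i hi; rewrite size_rcons addSnnS hQ.
rewrite !u !I.
by have := hQ 0 isT; rewrite addn0 => ->; case: a {hQ}.
Qed.

Lemma qbf_form : qbf_true phi = form_true fn fc fq fl.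
Proof.
rewrite /qbf_true /form_true (@prefix_pt _ _ _ fq) => [|i _]; last by rewrite add0n.
rewrite size_tuple (_ : nth false [::] = fun _ => false); last by apply/funext => i; rewrite nth_nil.
congr (pt _ _ _ _ _); apply/funext => r; rewrite /cnf_true -{1}[qbf_matrix phi](mkseq_nth [::]) all_map.
by apply: eq_in_all => j; rewrite mem_iota => /= hj; rewrite clause_true_lit.
Qed.
End QBF.

End Formulas.

Module Graph.
Export Game Reaching Layout Dag UpperBound Formulas.
End Graph.

(** * Expressibility of the graph and of its code *)

Module GraphExprs.
Import Exp Graph Lib.

Ltac m2 h := lazymatch goal with |- E (fun w x => h (@?a0 w x) (@?a1 w x)) => idtac | |- Eb (fun w x => h (@?a0 w x) (@?a1 w x)) => idtac end.
Ltac m3 h := lazymatch goal with |- E (fun w x => h (@?a0 w x) (@?a1 w x) (@?a2 w x)) => idtac | |- Eb (fun w x => h (@?a0 w x) (@?a1 w x) (@?a2 w x)) => idtac end.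
Ltac m4 h := lazymatch goal with |- E (fun w x => h (@?a0 w x) (@?a1 w x) (@?a2 w x) (@?a3 w x)) => idtac | |- Eb (fun w x => h (@?a0 w x) (@?a1 w x) (@?a2 w x) (@?a3 w x)) => idtac end.
Ltac m5 h := lazymatch goal with |- E (fun w x => h (@?a0 w x) (@?a1 w x) (@?a2 w x) (@?a3 w x) (@?a4 w x)) => idtac | |- Eb (fun w x => h (@?a0 w x) (@?a1 w x) (@?a2 w x) (@?a3 w x) (@?a4 w x)) => idtac end.
Ltac m6 h := lazymatch goal with |- E (fun w x => h (@?a0 w x) (@?a1 w x) (@?a2 w x) (@?a3 w x) (@?a4 w x) (@?a5 w x)) => idtac | |- Eb (fun w x => h (@?a0 w x) (@?a1 w x) (@?a2 w x) (@?a3 w x) (@?a4 w x) (@?a5 w x)) => idtac end.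

Ltac Ehook ::= lazymatch goal with
  | |- E (fun w x => divn (@?f w x) (@?g w x)) => apply: (@E_div _ f g); cbv beta
  | |- E (fun w x => modn (@?f w x) (@?g w x)) => apply: (@E_mod _ f g); cbv beta
  | |- E (fun w x => up_log 2 (@?f w x)) => apply: (@E_uplog _ f); cbv beta
  end.

Definition dlen D := D.+1 + D * D.
Definition dbit n c q lf j := let D := ord_dag n c in
  if j <= D then j < D else edge n c q lf ((j - D.+1) %/ D) ((j - D.+1) %% D).
Definition gam n c := H n c (lmax n c).+1 + 1.
Definition glen g := (up_log 2 g.+1).+1.
(** Bit 0 is the sign. The minimum caps the power of two for arguments [j] beyond the code. *)
Definition gbit g j := (0 < j) && odd (g %/ 2 ^ minn j.-1 (up_log 2 g.+1)).

Section Desc.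
Variable d : nat.
Implicit Types (n c lam f l p k i t v : efun d).

Lemma E_lmax n c : E n -> E c -> E (fun w x => lmax (n w x) (c w x)).
Proof. by move=> *; rewrite /lmax; Es. Qed.
Lemma E_usz n c : E n -> E c -> E (fun w x => usz (n w x) (c w x)).
Proof. by move=> *; rewrite /usz; do ?[(m2 lmax; apply: E_lmax) | E1]. Qed.
Lemma E_unt n c : E n -> E c -> E (fun w x => unt (n w x) (c w x)).
Proof.
move=> hn hc; apply: (E_ext (f := fun w x => 2 ^ up_log 2 (lmax (n w x) (c w x)).+1 * 2 ^ up_log 2 (lmax (n w x) (c w x)).+1 * 1024)).
  by move=> w x; rewrite /unt /usz expnD mul2n -addnn expnD.
have h := E_pow2log (E_succ (E_lmax hn hc)).
by apply: E_mul; [apply: E_mul | exact: E_nat].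
Qed.
Ltac h1 := first [(m2 lmax; apply: E_lmax) | (m2 usz; apply: E_usz) | (m2 unt; apply: E_unt)].
Lemma E_wid n c : E n -> E c -> E (fun w x => wid (n w x) (c w x)).
Proof. by move=> *; rewrite /wid; do ?[h1 | E1]. Qed.
Lemma E_fams n c : E n -> E c -> E (fun w x => fams (n w x) (c w x)).
Proof. by move=> *; rewrite /fams; do ?[h1 | E1]. Qed.
Ltac h2 := first [(m2 wid; apply: E_wid) | (m2 fams; apply: E_fams) | h1].
Lemma E_chains n c : E n -> E c -> E (fun w x => chains (n w x) (c w x)).
Proof. by move=> *; rewrite /chains; do ?[h2 | E1]. Qed.
Lemma E_ord_real n c : E n -> E c -> E (fun w x => ord_real (n w x) (c w x)).
Proof. by move=> *; rewrite /ord_real; do ?[(m2 chains; apply: E_chains) | h2 | E1]. Qed.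
Lemma E_ord_dag n c : E n -> E c -> E (fun w x => ord_dag (n w x) (c w x)).
Proof. by move=> *; rewrite /ord_dag; do ?[(m2 ord_real; apply: E_ord_real) | E1]. Qed.
Lemma E_nbr n c : E n -> E c -> E (fun w x => nbr (n w x) (c w x)).
Proof. by move=> *; rewrite /nbr; do ?[h2 | E1]. Qed.
Lemma E_nlit n c : E n -> E c -> E (fun w x => nlit (n w x) (c w x)).
Proof. by move=> *; rewrite /nlit; do ?[h2 | E1]. Qed.
Lemma E_nsml n c : E n -> E c -> E (fun w x => nsml (n w x) (c w x)).
Proof. by move=> *; rewrite /nsml; do ?[h2 | E1]. Qed.
Ltac h3 := first [(m2 chains; apply: E_chains) | (m2 ord_real; apply: E_ord_real) | (m2 ord_dag; apply: E_ord_dag) | (m2 nbr; apply: E_nbr) | (m2 nlit; apply: E_nlit) | (m2 nsml; apply: E_nsml) | h2].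
Lemma E_vi n c lam : E n -> E c -> E lam -> E (fun w x => vi (n w x) (c w x) (lam w x)).
Proof. by move=> *; rewrite /vi; do ?[h1 | E1]. Qed.
Lemma E_vr n c lam : E n -> E c -> E lam -> E (fun w x => vr (n w x) (c w x) (lam w x)).
Proof. by move=> *; rewrite /vr; do ?[h1 | E1]. Qed.
Lemma E_isvar n c lam : E n -> E c -> E lam -> Eb (fun w x => isvar (n w x) (c w x) (lam w x)).
Proof. by move=> *; rewrite /isvar; do ?[h1 | E1]. Qed.
Lemma E_cn n c lam f l : E n -> E c -> E lam -> E f -> E l -> E (fun w x => cn (n w x) (c w x) (lam w x) (f w x) (l w x)).
Proof. by move=> *; rewrite /cn; do ?[h2 | E1]. Qed.
Lemma E_vn n c lam f l p : E n -> E c -> E lam -> E f -> E l -> E p ->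
  E (fun w x => vn (n w x) (c w x) (lam w x) (f w x) (l w x) (p w x)).
Proof. by move=> *; rewrite /vn; do ?[h2 | (m5 cn; apply: E_cn) | E1]. Qed.
Ltac h4 := first [(m3 vi; apply: E_vi) | (m3 vr; apply: E_vr) | (m3 isvar; apply: E_isvar) | (m5 cn; apply: E_cn) | (m6 vn; apply: E_vn) | h3].
Lemma E_kd n c lam f : E n -> E c -> E lam -> E f -> E (fun w x => kd (n w x) (c w x) (lam w x) (f w x)).
Proof. by move=> *; rewrite /kd; do ?[h4 | E1]. Qed.
Lemma E_br0 n c lam f : E n -> E c -> E lam -> E f -> E (fun w x => br0 (n w x) (c w x) (lam w x) (f w x)).
Proof. by move=> *; rewrite /br0; do ?[h4 | E1]. Qed.
Lemma E_br1 n c lam f : E n -> E c -> E lam -> E f -> E (fun w x => br1 (n w x) (c w x) (lam w x) (f w x)).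
Proof. by move=> *; rewrite /br1; do ?[h4 | E1]. Qed.
Lemma E_gp n c k : E n -> E c -> E k -> E (fun w x => gp (n w x) (c w x) (k w x)).
Proof. by move=> *; rewrite /gp; do ?[h4 | E1]. Qed.
Ltac h5 := first [(m4 kd; apply: E_kd) | (m4 br0; apply: E_br0) | (m4 br1; apply: E_br1) | (m3 gp; apply: E_gp) | h4].
Lemma E_lfc n c lam f p : E n -> E c -> E lam -> E f -> E p ->
  E (fun w x => lfc (n w x) (c w x) (lam w x) (f w x) (p w x)).
Proof. by move=> *; rewrite /lfc; do ?[h5 | E1]. Qed.
Lemma E_ul n c f : E n -> E c -> E f -> E (fun w x => ul (n w x) (c w x) (f w x)).
Proof. by move=> *; rewrite /ul; do ?[h5 | E1]. Qed.
Lemma E_live n c lam f l : E n -> E c -> E lam -> E f -> E l ->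
  Eb (fun w x => live (n w x) (c w x) (lam w x) (f w x) (l w x)).
Proof. by move=> *; rewrite /live; do ?[h5 | (m3 ul; apply: E_ul) | E1]. Qed.
Lemma E_gl n c lam f l : E n -> E c -> E lam -> E f -> E l ->
  E (fun w x => gl (n w x) (c w x) (lam w x) (f w x) (l w x)).
Proof. by move=> *; rewrite /gl; do ?[h5 | (m5 live; apply: E_live) | E1]. Qed.
Lemma E_lve n c i : E n -> E c -> E i -> E (fun w x => lve (n w x) (c w x) (i w x)).
Proof. by move=> *; rewrite /lve; do ?[h5 | E1]. Qed.

Variables (q : seq bool -> ctx d -> nat -> bool) (lf : seq bool -> ctx d -> nat -> nat -> nat).
Hypothesis hq : forall t, E t -> Eb (fun w x => q w x (t w x)).
Hypothesis hlf : forall t k, E t -> E k -> E (fun w x => lf w x (t w x) (k w x)).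

Lemma E_lcode n t k : E n -> E t -> E k -> E (fun w x => lcode (n w x) (q w x) (lf w x) (t w x) (k w x)).
Proof. by move=> *; rewrite /lcode; do ?[(lazymatch goal with |- Eb (fun w x => q w x (@?t w x)) => idtac end; apply: hq) | (lazymatch goal with |- E (fun w x => lf w x (@?t w x) (@?k w x)) => idtac end; apply: hlf) | E1]. Qed.
Lemma E_slotv n c t k : E n -> E c -> E t -> E k ->
  E (fun w x => slotv (n w x) (c w x) (q w x) (lf w x) (t w x) (k w x)).
Proof. by move=> *; rewrite /slotv; do ?[(m5 lcode; apply: E_lcode) | (m3 lve; apply: E_lve) | h5 | E1]. Qed.
Lemma E_dlam n c v : E n -> E c -> E v -> E (fun w x => dlam (n w x) (c w x) (v w x)).
Proof. by move=> *; rewrite /dlam; do ?[h5 | E1]. Qed.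
Lemma E_dfam n c v : E n -> E c -> E v -> E (fun w x => dfam (n w x) (c w x) (v w x)).
Proof. by move=> *; rewrite /dfam; do ?[h5 | E1]. Qed.
Lemma E_dcop n c v : E n -> E c -> E v -> E (fun w x => dcop (n w x) (c w x) (v w x)).
Proof. by move=> *; rewrite /dcop; do ?[h5 | E1]. Qed.
Lemma E_dpos n c v : E n -> E c -> E v -> E (fun w x => dpos (n w x) (c w x) (v w x)).
Proof. by move=> *; rewrite /dpos; do ?[h5 | E1]. Qed.
Ltac h6 := first [(m3 dlam; apply: E_dlam) | (m3 dfam; apply: E_dfam) | (m3 dcop; apply: E_dcop) | (m3 dpos; apply: E_dpos) | h5].
Lemma E_dgl n c v : E n -> E c -> E v -> E (fun w x => dgl (n w x) (c w x) (v w x)).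
Proof. by move=> *; rewrite /dgl; do ?[(m5 gl; apply: E_gl) | h6 | E1]. Qed.
Lemma E_pr1 n c v : E n -> E c -> E v -> E (fun w x => pr1 (n w x) (c w x) (q w x) (lf w x) (v w x)).
Proof. by move=> *; rewrite /pr1; do ?[(m6 slotv; apply: E_slotv) | (m3 dgl; apply: E_dgl) | h6 | E1]. Qed.
Lemma E_pr2 n c v : E n -> E c -> E v -> E (fun w x => pr2 (n w x) (c w x) (q w x) (lf w x) (v w x)).
Proof. by move=> *; rewrite /pr2; do ?[(m6 slotv; apply: E_slotv) | (m5 lfc; apply: E_lfc) | (m3 dgl; apply: E_dgl) | h6 | E1]. Qed.
Lemma E_edge n c u v : E n -> E c -> E u -> E v -> Eb (fun w x => edge (n w x) (c w x) (q w x) (lf w x) (u w x) (v w x)).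
Proof. by move=> *; rewrite /edge; do ?[(m5 pr1; apply: E_pr1) | (m5 pr2; apply: E_pr2) | E1]. Qed.

Lemma E_dbit n c j : E n -> E c -> E j -> Eb (fun w x => dbit (n w x) (c w x) (q w x) (lf w x) (j w x)).
Proof. by move=> *; rewrite /dbit; do ?[(m2 ord_dag; apply: E_ord_dag) | (m6 edge; apply: E_edge) | E1]. Qed.
Lemma E_gam n c : E n -> E c -> E (fun w x => gam (n w x) (c w x)).
Proof. by move=> *; rewrite /gam /H /rnd; do ?[(m2 usz; apply: E_usz) | (m2 lmax; apply: E_lmax) | E1]. Qed.
Lemma E_gbit (g j : efun d) : E g -> E j -> Eb (fun w x => gbit (g w x) (j w x)).
Proof.
move=> hg hj; rewrite /gbit; apply: Eb_and; first by Es.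
have e a : odd a = (a %% 2 == 1) by rewrite modn2; case: odd.
apply: (E_ext (f := fun w x => (g w x %/ 2 ^ minn (j w x).-1 (up_log 2 (g w x).+1)) %% 2 == 1 : nat)) => [w x|]; first by rewrite e.
apply: Eb_eq; last exact: E_nat; apply: E_mod; last exact: E_nat; apply: E_div => //.
apply: (E_pow (f := fun _ _ => 2)); [exact: E_nat | by Es |].
have [k hk] := E_bd (E_pow2log (E_succ hg)); exists k => w x X hx; apply: leq_trans (hk w x X hx).
by rewrite leq_exp2l // geq_minr.
Qed.
End Desc.

Lemma allpairs_mkseq (T : Type) (f : nat -> nat -> T) m D :
  [seq f u v | u <- iota 0 m, v <- iota 0 D] = mkseq (fun j => f (j %/ D) (j %% D)) (m * D).
Proof.
elim: m => [|m IH]; first by rewrite mul0n.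
rewrite -addn1 iotaD allpairs_cat IH add0n /= cats0 mulnDl mul1n /mkseq iotaD map_cat add0n; congr (_ ++ _).
have -> : iota (m * D) D = [seq m * D + j | j <- iota 0 D] by rewrite -iotaDl addn0.
rewrite -map_comp; apply/eq_in_map => j; rewrite mem_iota => /andP[_ hj] /=.
by rewrite divnMDl ?modnMDl ?divn_small ?modn_small ?addn0 //; lia.
Qed.

Lemma allpairs_val D (F : 'I_D -> 'I_D -> bool) (G : nat -> nat -> bool) s t : (forall a b, F a b = G a b) ->
  [seq F u v | u <- s, v <- t] = [seq G u v | u <- map (@nat_of_ord D) s, v <- map (@nat_of_ord D) t].
Proof.
move=> h; have e a : map (F a) t = map (G a) (map (@nat_of_ord D) t) by elim: t => //= b t ->; rewrite h.
by elim: s => //= a s ->; rewrite e.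
Qed.

Lemma enc_dag_bits n c q lf : enc_dag (pdag n c q lf) = mkseq (dbit n c q lf) (dlen (ord_dag n c)).
Proof.
rewrite /enc_dag /=; set D := ord_dag n c.
have -> : [seq @ed n c q lf u v | u <- enum 'I_D, v <- enum 'I_D] = [seq edge n c q lf u v | u <- iota 0 D, v <- iota 0 D].
  have e : iota 0 D = [seq nat_of_ord i | i <- enum 'I_D] by rewrite val_enum_ord.
  by rewrite e; apply: allpairs_val.
rewrite allpairs_mkseq /dlen /mkseq iotaD map_cat; congr (_ ++ _).
  rewrite /enc_unary -addn1 iotaD map_cat /= add0n /dbit leqnn ltnn -cats1; congr (_ ++ _).
  apply: (@eq_from_nth _ false); rewrite ?size_map ?size_nseq ?size_iota // => i hi.
  by rewrite nth_nseq hi (nth_map 0) ?size_iota // nth_iota // add0n (ltnW hi) hi.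
have -> : iota (0 + D.+1) (D * D) = [seq D.+1 + j | j <- iota 0 (D * D)] by rewrite -iotaDl addn0 add0n.
rewrite -map_comp; apply: eq_map => j /=; have e : (D.+1 + j <= D) = false by clear; lia.
by rewrite /dbit -/D e addKn.
Qed.

Lemma enc_int_bits g : enc_int (Posz g) = mkseq (gbit g) (glen g).
Proof.
rewrite /enc_int /enc_binary /glen /mkseq /= /gbit /=; congr cons.
rewrite -[iota 1 _]/(iota (1 + 0) _) iotaDl -map_comp; apply/eq_in_map => j; rewrite mem_iota => /andP[_ hj] /=.
by rewrite (minn_idPl _) // ltnW.
Qed.

End GraphExprs.

(** * Reading a quantified formula from its code *)

Module Reduction.
Import Exp Graph GraphExprs Lib.

Lemma E_skip d (f : efun d.+1) : E f -> E (fun w (x : ctx d.+2) => f w (x.1.1, x.2)).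
Proof.
move=> h D s; elim/last_ind: s => // s b _; elim/last_ind: s => // s a _; rewrite !size_rcons => -[hs].
rewrite !all_rcons => /and3P[hb ha hall]; have [||e [k [hw H]]] := h D (rcons s b).
- by rewrite size_rcons hs.
- by rewrite all_rcons hb.
exists e, k; split=> // w x v X hv; rewrite /= !map_rcons => /rcons_inj[/rcons_inj[e1 e2] e3]; apply: H => //.
by rewrite /= map_rcons e1 e3.
Qed.

(** An increase per round by an amount independent of the current value keeps all iterates
    polynomial, which is what [E_iter] demands. *)
Lemma E_iterk d (n a b : efun d) (G : seq bool -> ctx d -> nat -> nat) : E n -> E a -> E b ->
  E (fun w (x : ctx d.+1) => G w x.1 x.2) -> (forall w x y, G w x y <= y + b w x) ->
  E (fun w x => iter (n w x) (G w x) (a w x)).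
Proof.
move=> hn ha hb hG le; have e (m : nat) F (y : nat) : iteri m (fun _ => F) y = iter m F y by elim: m => //= m ->.
apply: (E_ext (f := fun w x => iteri (n w x) (fun _ => G w x) (a w x))) => [w x|]; first by rewrite e.
apply: (E_iteri (G := fun w x _ => G w x)) => //.
  exact: (E_skip hG).
have [k hk] := E_bd (E_add ha (E_mul hn hb)); exists k => w x X i hx hi; apply: leq_trans (hk w x X hx).
rewrite e; have {}le := le w x; apply: (@leq_trans (a w x + i * b w x)); last by rewrite leq_add2l leq_mul2r hi orbT.
by elim: i {hi} => [|i IH] /=; [rewrite addn0 | apply: leq_trans (le _) _; rewrite mulSn; lia].
Qed.

(* The code is read by walking over positions: [nl] passes a literal and [nc] passes a clause. *)
Section Parse.
Variables (w : seq bool) (N : nat).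
Definition bit1 p := inpv w p == 2.
Definition run p := bsum N (fun m => alln m.+1 (fun t => bit1 (p + t))).
Definition nl p := if bit1 p then p + 3 + run (p + 2) else p.
Definition nc p := if bit1 p then (iter 3 nl p.+1).+1 else p.
Definition clp j := iter j nc (2 * run 0).+1.
Definition litp j k := iter k nl (clp j).+1.
Definition pq i := bit1 ((run 0).+1 + i).
Definition pc := bsum N (fun j => bit1 (clp j)).
Definition pl j k := if bit1 (clp j) && bit1 (litp j k) && (k < 3) then 2 * run (litp j k + 2) + bit1 (litp j k).+1 + 1 else 0.

Lemma oneE p : bit1 p = nth false w p.
Proof.
rewrite /bit1 /inpv; case: ltnP => h; first by case: (nth _ _ _).
by rewrite nth_default.
Qed.

Lemma one_drop p t : bit1 (p + t) = nth false (drop p w) t.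
Proof. by rewrite oneE nth_drop. Qed.

Lemma runE p i s : drop p w = enc_unary i ++ s -> i <= N -> run p = i.
Proof.
move=> h hi; have e m : bsum m (fun j => (j < i) : nat) = minn m i.
  by elim: m => [|m IH]; [rewrite /bsum big_nil min0n | rewrite bsumS IH; case: ltnP; lia].
rewrite -(minn_idPr hi) -e; apply: eq_bigr => m _; congr nat_of_bool.
have o t : bit1 (p + t) = if t < i then true else (i < t) && nth false s (t - i.+1).
  rewrite one_drop h /enc_unary -cats1 -catA nth_cat size_nseq; case: ltnP => ht; first by rewrite nth_nseq ht.
  case: ltngtP ht => // [ht|->] _; last by rewrite subnn.
  by rewrite (_ : t - i = (t - i.+1).+1) //; lia.
apply/allnP/idP => [h1|hm t ht]; last by rewrite o (leq_ltn_trans _ hm).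
by rewrite ltnNge; apply/negP => him; have := h1 i him; rewrite o ltnn.
Qed.

Hypothesis hN : size w <= N.

Lemma run_drop p i s : drop p w = enc_unary i ++ s -> run p = i.
Proof.
move=> h; apply: (runE h); have := congr1 size h.
by rewrite size_drop size_cat size_rcons size_nseq; lia.
Qed.

Lemma dropA p (a s : seq bool) : drop p w = a ++ s -> drop (p + size a) w = s.
Proof. by move=> h; rewrite addnC -drop_drop h drop_size_cat. Qed.

Lemma enc_seq_cons (T : Type) (enc : T -> seq bool) x xs : enc_seq enc (x :: xs) = true :: enc x ++ enc_seq enc xs.
Proof. by rewrite /enc_seq /= rcons_cat. Qed.

Variable n : nat.
Notation enc_literal := (@enc_literal n).

Lemma nl_lit p l s : drop p w = true :: enc_literal l ++ s ->
  [/\ bit1 p, bit1 p.+1 = l.2, run (p + 2) = l.1 & drop (nl p) w = s].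
Proof.
move=> h; have o1 : bit1 p by have := one_drop p 0; rewrite addn0 h.
have h2 : drop (p + 2) w = enc_unary l.1 ++ s by apply: (@dropA p [:: true; l.2]); rewrite h.
have r := run_drop h2; split=> //; first by have := one_drop p 1; rewrite addn1 h.
rewrite /nl o1 r; have := dropA h2; rewrite size_rcons size_nseq => <-; congr drop; lia.
Qed.

Lemma nl_lits p ls s k : drop p w = enc_seq enc_literal ls ++ s -> k <= size ls ->
  drop (iter k nl p) w = enc_seq enc_literal (drop k ls) ++ s.
Proof.
move=> h; elim: k => [|k IH] hk; first by rewrite drop0.
have l0 : literal n by case: (ls) hk => // l.
have {}IH := IH (ltnW hk); rewrite (drop_nth l0 hk) enc_seq_cons in IH.
rewrite cat_cons -catA in IH.
by have [_ _ _] := nl_lit IH; rewrite iterS => ->.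
Qed.

(** At the end mark of a clause [nl] stands still, so [nc] may always make three steps. *)
Lemma nl_stop p s k : drop p w = false :: s -> iter k nl p = p.
Proof.
move=> h; elim: k => //= k ->; rewrite /nl; have := one_drop p 0.
by rewrite addn0 h /= => ->.
Qed.

Lemma nl_end p ls s k : drop p w = enc_seq enc_literal ls ++ s -> size ls <= k ->
  drop (iter k nl p) w = false :: s.
Proof.
move=> h hk; have e := nl_lits h (leqnn _); rewrite drop_size /= in e.
by rewrite -(subnK hk) iterD (nl_stop _ e).
Qed.

Lemma nc_clause p C s : drop p w = true :: enc_seq enc_literal C ++ s -> size C <= 3 -> drop (nc p) w = s.
Proof.
move=> h hC; have o1 : bit1 p by have := one_drop p 0; rewrite addn0 h.
have h2 : drop p.+1 w = enc_seq enc_literal C ++ s by rewrite -addn1; apply: (@dropA p [:: true]); rewrite h.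
rewrite /nc o1 -addn1; apply: (@dropA _ [:: false]); exact: (nl_end h2 hC).
Qed.

Variable (M : seq (clause n)) (p0 : nat).
Hypothesis hM : all (fun C : clause n => size C <= 3) M.
Hypothesis hw : drop p0 w = enc_seq (enc_seq enc_literal) M.

Lemma nc_clauses j : j <= size M -> drop (iter j nc p0) w = enc_seq (enc_seq enc_literal) (drop j M).
Proof.
elim: j => [|j IH] hj; first by rewrite drop0.
have {}IH := IH (ltnW hj); rewrite (drop_nth [::] hj) enc_seq_cons in IH.
by rewrite iterS; apply: nc_clause IH _; apply: (allP hM); apply: mem_nth.
Qed.

Lemma one_clause j : bit1 (iter j nc p0) = (j < size M).
Proof.
case: ltnP => hj.
  have := nc_clauses (ltnW hj); rewrite (drop_nth [::] hj) enc_seq_cons => h.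
  by have := one_drop (iter j nc p0) 0; rewrite addn0 h.
have h := nc_clauses (leqnn (size M)); rewrite drop_size in h.
have e : bit1 (iter (size M) nc p0) = false by have := one_drop (iter (size M) nc p0) 0; rewrite addn0 h.
have -> : iter j nc p0 = iter (size M) nc p0; last exact: e.
rewrite -(subnK hj) iterD; elim: (j - size M) => //= k ->.
by rewrite {1}/nc e.
Qed.

Lemma count_clauses : bsum N (fun j => bit1 (iter j nc p0)) = size M.
Proof.
have hs : size M <= N.
  apply: leq_trans hN; apply: (@leq_trans (size (drop p0 w))); last by rewrite size_drop leq_subr.
  rewrite hw; elim: (M) => [|C M' IH] //; rewrite enc_seq_cons /= size_cat; lia.
have e m : bsum m (fun j => bit1 (iter j nc p0)) = minn m (size M).
  by elim: m => [|m IH]; [rewrite /bsum big_nil min0n | rewrite bsumS IH one_clause; case: ltnP; lia].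
by rewrite e; apply/minn_idPr.
Qed.

Lemma lit_at j k : j < size M -> k < 3 -> let C := nth [::] M j in let p := iter k nl (iter j nc p0).+1 in
  if bit1 p then [/\ k < size C & forall l0, (bit1 p.+1 = (nth l0 C k).2) /\ (run (p + 2) = (nth l0 C k).1)] else size C <= k.
Proof.
move=> hj hk C p; have := nc_clauses (ltnW hj); rewrite (drop_nth [::] hj) enc_seq_cons => h.
have h2 : drop (iter j nc p0).+1 w = enc_seq enc_literal C ++ enc_seq (enc_seq enc_literal) (drop j.+1 M).
  by rewrite -addn1; apply: (@dropA _ [:: true]); rewrite h.
case: (ltnP k (size C)) => hkC; last first.
  have e := nl_end h2 hkC.
  by have := one_drop p 0; rewrite addn0 e /= => ->.
have e := nl_lits h2 (ltnW hkC).
have l0 : literal n by case: (C) hkC => // l.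
rewrite (drop_nth l0 hkC) enc_seq_cons cat_cons -catA in e.
have [o1 o2 o3 _] := nl_lit e; rewrite -/p in o1 o2 o3; rewrite o1; split=> // l1.
by rewrite (set_nth_default l0 l1 hkC).
Qed.
End Parse.

Section ParseQBF.
Variable phi : qbf.
Let w := enc_qbf phi.
Let N := size w.

Lemma parse_n : run w N 0 = fn phi.
Proof. by apply: (run_drop (leqnn _)); rewrite drop0. Qed.

Lemma parse_q i : i < fn phi -> pq w N i = fq phi i.
Proof.
move=> hi; rewrite /pq parse_n one_drop.
have h : drop (fn phi).+1 w = map enc_quantifier (qbf_prefix phi) ++ enc_seq (enc_seq (@enc_literal _)) (qbf_matrix phi).
  by rewrite /w /enc_qbf drop_size_cat // size_rcons size_nseq.
rewrite h nth_cat size_map size_tuple hi (nth_map QEx) ?size_tuple // /fq.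
Qed.

Lemma parse_drop : drop (2 * run w N 0).+1 w = enc_seq (enc_seq (@enc_literal _)) (qbf_matrix phi).
Proof.
rewrite parse_n /w /enc_qbf catA drop_size_cat // size_cat size_rcons size_nseq size_map size_tuple /fn; lia.
Qed.

Lemma parse_c : pc w N = fc phi.
Proof. exact: (count_clauses (leqnn _) (qbf_3cnf phi) parse_drop). Qed.

Lemma parse_l j k : pl w N j k = fl phi j k.
Proof.
rewrite /pl /fl (one_clause (leqnn _) (qbf_3cnf phi) parse_drop).
case: (ltnP j (size (qbf_matrix phi))) => hj; last by rewrite nth_default.
case: (ltnP k 3) => hk; last first.
  rewrite andbF ifF //; apply/negbTE; rewrite -leqNgt; apply: leq_trans hk.
  exact: (allP (qbf_3cnf phi) _ (mem_nth [::] hj)).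
have := lit_at (leqnn _) (qbf_3cnf phi) parse_drop hj hk; rewrite -/(litp w N j k) /= andbT.
case: ifP => _; last by rewrite ltnNge => ->.
case=> hkC h; rewrite hkC; have l0 : literal (qbf_size phi) by case: (nth _ _ _) hkC => // l.
by have [h1 h2] := h l0; rewrite (nth_map l0) // h1 h2.
Qed.

(** The graph is built from what is parsed out of the word rather than from [phi], so that it is an
    expressible function of the word. *)
Definition Gq := pdag (run w N 0) (pc w N) (pq w N) (pl w N).
Definition gq := gam (run w N 0) (pc w N).

Lemma Gq_price : rev_price Gq = gq + ~~ qbf_true phi.
Proof.
rewrite /Gq pdag_priceE /gq /gam qbf_form; congr (_ + ~~ _).
rewrite parse_n parse_c /form_true.
have -> : pl w N = fl phi by apply/funext => j; apply/funext => k; rewrite parse_l.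
have key k i r : i + k = fn phi -> forall F, pt (pq w N) F k i r = pt (fq phi) F k i r.
  elim: k i r => //= k IH i r hik F; rewrite parse_q ?IH //; lia.
exact: key.
Qed.
End ParseQBF.

Section DescParse.
Variable d : nat.
Implicit Types N p j k : efun d.
Lemma E_one p : E p -> Eb (fun w x => bit1 w (p w x)).
Proof. by move=> h; rewrite /bit1; Es. Qed.
End DescParse.
Lemma E_run d (N p : efun d) : E N -> E p -> E (fun w x => run w (N w x) (p w x)).
Proof. by move=> *; rewrite /run; do ?[(m2 bit1; apply: E_one) | E1]. Qed.
Lemma run_le w N p : run w N p <= N.
Proof. by rewrite /run bsumE -[X in _ <= X](card_ord N) -sum1_card; apply: leq_sum => i _; case: alln. Qed.
Lemma E_nl d (N p : efun d) : E N -> E p -> E (fun w x => nl w (N w x) (p w x)).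
Proof. by move=> *; rewrite /nl; do ?[(m2 bit1; apply: E_one) | (m3 run; apply: E_run) | E1]. Qed.
Lemma nl_le w N p : nl w N p <= p + (3 + N).
Proof. by rewrite /nl; have := run_le w N (p + 2); case: ifP; lia. Qed.
Lemma E_iter_nl d (N p k : efun d) : E N -> E p -> E k -> E (fun w x => iter (k w x) (nl w (N w x)) (p w x)).
Proof.
move=> hN hp hk; apply: (E_iterk (b := fun w x => 3 + N w x)); [by Es | by Es | by Es | by apply: E_nl; Es |].
by move=> w x y; apply: nl_le.
Qed.
Lemma E_nc d (N p : efun d) : E N -> E p -> E (fun w x => nc w (N w x) (p w x)).
Proof. by move=> *; rewrite /nc; do ?[(lazymatch goal with |- E (fun w x => iter (@?k w x) (@?f w x) (@?p w x)) => apply: (E_iter_nl (k := fun _ _ => 3)) end) | (m2 bit1; apply: E_one) | (m3 run; apply: E_run) | E1]. Qed.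
Lemma nc_le w N p : nc w N p <= p + (11 + 3 * N).
Proof.
rewrite /nc; case: ifP => _ /=; last by lia.
have h1 := nl_le w N p.+1; have h2 := nl_le w N (nl w N p.+1); have h3 := nl_le w N (nl w N (nl w N p.+1)); lia.
Qed.
Lemma E_clp d (N j : efun d) : E N -> E j -> E (fun w x => clp w (N w x) (j w x)).
Proof.
move=> hN hj; rewrite /clp; apply: (E_iterk (b := fun w x => 11 + 3 * N w x)).
- by [].
- by do ?[(m3 run; apply: E_run) | E1].
- by Es.
- by apply: E_nc; Es.
by move=> w x y; apply: nc_le.
Qed.
Lemma E_litp d (N j k : efun d) : E N -> E j -> E k -> E (fun w x => litp w (N w x) (j w x) (k w x)).
Proof. by move=> *; rewrite /litp; apply: E_iter_nl => //; apply: E_succ; apply: E_clp. Qed.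
Lemma E_pq d (N i : efun d) : E N -> E i -> Eb (fun w x => pq w (N w x) (i w x)).
Proof. by move=> *; rewrite /pq; do ?[(m2 bit1; apply: E_one) | (m3 run; apply: E_run) | E1]. Qed.
Lemma E_pc d (N : efun d) : E N -> E (fun w x => pc w (N w x)).
Proof. by move=> *; rewrite /pc; do ?[(m2 bit1; apply: E_one) | (m3 clp; apply: E_clp) | E1]. Qed.
Lemma E_pl d (N j k : efun d) : E N -> E j -> E k -> E (fun w x => pl w (N w x) (j w x) (k w x)).
Proof. by move=> *; rewrite /pl; do ?[(m2 bit1; apply: E_one) | (m3 run; apply: E_run) | (m3 clp; apply: E_clp) | (m4 litp; apply: E_litp) | E1]. Qed.

Theorem Gq_polytime : polytime enc_qbf enc_dag Gq.
Proof.
apply: (@polytime_E _ _ _ _ _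
  (fun w x => dlen (ord_dag (run w x.2 0) (pc w x.2)))
  (fun w x => dbit (run w x.1.2 0) (pc w x.1.2) (pq w x.1.2) (pl w x.1.2) x.2)).
- by rewrite /dlen; do ?[(m2 ord_dag; apply: E_ord_dag) | (m2 pc; apply: E_pc) | (m3 run; apply: E_run) | E1].
- apply: (@E_dbit 2 (fun w x => pq w x.1.2) (fun w x => pl w x.1.2) _ _ (fun w x => run w x.1.2 0) (fun w x => pc w x.1.2) (fun w x => x.2)) => *;
    by do ?[(m3 pq; apply: E_pq) | (m4 pl; apply: E_pl) | (m2 pc; apply: E_pc) | (m3 run; apply: E_run) | E1].
by move=> phi; apply: enc_dag_bits.
Qed.

Theorem gq_polytime : polytime enc_qbf enc_int (fun phi => Posz (gq phi)).
Proof.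
apply: (@polytime_E _ _ _ _ _
  (fun w x => glen (gam (run w x.2 0) (pc w x.2)))
  (fun w x => gbit (gam (run w x.1.2 0) (pc w x.1.2)) x.2)).
- by rewrite /glen; do ?[(m2 gam; apply: E_gam) | (m2 pc; apply: E_pc) | (m3 run; apply: E_run) | apply: E_uplog | E1].
- by apply: E_gbit; do ?[(m2 gam; apply: E_gam) | (m2 pc; apply: E_pc) | (m3 run; apply: E_run) | E1].
by move=> phi; apply: enc_int_bits.
Qed.

End Reduction.

(** * Unique readability of graphs and numbers *)

Module Decoding.
Import Exp Graph GraphExprs Lib.

Definition rbit D (e : nat -> nat -> bool) j := if j <= D then j < D else e ((j - D.+1) %/ D) ((j - D.+1) %% D).

Lemma rel_bits D (F : rel 'I_D) (e : nat -> nat -> bool) : (forall a b, F a b = e a b) ->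
  enc_unary D ++ [seq F u v | u <- enum 'I_D, v <- enum 'I_D] = mkseq (rbit D e) (dlen D).
Proof.
move=> hF.
have -> : [seq F u v | u <- enum 'I_D, v <- enum 'I_D] = [seq e u v | u <- iota 0 D, v <- iota 0 D].
  have h : iota 0 D = [seq nat_of_ord i | i <- enum 'I_D] by rewrite val_enum_ord.
  by rewrite h; apply: allpairs_val.
rewrite allpairs_mkseq /dlen /mkseq iotaD map_cat; congr (_ ++ _).
  rewrite /enc_unary -addn1 iotaD map_cat /= add0n /rbit leqnn ltnn -cats1; congr (_ ++ _).
  apply: (@eq_from_nth _ false); rewrite ?size_map ?size_nseq ?size_iota // => i hi.
  by rewrite nth_nseq hi (nth_map 0) ?size_iota // nth_iota // add0n (ltnW hi) hi.
have -> : iota (0 + D.+1) (D * D) = [seq D.+1 + j | j <- iota 0 (D * D)] by rewrite -iotaDl addn0 add0n.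
rewrite -map_comp; apply: eq_map => j /=; have h : (D.+1 + j <= D) = false by clear; lia.
by rewrite /rbit h addKn.
Qed.

Lemma unary_inj n n' (a a' : seq bool) : enc_unary n ++ a = enc_unary n' ++ a' -> n = n'.
Proof.
have h k b : index false (enc_unary k ++ b) = k by elim: k => //= k ->.
by move=> e; rewrite -(h n a) e h.
Qed.

Lemma size_enc_dag G : size (enc_dag G) = dlen (dag_size G).
Proof. by rewrite size_cat size_rcons size_nseq size_allpairs size_enum_ord. Qed.

(** The unary prefix gives the number of vertices, hence the length of the code, and the matrix
    gives the edges. These determine the sink, and the remaining fields are propositions. *)
Lemma enc_dag_inj G G' (a a' : seq bool) : enc_dag G ++ a = enc_dag G' ++ a' -> G = G' /\ a = a'.
Proof.
move=> h; have hD : dag_size G = dag_size G' by move: h; rewrite /enc_dag -!catA; exact: unary_inj.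
have hs : size (enc_dag G) = size (enc_dag G') by rewrite !size_enc_dag hD.
have := congr1 (fun s => (take (size (enc_dag G)) s, drop (size (enc_dag G)) s)) h.
rewrite take_size_cat // drop_size_cat // take_size_cat // drop_size_cat // => -[h1 ->]; split=> //.
case: G G' hD h1 {h hs} => D e ac z zP [D' e' ac' z' zP'] /= hD; subst D'; rewrite /enc_dag /=.
move/eqP; rewrite eqseq_cat // eqxx /= => /eqP h1.
have ee : e = e'.
  apply/funext => u; apply/funext => v.
  have key (F F' : rel 'I_D) s t : [seq F u v | u <- s, v <- t] = [seq F' u v | u <- s, v <- t] ->
      forall u v, u \in s -> v \in t -> F u v = F' u v.
    elim: s => // x s IH /= /eqP; rewrite eqseq_cat ?size_map // => /andP[/eqP h2 /eqP h3] u' v'.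
    by rewrite inE => /orP[/eqP->|hu] hv; [move/eq_in_map: h2; apply | apply: IH].
  by apply: key h1 _ _ _ _; rewrite mem_enum.
subst e'; have zz : z = z' by apply/eqP; rewrite -zP' zP.
by subst z'; rewrite (Prop_irrelevance ac' ac) (Prop_irrelevance zP' zP).
Qed.

Lemma enc_binaryS n : 0 < n -> enc_binary n = odd n :: enc_binary n./2.
Proof.
move=> h; rewrite /enc_binary up_log2S // -[iota 0 _.+1]/(0 :: iota (1 + 0) _) iotaDl /= expn0 divn1; congr cons.
by rewrite -map_comp; apply: eq_map => i /=; rewrite expnS divnMA divn2.
Qed.

Lemma enc_binaryP n : Registers.val (enc_binary n) = n /\ Registers.canon (enc_binary n).
Proof.
elim/ltn_ind: n => n IH; have [->|n0] := posnP n; first by [].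
have [|h1 h2] := IH n./2; first by rewrite -divn2 ltn_Pdiv.
rewrite enc_binaryS //= h1 /Registers.canon /=; split; first by rewrite mul2n odd_double_half.
move: h2; rewrite /Registers.canon; have [e|n2] := posnP n./2.
  by rewrite e /= => _; have := odd_double_half n; rewrite e; case: (odd n) => //; lia.
by rewrite enc_binaryS.
Qed.

Lemma enc_binary_val l : Registers.canon l -> enc_binary (Registers.val l) = l.
Proof.
elim: l => [|b l IH] // h.
have hc : Registers.canon l by move: h; rewrite /Registers.canon; case: (l).
have p : 0 < Registers.val (b :: l) by apply: canon_pos.
rewrite enc_binaryS //= oddD oddM /= addbF oddb; congr cons.
by rewrite mul2n half_bit_double IH.
Qed.

Lemma enc_int_nat g s : enc_int (Posz g) = enc_int s -> s = Posz g.
Proof.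
rewrite /enc_int; case: s => [n|n] //= [h]; congr Posz.
by have [<- _] := enc_binaryP n; rewrite -h; have [-> _] := enc_binaryP g.
Qed.

Lemma mkseq_cat (T : Type) (f g : nat -> T) a b :
  mkseq f a ++ mkseq g b = mkseq (fun j => if j < a then f j else g (j - a)) (a + b).
Proof.
rewrite /mkseq iotaD map_cat; congr (_ ++ _).
  by apply/eq_in_map => j; rewrite mem_iota => /= ->.
have -> : iota (0 + a) b = [seq a + j | j <- iota 0 b] by rewrite -iotaDl addn0 add0n.
by rewrite -map_comp; apply: eq_map => j /=; rewrite ltnNge leq_addr /= addKn.
Qed.

Lemma problem_pdag n c q lf : rev_price_problem (enc_dag (pdag n c q lf) ++ enc_int (Posz (gam n c))) <-> form_true n c q lf.
Proof.
split=> [[G [s [/enc_dag_inj[<- /enc_int_nat->] _]]]|h].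
  by rewrite pdag_priceE /gam lez_nat; case: form_true => //=; move: (H _ _ _) => x; clear; lia.
exists (pdag n c q lf), (Posz (gam n c)); split=> //; first exact: pdag_fanin.
by rewrite pdag_priceE h /= addn0 lez_nat.
Qed.

End Decoding.

(** * Evaluating the game tree by a walk over its leaves *)

Module GameWalk.
Import Exp Graph GraphExprs Reduction Lib.

Lemma bsum_first n F : bsum n.+1 F = F 0 + bsum n (fun i => F i.+1).
Proof. by rewrite /bsum /= big_cons -[iota 1 n]/(iota (1 + 0) n) iotaDl big_map. Qed.
Lemma exn_first n P : exn n.+1 P = P 0 || exn n (fun i => P i.+1).
Proof. by rewrite /exn /= -[iota 1 n]/(iota (1 + 0) n) iotaDl has_map. Qed.
Lemma alln_first n P : alln n.+1 P = P 0 && alln n (fun i => P i.+1).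
Proof. by rewrite /alln /= -[iota 1 n]/(iota (1 + 0) n) iotaDl all_map. Qed.

(* The tree of depth [k] whose inner nodes are of the form "for some u < Dn, for both b" is evaluated by
   walking over its leaves, which are numbered in base [2 * Dn]: a leaf and its truth value determine the next
   leaf that matters. *)
Section Jump.
Variables (Dn k : nat) (leaf : nat -> bool).
Hypothesis D0 : 0 < Dn.
Definition Mb := 2 * Dn.
Fixpoint tval l P := if l is l'.+1 then exn Dn (fun u => tval l' (P * Mb + 2 * u) && tval l' (P * Mb + 2 * u).+1) else leaf P.
(** Digits are [2 * u + b]. The parent is decided true once the second child of a pair is true, and
    false once a child of the last pair is false; otherwise [dl] gives the child to visit next. *)
Definition cl (b : bool) g := if b then g %% 2 == 1 else g %/ 2 == Dn.-1.
Definition dl (b : bool) P := if b then P.+1 else P + 2 - P %% 2.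
Definition tcl b P m := bsum m (fun j => alln j.+1 (fun i => cl b (P %/ Mb ^ i %% Mb))).
(** The numbers 0 and 1 are reserved for the final value, so leaves are stored with 2 added. [tcl]
    counts how many ancestors in a row are decided by the value [b]. *)
Definition jump b P l := let t := tcl b P (k - l) in if t == k - l then nat_of_bool b else dl b (P %/ Mb ^ t) * Mb ^ (t + l) + 2.
Definition jstep y := if y <= 1 then y else jump (leaf (y - 2)) (y - 2) 0.

Lemma Mb_gt0 : 0 < Mb. Proof. by rewrite /Mb; lia. Qed.

Lemma tcl_close b P m : cl b (P %% Mb) -> tcl b P m.+1 = (tcl b (P %/ Mb) m).+1.
Proof.
move=> h; rewrite /tcl bsum_first alln_first expn0 divn1 h /= add1n; congr _.+1; apply: eq_bigr => j _; congr nat_of_bool.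
rewrite [in LHS]alln_first expn0 divn1 h /=; apply: eq_all => i; by rewrite -divnMA -expnS.
Qed.

Lemma tcl_open b P m : ~~ cl b (P %% Mb) -> tcl b P m = 0.
Proof.
move=> h; rewrite /tcl bsumE big1 // => j _.
by rewrite alln_first expn0 divn1 (negbTE h).
Qed.

Lemma jump_close b P l : l < k -> cl b (P %% Mb) -> jump b P l = jump b (P %/ Mb) l.+1.
Proof.
move=> hl hc; rewrite /jump; have -> : k - l = (k - l.+1).+1 by lia.
rewrite tcl_close // eqSS; case: eqP => // _.
by rewrite -divnMA -expnS addSnnS.
Qed.
Lemma jump_open b P l : l < k -> ~~ cl b (P %% Mb) -> jump b P l = dl b P * Mb ^ l + 2.
Proof. by move=> hl hc; rewrite /jump tcl_open // ifF ?divn1 //; lia. Qed.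
Lemma jump_top b P : jump b P k = b.
Proof. by rewrite /jump subnn /tcl /bsum big_nil. Qed.

Lemma child u b P : u < Dn -> b < 2 -> (P * Mb + 2 * u + b) %% Mb = 2 * u + b /\ (P * Mb + 2 * u + b) %/ Mb = P.
Proof.
move=> hu hb; have h : 2 * u + b < Mb by rewrite /Mb; lia.
by rewrite -addnA modnMDl modn_small // divnMDl ?Mb_gt0 // divn_small // addn0.
Qed.

Ltac qlia := repeat match goal with H : forall _, _ |- _ => clear H | H : iter _ _ _ = _ |- _ => clear H | H : tval _ _ = _ |- _ => clear H
  | H : context [modn] |- _ => clear H | H : context [divn] |- _ => clear H end; lia.
(** The walk enters the subtree at its leftmost leaf and, after at most as many steps as it has
    leaves, leaves it by the jump that belongs to its value. *)
Lemma tval_run l P : l <= k -> exists2 n, n <= Mb ^ l & iter n jstep (P * Mb ^ l + 2) = jump (tval l P) P l.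
Proof.
elim: l P => [|l IH] P hl; first by exists 1 => //=; rewrite muln1 /jstep ifF ?addnK //; qlia.
have step u : u < Dn -> exists2 n, n <= (Dn - u) * 2 * Mb ^ l & iter n jstep ((P * Mb + 2 * u) * Mb ^ l + 2)
    = jump (has (fun u => tval l (P * Mb + 2 * u) && tval l (P * Mb + 2 * u).+1) (iota u (Dn - u))) P l.+1.
  have [r] := ubnP (Dn - u); elim: r u => // r IHr u hr hu.
  have [n0 l0 e0] := IH (P * Mb + 2 * u) (ltnW hl); have [n1 l1 e1] := IH (P * Mb + 2 * u).+1 (ltnW hl).
  have [m0 d0] := child P hu (isT : 0 < 2); rewrite addn0 in m0 d0.
  have [m1 d1] := child P hu (isT : 1 < 2); rewrite addn1 in m1 d1.
  have par : (P * Mb + 2 * u) %% 2 = 0 by rewrite /Mb mulnCA -mulnDr modnMr.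
  have par1 : (P * Mb + 2 * u).+1 %% 2 = 1 by rewrite -addn1 -modnDml par.
  have -> : Dn - u = (Dn - u.+1).+1 by qlia.
  rewrite [iota _ _]/= [has _ _]/=.
  (* One child of the pair [u] is false: go on with the next pair, or close the parent if this was
     the last one. *)
  have fin n b (g : nat) : n <= 2 * Mb ^ l -> iter n jstep ((P * Mb + 2 * u) * Mb ^ l + 2) = jump false (P * Mb + 2 * u + g) l ->
      g < 2 -> b = false -> exists2 n, n <= (Dn - u.+1).+1 * 2 * Mb ^ l & iter n jstep ((P * Mb + 2 * u) * Mb ^ l + 2)
    = jump (b || has (fun u => tval l (P * Mb + 2 * u) && tval l (P * Mb + 2 * u).+1) (iota u.+1 (Dn - u.+1))) P l.+1.
    move=> hn he hg ->; have [mg dg] := child P hu hg.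
    have [uD|uD] := eqVneq u Dn.-1.
      exists n; first by apply: leq_trans hn _; rewrite leq_mul2r; qlia.
      rewrite he jump_close ?dg //; last by rewrite /cl mg; apply/eqP; qlia.
      by rewrite (_ : Dn - u.+1 = 0) //; qlia.
    have hu1 : u.+1 < Dn by qlia.
    have [n' l' e'] := IHr u.+1 (ltac:(qlia)) hu1.
    exists (n' + n); first by rewrite mulSn mulnDl; move: hn l'; rewrite -!mulnA; qlia.
    rewrite iterD he jump_open //; last by rewrite /cl mg; apply/eqP; qlia.
    rewrite -[RHS]e'; congr (iter _ _ (_ * _ + _)); rewrite /dl; have -> : (P * Mb + 2 * u + g) %% 2 = g by rewrite -modnDml par add0n modn_small.
    qlia.
  case v0 : (tval l (P * Mb + 2 * u)) e0 => e0; last first.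
    by apply: (fin n0 _ 0); rewrite ?addn0 //; qlia.
  rewrite jump_open //= in e0; last by rewrite m0 /cl; qlia.
  case v1 : (tval l (P * Mb + 2 * u).+1) e1 => e1; last first.
    apply: (fin (n1 + n0) _ 1); rewrite ?addn1 //; first by qlia.
    by rewrite iterD e0.
  exists (n1 + n0); first by rewrite -mulnA mulSn; apply: leq_trans (leq_addr _ _); move: l0 l1; clear; lia.
  by rewrite iterD e0 e1 jump_close ?d1 //= /cl m1; qlia.
have [n h1 h2] := step 0 D0; rewrite subn0 muln0 addn0 in h1 h2; exists n; last by rewrite expnS mulnA h2.
by apply: leq_trans h1 _; rewrite expnS /Mb [Dn * 2]mulnC.
Qed.

Lemma tval_iter n : Mb ^ k <= n -> (iter n jstep 2 == 1) = tval k 0.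
Proof.
have [m h1] := tval_run 0 (leqnn k); rewrite mul0n add0n jump_top => h2 hn.
rewrite -(subnK (leq_trans h1 hn)) iterD h2.
have -> : iter (n - m) jstep (tval k 0) = tval k 0 by elim: (n - m) => //= i ->; case: (tval k 0).
by case: (tval k 0).
Qed.
End Jump.

Section GameEval.
Variables (Dn : nat) (ed : rel 'I_Dn) (e : nat -> nat -> bool) (z : 'I_Dn) (K : nat).
Hypothesis he : forall u v, ed u v = e u v.
Hypothesis D0 : 0 < Dn.
Notation M := (Mb Dn).
Definition dg P i := P %/ M ^ i %% M.
(** The digits of [P], least significant first, are the moves from the latest to the first, and an
    odd digit means that the challenger followed. The challenged vertex is therefore the one in the
    first odd digit, and [z] if there is none. *)
Definition cur (z : nat) m P := bsum m (fun i => if (dg P i %% 2 == 1) && alln i (fun j => dg P j %% 2 == 0) then dg P i %/ 2 else 0)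
  + (if alln m (fun j => dg P j %% 2 == 0) then z else 0).
Definition gleaf z P := alln Dn (fun u => e u (cur z K P) ==> exn K (fun i => dg P i %/ 2 == u)).

Lemma dg0 P g : g < M -> dg (P * M + g) 0 = g.
Proof. by move=> h; rewrite /dg expn0 divn1 modnMDl modn_small. Qed.
Lemma dgS P g i : g < M -> dg (P * M + g) i.+1 = dg P i.
Proof. by move=> h; rewrite /dg expnS divnMA divnMDl ?Mb_gt0 // (divn_small h) addn0. Qed.

Lemma cur_app m P g : g < M -> cur z m.+1 (P * M + g) = if g %% 2 == 1 then g %/ 2 else cur z m P.
Proof.
move=> h; rewrite /cur bsum_first alln_first !dg0 //= andbT.
have E0 : alln m (fun i => dg (P * M + g) i.+1 %% 2 == 0) = alln m (fun i => dg P i %% 2 == 0).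
  by apply: eq_all => i; rewrite dgS.
rewrite E0; have [g1|g1] : g %% 2 = 1 \/ g %% 2 = 0 by lia.
  rewrite g1 /= addn0 -[RHS]addn0; congr (_ + _); rewrite bsumE big1 // => i _.
  by rewrite alln_first dg0 // g1 /= andbF.
rewrite g1 /= add0n; congr (_ + _); rewrite /bsum; apply: eq_bigr => i _; rewrite dgS // alln_first dg0 // g1 /=.
by congr (if _ && _ then _ else _); apply: eq_all => j; rewrite dgS.
Qed.

Lemma tval_win l m P : m + l = K -> forall v : 'I_Dn, cur z m P = v ->
  tval Dn (gleaf z) l P = win ed l [set u : 'I_Dn | exn m (fun i => dg P i %/ 2 == u)] v.
Proof.
elim: l m P => [|l IH] m P hm v hv.
  rewrite addn0 in hm; have -> : forall S : {set 'I_Dn}, win ed 0 S v = (pred_set ed v \subset S) by move=> S; exact: orbF.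
  rewrite /= /gleaf -hm hv.
  apply/allnP/subsetP => [h u|h u hu].
    by rewrite !inE he => /(implyP (h u (ltn_ord u))).
  by apply/implyP => hev; have := h (Ordinal hu); rewrite !inE he => /(_ hev).
have app (u : 'I_Dn) (b : bool) : tval Dn (gleaf z) l (P * M + 2 * u + b) =
    win ed l (u |: [set u : 'I_Dn | exn m (fun i => dg P i %/ 2 == u)]) (if b then u else v).
  have hg : 2 * u + b < M by rewrite /Mb; have := ltn_ord u; case: b; lia.
  rewrite -addnA (IH m.+1 _ _ (if b then u else v)); [|by lia|]; last first.
    rewrite cur_app // hv (_ : (2 * u + b) %% 2 = b); last by case: b {hg}; lia.
    by rewrite (_ : (2 * u + b) %/ 2 = u); [case: b {hg} | case: b {hg}; lia].
  congr (win _ _ _ _); apply/setP => x; rewrite !inE exn_first dg0 // (_ : (2 * u + b) %/ 2 = u); last by case: b {hg}; lia.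
  by rewrite -(inj_eq val_inj) eq_sym; congr (_ || _); apply: eq_has => i; rewrite dgS.
have nx : tval Dn (gleaf z) l.+1 P = [exists u : 'I_Dn, win ed l (u |: [set u : 'I_Dn | exn m (fun i => dg P i %/ 2 == u)]) v && win ed l (u |: [set u : 'I_Dn | exn m (fun i => dg P i %/ 2 == u)]) u].
  have tS : tval Dn (gleaf z) l.+1 P = exn Dn (fun u => tval Dn (gleaf z) l (P * M + 2 * u) && tval Dn (gleaf z) l (P * M + 2 * u).+1) by [].
  rewrite tS; apply/exnP/existsP => [[u hu]|[u]].
    by have := app (Ordinal hu) false; have := app (Ordinal hu) true; rewrite /= addn0 addn1 => -> -> h; exists (Ordinal hu).
  by have := app u false; have := app u true; rewrite /= addn0 addn1 => <- <- h; exists u; rewrite ?ltn_ord.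
rewrite nx; apply/existsP/orP => [h|[h|/existsP//]]; first by right; apply/existsP.
(* All leaves of the tree have the same depth; a position won earlier is prolonged by pebbling the
   challenged vertex. *)
exists v; rewrite andbb; apply: win0; apply: subset_trans h _; exact: subsetUr.
Qed.

Definition geval z x := iter x (jstep Dn K (gleaf z)) 2 == 1.
Lemma gevalE x : M ^ K <= x -> geval z x = win ed K set0 z.
Proof.
move=> hx; rewrite /geval (tval_iter _ D0) // (@tval_win K 0 0 (add0n K) z); last by rewrite /cur /bsum big_nil.
by congr (win _ _ _ _); apply/setP => u; rewrite !inE.
Qed.
End GameEval.

End GameWalk.

(** * Membership in PSPACE *)

Module Membership.
Import Exp Graph GraphExprs Reduction Decoding GameWalk Lib.

Lemma E_powle d (a n m : efun d) : E a -> E n -> (forall w x, 0 < a w x) -> Bd (fun w x => a w x ^ m w x) ->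
  (forall w x, n w x <= m w x) -> E (fun w x => a w x ^ n w x).
Proof.
move=> ha hn a0 [k hk] le; apply: E_pow => //; exists k => w x X hx; apply: leq_trans (hk w x X hx).
by rewrite leq_pexp2l.
Qed.

Lemma rev_price_bounds (G : ssdag) : 0 < rev_price G <= dag_size G.
Proof.
rewrite /rev_price; case: ex_minnP => k /asboolP[Ps [_ hl <-]] _; apply/andP; split.
  apply: (@leq_trans #|[set dag_sink G]|); first by rewrite cards1.
  by rewrite -hl; apply: (@leq_bigmax_seq _ _ _ (fun P : {set _} => #|P|)) => //; exact: mem_last.
by apply/bigmax_leqP_seq => P _ _; rewrite -[X in _ <= X]card_ord; exact: max_card.
Qed.

Lemma rev_price_leK (G : ssdag) k : (rev_price G <= k) = (0 < k) && win (@dag_edge G) (minn k (dag_size G)).-1 set0 (dag_sink G).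
Proof.
have /andP[h1 h2] := rev_price_bounds G.
case: k => [|k] /=; first by apply/negbTE; rewrite -ltnNge.
have hD : 0 < dag_size G by apply: leq_trans h2.
rewrite -rev_price_le prednK; last by rewrite leq_min hD.
by rewrite leq_min h2 andbT.
Qed.

Section Decide.
Variables (w : seq bool) (X : nat).
(** For [X] equal to [2 ^ size w] this is the length of the word. *)
Definition NN := up_log 2 X.
Definition D0 := run w NN 0.
Definition ok1 := (0 < D0) && (dlen D0 + 1 <= NN).
(** The default 1 keeps the bounds, [DD_sq] above all, valid for malformed words. *)
Definition DD := if ok1 then D0 else 1.
Definition off := dlen DD.
Definition ee_ u v := bit1 w (DD.+1 + (u * DD + v)).
Definition gg := bsum NN (fun i => if bit1 w (off.+1 + i) then 2 ^ minn i NN else 0).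
Definition bitm s v := s %/ 2 ^ v %% 2 == 1.
(** Acyclicity in the form that every nonempty set of vertices contains one without predecessors in
    the set; sets are bit masks [s]. *)
Definition acyc := alln (2 ^ minn DD NN) (fun s => exn DD (fun v => bitm s v) ==>
  exn DD (fun v => bitm s v && alln DD (fun u => bitm s u ==> ~~ ee_ u v))).
Definition snk v := alln DD (fun u => ~~ ee_ v u).
Definition zz := bsum DD (fun v => if snk v then v else 0).
(** One round fewer than pebbles, by [rev_price_le]; the cap at [DD] is justified because the price
    never exceeds the number of vertices. *)
Definition KK := (minn gg DD).-1.
Definition gl_ P := gleaf DD ee_ KK zz P.
Definition stp y := jstep DD KK gl_ y.
(** A word is accepted only if it is exactly a code: the unary prefix and its end mark, a
    nonnegative sign, and either no digits or a leading digit 1. *)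
Definition okw := [&& alln DD (fun i => bit1 w i), ~~ bit1 w DD, ~~ bit1 w off & (off + 1 == NN) || bit1 w NN.-1].
Definition okg := [&& acyc, zz < DD, alln DD (fun v => snk v == (v == zz)) & alln DD (fun v => bsum DD (fun u => ee_ u v : nat) <= 2)].
Definition decide := [&& ok1, okw, okg, 0 < gg & iter (Mb DD ^ KK) stp 2 == 1].

Lemma DD_gt0 : 0 < DD. Proof. by rewrite /DD; case: ifP => // /andP[]. Qed.
(** The word contains the adjacency matrix, so [DD * DD] is below its length, and the tree has at
    most [(2 ^ DD) ^ DD] leaves. *)
Lemma DD_sq : Mb DD ^ KK <= 2 ^ NN.
Proof.
have hK : KK < DD by rewrite /KK; have := DD_gt0; lia.
have [h|h] := boolP ok1; last by move: hK; rewrite /DD (negbTE h) ltnS leqn0 => /eqP->; rewrite expn0 expn_gt0.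
apply: (@leq_trans ((2 ^ DD) ^ DD)).
  have h2 : Mb DD <= 2 ^ DD.
    rewrite /Mb; have := DD_gt0; case: (DD) => // d _; rewrite expnS leq_mul2l /=; exact: ltn_expl.
  apply: (@leq_trans ((2 ^ DD) ^ KK)); first by case: (KK) => // k; rewrite leq_exp2r.
  by rewrite leq_pexp2l ?expn_gt0 // ltnW.
rewrite -expnM leq_exp2l //; rewrite /DD h; case/andP: h => _; rewrite /dlen; lia.
Qed.

Lemma digits_mask D (A : pred nat) : exists2 s, s < 2 ^ D & forall v, v < D -> bitm s v = A v.
Proof.
elim: D A => [|D IH] A; first by exists 0.
have [s hs h] := IH (fun v => A v.+1); exists (2 * s + A 0); first by rewrite expnS; case: (A 0); lia.
case=> [|v] hv; rewrite /bitm; first by rewrite expn0 divn1; case: (A 0); lia.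
by rewrite expnS divnMA (_ : (2 * s + A 0) %/ 2 = s) -?h //; case: (A 0); lia.
Qed.

Lemma val_bsum l m : size l <= m -> Registers.val l = bsum m (fun i => if nth false l i then 2 ^ i else 0).
Proof.
elim: l m => [|b l IH] m /=; first by rewrite /bsum big1 // => i _; rewrite nth_nil.
case: m => // m hm; rewrite bsum_first /= expn0 (IH m) // (_ : (if b then 1 else 0) = b); last by case: (b).
congr (_ + _).
by rewrite /bsum big_distrr /=; apply: eq_bigr => i _; case: nth; rewrite ?muln0 // expnS.
Qed.

Section Facts.
Hypotheses (hN : NN = size w) (h1 : ok1).
Lemma DDE : DD = D0. Proof. by rewrite /DD h1. Qed.
Lemma off_lt : off < NN. Proof. by rewrite /off DDE; case/andP: h1 => _; lia. Qed.
Lemma ggE : gg = Registers.val (drop off.+1 w).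
Proof.
rewrite (@val_bsum _ NN); last by rewrite size_drop hN leq_subr.
by rewrite /gg /bsum !big_seq; apply: eq_bigr => i; rewrite mem_iota => /= hi; rewrite one_drop (minn_idPl (ltnW hi)).
Qed.

Lemma decide_graph (G : ssdag) : dag_size G = DD -> (forall a b : 'I_(dag_size G), dag_edge a b = ee_ a b) -> fanin_le 2 G ->
  okg && (0 < gg) && (iter (Mb DD ^ KK) stp 2 == 1) = (rev_price G <= gg).
Proof.
move=> eD he hf; rewrite rev_price_leK.
have D_gt0 := DD_gt0.
have ordP v : v < DD -> exists a : 'I_(dag_size G), v = a by rewrite -eD => h; exists (Ordinal h).
have aD (a : 'I_(dag_size G)) : a < DD by rewrite -eD ltn_ord.
have hs (a : 'I_(dag_size G)) : snk a = (a == dag_sink G).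
  rewrite -dag_sinkP /snk; apply/allnP/forallP => [h b|h u hu]; first by rewrite he; apply: h; exact: aD.
  by have [b ->] := ordP u hu; rewrite -he.
have hz : zz = dag_sink G.
  rewrite /zz bsumE -eD (bigD1 (dag_sink G)) //= hs eqxx big1 ?addn0 // => i ne.
  by rewrite hs (negbTE ne).
have hac : acyc.
  apply/allnP => s _; apply/implyP => /exnP[v hv sv].
  have : [set a : 'I_(dag_size G) | bitm s a] != set0.
    by have [a ea] := ordP v hv; apply/set0Pn; exists a; rewrite inE -ea.
  case/(acyclic_source (@dag_acyclic G)) => a; rewrite inE => sa /pred0P dis.
  apply/exnP; exists a => //; rewrite sa; apply/allnP => u hu; apply/implyP => su.
  have [b eb] := ordP u hu; by have := dis b; rewrite /= !inE he -eb su andbT => ->.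
have -> : okg.
  rewrite /okg hac hz aD /=; apply/andP; split; apply/allnP => v /ordP[a ->].
    by rewrite hs; apply/eqP; exact/esym/(inj_eq val_inj).
  apply: leq_trans (hf a); apply: eq_leq; rewrite bsumE -eD -sum1_card [RHS]big_mkcond /=; apply: eq_bigr => b _.
  by rewrite inE he; case: (ee_ _ _).
rewrite /=; congr (_ && _).
have D0' : 0 < dag_size G by rewrite eD.
have eK : (minn gg (dag_size G)).-1 = KK by rewrite eD.
have hM : Mb (dag_size G) ^ KK <= Mb DD ^ KK by rewrite eD.
have h := @gevalE (dag_size G) (@dag_edge G) ee_ (dag_sink G) KK he D0' (Mb DD ^ KK) hM.
by rewrite eK -h -hz eD.
Qed.
End Facts.
End Decide.

Lemma decideP w : rev_price_problem w <-> decide w (2 ^ size w).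
Proof.
set X := 2 ^ size w; have hN : NN X = size w by rewrite /NN up_expnK.
split=> [[G [s [hw hf hp]]]|].
  case: s hw hp => [s|s] hw hp; last by [].
  have hu : drop 0 w = enc_unary (dag_size G) ++ ([seq dag_edge u v | u <- enum 'I_(dag_size G), v <- enum 'I_(dag_size G)] ++ enc_int (Posz s)).
    by rewrite drop0 hw /enc_dag catA.
  have eD0 : D0 w X = dag_size G by apply: run_drop hu; rewrite hN.
  have Dp : 0 < dag_size G by apply: leq_ltn_trans (ltn_ord (dag_sink G)).
  have sw : size w = dlen (dag_size G) + (size (enc_binary s)).+1 by rewrite hw size_cat size_enc_dag.
  have o1 : ok1 w X by rewrite /ok1 eD0 Dp hN sw; lia.
  have eD : DD w X = dag_size G by rewrite DDE.
  pose eN u v := dag_edge (insubd (dag_sink G) u) (insubd (dag_sink G) v).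
  have hbits : enc_dag G = mkseq (rbit (dag_size G) eN) (dlen (dag_size G)).
    by apply: rel_bits => a b; rewrite /eN !valKd.
  have on j : j < dlen (dag_size G) -> bit1 w j = rbit (dag_size G) eN j.
    by move=> hj; rewrite oneE hw nth_cat size_enc_dag hj hbits nth_mkseq.
  have dofs : drop (off w X) w = enc_int (Posz s) by rewrite /off eD hw drop_size_cat // size_enc_dag.
  have dbin : drop (off w X).+1 w = enc_binary s by rewrite -addn1 addnC -drop_drop dofs /enc_int /= drop0.
  have he (a b : 'I_(dag_size G)) : dag_edge a b = ee_ w X a b.
    rewrite /ee_ eD on; last first.
      by rewrite /dlen ltn_add2l; have := ltn_ord a; have := ltn_ord b; move: (dag_size G) (a : nat) (b : nat) => D x y; clear; nia.
    rewrite /rbit ifF; last by move: (_ * _ + _) => y; clear; lia.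
    rewrite addKn divnMDl // modnMDl modn_small // divn_small // addn0 /eN.
    by rewrite !valKd.
  have gE : gg w X = s by rewrite ggE // dbin; have [] := enc_binaryP s.
  have okw' : okw w X.
    rewrite /okw eD; apply/and4P; split.
    - by apply/allnP => i hi; rewrite on ?/rbit ?(ltnW hi) //; rewrite /dlen; lia.
    - by rewrite on /rbit ?leqnn ?ltnn // /dlen; lia.
    - by have := one_drop w (off w X) 0; rewrite addn0 dofs => ->.
    rewrite hN sw; case: (posnP s) => [s0|s0].
      by rewrite s0 /off eD (_ : enc_binary 0 = [::]) // eqxx.
    have [_ cs] := enc_binaryP s; have b0 : 0 < size (enc_binary s) by rewrite enc_binaryS.
    have h := one_drop w (off w X).+1 (size (enc_binary s)).-1; rewrite dbin nth_last in h.
    have -> : (dlen (dag_size G) + (size (enc_binary s)).+1).-1 = (off w X).+1 + (size (enc_binary s)).-1 by rewrite /off eD; lia.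
    by rewrite h; move: cs b0; rewrite /Registers.canon; case: (enc_binary s) => [|b l] //= ->; rewrite orbT.
  have /andP[/andP[p1 p2] p3] : okg w X && (0 < gg w X) && (iter (Mb (DD w X) ^ KK w X) (stp w X) 2 == 1).
    by rewrite (@decide_graph w X G (esym eD) he hf) gE -lez_nat.
  by rewrite /decide o1 okw' p1 p2 p3.
case/and5P => o1 /and4P[w1 w2 w3 w4] hok g0 hev.
have Dp := DD_gt0 w X; have ol := off_lt hN o1.
pose F (a b : 'I_(DD w X)) := ee_ w X a b.
case/and4P: (hok) => ha hz hs hf.
have fac : acyclic F.
  move=> c hc; case: c hc => // a c hc; exfalso.
  (* The vertices of a cycle would form a mask in which each vertex has a predecessor. *)
  have [s hs' hb] := digits_mask (DD w X) (fun v => v \in map (@nat_of_ord _) (a :: c)).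
  have mD : minn (DD w X) (NN X) = DD w X.
    by apply/minn_idPl; apply: ltnW; apply: leq_ltn_trans ol; rewrite /off /dlen; lia.
  have := allnP _ _ ha s; rewrite mD => /(_ hs') /implyP h.
  have /exnP[v hv /andP[sv /allnP nv]] : exn (DD w X) (fun v => bitm s v && alln (DD w X) (fun u => bitm s u ==> ~~ ee_ w X u v)).
    by apply: h; apply/exnP; exists a => //; rewrite hb // mem_head.
  move: sv; rewrite hb // => /mapP[b hbc ev]; have := nv (prev (a :: c) b) (ltn_ord _).
  rewrite hb // map_f ?mem_prev //= ev => /negP; apply; exact: (prev_cycle hc).
have fs v : is_sink F v = (v == Ordinal hz).
  have hv := allnP _ _ hs v (ltn_ord v).
  rewrite (_ : (v == Ordinal hz) = (nat_of_ord v == zz w X)) //; move/eqP: hv => <-.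
  by apply/forallP/allnP => [h u hu|h u]; [exact: (h (Ordinal hu)) | exact: h].
pose G := SSDag fac fs.
have fG : fanin_le 2 G.
  move=> v; have := allnP _ _ hf v (ltn_ord v); rewrite bsumE; apply: leq_trans.
  apply: eq_leq; rewrite -sum1_card [LHS]big_mkcond /=; apply: eq_bigr => b _; by rewrite inE /= /F; case: (ee_ _ _ _ _).
exists G, (Posz (gg w X)); split=> //; last first.
  by rewrite lez_nat -(@decide_graph w X G (erefl _) (fun _ _ => erefl _) fG) hok g0 hev.
have -> : enc_dag G = mkseq (rbit (DD w X) (ee_ w X)) (off w X) by apply: rel_bits.
rewrite -[LHS](cat_take_drop (off w X)); congr (_ ++ _).
  have sz : size (take (off w X) w) = off w X by rewrite size_takel // -hN ltnW.
  apply: (@eq_from_nth _ false); first by rewrite sz size_mkseq.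
  move=> j; rewrite sz => hj; rewrite nth_take // nth_mkseq // -oneE /rbit.
  case: ltngtP => h; [by apply: (allnP _ _ w1) | | by rewrite h; apply/negbTE].
  rewrite /ee_ -divn_eq subnKC //.
rewrite (drop_nth false); last by rewrite -hN.
rewrite -oneE (negbTE w3) /enc_int /= ggE // enc_binary_val //.
rewrite /Registers.canon; set l := drop _ _; have sl : size l = size w - (off w X).+1 by rewrite size_drop.
case/orP: w4 => [/eqP h|h].
  by have -> : l = [::]; [apply: size0nil; rewrite sl -hN; lia |].
have l0 : 0 < size l \/ size l = 0 by lia.
case: l0 => l0; last by rewrite (size0nil l0).
have -> : last true l = nth false l (size l).-1 by rewrite nth_last; case: (l) l0.
rewrite -one_drop sl; move: h; rewrite hN; congr (is_true (bit1 w _)); rewrite sl in l0; lia.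
Qed.

Section DecideE.
Variable d : nat.
Implicit Types X u v p i f m : efun d.
Lemma Eb_weak2 (b : epred d) : Eb b -> Eb (fun w (x : ctx d.+2) => b w x.1.1). Proof. exact: E_weak2. Qed.
Lemma E_divpow f m i : E f -> E m -> E i -> E (fun w x => f w x %/ m w x ^ i w x).
Proof.
move=> hf hm hi; apply: (E_ext (f := fun w x => iter (i w x) (fun y => y %/ m w x) (f w x))) => [w x|].
  by elim: (i w x) => [|n IH] /=; rewrite ?divn1 // IH -divnMA -expnSr.
apply: (E_iterk (b := fun _ _ => 0) (G := fun w x y => y %/ m w x)) => //; first exact: E_nat.
  by apply: E_div; [exact: E_v0 | exact: E_weak].
by move=> w x y; rewrite addn0 leq_div.
Qed.
Lemma E_NN X : E X -> E (fun w y => NN (X w y)).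
Proof. by move=> h; rewrite /NN; apply: E_uplog. Qed.
Lemma E_D0 X : E X -> E (fun w y => D0 w (X w y)).
Proof. by move=> h; rewrite /D0; apply: E_run; [apply: E_NN | exact: E_nat]. Qed.
Lemma E_DD X : E X -> E (fun w y => DD w (X w y)).
Proof.
move=> h; have h1 := E_D0 h; have h2 := E_NN h; rewrite /DD /ok1 /dlen.
by apply: E_if => //; [Es | exact: E_nat].
Qed.
Lemma E_off X : E X -> E (fun w y => off w (X w y)).
Proof. by move=> h; have h1 := E_DD h; rewrite /off /dlen; Es. Qed.
Lemma E_ee X u v : E X -> E u -> E v -> Eb (fun w y => ee_ w (X w y) (u w y) (v w y)).
Proof. by move=> h hu hv; have h1 := E_DD h; rewrite /ee_; apply: E_one; Es. Qed.
Lemma E_pow2 X i : E X -> E i -> (forall w y, i w y <= NN (X w y)) -> E (fun w y => 2 ^ i w y).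
Proof.
move=> hx hi le; apply: (E_powle (a := fun _ _ => 2) (m := fun w y => NN (X w y))) => //; first exact: E_nat.
by apply: E_bd; apply: E_pow2log.
Qed.
Lemma E_bitm i v : E i -> E v -> Eb (fun w y => bitm (i w y) (v w y)).
Proof.
move=> hi hv; rewrite /bitm; apply: Eb_eq; last exact: E_nat; apply: E_mod; last exact: E_nat.
by apply: (E_divpow (m := fun _ _ => 2)) => //; exact: E_nat.
Qed.
End DecideE.
Lemma E_gg d (x : efun d) : E x -> E (fun w y => gg w (x w y)).
Proof.
move=> h; have h1 := E_NN h; have h2 := E_off h; rewrite /gg.
apply: (E_sum (F := fun w y i => if bit1 w ((off w (x w y)).+1 + i) then 2 ^ minn i (NN (x w y)) else 0)) => //.
have hw := E_weak h.
apply: E_if; [by apply: E_one; apply: E_add; [apply: E_succ; exact: E_off hw | exact: E_v0] | | exact: E_nat].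
apply: (@E_pow2 d.+1 (fun w y => x w y.1) (fun w y => minn y.2 (NN (x w y.1)))); [exact: hw | by apply: E_min; [exact: E_v0 | exact: E_NN hw] |].
by move=> w y; apply: geq_minr.
Qed.
Ltac hD := lazymatch goal with
  | |- Eb (fun w x => bitm (@?a w x) (@?b w x)) => apply: (@E_bitm _ a b); cbv beta
  | |- Eb (fun w x => ee_ w (@?a w x) (@?b w x) (@?c w x)) => apply: (@E_ee _ a b c); cbv beta
  | |- E (fun w x => DD w (@?a w x)) => apply: (@E_DD _ a); cbv beta
  | |- E (fun w x => gg w (@?a w x)) => apply: (@E_gg _ a); cbv beta
  | |- E (fun w x => NN (@?a w x)) => apply: (@E_NN _ a); cbv beta
  | |- E (fun w x => off w (@?a w x)) => apply: (@E_off _ a); cbv beta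
  | |- Eb (fun w x => bit1 w (@?a w x)) => apply: (@E_one _ a); cbv beta
  | |- E (fun w x => divn (@?f w x) (expn (@?m w x) (@?i w x))) => apply: (@E_divpow _ f m i); cbv beta
  end.
Lemma E_acyc d (x : efun d) : E x -> Eb (fun w y => acyc w (x w y)).
Proof.
move=> h; have h1 := E_DD h; have h2 := E_NN h.
have h3 : E (fun w y => 2 ^ minn (DD w (x w y)) (NN (x w y))).
  by apply: (E_pow2 h) => [|w y]; [exact: E_min | exact: geq_minr].
by rewrite /acyc; do ?[hD | E1].
Qed.
Lemma E_snk d (x v : efun d) : E x -> E v -> Eb (fun w y => snk w (x w y) (v w y)).
Proof. by move=> *; rewrite /snk; do ?[hD | E1]. Qed.
Lemma E_zz d (x : efun d) : E x -> E (fun w y => zz w (x w y)).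
Proof. by move=> *; rewrite /zz; do ?[hD | (lazymatch goal with |- Eb (fun w x => snk w (@?a w x) (@?b w x)) => apply: (@E_snk _ a b) end; cbv beta) | E1]. Qed.
Lemma E_KK d (x : efun d) : E x -> E (fun w y => KK w (x w y)).
Proof. by move=> *; rewrite /KK; do ?[hD | E1]. Qed.
Ltac hK := lazymatch goal with
  | |- Eb (fun w x => snk w (@?a w x) (@?b w x)) => apply: (@E_snk _ a b); cbv beta
  | |- E (fun w x => zz w (@?a w x)) => apply: (@E_zz _ a); cbv beta
  | |- E (fun w x => KK w (@?a w x)) => apply: (@E_KK _ a); cbv beta
  | _ => hD end.
Lemma E_gl_ d (x p : efun d) : E x -> E p -> Eb (fun w y => gl_ w (x w y) (p w y)).
Proof. by move=> *; rewrite /gl_ /gleaf /cur /dg /Mb; do ?[hK | E1]. Qed.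

Lemma tcl_le D b P m : tcl D b P m <= m.
Proof. by rewrite /tcl bsumE -[X in _ <= X](card_ord m) -sum1_card; apply: leq_sum => i _; case: alln. Qed.

Lemma E_stp d (x p : efun d) : E x -> E p -> E (fun w y => stp w (x w y) (p w y)).
Proof.
move=> hx hp; have hb := E_gl_ hx (E_sub hp (@E_nat d 2)).
have h1 := E_DD hx; have h2 := E_KK hx.
rewrite /stp /jstep /jump; cbv zeta.
have ht : E (fun w y => tcl (DD w (x w y)) (gl_ w (x w y) (p w y - 2)) (p w y - 2) (KK w (x w y) - 0)).
  rewrite /tcl /cl; move: hb; set b := (fun w y => gl_ w (x w y) (p w y - 2)) => hb.
  apply: (E_sum (F := fun w y j => alln j.+1 (fun i => if b w y then (p w y - 2) %/ Mb (DD w (x w y)) ^ i %% Mb (DD w (x w y)) %% 2 == 1 else (p w y - 2) %/ Mb (DD w (x w y)) ^ i %% Mb (DD w (x w y)) %/ 2 == (DD w (x w y)).-1) : nat)); first by Es.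
  by rewrite /Mb; do ?[(apply: (Eb_weak2 hb)) | hK | E1].
apply: E_if; [by Es | by Es |]; apply: E_if; [by Es | exact: hb |].
apply: E_add; last exact: E_nat; apply: E_mul.
  rewrite /dl; apply: E_if => //; first by apply: E_succ; apply: E_divpow => //; rewrite /Mb; Es.
  by apply: E_sub; [apply: E_add; last exact: E_nat | apply: E_mod; last exact: E_nat]; apply: E_divpow => //; rewrite /Mb; Es.
apply: (E_powle (m := fun w y => KK w (x w y))).
- by rewrite /Mb; Es.
- by apply: E_add => //; exact: E_nat.
- by move=> w y; rewrite /Mb muln_gt0 DD_gt0.
- by apply: (Bd_le (g := fun w y => 2 ^ NN (x w y))) => [w y|]; [exact: DD_sq | apply: E_bd; apply: E_pow2log].
by move=> w y; rewrite addn0; apply: leq_trans (tcl_le _ _ _ _) _; rewrite subn0.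
Qed.

(** The increase is bounded independently of [y], as [E_iterk] requires. *)
Lemma stp_le w X y : stp w X y <= y + (2 * Mb (DD w X) ^ KK w X + 2).
Proof.
rewrite /stp /jstep; case: (leqP y 1) => h; first exact: leq_addr.
rewrite /jump; set b := gl_ _ _ _; set t := tcl _ _ _ _; case: ifP => _; first by case: (b); lia.
have ht : t <= KK w X by apply: leq_trans (tcl_le _ _ _ _) _; rewrite subn0.
have hM : Mb (DD w X) ^ t <= Mb (DD w X) ^ KK w X by rewrite leq_pexp2l // muln_gt0 DD_gt0.
rewrite addn0; set Q := Mb _ ^ t in hM *; set R := Mb _ ^ KK w X in hM *.
have h1 : (y - 2) %/ Q * Q <= y - 2 by exact: leq_divM.
have h2 : dl b ((y - 2) %/ Q) <= (y - 2) %/ Q + 2 by move: (_ %/ Q) (b) => x c; rewrite /dl; clear; case: c; lia.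
have h3 : dl b ((y - 2) %/ Q) * Q <= ((y - 2) %/ Q + 2) * Q by rewrite leq_mul2r h2 orbT.
move: h1 h3 hM h; clear; rewrite mulnDl; move: (_ * Q) (dl b _ * Q) => a c; lia.
Qed.

Theorem problem_PSPACE : in_PSPACE rev_price_problem.
Proof.
apply: (@pspace_E _ (fun w x => decide w x.2)); last by move=> w; exact: decideP.
have hx := @E_v0 0; have h1 := E_DD hx; have h2 := E_KK hx; have h3 := E_acyc hx; have h4 := E_gg hx; have h5 := E_D0 hx; have h6 := E_NN hx.
have hp : E (fun (w : seq bool) (x : ctx 1) => Mb (DD w x.2) ^ KK w x.2).
  apply: E_pow => //; first by rewrite /Mb; Es.
  by apply: (Bd_le (g := fun w (y : ctx 1) => 2 ^ NN y.2)) => [w y|]; [exact: DD_sq | apply: E_bd; apply: E_pow2log].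
rewrite /decide; apply: Eb_and; first by rewrite /ok1 /dlen; Es.
apply: Eb_and; first by rewrite /okw; do ?[hK | E1].
apply: Eb_and; first by rewrite /okg; do ?[hK | E1].
apply: Eb_and; first by Es.
apply: Eb_eq; last exact: E_nat.
apply: (@E_iterk 1 (fun w x => Mb (DD w x.2) ^ KK w x.2) (fun _ _ => 2) (fun w x => 2 * (Mb (DD w x.2) ^ KK w x.2) + 2) (fun w x => stp w x.2)) => //; first exact: E_nat.
- by apply: E_add; [apply: E_mul => //; exact: E_nat | exact: E_nat].
- by apply: E_stp; [exact: E_v1 | exact: E_v0].
by move=> w x y; apply: stp_le.
Qed.

End Membership.

(** * Space-bounded computation as a quantified formula *)

Module Savitch.
Import Graph Lib.

Section Skolem.
Variables (q : nat -> bool) (F : (nat -> bool) -> bool) (n : nat).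
Definition trunc i (r : nat -> bool) j := (j < i) && r j.
(** [sk] plays the part of Skolem functions: it turns a sequence [y] of universal values into a full
    valuation, and the value at [i] may depend only on [y] up to [i]. *)
Definition causal (sk : (nat -> bool) -> nat -> bool) := forall y y' i, (forall j, j <= i -> y j = y' j) -> sk y i = sk y' i.

Lemma trunc_upd i r b : r i = b -> upd (trunc i r) i b = trunc i.+1 r.
Proof.
move=> h; apply/funext => j; rewrite /upd /trunc ltnS; case: eqP => [->|ne]; first by rewrite leqnn h.
by rewrite [j <= i]leq_eqVlt (introF eqP ne).
Qed.

Lemma skolem_pt sk : causal sk -> (forall y i, i < n -> q i -> sk y i = y i) -> (forall y, F (trunc n (sk y))) ->
  pt q F n 0 (fun _ => false).
Proof.
move=> hc hq hF.
have key k i y : i + k = n -> pt q F k i (trunc i (sk y)).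
  elim: k i y => [|k IH] i y hik /=; first by rewrite -(addn0 i) hik; apply: hF.
  case: ifP => qi.
    have al b : pt q F k i.+1 (upd (trunc i (sk y)) i b).
      pose y' := upd y i b; have e : trunc i (sk y) = trunc i (sk y').
        apply/funext => j; rewrite /trunc; case: ltnP => //= hj; apply: hc => l hl.
        by rewrite /y' /upd ifF //; apply/eqP; lia.
      rewrite e trunc_upd; first by apply: IH; lia.
      by rewrite hq //; [rewrite /y' /upd eqxx | lia].
    by rewrite !al.
  have h : pt q F k i.+1 (upd (trunc i (sk y)) i (sk y i)) by rewrite trunc_upd //; apply: IH; lia.
  by case: (sk y i) h => ->; rewrite ?orbT.
by have := key n 0 (fun _ => false) (add0n n).
Qed.

Lemma pt_skolem : pt q F n 0 (fun _ => false) -> exists sk, [/\ causal sk,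
  forall y i, i < n -> q i -> sk y i = y i & forall y, F (trunc n (sk y))].
Proof.
move=> h0.
(* Existential values are chosen greedily: true exactly when the rest of the formula then holds. *)
pose fix rr (y : nat -> bool) i : nat -> bool := if i is i'.+1 then
  upd (rr y i') i' (if q i' then y i' else pt q F (n - i) i (upd (rr y i') i' true)) else fun _ => false.
have rrS y i : rr y i.+1 = upd (rr y i) i (if q i then y i else pt q F (n - i.+1) i.+1 (upd (rr y i) i true)) by [].
pose sk y j := rr y j.+1 j.
have inv y i : i <= n -> pt q F (n - i) i (rr y i).
  elim: i => [|i IH] hi; first by rewrite subn0.
  have := IH (ltnW hi); rewrite (_ : n - i = (n - i.+1).+1) /=; last by lia.
  case: ifP => qi; first by case/andP => h1 h2; case: (y i).
  by case h : (pt q F (n - i.+1) i.+1 (upd (rr y i) i true)) => //; rewrite orbF.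
have rt y i : rr y i = trunc i (sk y).
  elim: i => [|i IH]; first by apply/funext => j; rewrite /trunc ltn0.
  rewrite rrS IH trunc_upd // /sk rrS /upd eqxx IH //.
have cz y y' i : (forall j, j < i -> y j = y' j) -> rr y i = rr y' i.
  elim: i => // i IH h; rewrite !rrS IH; last by move=> j hj; apply: h; lia.
  by rewrite h.
exists sk; split.
- by move=> y y' i h; rewrite /sk (cz y y') // => j hj; apply: h.
- by move=> y i hi qi; rewrite /sk rrS /upd eqxx qi.
- by move=> y; rewrite -rt; have := inv y n (leqnn n); rewrite subnn.
Qed.
End Skolem.

(* Savitch's recursion: block [b] holds a selector bit [yv b], two configurations and their midpoint; for both
   values of [yv b.+1] the next block covers one half of the interval.  All clauses are Horn, so a valuation may
   only overapproximate the configurations, and it suffices to forbid rejection. *)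
Section Savitch.
Variables (m g J : nat) (delta : nat -> nat -> nat -> nat -> nat) (ini : nat -> nat) (rej : nat -> bool).
Variable cfg : nat -> nat -> nat.
Hypotheses (m0 : 1 < m) (g0 : 0 < g).
Hypothesis cfg_lt : forall t p, p < m -> cfg t p < g.
Hypothesis cfg0 : forall p, p < m -> cfg 0 p = ini p.
Hypothesis cfgS : forall t p, p < m -> cfg t.+1 p = delta (cfg t 0) (cfg t p.-1) (cfg t p) (cfg t (minn p.+1 m.-1)).

Definition Nb := m * g.
Definition Bk := 3 * Nb + 1.
Definition yv b := b * Bk.
Definition Av b i := b * Bk + 1 + i.
Definition Bv b i := b * Bk + 1 + Nb + i.
Definition Mv b i := b * Bk + 1 + 2 * Nb + i.
(** [U1] and [U2] name partial conjunctions of cell contents; they break the transition clause,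
    which has five literals, into clauses of three. *)
Definition U1 p a0 a1 := J.+1 * Bk + (p * g + a0) * g + a1.
Definition U2 p a0 a1 a2 := J.+1 * Bk + m * g * g + ((p * g + a0) * g + a1) * g + a2.
Definition nv := J.+1 * Bk + m * g * g + m * g * g * g.
Definition qv i := (i < J.+1 * Bk) && (i %% Bk == 0).
Definition pos v := 2 * v + 2.
Definition neg v := 2 * v + 1.
(** Nine kinds of clauses; the sum of the index ranges serves as a common range for all kinds. *)
Definition cc := 9 * (J * Nb + m * g ^ 4 + m + g).

(** The kind is [j %% 9]: 0 to 3 pass configurations to the next block and back, 4 to 6 make one
    transition, 7 is the initial configuration, and 8 forbids rejection. Numbers outside the range
    of their kind give a tautology. *)
Definition lfv j k :=
  let kd := j %% 9 in let j' := j %/ 9 in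
  let b := j' %/ Nb in let i := j' %% Nb in
  let a0 := j' %% g in let a1 := j' %/ g %% g in let a2 := j' %/ g ^ 2 %% g in let a3 := j' %/ g ^ 3 %% g in let p := j' %/ g ^ 4 in
  let c3 x y z := if k == 0 then x else if k == 1 then y else z in
  if (kd < 4) && (b < J) then
    (if kd == 0 then c3 (pos (yv b.+1)) (neg (Av b i)) (pos (Av b.+1 i)) else
     if kd == 1 then c3 (pos (yv b.+1)) (neg (Bv b.+1 i)) (pos (Mv b i)) else
     if kd == 2 then c3 (neg (yv b.+1)) (neg (Mv b i)) (pos (Av b.+1 i)) else
     c3 (neg (yv b.+1)) (neg (Bv b.+1 i)) (pos (Bv b i)))
  else if (4 <= kd < 7) && (p < m) then
    (if kd == 4 then c3 (neg (Av J a0)) (neg (Av J (p.-1 * g + a1))) (pos (U1 p a0 a1)) else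
     if kd == 5 then c3 (neg (U1 p a0 a1)) (neg (Av J (p * g + a2))) (pos (U2 p a0 a1 a2)) else
     c3 (neg (U2 p a0 a1 a2)) (neg (Av J (minn p.+1 m.-1 * g + a3))) (pos (Bv J (p * g + delta a0 a1 a2 a3))))
  else if (kd == 7) && (j' < m) then c3 (pos (Av 0 (j' * g + ini j'))) 0 0
  else if [&& kd == 8, j' < g & rej j'] then c3 (neg (Bv 0 j')) 0 0
  else c3 (pos 0) (neg 0) 0.

Definition Sat (r : nat -> bool) := [/\
  (forall b i, b < J -> i < Nb -> [/\ r (yv b.+1) || (r (Av b i) ==> r (Av b.+1 i)), r (yv b.+1) || (r (Bv b.+1 i) ==> r (Mv b i)),
     r (yv b.+1) ==> r (Mv b i) ==> r (Av b.+1 i) & r (yv b.+1) ==> r (Bv b.+1 i) ==> r (Bv b i)]),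
  (forall p a0 a1 a2 a3, p < m -> a0 < g -> a1 < g -> a2 < g -> a3 < g ->
     [/\ r (Av J a0) ==> r (Av J (p.-1 * g + a1)) ==> r (U1 p a0 a1), r (U1 p a0 a1) ==> r (Av J (p * g + a2)) ==> r (U2 p a0 a1 a2)
      & r (U2 p a0 a1 a2) ==> r (Av J (minn p.+1 m.-1 * g + a3)) ==> r (Bv J (p * g + delta a0 a1 a2 a3))]),
  (forall p, p < m -> r (Av 0 (p * g + ini p))) & (forall a, a < g -> rej a -> ~~ r (Bv 0 a))].

Lemma N0 : 0 < Nb. Proof. by rewrite /Nb muln_gt0 g0; lia. Qed.
Lemma idx p a : p < m -> a < g -> p * g + a < Nb.
Proof. by move=> hp ha; rewrite /Nb; nia. Qed.

(** By induction on the remaining depth [d], block [b] carries the run over [2 ^ d] steps. Both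
    halves are obtained from the next block by flipping its universal bit, and causality keeps the
    variables of block [b] fixed under the flip. *)
Lemma sound sk : causal sk -> (forall y b, b <= J -> sk y (yv b) = y (yv b)) -> (forall y, Sat (sk y)) -> ~~ rej (cfg (2 ^ J) 0).
Proof.
move=> hc hy hS.
have key d b : b + d = J -> forall y t, (forall p, p < m -> sk y (Av b (p * g + cfg t p))) ->
    forall p, p < m -> sk y (Bv b (p * g + cfg (t + 2 ^ d) p)).
  elim: d b => [|d IH] b hb y t hA p hp.
    rewrite addn0 in hb; subst b; rewrite expn0 addn1 cfgS //.
    have [_ S _ _] := hS y; have m1 : 0 < m by lia.
    have pm : p.-1 < m by move: hp; clear; lia. have pM : minn p.+1 m.-1 < m by move: m1; clear; lia.
    have [s1 s2 s3] := S p _ _ _ _ hp (cfg_lt t m1) (cfg_lt t pm) (cfg_lt t hp) (cfg_lt t pM).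
    have := hA _ m1; rewrite mul0n add0n => h0.
    by move: s1 s2 s3; rewrite h0 (hA _ pm) (hA _ hp) (hA _ pM) /= => -> /= -> /=.
  have bJ : b < J by lia.
  have ag c : let y' := upd y (yv b.+1) c in sk y' (yv b.+1) = c /\ forall i, i < yv b.+1 -> sk y' i = sk y i.
    move=> y'; split; first by rewrite hy // /y' /upd eqxx.
    by move=> i hi; apply: hc => j hj; rewrite /y' /upd ifF //; apply/eqP; lia.
  have lA i : i < Nb -> Av b i < yv b.+1 by rewrite /Av /yv /Bk; lia.
  have lB i : i < Nb -> Bv b i < yv b.+1 by rewrite /Bv /yv /Bk; lia.
  have lM i : i < Nb -> Mv b i < yv b.+1 by rewrite /Mv /yv /Bk; lia.
  have hM p' : p' < m -> sk y (Mv b (p' * g + cfg (t + 2 ^ d) p')).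
    move=> hp'; have [yb ye] := ag false; have [L _ _ _] := hS (upd y (yv b.+1) false).
    have ip s q : q < m -> q * g + cfg s q < Nb by move=> hq; apply: idx => //; apply: cfg_lt.
    rewrite -ye ?lM ?ip //; have [_ l1 _ _] := L b _ bJ (ip (t + 2 ^ d) _ hp').
    move: l1; rewrite yb /= => /implyP; apply; apply: (IH b.+1); [lia | move=> p2 hp2 | exact: hp'].
    have [l0 _ _ _] := L b _ bJ (ip t _ hp2); move: l0; rewrite yb /= => /implyP; apply.
    by rewrite ye ?lA ?ip //; apply: hA.
  have [yb ye] := ag true; have [L _ _ _] := hS (upd y (yv b.+1) true).
  have ip s q : q < m -> q * g + cfg s q < Nb by move=> hq; apply: idx => //; apply: cfg_lt.
  rewrite -ye ?lB ?ip //; have [_ _ _ l3] := L b _ bJ (ip (t + 2 ^ d.+1) _ hp).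
  move: l3; rewrite yb /= => /implyP; apply.
  have -> : t + 2 ^ d.+1 = (t + 2 ^ d) + 2 ^ d by rewrite expnS; lia.
  apply: (IH b.+1); [lia | move=> p2 hp2 | exact: hp].
  have [_ _ l2 _] := L b _ bJ (ip (t + 2 ^ d) _ hp2); move: l2; rewrite yb /= => /implyP; apply.
  by rewrite ye ?lM ?ip //; apply: hM.
have m1 : 0 < m by lia.
have [_ _ I Fn] := hS (fun _ => false).
have := key J 0 (add0n J) (fun _ => false) 0; rewrite add0n => /(_ _ 0 m1); rewrite mul0n add0n => h.
apply/negP => hr; have := Fn _ (cfg_lt (2 ^ J) m1) hr; rewrite h // => p hp.
by rewrite cfg0 //; apply: I.
Qed.

(** The starting time of block [b]: every selector bit equal to 1 moves on to the second half of the
    enclosing interval. *)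
Fixpoint stt (y : nat -> bool) b := if b is b'.+1 then stt y b' + y (yv b'.+1) * 2 ^ (J - b'.+1) else 0.
Definition at_ t i := cfg t (i %/ g) == i %% g.
(** The intended valuation holds the true configurations at the times fixed by the selector bits.
    The variables of block [b] use only the bits up to [b], so it is causal. *)
Definition skv (y : nat -> bool) v :=
  if v < J.+1 * Bk then
    let b := v %/ Bk in let o := v %% Bk in
    if o == 0 then y v else if o.-1 < Nb then at_ (stt y b) o.-1
    else if o.-1 < 2 * Nb then at_ (stt y b + 2 ^ (J - b)) (o.-1 - Nb)
    else at_ (stt y b + 2 ^ (J - b.+1)) (o.-1 - 2 * Nb)
  else let v' := v - J.+1 * Bk in let T := stt y J in
    if v' < m * g * g then (cfg T 0 == v' %/ g %% g) && (cfg T (v' %/ g %/ g).-1 == v' %% g)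
    else let v2 := v' - m * g * g in [&& cfg T 0 == v2 %/ g %/ g %% g, cfg T (v2 %/ g %/ g %/ g).-1 == v2 %/ g %% g & cfg T (v2 %/ g %/ g %/ g) == v2 %% g].

Lemma stt_causal y y' b : (forall j, j <= yv b -> y j = y' j) -> stt y b = stt y' b.
Proof.
elim: b => //= b IH h; rewrite h // IH // => j hj; apply: h; apply: leq_trans hj _.
by rewrite /yv leq_mul2r leqnSn orbT.
Qed.

Lemma skv_block y b o : b <= J -> o < Bk -> skv y (b * Bk + o) = if o == 0 then y (b * Bk + o) else if o.-1 < Nb then at_ (stt y b) o.-1
    else if o.-1 < 2 * Nb then at_ (stt y b + 2 ^ (J - b)) (o.-1 - Nb)
    else at_ (stt y b + 2 ^ (J - b.+1)) (o.-1 - 2 * Nb).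
Proof.
move=> hb ho; rewrite /skv; have -> : b * Bk + o < J.+1 * Bk by nia.
by rewrite divnMDl 1?modnMDl ?(modn_small ho) ?(divn_small ho) ?addn0 //; lia.
Qed.

Lemma skv_causal : causal skv.
Proof.
move=> y y' v h; rewrite /skv; case: ifP => hv; last first.
  rewrite (@stt_causal y y' J) // => j hj; apply: h; apply: leq_trans hj _.
  by move/negbT: hv; rewrite -leqNgt /yv; nia.
by rewrite h // (@stt_causal y y') // => j hj; apply: h; apply: leq_trans hj _; rewrite /yv leq_divM.
Qed.

Lemma skvA y b i : b <= J -> i < Nb -> skv y (Av b i) = at_ (stt y b) i.
Proof. by move=> hb hi; rewrite /Av -addnA skv_block // ?add1n /= ?hi // /Bk; lia. Qed.
Lemma skvB y b i : b <= J -> i < Nb -> skv y (Bv b i) = at_ (stt y b + 2 ^ (J - b)) i.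
Proof.
move=> hb hi; rewrite /Bv -!addnA skv_block // ?add1n /=; last by rewrite /Bk; lia.
by rewrite ifF ?ifT ?addKn //; lia.
Qed.
Lemma skvM y b i : b <= J -> i < Nb -> skv y (Mv b i) = at_ (stt y b + 2 ^ (J - b.+1)) i.
Proof.
move=> hb hi; have -> : Mv b i = b * Bk + (2 * Nb + i).+1 by rewrite /Mv; lia.
rewrite skv_block //; last by rewrite /Bk; lia.
rewrite -[_.+1 == 0]/false -[_.+1.-1]/(2 * Nb + i).
have -> : (2 * Nb + i < Nb) = false by clear; lia.
have -> : (2 * Nb + i < 2 * Nb) = false by clear; lia.
by rewrite addKn.
Qed.
Lemma skvY y b : b <= J -> skv y (yv b) = y (yv b).
Proof. by move=> hb; rewrite /yv -[X in skv _ X]addn0 skv_block //= ?addn0 // /Bk; lia. Qed.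
Lemma dm x a : a < g -> (x * g + a) %/ g = x /\ (x * g + a) %% g = a.
Proof. by move=> h; rewrite divnMDl ?modnMDl ?modn_small ?divn_small ?addn0. Qed.
Lemma skvU1 y p a0 a1 : p < m -> a0 < g -> a1 < g -> skv y (U1 p a0 a1) = (cfg (stt y J) 0 == a0) && (cfg (stt y J) p.-1 == a1).
Proof.
move=> hp h0 h1; rewrite /skv /U1 -addnA ifF; last by lia.
rewrite addKn ifT; last by nia.
by have [-> ->] := dm (p * g + a0) h1; have [-> ->] := dm p h0.
Qed.
Lemma skvU2 y p a0 a1 a2 : p < m -> a0 < g -> a1 < g -> a2 < g ->
  skv y (U2 p a0 a1 a2) = [&& cfg (stt y J) 0 == a0, cfg (stt y J) p.-1 == a1 & cfg (stt y J) p == a2].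
Proof.
move=> hp h0 h1 h2; have nlt x y' : (x + y' < x) = false by clear; lia.
by rewrite /skv /U2 -2!addnA nlt addKn nlt addKn; have [-> ->] := dm ((p * g + a0) * g + a1) h2;
  have [-> ->] := dm (p * g + a0) h1; have [-> ->] := dm p h0.
Qed.
Lemma at_idx t p a : a < g -> at_ t (p * g + a) = (cfg t p == a).
Proof. by move=> h; rewrite /at_; have [-> ->] := dm p h. Qed.

Lemma complete : (forall a0 a1 a2 a3, a0 < g -> a1 < g -> a2 < g -> a3 < g -> delta a0 a1 a2 a3 < g) ->
  ~~ rej (cfg (2 ^ J) 0) -> forall y, Sat (skv y).
Proof.
move=> dg hr y; have m1 : 0 < m by lia. split.
- move=> b i hb hi; rewrite !skvA ?skvB ?skvM ?skvY //; try lia.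
  have e : J - b = (J - b.+1).+1 by lia.
  rewrite /= e expnS; case: (y (yv b.+1)); rewrite /= ?mul0n ?mul1n ?addn0 ?implybb //.
  split=> //.
  by rewrite (_ : stt y b + 2 ^ (J - b.+1) + 2 ^ (J - b.+1) = stt y b + 2 * 2 ^ (J - b.+1)) ?implybb //; lia.
- move=> p a0 a1 a2 a3 hp h0 h1 h2 h3; have pm : p.-1 < m by move: hp; clear; lia. have pM : minn p.+1 m.-1 < m by move: m1; clear; lia.
  have i0 : a0 < Nb by have := idx m1 h0; rewrite mul0n add0n.
  rewrite skvU1 // skvU2 // !skvA ?skvB ?idx ?dg // !at_idx ?dg // subnn expn0 addn1.
  have -> : at_ (stt y J) a0 = (cfg (stt y J) 0 == a0) by have := at_idx (stt y J) 0 h0; rewrite mul0n add0n.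
  split.
  + by case: (_ == a0); case: (_ == a1).
  + by case: (cfg _ 0 == a0); case: (cfg _ p.-1 == a1); case: (cfg _ p == a2).
  + by apply/implyP => /and3P[/eqP<- /eqP<- /eqP<-]; apply/implyP => /eqP<-; rewrite cfgS.
- by move=> p hp; rewrite skvA ?idx // -?cfg0 ?cfg_lt // at_idx ?cfg_lt //= eqxx.
- move=> a ha hra; have ia : a < Nb by have := idx m1 ha; rewrite mul0n add0n.
  rewrite skvB // subn0 /= add0n; have := at_idx (2 ^ J) 0 ha; rewrite mul0n add0n => ->.
  by apply/eqP => e; move: hr; rewrite e hra.
Qed.

Lemma lit_pos r v : v < nv -> lit_true nv r (pos v) = r v.
Proof.
move=> hv; rewrite /lit_true /pos; have -> : 0 < 2 * v + 2 <= 2 * nv by lia.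
have -> : (2 * v + 2).-1 %/ 2 = v by clear; lia.
have -> : (2 * v + 2).-1 %% 2 = 1 by clear; lia.
by case: (r v).
Qed.
Lemma lit_neg r v : v < nv -> lit_true nv r (neg v) = ~~ r v.
Proof.
move=> hv; rewrite /lit_true /neg; have -> : 0 < 2 * v + 1 <= 2 * nv by lia.
have -> : (2 * v + 1).-1 %/ 2 = v by clear; lia.
have -> : (2 * v + 1).-1 %% 2 = 0 by clear; lia.
by case: (r v).
Qed.
Lemma lit_0 r : lit_true nv r 0 = false. Proof. by []. Qed.

Hypothesis delta_lt : forall a0 a1 a2 a3, a0 < g -> a1 < g -> a2 < g -> a3 < g -> delta a0 a1 a2 a3 < g.
Hypothesis ini_lt : forall p, p < m -> ini p < g.

Lemma bnd_y b : b <= J -> yv b < nv.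
Proof.
move=> h; rewrite /yv /nv mulSn; have : b * Bk <= J * Bk by rewrite leq_mul2r h orbT.
by move: (b * Bk) (J * Bk) (m * g * g) (m * g * g * g) => x y z t; rewrite /Bk; clear; lia.
Qed.
Lemma bnd_AB b i : b <= J -> i < Nb -> [/\ Av b i < nv, Bv b i < nv & Mv b i < nv].
Proof.
move=> h hi; rewrite /Av /Bv /Mv /nv mulSn; have : b * Bk <= J * Bk by rewrite leq_mul2r h orbT.
move: (b * Bk) (J * Bk) (m * g * g) (m * g * g * g) => x y z t; rewrite /Bk; split; lia.
Qed.
Lemma bnd_U1 p a0 a1 : p < m -> a0 < g -> a1 < g -> U1 p a0 a1 < nv.
Proof.
move=> hp h0 h1; have := idx hp h0; rewrite /Nb /U1 /nv => h.
have : (p * g + a0) * g + a1 < m * g * g by nia.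
by move: (J.+1 * Bk) (m * g * g) (m * g * g * g); lia.
Qed.
Lemma bnd_U2 p a0 a1 a2 : p < m -> a0 < g -> a1 < g -> a2 < g -> U2 p a0 a1 a2 < nv.
Proof.
move=> hp h0 h1 h2; have := idx hp h0; rewrite /Nb /U2 /nv => h.
have h' : (p * g + a0) * g + a1 < m * g * g by nia.
have : ((p * g + a0) * g + a1) * g + a2 < m * g * g * g by nia.
by move: (J.+1 * Bk) (m * g * g) (m * g * g * g); lia.
Qed.

Definition c3t r x y z := [|| lit_true nv r x, lit_true nv r y | lit_true nv r z].

Lemma cls_sat r : (forall j, j < cc -> clause_true nv lfv r j) <-> Sat r.
Proof.
have m1 : 0 < m by lia.
have ct j : clause_true nv lfv r j = c3t r (lfv j 0) (lfv j 1) (lfv j 2) by [].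
have kdE j' k : k < 9 -> (9 * j' + k) %% 9 = k /\ (9 * j' + k) %/ 9 = j' by move=> h; split; move: h; clear; lia.
have dN x i : i < Nb -> (x * Nb + i) %/ Nb = x /\ (x * Nb + i) %% Nb = i.
  by move=> h; rewrite divnMDl ?N0 // modnMDl modn_small // divn_small // addn0.
pose t4 p a0 a1 a2 a3 := p * g ^ 4 + a3 * g ^ 3 + a2 * g ^ 2 + a1 * g + a0.
have tE p a0 a1 a2 a3 : a0 < g -> a1 < g -> a2 < g -> a3 < g -> let t := t4 p a0 a1 a2 a3 in
   [/\ t %% g = a0, t %/ g %% g = a1, t %/ g ^ 2 %% g = a2, t %/ g ^ 3 %% g = a3 & t %/ g ^ 4 = p].
  move=> h0 h1 h2 h3 t; have e : t = (((p * g + a3) * g + a2) * g + a1) * g + a0.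
    by rewrite /t /t4 !expnS expn0; ring.
  have e1 : t %/ g = ((p * g + a3) * g + a2) * g + a1 by rewrite e; have [] := dm (((p * g + a3) * g + a2) * g + a1) h0.
  have e2 : t %/ g ^ 2 = (p * g + a3) * g + a2 by rewrite expnS expn1 divnMA e1; have [] := dm ((p * g + a3) * g + a2) h1.
  have e3 : t %/ g ^ 3 = p * g + a3 by rewrite expnSr divnMA e2; have [] := dm (p * g + a3) h2.
  have e4 : t %/ g ^ 4 = p by rewrite expnSr divnMA e3; have [] := dm p h3.
  split=> //; first by rewrite e; have [] := dm (((p * g + a3) * g + a2) * g + a1) h0.
  - by rewrite e1; have [] := dm ((p * g + a3) * g + a2) h1.
  - by rewrite e2; have [] := dm (p * g + a3) h2.
  - by rewrite e3; have [] := dm p h3.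
split=> [H|[S1 S2 S3 S4] j hj].
  have Hk j' k : k < 9 -> j' < J * Nb + m * g ^ 4 + m + g -> c3t r (lfv (9 * j' + k) 0) (lfv (9 * j' + k) 1) (lfv (9 * j' + k) 2).
    by move=> hk hj'; rewrite -ct; apply: H; rewrite /cc; move: hk hj'; clear; lia.
  split.
  - move=> b i hb hi; have [d1 d2] := dN b i hi.
    have lt : b * Nb + i < J * Nb + m * g ^ 4 + m + g.
      by do 3 apply: ltn_addr; have : b.+1 * Nb <= J * Nb by [rewrite leq_mul2r hb orbT]; rewrite mulSn; move: hi; clear; lia.
    have [a1 a2 a3] := bnd_AB (ltnW hb) hi; have [b1 b2 b3] := bnd_AB hb hi; have y1 := bnd_y hb.
    have := Hk _ 0 isT lt; have := Hk _ 1 isT lt; have := Hk _ 2 isT lt; have := Hk _ 3 isT lt; rewrite /lfv.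
    have [-> ->] := kdE (b * Nb + i) 0 isT; have [-> ->] := kdE (b * Nb + i) 1 isT.
    have [-> ->] := kdE (b * Nb + i) 2 isT; have [-> ->] := kdE (b * Nb + i) 3 isT.
    rewrite d1 d2 hb /= /c3t !lit_pos ?lit_neg // => h3 h2 h1 h0; rewrite !implybE; split; move: h0 h1 h2 h3.
    + by [].
    + by [].
    + by [].
    + by [].
  - move=> p a0 a1 a2 a3 hp h0 h1 h2 h3; have [e0 e1 e2 e3 e4] := tE p a0 a1 a2 a3 h0 h1 h2 h3.
    have pm : p.-1 < m by move: hp; clear; lia. have pM : minn p.+1 m.-1 < m by move: m1; clear; lia.
    set t := t4 _ _ _ _ _ in e0 e1 e2 e3 e4.
    have lt : t < J * Nb + m * g ^ 4 + m + g.
      have tp : t < p.+1 * g ^ 4 by rewrite -ltn_divLR ?e4 // expn_gt0 g0.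
      have : p.+1 * g ^ 4 <= m * g ^ 4 by rewrite leq_mul2r hp orbT.
      by move: tp; move: (p.+1 * g ^ 4) (m * g ^ 4) => A B; clear; lia.
    have i0 : a0 < Nb by have := idx m1 h0; rewrite mul0n add0n.
    have [A0 _ _] := bnd_AB (leqnn J) i0; have [A1 _ _] := bnd_AB (leqnn J) (idx pm h1).
    have [A2 _ _] := bnd_AB (leqnn J) (idx hp h2); have [A3 _ _] := bnd_AB (leqnn J) (idx pM h3).
    have [_ Bd _] := bnd_AB (leqnn J) (idx hp (delta_lt h0 h1 h2 h3)).
    have u1 := bnd_U1 hp h0 h1; have u2 := bnd_U2 hp h0 h1 h2.
    have := Hk _ 4 isT lt; have := Hk _ 5 isT lt; have := Hk _ 6 isT lt; rewrite /lfv.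
    have [-> ->] := kdE t 4 isT; have [-> ->] := kdE t 5 isT; have [-> ->] := kdE t 6 isT.
    rewrite e0 e1 e2 e3 e4 hp /= /c3t !lit_pos ?lit_neg // => g3 g2 g1; rewrite !implybE; split; move: g1 g2 g3.
    + by [].
    + by [].
    + by [].
  - move=> p hp; have lt : p < J * Nb + m * g ^ 4 + m + g by move: hp; clear; lia.
    have := Hk _ 7 isT lt; rewrite /lfv; have [-> ->] := kdE p 7 isT.
    have [a1 _ _] := bnd_AB (leq0n J) (idx hp (ini_lt hp)).
    by rewrite hp /= /c3t lit_pos // lit_0 !orbF.
  - move=> a ha hr; have lt : a < J * Nb + m * g ^ 4 + m + g by move: ha; clear; lia.
    have ia : a < Nb by have := idx m1 ha; rewrite mul0n add0n.
    have := Hk _ 8 isT lt; rewrite /lfv; have [-> ->] := kdE a 8 isT.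
    have [_ b1 _] := bnd_AB (leq0n J) ia.
    by rewrite ha hr /= /c3t lit_neg // lit_0 !orbF.
have lg x : x %% g < g by rewrite ltn_mod.
have n0 : 0 < nv by have := bnd_y (leq0n J); rewrite /yv mul0n.
rewrite ct /lfv; set kd := j %% 9; set j' := j %/ 9.
case: ifP => [/andP[k4 hb]|_].
  have hi : j' %% Nb < Nb by rewrite ltn_mod N0.
  have [s0 s1 s2 s3] := S1 _ _ hb hi.
  have [a1 a2 a3] := bnd_AB (ltnW hb) hi; have [b1 b2 b3] := bnd_AB hb hi; have y1 := bnd_y hb.
  rewrite !implybE in s0 s1 s2 s3.
  by do 3 (case: ifP => _; first by rewrite /= /c3t !lit_pos ?lit_neg); rewrite /= /c3t !lit_pos ?lit_neg.
case: ifP => [/andP[k7 hp]|_].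
  have [s0 s1 s2] := S2 _ _ _ _ _ hp (lg j') (lg (j' %/ g)) (lg (j' %/ g ^ 2)) (lg (j' %/ g ^ 3)).
  set p := j' %/ g ^ 4 in hp s0 s1 s2 *.
  have pm : p.-1 < m by move: hp; clear; lia. have pM : minn p.+1 m.-1 < m by move: m1; clear; lia.
  have i0 : j' %% g < Nb by have := idx m1 (lg j'); rewrite mul0n add0n.
  have [A0 _ _] := bnd_AB (leqnn J) i0; have [A1 _ _] := bnd_AB (leqnn J) (idx pm (lg (j' %/ g))).
  have [A2 _ _] := bnd_AB (leqnn J) (idx hp (lg (j' %/ g ^ 2))); have [A3 _ _] := bnd_AB (leqnn J) (idx pM (lg (j' %/ g ^ 3))).
  have [_ Bd _] := bnd_AB (leqnn J) (idx hp (delta_lt (lg j') (lg (j' %/ g)) (lg (j' %/ g ^ 2)) (lg (j' %/ g ^ 3)))).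
  have u1 := bnd_U1 hp (lg j') (lg (j' %/ g)); have u2 := bnd_U2 hp (lg j') (lg (j' %/ g)) (lg (j' %/ g ^ 2)).
  rewrite !implybE in s0 s1 s2.
  by do 2 (case: ifP => _; first by rewrite /= /c3t !lit_pos ?lit_neg); rewrite /= /c3t !lit_pos ?lit_neg.
case: ifP => [/andP[_ hp]|_].
  have [a1 _ _] := bnd_AB (leq0n J) (idx hp (ini_lt hp)).
  by rewrite /= /c3t lit_pos // S3.
case: ifP => [/and3P[_ ha hr]|_].
  have ia : j' < Nb by have := idx m1 ha; rewrite mul0n add0n.
  have [_ b1 _] := bnd_AB (leq0n J) ia.
  by rewrite /= /c3t lit_neg // S4.
by rewrite /= /c3t lit_pos // lit_neg //; case: (r 0).
Qed.

Lemma sat_ext r r' : (forall v, v < nv -> r v = r' v) -> (forall j, j < cc -> clause_true nv lfv r j) -> Sat r'.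
Proof.
move=> h H; apply/cls_sat => j hj; have := H j hj.
have lt_ x : lit_true nv r x = lit_true nv r' x.
  by rewrite /lit_true; case hx : (0 < x <= 2 * nv) => //=; rewrite h //; lia.
by rewrite /clause_true !lt_.
Qed.

Theorem savitch_form : form_true nv cc qv lfv = ~~ rej (cfg (2 ^ J) 0).
Proof.
apply/idP/idP => [/pt_skolem[sk [c1 c2 c3]]|h].
  apply: (@sound sk) => // [y b hb|y].
    have l1 : yv b < J.+1 * Bk by rewrite /yv ltn_mul2r ltnS hb /Bk; lia.
    apply: c2; first exact: bnd_y.
    by rewrite /qv l1 /yv modnMl.
  apply: (@sat_ext (trunc nv (sk y))) => [v hv|j hj]; first by rewrite /trunc hv.
  by apply: (allP (c3 y)); rewrite mem_iota.
apply: (@skolem_pt _ _ _ skv) => [|y i hi|y]; first exact: skv_causal.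
  rewrite /qv => /andP[l1 /eqP l2]; rewrite (divn_eq i Bk) l2 addn0.
  by apply: skvY; rewrite -ltnS ltn_divLR // /Bk; lia.
apply/allP => j; rewrite mem_iota => /andP[_ hj].
have lt_ x : lit_true nv (trunc nv (skv y)) x = lit_true nv (skv y) x.
  by rewrite /lit_true /trunc; case hx : (0 < x <= 2 * nv) => //=; rewrite (_ : x.-1 %/ 2 < nv) //; lia.
by rewrite /clause_true !lt_ -/(clause_true nv lfv (skv y) j); apply: (iffRL (cls_sat _)) => //; apply: complete.
Qed.
End Savitch.

End Savitch.

(** * Turing machines as cellular automata *)

Module Cells.
Import Exp Graph GraphExprs Decoding Savitch Lib.

Section Cells.
Variable M : tm.
Notation sym := (symbol (tm_alpha M)).
Notation I := 'I_(tm_extra M).+1.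
(* A cell of a configuration carries the state, the scanned symbols, and the symbols at its distance from the
   heads; the flag tells whether it is the first one. *)
Definition cellT : finType := (tm_state M * bool * {ffun I -> sym * sym * sym})%type.
Definition cell (c : config M) p : cellT := (conf_state c, p == 0,
  [ffun i => (tape_head (conf_tape c i), nth None (tape_left (conf_tape c i)) p, nth None (tape_right (conf_tape c i)) p)]).

(** The heads rest at the origin and the tapes are shifted instead. Hence the new cell depends on
    the first cell [a0], which holds state and scanned symbols, on the cell [a2] itself and on its
    neighbours [a1] and [a3]. *)
Definition cnext (a0 a1 a2 a3 : cellT) : cellT :=
  match tm_trans a0.1.1 [ffun i => (a0.2 i).1.1] with
  | None => a2
  | Some (s, act) => (s, a2.1.2, [ffun i => match (act i).2 with
      | MoveN => ((act i).1, (a2.2 i).1.2, (a2.2 i).2)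
      | MoveR => ((a0.2 i).2, if a2.1.2 then (act i).1 else (a1.2 i).1.2, (a3.2 i).2)
      | MoveL => ((a0.2 i).1.2, (a3.2 i).1.2, if a2.1.2 then (act i).1 else (a1.2 i).2)
      end])
  end.

Lemma nth_behead' (s : seq sym) p : nth None (behead s) p = nth None s p.+1.
Proof. by case: s => //=; rewrite nth_nil. Qed.

Lemma cell_next c p : cell (conf_next c) p = cnext (cell c 0) (cell c p.-1) (cell c p) (cell c p.+1).
Proof.
rewrite /cnext /conf_next /conf_trans /=.
have -> : [ffun i => ([ffun i0 => (tape_head (conf_tape c i0), nth None (tape_left (conf_tape c i0)) 0, nth None (tape_right (conf_tape c i0)) 0)] i).1.1]
   = [ffun i => tape_head (conf_tape c i)] :> {ffun I -> sym} by apply/ffunP => i; rewrite !ffunE.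
case: (tm_trans _ _) => [[s act]|] //; congr (_, _, _); apply/ffunP => i; rewrite !ffunE /=.
case: (conf_tape c i) => l h r; case: (act i) => a [] /=.
- by rewrite nth_behead'; case: p => [|p] //=; case: (l).
- by [].
- by rewrite nth_behead'; case: p => [|p] //=; case: (r).
Qed.

Lemma cell_halted c c' : cell c 0 = cell c' 0 -> halted c = halted c'.
Proof.
move=> [e1 /ffunP e2]; rewrite /halted /conf_trans e1; congr (~~ isSome (tm_trans _ _)).
by apply/ffunP => i; rewrite !ffunE; have := e2 i; rewrite !ffunE => -[].
Qed.

Variables (w : seq bool) (m : nat).
Hypothesis m1 : 1 < m.
Hypothesis hsp : forall t, conf_space (conf_run M w t) < m.

Definition g := #|cellT|.
Definition c0 : cellT := cell (conf_init M w) 0.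
Definition codec (x : cellT) : nat := index x (enum cellT).
Definition decc (k : nat) : cellT := nth (tm_start M, true, [ffun=> (None, None, None)]) (enum cellT) k.
Lemma codec_lt x : codec x < g. Proof. by rewrite /g cardE index_mem mem_enum. Qed.
Lemma codecK x : decc (codec x) = x. Proof. by rewrite /decc nth_index // mem_enum. Qed.
Definition cfgM t p := codec (cell (conf_run M w t) p).
Definition deltaM a0 a1 a2 a3 := codec (cnext (decc a0) (decc a1) (decc a2) (decc a3)).
Definition sy (v : nat) : sym := if v == 2 then Some (inl true) else if v == 1 then Some (inl false) else None.
Definition initab b v0 v1 := codec (tm_start M, b, [ffun i : I => if i == ord0 then (sy v0, None, sy v1) else (None, None, None)]).
Definition iniM p := initab (p == 0) (inpv w 0) (inpv w p.+1).
Definition rejM a := ~~ tm_accept (decc a).1.1.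

Lemma sp_small t i : size (tape_left (conf_tape (conf_run M w t) i)) < m.-1 /\ size (tape_right (conf_tape (conf_run M w t) i)) < m.-1.
Proof.
have : tape_size (conf_tape (conf_run M w t) i) <= conf_space (conf_run M w t).
  by rewrite /conf_space (bigD1 i) //= leq_addr.
by have := hsp t; rewrite /tape_size; lia.
Qed.

(** Beyond the space bound all cells are blank and equal, so the last of the [m] cells can stand in
    for its right neighbour. *)
Lemma cell_far t p : m.-1 <= p -> cell (conf_run M w t) p = cell (conf_run M w t) m.-1.
Proof.
move=> hp; rewrite /cell; congr (_, _, _); first by lia.
apply/ffunP => i; rewrite !ffunE; have [h1 h2] := sp_small t i.
by rewrite (nth_default _ (leq_trans (ltnW h1) hp)) (nth_default _ (leq_trans (ltnW h2) hp)) (nth_default _ (ltnW h1)) (nth_default _ (ltnW h2)).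
Qed.

Lemma cfgM_S t p : p < m -> cfgM t.+1 p = deltaM (cfgM t 0) (cfgM t p.-1) (cfgM t p) (cfgM t (minn p.+1 m.-1)).
Proof.
move=> hp; rewrite /deltaM /cfgM !codecK; congr codec.
rewrite -[conf_run M w t.+1]/(conf_next (conf_run M w t)) cell_next; congr cnext.
by rewrite /minn; case: ltnP => // h; apply: cell_far.
Qed.

Lemma cfgM_0 p : p < m -> cfgM 0 p = iniM p.
Proof.
move=> hp; rewrite /cfgM /iniM /initab; congr codec; rewrite /cell /=; congr (_, _, _).
have hsy j : nth None (map (@bit (tm_alpha M)) w) j = sy (inpv w j).
  rewrite /inpv; case: ltnP => h; last by rewrite nth_default // size_map.
  by rewrite (nth_map false) //; case: (nth _ _ _).
apply/ffunP => i; rewrite !ffunE; case: eqP => _ /=; rewrite ?nth_nil //.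
by rewrite nth_behead' hsy -nth0 hsy.
Qed.

(** There are at most [g ^ m] contents of [m] cells, which is at most [2 ^ (g * m)]. Without a halt
    within that many steps some content repeats, the run is periodic, and it never halts. *)
Lemma halt_bound : (exists t, halted (conf_run M w t)) -> halted (conf_run M w (2 ^ (g * m))).
Proof.
case=> th hth; apply: contraT => nh; set T := 2 ^ (g * m) in nh.
have hm t t' : t <= t' -> halted (conf_run M w t) -> conf_run M w t' = conf_run M w t.
  by move=> h hh; rewrite -(subnK h) /conf_run iterD -/(conf_run M w t) iter_halt.
have nht t : t <= T -> ~~ halted (conf_run M w t) by move=> h; apply: contra nh => hh; rewrite (hm _ _ h hh).
pose e t : {ffun 'I_m -> cellT} := [ffun p : 'I_m => cell (conf_run M w t) p].
have eS t t' : e t = e t' -> e t.+1 = e t'.+1.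
  move/ffunP => h; have h' p : p < m -> cfgM t p = cfgM t' p.
    by move=> hp; have := h (Ordinal hp); rewrite !ffunE /cfgM => ->.
  apply/ffunP => p; rewrite !ffunE; have := cfgM_S t (ltn_ord p); have := cfgM_S t' (ltn_ord p).
  have hp := ltn_ord p; rewrite !h'; [|lia|lia|lia|lia]; move=> <- /(congr1 decc).
  by rewrite /cfgM !codecK.
have [i [j [hij hjT eij]]] : exists i j, [/\ i < j, j <= T & e i = e j].
  have : ~~ injectiveb (fun t : 'I_T.+1 => e t).
    apply/negP => /injectiveP /leq_card; rewrite card_ord card_ffun card_ord -/g.
    rewrite leqNgt ltnS => /negP; apply; rewrite /T mulnC expnM; have : g <= 2 ^ g by apply: ltnW; apply: ltn_expl.
    by rewrite -expnM mulnC expnM => h; rewrite leq_exp2r //; lia.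
  move/injectivePn => [a [b ne eab]]; case: (ltngtP a b) => h.
  - by exists a, b; split=> //; rewrite -ltnS.
  - by exists b, a; split=> //; rewrite -ltnS.
  - by case/eqP: ne; apply: val_inj.
have per t : exists2 t', t' < j & e t = e t'.
  elim: t => [|t [t' ht' et]]; first by exists 0 => //; lia.
  case: (ltnP t'.+1 j) => h; first by exists t'.+1 => //; apply: eS.
  by exists i => //; rewrite (eS _ _ et) (_ : t'.+1 = j) //; lia.
have [t' ht' et] := per th.
have m0 : 0 < m by lia.
have ce : cell (conf_run M w th) 0 = cell (conf_run M w t') 0 by move/ffunP: et => /(_ (Ordinal m0)); rewrite !ffunE.
by have := nht t'; rewrite -(cell_halted ce) hth => /(_ _); rewrite (leq_trans (ltnW ht') hjT) => /(_ isT).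
Qed.

Lemma formM P : (exists t, halted (conf_run M w t) /\ (conf_accept (conf_run M w t) <-> P)) ->
  let J := g * m in form_true (nv m g J) (cc m g J) (qv m g J) (lfv m g J deltaM iniM rejM) <-> P.
Proof.
case=> t [ht hP] J.
have g0 : 0 < g by apply: leq_trans (codec_lt c0).
rewrite (@savitch_form m g J deltaM iniM rejM cfgM m1 g0); first last.
- by move=> *; apply: codec_lt.
- by move=> *; apply: codec_lt.
- exact: cfgM_S.
- exact: cfgM_0.
- by move=> *; apply: codec_lt.
have hT : halted (conf_run M w (2 ^ J)) by apply: halt_bound; exists t.
rewrite /rejM negbK /cfgM codecK /=; rewrite -hP /conf_accept.
have -> // : conf_run M w (2 ^ J) = conf_run M w t.
have hm a b : a <= b -> halted (conf_run M w a) -> conf_run M w b = conf_run M w a.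
  by move=> h hh; rewrite -(subnK h) /conf_run iterD -/(conf_run M w a) iter_halt.
by case: (leqP t (2 ^ J)) => h; [apply: hm | rewrite (hm _ _ (ltnW h))].
Qed.
End Cells.

End Cells.

(** * PSPACE-hardness *)

Module Hardness.
Import Exp Graph GraphExprs Decoding Savitch Cells Lib.

(** The transition function of a fixed machine is a finite table and becomes a case distinction of
    constant size. *)
Lemma E_table d n (T : nat -> efun d) f : (forall a, E (T a)) -> E f ->
  E (fun w x => if f w x < n then T (f w x) w x else 0).
Proof.
move=> hT hf; elim: n => [|n IH]; first by apply: (E_ext (f := fun _ _ => 0)) => //; exact: E_nat.
apply: (E_ext (f := fun w x => if f w x == n then T n w x else if f w x < n then T (f w x) w x else 0)) => [w x|].
  by rewrite ltnS; case: (ltngtP (f w x) n) => // ->.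
by apply: E_if => //; apply: Eb_eq => //; exact: E_nat.
Qed.

Section Tables.
Variables (M : tm) (d : nat).
Notation g := (g M).
Implicit Types (a b p m J : efun d).

Lemma g_gt0 : 0 < g. Proof. exact: leq_trans (codec_lt (c0 M [::])). Qed.

Lemma E_delta a0 a1 a2 a3 : E a0 -> E a1 -> E a2 -> E a3 -> (forall w x, a0 w x < g) -> (forall w x, a1 w x < g) ->
  (forall w x, a2 w x < g) -> (forall w x, a3 w x < g) -> E (fun w x => deltaM M (a0 w x) (a1 w x) (a2 w x) (a3 w x)).
Proof.
move=> h0 h1 h2 h3 l0 l1 l2 l3.
apply: (E_ext (f := fun w x => if a0 w x < g then (if a1 w x < g then (if a2 w x < g then (if a3 w x < g then
  deltaM M (a0 w x) (a1 w x) (a2 w x) (a3 w x) else 0) else 0) else 0) else 0)) => [w x|].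
  by rewrite l0 l1 l2 l3.
apply: (@E_table d g (fun n0 w x => if a1 w x < g then (if a2 w x < g then (if a3 w x < g then deltaM M n0 (a1 w x) (a2 w x) (a3 w x) else 0) else 0) else 0)) => // n0.
apply: (@E_table d g (fun n1 w x => if a2 w x < g then (if a3 w x < g then deltaM M n0 n1 (a2 w x) (a3 w x) else 0) else 0)) => // n1.
apply: (@E_table d g (fun n2 w x => if a3 w x < g then deltaM M n0 n1 n2 (a3 w x) else 0)) => // n2.
by apply: (@E_table d g (fun n3 w x => deltaM M n0 n1 n2 n3)) => // n3; exact: E_nat.
Qed.

Lemma inpv_le w v : inpv w v < 3.
Proof. by rewrite /inpv; case: ifP => // _; case: ifP. Qed.

Lemma E_ini p : E p -> E (fun w x => iniM M w (p w x)).
Proof.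
move=> hp; pose b w x : nat := p w x == 0.
have hb : E b by apply: Eb_eq => //; exact: E_nat.
apply: (E_ext (f := fun w x => if b w x < 2 then (if inpv w 0 < 3 then (if inpv w (p w x).+1 < 3 then
  initab M (b w x == 1) (inpv w 0) (inpv w (p w x).+1) else 0) else 0) else 0)) => [w x|].
  by rewrite !inpv_le /b /iniM; case: (_ == 0).
apply: (@E_table d 2 (fun n0 w x => if inpv w 0 < 3 then (if inpv w (p w x).+1 < 3 then initab M (n0 == 1) (inpv w 0) (inpv w (p w x).+1) else 0) else 0)) => // n0.
apply: (@E_table d 3 (fun n1 w x => if inpv w (p w x).+1 < 3 then initab M (n0 == 1) n1 (inpv w (p w x).+1) else 0) (fun w x => inpv w 0)) => [n1|]; last by apply: (E_inp (f := fun _ _ => 0)); exact: E_nat.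
apply: (@E_table d 3 (fun n2 w x => initab M (n0 == 1) n1 n2) (fun w x => inpv w (p w x).+1)) => [n2|]; first exact: E_nat.
by apply: E_inp; apply: E_succ.
Qed.

Lemma E_rej a : E a -> Eb (fun w x => rejM M (a w x)).
Proof.
move=> ha; apply: (E_ext (f := fun w x => if a w x < g then (if a w x < g then rejM M (a w x) : nat else 0) else rejM M g : nat)) => [w x|].
  case: ltnP => h //; rewrite /rejM /decc !nth_default //; rewrite -cardE //.
apply: E_if; [by apply: Eb_leq; [exact: E_succ | exact: E_nat] | | exact: E_nat].
by apply: (@E_table d g (fun n w x => rejM M n : nat)) => // n; exact: E_nat.
Qed.

Lemma E_nv m J : E m -> E J -> E (fun w x => nv (m w x) g (J w x)).
Proof. by move=> *; rewrite /nv /Bk /Nb; Es. Qed.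
Lemma E_cc m J : E m -> E J -> E (fun w x => cc (m w x) g (J w x)).
Proof. by move=> *; rewrite /cc /Nb; Es. Qed.
Lemma E_qv m J i : E m -> E J -> E i -> Eb (fun w x => qv (m w x) g (J w x) (i w x)).
Proof. by move=> *; rewrite /qv /Bk /Nb; Es. Qed.

Ltac hT := lazymatch goal with
  | |- E (fun w x => deltaM M (@?a w x) (@?b w x) (@?c w x) (@?f w x)) => apply: (@E_delta a b c f); try (by move=> *; rewrite ltn_mod g_gt0); cbv beta
  | |- E (fun w x => iniM M w (@?a w x)) => apply: (@E_ini a); cbv beta
  | |- Eb (fun w x => rejM M (@?a w x)) => apply: (@E_rej a); cbv beta
  end.

Lemma E_lfv m J j k : E m -> E J -> E j -> E k ->
  E (fun w x => lfv (m w x) g (J w x) (deltaM M) (iniM M w) (rejM M) (j w x) (k w x)).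
Proof.
move=> hm hJ hj hk; rewrite /lfv /pos /neg /yv /Av /Bv /Mv /U1 /U2 /Bk /Nb; cbv zeta beta.
by do ?[hT | E1].
Qed.
End Tables.

Lemma E_powc d (f : efun d) k : E f -> E (fun w x => f w x ^ k).
Proof.
move=> hf; elim: k => [|k IH]; first exact: (@E_nat d 1).
by apply: (E_ext (f := fun w x => f w x * f w x ^ k)) => [w x|]; [rewrite expnS | apply: E_mul].
Qed.

Theorem hardness L' : in_PSPACE L' -> polytime_reducible L' rev_price_problem.
Proof.
case=> M [s [[c [k hb]] H]].
(* The summand 2 makes [m] exceed both 1 and the space bound of [M]. *)
pose m N := c * N ^ k + c + 2; pose J N := g M * m N.
pose n N := nv (m N) (g M) (J N); pose cl N := cc (m N) (g M) (J N).
pose q N := qv (m N) (g M) (J N); pose lf w N := lfv (m N) (g M) (J N) (deltaM M) (iniM M w) (rejM M).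
pose G w := pdag (n (size w)) (cl (size w)) (q (size w)) (lf w (size w)).
exists (fun w => enc_dag (G w) ++ enc_int (Posz (gam (n (size w)) (cl (size w))))); split; last first.
  move=> w; have [h1 h2] := H w; rewrite problem_pdag /n /cl /q /lf.
  have m1 : 1 < m (size w) by rewrite /m; lia.
  have hsp t : conf_space (conf_run M w t) < m (size w).
    by apply: leq_ltn_trans (h1 t) _; apply: leq_ltn_trans (hb _) _; rewrite /m; lia.
  by have := formM m1 hsp h2 => h; split=> ?; apply/h.
have Em d (N : efun d) : E N -> E (fun w x => m (N w x)).
  by move=> hN; rewrite /m; have := E_powc k hN => hp; Es.
have EJ d (N : efun d) : E N -> E (fun w x => J (N w x)).
  by move=> hN; rewrite /J; apply: E_mul; [exact: E_nat | exact: Em].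
have En d (N : efun d) : E N -> E (fun w x => n (N w x)).
  by move=> hN; apply: E_nv; [apply: Em | apply: EJ].
have Ec d (N : efun d) : E N -> E (fun w x => cl (N w x)).
  by move=> hN; apply: E_cc; [apply: Em | apply: EJ].
apply: (@polytime_E _ _ _ _ _
  (fun w x => dlen (ord_dag (n x.2) (cl x.2)) + glen (gam (n x.2) (cl x.2)))
  (fun w x => if x.2 < dlen (ord_dag (n x.1.2) (cl x.1.2)) then dbit (n x.1.2) (cl x.1.2) (q x.1.2) (lf w x.1.2) x.2
    else gbit (gam (n x.1.2) (cl x.1.2)) (x.2 - dlen (ord_dag (n x.1.2) (cl x.1.2))))).
- have h1 := @En 1 _ (@E_v0 0); have h2 := @Ec 1 _ (@E_v0 0); have h3 := E_ord_dag h1 h2; have h4 := E_gam h1 h2.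
  have h5 := E_uplog (E_succ h4).
  by rewrite /dlen /glen; apply: E_add; [apply: E_add; [apply: E_succ | apply: E_mul] | apply: E_succ].
- have h1 := @En 2 _ (@E_v1 0); have h2 := @Ec 2 _ (@E_v1 0); have h3 := E_ord_dag h1 h2; have h4 := E_gam h1 h2.
  have hv := @E_v0 1; have h5 : E (fun (w : seq bool) (x : ctx 2) => dlen (ord_dag (n x.1.2) (cl x.1.2))).
    by rewrite /dlen; apply: E_add; [apply: E_succ | apply: E_mul].
  apply: Eb_if; first by apply: Eb_leq => //; apply: E_succ.
    apply: (@E_dbit 2 (fun w x => q x.1.2) (fun w x => lf w x.1.2) _ _ (fun w x => n x.1.2) (fun w x => cl x.1.2) (fun w x => x.2)) => // [t ht|t l ht hl].
      by apply: E_qv => //; [apply: Em (@E_v1 0) | apply: EJ (@E_v1 0)].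
    by apply: E_lfv => //; [apply: Em (@E_v1 0) | apply: EJ (@E_v1 0)].
  by apply: E_gbit => //; apply: E_sub.
move=> w w'; rewrite enc_dag_bits enc_int_bits mkseq_cat; exact: erefl.
Qed.

End Hardness.

Local Open Scope ring_scope.

Theorem theorem3p2 :
  PSPACE_complete rev_price_problem /\
  exists (G : qbf -> ssdag) (gamma : qbf -> int),
    [/\ polytime enc_qbf enc_dag G,
        polytime enc_qbf enc_int gamma,
        forall phi : qbf, fanin_le 2 (G phi)
      & forall phi : qbf,
          (rev_price (G phi))%:Z = gamma phi + (~~ qbf_true phi : nat)%:Z].
Proof.
split; first by split; [exact: Membership.problem_PSPACE | exact: Hardness.hardness].
exists Reduction.Gq, (fun phi => Posz (Reduction.gq phi)); split.
- exact: Reduction.Gq_polytime.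
- exact: Reduction.gq_polytime.
- by move=> phi; exact: Dag.pdag_fanin.
by move=> phi; rewrite Reduction.Gq_price PoszD.
Qed.
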